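(* Let $m$ be a positive integer, let $\xi_1,\dots,\xi_m$ be non-zero multiplicatively independent complex numbers which generate over $\mathbb{Q}$ a field of transcendence degree one, and let $\beta,\sigma,\tau,\nu\in\mathbb{R}$ satisfy \[ \sigma\ge 0,\quad \tau\ge 0,\quad \frac{5m+1}{m+5}\,\sigma+\tau<1,\quad \beta\ge 1+\sigma, \] and \[ \nu > 1+\beta-\frac{3m-1}{m+5}\,\sigma-\tau \ \text{ if } m\ge 2, \qquad \nu > 1+\beta-\frac{5}{11}\,\sigma-\tau \ \text{ if } m=1. \] Then, for infinitely many positive integers $n$, there exists no non-zero polynomial $P\in\mathbb{Z}[T]$ with $\deg(P)\le n$ and $H(P)\le \exp(n^\beta)$ such that \[ \max\left\{ |P^{[j]}(\xi_1^{i_1}\cdots\xi_m^{i_m})| \,;\, i_1,\dots,i_m,j\in\mathbb{Z},\ 0\le i_1,\dots,i_m\le n^\sigma,\ 0\le j<n^\tau\right\} < \exp(-n^\nu). \]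
   Context: For a non-zero polynomial $P\in\mathbb{Z}[T]$, its height $H(P)$ is the maximum of the absolute values of its coefficients divided by the greatest common divisor of its coefficients. For an integer $j\ge 0$, $P^{[j]}=(j!)^{-1}\,d^jP/dT^j$ denotes the $j$-th divided derivative of $P$. *)

(* Defs.v *)
From HB Require Import structures.
From mathcomp Require Import all_boot all_order all_algebra.
From mathcomp Require Import all_classical all_reals.
From mathcomp Require Import topology normedtype sequences exp.
From mathcomp Require Import complex.
(* The notations of mpoly clash with those of mathcomp-analysis. *)
From mathcomp Require Import -(notations) mpoly.

Set Implicit Arguments.
Unset Strict Implicit.
Unset Printing Implicit Defensive.

Import Order.TTheory GRing.Theory Num.Theory.

Local Open Scope classical_set_scope.
Local Open Scope ring_scope.

(* The subfield Q(S) of a field F of characteristic zero: the intersection of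
   all subfields of F containing S. *)
Definition adjoinQ (F : fieldType) (S : set F) : set F :=
  smallest [set K : set F | GRing.divring_closed [in K]] S.

(* The library's algebraicOver needs the base field to be a type; here it is
   a subset K of F. *)
Definition algebraic_over (F : fieldType) (K : set F) (x : F) : Prop :=
  exists p : {poly F}, [/\ p != 0, forall i, K p`_i & root p x].

Definition alg_indepQ (F : fieldType) (d : nat) (t : 'I_d -> F) : Prop :=
  forall p : mpoly.mpoly d rat, mpoly.mmap (@ratr F) t p = 0 -> p = 0.

(* K has transcendence degree d over Q: it has a transcendence basis
   t_0, ..., t_(d-1). *)
Definition has_trdegQ (F : fieldType) (K : set F) (d : nat) : Prop :=
  exists t : 'I_d -> F,
    [/\ forall k, K (t k), alg_indepQ t
      & forall x, K x -> algebraic_over (adjoinQ (range t)) x].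

Definition mult_indep (F : fieldType) (m : nat) (xi : 'I_m -> F) : Prop :=
  forall e : 'I_m -> int, \prod_(k < m) xi k ^ e k = 1 -> forall k, e k = 0.

(* zcontents P is the gcd of the coefficients up to sign. *)
Definition height (R : realType) (P : {poly int}) : R :=
  (\max_(i < size P) `|(P`_i)%R|)%N%:R / `|zcontents P|%N%:R.

(* The value at z of the divided derivative P^[j] = P^`N(j). *)
Definition dderiv_at (F : fieldType) (P : {poly int}) (j : nat) (z : F) : F :=
  (map_poly intr P^`N(j)).[z].

(* Main.v *)
(* Suppose that small polynomials exist for all large n. The polynomials
   P^[j](T^p), for primes p up to a small power of n, are simultaneously small
   at the grid of monomials in the xi_j; an interpolation estimate then makes
   their greatest common divisor G small at most of these points. Comparing
   the degrees and Mahler measures of the irreducible factors of P at points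
   z^p with those of G shows that G is a product of torsion factors and of
   non-torsion factors of low weight. Hence either the xi_j are very close to
   roots of unity, or two points of the grid nearly coincide, or most points
   are close to a root of a non-torsion factor of small degree and height.
   For m >= 2 two suitable points yield, through a norm to Q(th), an integer
   polynomial very small at the transcendental th; as this occurs at every
   level n, resultants of consecutive ones force a common root, which is
   impossible. For m = 1, pairs of exponents are compared in a similar way:
   the roots attached to the points x^v are powers of one number y
   approximating x, the same at all levels. *)
Require Import Defs.
From HB Require Import structures.
From mathcomp Require Import all_boot all_order all_algebra all_field cyclic perm.
From mathcomp Require Import all_classical all_reals.
From mathcomp Require Import topology normedtype sequences exp.
From mathcomp Require Import complex zify ring lra.
From mathcomp Require Import -(notations) mpoly.

Set Implicit Arguments.
Unset Strict Implicit.
Unset Printing Implicit Defensive.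

Import Order.TTheory GRing.Theory Num.Theory.

Local Open Scope classical_set_scope.
Local Open Scope ring_scope.

(** Sizes at level [n] are compared as powers [n^a]; a slack exponent [ka] absorbs constants,
    logarithms and divisor counts. A prime [p] about [n^al] that preserves the degree of a factor
    multiplies its logarithmic Mahler measure by at least [p], so that summation over about [n^al]
    primes saves [n^al] in degree but [n^(2 al)] in logarithmic Mahler measure. Because of this
    imbalance the smallness of a polynomial at a point is measured by [deg * n^a + ln M * n^b], the
    shape that a resultant with another polynomial consumes. The obstacle in linking level [n] to
    [n+1] is a passage between the case where the [xi_j] are near roots of unity and the case of a
    non-torsion factor, since their approximants do not satisfy the inequalities needed for
    comparison. A gap excludes it: whenever a weak form of the first case holds, a high power of
    some [X^M - 1] joins the polynomials whose common divisor is taken, and then, on a separated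
    grid, the strong form follows. Hence the second case arises only where the weak form fails,
    while the strong form at one level implies the weak form at the next. *)

Notation polyQ := (map_poly (intr : int -> rat)).

(** * Primitive irreducible integer polynomials: factorization, minimal polynomials,
    multiplicities *)

(** [zcontents] carries the sign of the leading coefficient, so content one also makes that
    coefficient positive. An algebraic number then has exactly one such polynomial, and factors are
    compared by plain equality. *)
Definition irrz (Q : {poly int}) : Prop :=
 zcontents Q = 1 /\ irreducible_poly (polyQ Q).

Section IntPoly.
Variable F : numFieldType.
Notation polyF := (map_poly (intr : int -> F)).
Implicit Types (P Q : {poly int}) (z : F).

Lemma size_polyF P : size (polyF P) = size P.
Proof.
have [->|P0] := eqVneq P 0; first by rewrite rmorph0 !size_poly0.
by rewrite size_map_poly_id0 // intr_eq0 lead_coef_eq0.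
Qed.

Lemma polyF_eq0 P : (polyF P == 0) = (P == 0).
Proof. by rewrite -!size_poly_eq0 size_polyF. Qed.

Lemma lead_coef_polyF P : lead_coef (polyF P) = (lead_coef P)%:~R.
Proof. by rewrite lead_coefE size_polyF coef_map. Qed.

Lemma polyF_ratr P : polyF P = map_poly ratr (polyQ P).
Proof. by apply/polyP => i; rewrite !coef_map /= ratr_int. Qed.

End IntPoly.

Lemma irrz_neq0 Q : irrz Q -> Q != 0.
Proof. by case=> _ /irredp_neq0; rewrite polyF_eq0. Qed.

Lemma irrz_size_gt1 Q : irrz Q -> (1 < size Q)%N.
Proof. by case=> _ [+ _]; rewrite size_polyF. Qed.

(** Gauss's lemma. *)
Lemma primitive_dvdQ P Q : zcontents Q = 1 -> polyQ Q %| polyQ P ->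
 exists P', P = Q * P'.
Proof.
move=> cQ; rewrite dvdp_rat_int => /dvdpP_int [r ->]; exists r.
by rewrite [in RHS](zpolyEprim Q) cQ scale1r.
Qed.

Lemma rat_poly_primitive (q : {poly rat}) : q != 0 ->
 exists Q, zcontents Q = 1 /\ polyQ Q %= q.
Proof.
move=> q0; have [P [a a0 qE]] := rat_poly_scale q.
have P0 : P != 0 by apply: contraNneq q0 => P0; rewrite qE P0 rmorph0 scaler0.
exists (zprimitive P); split; first by rewrite zcontents_primitive P0.
rewrite qE; have a1 : a%:~R != 0 :> rat by rewrite intr_eq0.
have -> : polyQ P = (zcontents P)%:~R *: polyQ (zprimitive P) by rewrite {1}(zpolyEprim P) map_polyZ.
rewrite scalerA eqp_sym eqp_scale //.
by rewrite mulf_neq0 ?invr_eq0 // intr_eq0 zcontents_eq0.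
Qed.

Lemma exists_irrz_factor (P : {poly int}) : (1 < size P)%N -> exists Q P', irrz Q /\ P = Q * P'.
Proof.
have [n] := ubnP (size P); elim: n P => // n IH P; rewrite ltnS => sPn sP.
have P0 : P != 0 by rewrite -size_poly_gt0 ltnW.
have [irr|] := pselect (irreducible_poly (polyQ P)).
 exists (zprimitive P), (zcontents P)%:P; split; last first.
  by rewrite mulrC mul_polyC -zpolyEprim.
 split; first by rewrite zcontents_primitive P0.
 have e : polyQ P = (zcontents P)%:~R *: polyQ (zprimitive P).
  by rewrite {1}(zpolyEprim P) map_polyZ.
 have c0 : (zcontents P)%:~R != 0 :> rat by rewrite intr_eq0 zcontents_eq0.
 have ep : polyQ P %= polyQ (zprimitive P) by rewrite e eqp_scale.
 split; first by rewrite -(eqp_size ep); case: irr.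
 by move=> q sq; rewrite -(eqp_dvdr _ ep) => /(irr.2 _ sq) /eqp_trans ->.
move=> nirr; have [q [sq qP nq]] : exists q : {poly rat}, [/\ size q != 1, q %| polyQ P & ~~ (q %= polyQ P)].
 apply: contrapT => h; apply: nirr; split; first by rewrite size_polyF.
 by move=> q sq qP; apply/negPn/negP => nq; apply: h; exists q.
have q0 : q != 0.
 by apply: contraTneq qP => ->; rewrite dvd0p polyF_eq0.
have [Q [cQ eQ]] := rat_poly_primitive q0.
have [P' PE] : exists P', P = Q * P'.
 by apply: primitive_dvdQ => //; rewrite (eqp_dvdl _ eQ).
have sQ : size Q = size q by rewrite -(eqp_size eQ) size_polyF.
have sQP : (size Q < size P)%N.
 rewrite ltn_neqAle sQ -(size_polyF rat P) dvdp_leq ?polyF_eq0 // andbT.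
 by rewrite -(dvdp_size_eqp qP) in nq.
have sQ1 : (1 < size Q)%N.
 by rewrite sQ ltn_neqAle eq_sym sq size_poly_gt0.
have [Q1 [P1 [iQ1 QE]]] := IH Q (leq_trans sQP sPn) sQ1.
by exists Q1, (P1 * P'); split=> //; rewrite PE QE mulrA.
Qed.

Lemma irrz_factorization (P : {poly int}) : P != 0 -> exists c (s : seq {poly int}),
 [/\ c != 0, forall q, q \in s -> irrz q & P = c *: \prod_(q <- s) q].
Proof.
have [n] := ubnP (size P); elim: n P => // n IH P; rewrite ltnS => sPn P0.
have [sP|sP] := leqP (size P) 1.
 exists (P`_0), [::]; rewrite big_nil; split=> //.
  by apply: contraNneq P0 => e; rewrite (size1_polyC sP) e.
 by rewrite -mul_polyC mulr1 -size1_polyC.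
have [Q [P' [iQ PE]]] := exists_irrz_factor sP.
have P'0 : P' != 0 by apply: contraNneq P0 => e; rewrite PE e mulr0.
have sP' : (size P' < n)%N.
 apply: leq_trans sPn; rewrite PE (size_mul (irrz_neq0 iQ) P'0).
 have aux (a b : nat) : (1 < a -> 0 < b -> b < (a + b).-1)%N by lia.
 by apply: aux; rewrite ?size_poly_gt0 ?irrz_size_gt1.
have [c [s [c0 hs E]]] := IH P' sP' P'0.
exists c, (Q :: s); rewrite big_cons; split=> //.
 by move=> q; rewrite inE => /orP[/eqP->|/hs].
by rewrite scalerAr -E.
Qed.

Section Roots.
Variable F : numFieldType.
Notation polyF := (map_poly (intr : int -> F)).
Implicit Types (P Q : {poly int}) (z : F).

Lemma polyF_neq0 P : P != 0 -> polyF P != 0.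
Proof. by rewrite polyF_eq0. Qed.

Lemma irrz_dvd P Q z : irrz Q -> root (polyF Q) z -> root (polyF P) z ->
 exists P', P = Q * P'.
Proof.
move=> [cQ iQ] rQ rP; apply: primitive_dvdQ => //.
set g := gcdp (polyQ Q) (polyQ P).
have rg : root (map_poly (ratr : rat -> F) g) z.
 by rewrite gcdp_map root_gcd -!polyF_ratr rQ.
have sg : size g != 1.
 apply/negP => /eqP sg; move: rg; rewrite (size1_polyC (eq_leq sg)) map_polyC /= rootC.
 rewrite fmorph_eq0 => /eqP g0; have := size_polyC (g`_0).
 by rewrite g0 eqxx -[X in X%:P]g0 -(size1_polyC (eq_leq sg)) sg.
have gQ := iQ.2 g sg (dvdp_gcdl _ _).
by rewrite -(eqp_dvdl _ gQ) dvdp_gcdr.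
Qed.

Lemma irrz_eq Q Q' z : irrz Q -> irrz Q' ->
 root (polyF Q) z -> root (polyF Q') z -> Q = Q'.
Proof.
move=> iQ iQ' r r'.
have [U UE] := irrz_dvd iQ r r'; have [V VE] := irrz_dvd iQ' r' r.
have U1 : zcontents U = 1.
 by have := iQ'.1; rewrite UE zcontentsM iQ.1 mul1r.
have sU : (size U <= 1)%N.
 have U0 : U != 0 by rewrite -zcontents_eq0 U1.
 have V0 : V != 0 by apply: contraNneq (irrz_neq0 iQ) => e; rewrite VE e mulr0.
 have aux (a b c : nat) : (0 < a -> 0 < b -> 0 < c -> a = (a + (b + c).-1).-1 -> b <= 1)%N by lia.
 have e : Q = Q * (U * V) by rewrite mulrA -UE -VE.
 have UV0 : U * V != 0 by rewrite mulf_neq0.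
 have := congr1 (fun p : {poly int} => size p) e.
 rewrite (size_mul (irrz_neq0 iQ) UV0) (size_mul U0 V0).
 move=> h; apply: (aux _ _ _ _ _ _ h); rewrite size_poly_gt0; [exact: irrz_neq0|exact: U0|exact: V0].
have UC := size1_polyC sU.
have zC (c : int) : zcontents c%:P = c.
 by rewrite -[c%:P]mulr1 mul_polyC zcontentsZ zcontents_monic ?monic1 // mulr1.
have U_1 : U = 1 by rewrite UC -(zC U`_0) -UC U1.
by rewrite UE U_1 mulr1.
Qed.

Lemma exists_minpoly P z : P != 0 -> root (polyF P) z ->
 exists Q, irrz Q /\ root (polyF Q) z.
Proof.
move=> P0 rP; have [c [s [c0 hs PE]]] := irrz_factorization P0.
move: rP; rewrite PE map_polyZ /= rootZ ?intr_eq0 // rmorph_prod /=.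
elim: s hs {PE} => [|q s IH] hs; first by rewrite big_nil (negPf (root1 _)).
rewrite big_cons rootM => /orP[r|/IH]; first by exists q; split=> //; apply: hs; rewrite mem_head.
by apply=> q' q's; apply: hs; rewrite inE q's orbT.
Qed.

Lemma irrz_deriv_root Q z : irrz Q -> root (polyF Q) z ->
 ~~ root (polyF Q)^`() z.
Proof.
move=> iQ r; apply/negP; rewrite deriv_map => r'.
have [V VE] := irrz_dvd iQ r r'.
have sQ := irrz_size_gt1 iQ.
have d0 : Q^`() != 0.
 rewrite -size_poly_gt0; have := coef_deriv Q (size Q).-2.
 move=> e; rewrite lt0n; apply/negP => /eqP/eqP; rewrite size_poly_eq0 => /eqP e0.
 move: e; rewrite e0 coef0 => /esym/eqP; rewrite mulrn_eq0 /=.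
 by rewrite prednK -?subn1 ?subn_gt0 // subn1 -lead_coefE lead_coef_eq0 (negPf (irrz_neq0 iQ)).
have V0 : V != 0 by apply: contraNneq d0 => e; rewrite VE e mulr0.
have := lt_size_deriv (irrz_neq0 iQ); rewrite VE (size_mul (irrz_neq0 iQ) V0).
have aux (a b : nat) : (0 < b -> ~~ ((a + b).-1 < a))%N by lia.
by apply/negP/aux; rewrite size_poly_gt0.
Qed.

Lemma irrz_mup Q z : irrz Q -> root (polyF Q) z -> mup z (polyF Q) = 1%N.
Proof.
move=> iQ r; have Q0 := polyF_neq0 (irrz_neq0 iQ).
apply/eqP; rewrite eqn_leq -XsubC_dvd // dvdp_XsubCl r andbT mup_leq //.
apply/negP => /dvdpP [u E]; have := irrz_deriv_root iQ r.
by rewrite E expr2 mulrA derivM derivXsubC /root !hornerE /= subrr !mulr0 addr0 eqxx.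
Qed.

(** Distinct [irrz] polynomials share no root, and each has simple roots only. Multiplicities in a
    list of factors can therefore be read off from orders of vanishing at one root. *)
Lemma count_irrz_mup (s : seq {poly int}) Q z : (forall q, q \in s -> irrz q) ->
 irrz Q -> root (polyF Q) z -> mup z (polyF (\prod_(q <- s) q)) = count_mem Q s.
Proof.
move=> + iQ r; elim: s => [|q s IH] hs.
 by rewrite big_nil rmorph1 mupNroot // root1.
have iq : irrz q by apply: hs; rewrite mem_head.
have hs' : forall q, q \in s -> irrz q by move=> q' q's; apply: hs; rewrite inE q's orbT.
have p0 : polyF (\prod_(j <- s) j) != 0.
 rewrite polyF_eq0; apply/negP => /eqP; apply/eqP.
 by rewrite prodf_seq_neq0; apply/allP => j /hs' /irrz_neq0 ->.
rewrite big_cons rmorphM /= (mupM z (polyF_neq0 (irrz_neq0 iq)) p0).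
congr (_ + _)%N; last exact: IH.
have [->|nq] := eqVneq q Q; first by rewrite irrz_mup.
by rewrite mupNroot //; apply: contra nq => r'; apply/eqP/(irrz_eq iq iQ r' r).
Qed.

End Roots.

(* Landau's argument: swapping X - a and a^* X - 1 preserves the sum of the
  squared absolute values of the coefficients. *)
Section Landau.
Variable C : numClosedFieldType.
Implicit Types (p : {poly C}) (a : C).

Definition n2 p (N : nat) : C := \sum_(i < N) p`_i * (p`_i)^*.

Definition flip (b : bool) a : {poly C} := if b then 'X - a%:P else a^* *: 'X - 1.

Lemma size_flip b a : (size (flip b a) <= 2)%N.
Proof.
rewrite /flip; case: b; first by rewrite size_XsubC.
apply: leq_trans (size_polyD _ _) _; rewrite geq_max size_polyN size_poly1 andbT.
by apply: leq_trans (size_scale_leq _ _) _; rewrite size_polyX.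
Qed.

Lemma n2_flip p a N : (size p <= N)%N ->
 n2 (p * ('X - a%:P)) N.+1 = n2 (p * (a^* *: 'X - 1)) N.+1.
Proof.
(* [v i] is the squared modulus of the coefficient of index [i-1], with value 0 at 0. The cross
   terms of the two expansions agree, and what remains is [|a|^2 - 1] times a telescoping sum. *)
move=> sp; pose v i := if i is i'.+1 then p`_i' * (p`_i')^* else 0.
apply/eqP; rewrite -subr_eq0 /n2 -sumrB; apply/eqP.
rewrite (eq_bigr (fun i : 'I_N.+1 => (a * a^* - 1) * (v i.+1 - v i))) => [|i _].
 rewrite -mulr_sumr -(big_mkord xpredT (fun i => v i.+1 - v i)).
 by rewrite telescope_sumr //= nth_default // mul0r subr0 mulr0.
have e1 j : (p * ('X - a%:P))`_j = (if j is k.+1 then p`_k else 0) - p`_j * a.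
 by rewrite mulrBr coefB coefMC coefMX; case: j.
have e2 j : (p * (a^* *: 'X - 1))`_j = a^* * (if j is k.+1 then p`_k else 0) - p`_j.
 by rewrite mulrBr mulr1 coefB -scalerAr coefZ coefMX; case: j.
rewrite e1 e2 !rmorphB !rmorphM /= conjCK; case: i => [[|i] lti] /=.
 by rewrite ?rmorph0; ring.
by ring.
Qed.

Lemma n2_prod (s : seq C) p N (b : C -> bool) : (size p <= N)%N ->
 n2 (p * \prod_(a <- s) ('X - a%:P)) (size s + N) =
 n2 (p * \prod_(a <- s) flip (b a) a) (size s + N).
Proof.
elim: s p N => [|a s IH] p N sp; first by rewrite !big_nil.
have spf (bb : bool) : (size (p * flip bb a)%R <= N.+1)%N.
 apply: leq_trans (size_polyMleq _ _) _.
 by have := size_flip bb a; move: sp; lia.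
rewrite !big_cons /= addSn -addnS; case: (b a).
 by rewrite !mulrA; apply: IH; apply: (spf true).
have sq : (size (p * \prod_(j <- s) ('X - j%:P))%R <= size s + N)%N.
 apply: leq_trans (size_polyMleq _ _) _; rewrite size_prod_XsubC.
 by move: sp; lia.
set B := \prod_(j <- s) ('X - _).
have -> : p * (('X - a%:P) * B) = p * B * ('X - a%:P) by rewrite mulrAC mulrA.
rewrite addnS (n2_flip a sq) -addnS.
by rewrite mulrAC [in RHS]mulrA; apply: IH; apply: (spf false).
Qed.

Lemma n2_ge p N i : (i < N)%N -> `|p`_i| ^+ 2 <= n2 p N.
Proof.
move=> h; rewrite /n2 (bigD1 (Ordinal h)) //= -normCK lerDl sumr_ge0 // => j _.
by rewrite -normCK exprn_ge0.
Qed.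

Lemma lead_flip a : a != 0 -> lead_coef (flip false a) = a^*.
Proof.
move=> a0; rewrite /flip lead_coefDl ?lead_coefZ ?lead_coefX ?mulr1 //.
by rewrite size_polyN size_poly1 size_scale ?conjC_eq0 // size_polyX.
Qed.

(** Flipping the roots outside [b] keeps the sum of squares and moves the product of these roots
    into the leading coefficient, which is a single term of that sum. *)
Lemma landau c (s : seq C) (b : C -> bool) : (forall a, a \in s -> ~~ b a -> a != 0) ->
 (`|c| * \prod_(a <- s) (if b a then 1 else `|a|)) ^+ 2 <=
 n2 (c *: \prod_(a <- s) ('X - a%:P)) (size s).+1.
Proof.
move=> h; rewrite -mul_polyC -[(size s).+1]addn1 (@n2_prod _ _ _ b) ?size_polyC_leq1 //.
set q := c%:P * _; have E : `|c| * \prod_(a <- s) (if b a then 1 else `|a|) = `|lead_coef q|.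
 rewrite /q lead_coefM lead_coefC normrM lead_coef_prod normr_prod; congr (_ * _).
 rewrite big_seq [RHS]big_seq; apply: eq_bigr => a a_s; case: ifP => ba.
  by rewrite lead_coefXsubC normr1.
 by rewrite lead_flip ?norm_conjC //; apply: h; rewrite ?ba.
rewrite E lead_coefE; have [->|q0] := eqVneq q 0.
 by rewrite coef0 normr0 expr0n /= /n2 sumr_ge0 // => i _; rewrite coef0 mul0r.
apply: n2_ge; have : (size q <= (size s).+2.-1)%N.
 apply: leq_trans (size_polyMleq _ _) _.
 have : (size (\prod_(a <- s) flip (b a) a)%R <= (size s).+1)%N.
  elim: (s) => [|a s' IH]; first by rewrite big_nil size_poly1.
  rewrite big_cons; apply: leq_trans (size_polyMleq _ _) _ => /=.
  have aux (u v k : nat) : (u <= 2 -> v <= k.+1 -> (u + v).-1 <= k.+2)%N by lia.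
  exact: aux (size_flip _ _) IH.
 have aux (u v k : nat) : (u <= 1 -> v <= k.+1 -> (u + v).-1 <= k.+2.-1)%N by lia.
 exact: aux (size_polyC_leq1 c).
by have := size_poly_gt0 q; rewrite q0 /=; lia.
Qed.

End Landau.

(** * Real absolute values, lengths of polynomials, Mahler measure *)

Definition cab (R : rcfType) (z : R[i]) : R := complex.Re `|z|.

Lemma eq_le_ref (d : Order.disp_t) (T : porderType d) (x y : T) : x = y -> (x <= y)%O.
Proof. by move->. Qed.

Section Cab.
Variable R : rcfType.
Implicit Types (z w : R[i]) (p q : {poly R[i]}).

Lemma cabE z : `|z| = (cab z)%:C%C.
Proof. by rewrite /cab normc_def. Qed.

Lemma cab_ge0 z : 0 <= cab z.
Proof. by rewrite -lecR -cabE normr_ge0. Qed.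

Lemma cab0 : cab (0 : R[i]) = 0.
Proof. by apply: complexI; rewrite -cabE normr0. Qed.

Lemma cab1 : cab (1 : R[i]) = 1.
Proof. by apply: complexI; rewrite -cabE normr1. Qed.

Lemma cabM : {morph @cab R : z w / z * w}.
Proof. by move=> z w; apply: complexI; rewrite rmorphM -!cabE normrM. Qed.

Lemma cabN z : cab (- z) = cab z.
Proof. by apply: complexI; rewrite -!cabE normrN. Qed.

Lemma cabX z n : cab (z ^+ n) = cab z ^+ n.
Proof. by apply: complexI; rewrite rmorphXn -!cabE normrX. Qed.

Lemma cabV z : cab z^-1 = (cab z)^-1.
Proof. by apply: complexI; rewrite fmorphV -!cabE normfV. Qed.

Lemma cab_eq0 z : (cab z == 0) = (z == 0).
Proof. by rewrite -(inj_eq (@complexI R)) -cabE normr_eq0. Qed.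

Lemma cab_gt0 z : (0 < cab z) = (z != 0).
Proof. by rewrite lt0r cab_ge0 cab_eq0 andbT. Qed.

Lemma cabD z w : cab (z + w) <= cab z + cab w.
Proof. by rewrite -lecR rmorphD -!cabE ler_normD. Qed.

Lemma cabB z w : cab (z - w) <= cab z + cab w.
Proof. by rewrite -(cabN w) cabD. Qed.

Lemma cab_distC z w : cab (z - w) = cab (w - z).
Proof. by rewrite -cabN opprB. Qed.

Lemma cab_int (n : int) : cab (n%:~R : R[i]) = `|n|%:~R.
Proof. by apply: complexI; rewrite -cabE -intr_norm rmorph_int. Qed.

Lemma cab_nat (n : nat) : cab (n%:R : R[i]) = n%:R.
Proof. by rewrite -[n%:R]/((Posz n)%:~R) cab_int. Qed.

Lemma cab_int_ge1 (n : int) : n != 0 -> 1 <= cab (n%:~R : R[i]).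
Proof. by rewrite cab_int -[1]/(1%:~R) ler_int => n0; rewrite -gtz0_ge1 normr_gt0. Qed.

Lemma cab_prod (I : Type) (r : seq I) (P : pred I) (f : I -> R[i]) :
 cab (\prod_(i <- r | P i) f i) = \prod_(i <- r | P i) cab (f i).
Proof. exact: (big_morph _ cabM cab1). Qed.

Lemma cab_sum (I : Type) (r : seq I) (P : pred I) (f : I -> R[i]) :
 cab (\sum_(i <- r | P i) f i) <= \sum_(i <- r | P i) cab (f i).
Proof.
elim/big_rec2: _ => [|i y x _ h]; first by rewrite cab0.
by apply: le_trans (cabD _ _) _; rewrite lerD2l.
Qed.

(** The length of a polynomial. It is submultiplicative, which makes it more convenient than the
    height. *)
Definition n1 p : R := \sum_(i < size p) cab p`_i.

Lemma n1E p N : (size p <= N)%N -> n1 p = \sum_(i < N) cab p`_i.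
Proof.
move=> h; rewrite /n1 (big_ord_widen N (fun i => cab p`_i) h) big_mkcond /=.
by apply: eq_bigr => i _; case: ltnP => // ?; rewrite nth_default // cab0.
Qed.

Lemma n1_ge0 p : 0 <= n1 p.
Proof. by apply: sumr_ge0 => i _; apply: cab_ge0. Qed.

Lemma coef_le_n1 p i : cab p`_i <= n1 p.
Proof.
have [h|h] := ltnP i (size p); last by rewrite nth_default // cab0 n1_ge0.
rewrite /n1 (bigD1 (Ordinal h)) //= lerDl sumr_ge0 // => j _; exact: cab_ge0.
Qed.

Lemma n1_0 : n1 0 = 0. Proof. by rewrite /n1 size_poly0 big_ord0. Qed.

Lemma n1C (c : R[i]) : n1 c%:P = cab c.
Proof. by rewrite (@n1E _ 1) ?size_polyC_leq1 // big_ord1 coefC. Qed.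

Lemma n1D p q : n1 (p + q) <= n1 p + n1 q.
Proof.
pose N := maxn (size p) (size q).
rewrite (@n1E p N) ?leq_maxl // (@n1E q N) ?leq_maxr // (@n1E _ N) ?size_polyD //.
by rewrite -big_split /= ler_sum // => i _; rewrite coefD cabD.
Qed.

Lemma n1_sum (I : Type) (r : seq I) (P : pred I) (f : I -> {poly R[i]}) :
 n1 (\sum_(i <- r | P i) f i) <= \sum_(i <- r | P i) n1 (f i).
Proof.
elim/big_rec2: _ => [|i y x _ h]; first by rewrite n1_0.
by apply: le_trans (n1D _ _) _; rewrite lerD2l.
Qed.

Lemma n1Z c p : n1 (c *: p) = cab c * n1 p.
Proof.
rewrite (@n1E _ (size p)) ?size_scale_leq // mulr_sumr.
by apply: eq_bigr => i _; rewrite coefZ cabM.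
Qed.

Lemma n1Xn p n : n1 (p * 'X^n) = n1 p.
Proof.
have [->|p0] := eqVneq p 0; first by rewrite mul0r.
rewrite (@n1E _ (n + size p)); last by rewrite size_mulXn // addnC.
rewrite big_split_ord /= big1 => [|i _]; last by rewrite coefMXn ltn_ord cab0.
by rewrite add0r; apply: eq_bigr => i _; rewrite coefMXn ltnNge leq_addr addnC addnK.
Qed.

Lemma n1M p q : n1 (p * q) <= n1 p * n1 q.
Proof.
rewrite -[q in p * q]coefK poly_def mulr_sumr.
apply: le_trans (n1_sum _ _ _) _; rewrite mulr_sumr ler_sum // => i _.
by rewrite -scalerAr n1Z n1Xn mulrC.
Qed.

Lemma n1_1 : n1 1 = 1. Proof. by rewrite -[1]/(1%:P) n1C cab1. Qed.

Lemma n1_prod (I : Type) (r : seq I) (P : pred I) (f : I -> {poly R[i]}) :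
 n1 (\prod_(i <- r | P i) f i) <= \prod_(i <- r | P i) n1 (f i).
Proof.
elim/big_rec2: _ => [|i y x _ h]; first by rewrite n1_1.
by apply: le_trans (n1M _ _) _; rewrite ler_wpM2l ?n1_ge0.
Qed.

Lemma n1_exp p n : n1 (p ^+ n) <= n1 p ^+ n.
Proof.
elim: n => [|n IH]; first by rewrite !expr0 n1_1.
by rewrite !exprS; apply: le_trans (n1M _ _) _; rewrite ler_wpM2l ?n1_ge0.
Qed.

Lemma n1X : n1 'X = 1.
Proof. by rewrite -[X in n1 X]mul1r -['X]expr1 n1Xn n1_1. Qed.

Lemma n1_XsubC a : n1 ('X - a%:P) <= 1 + cab a.
Proof. by apply: le_trans (n1D _ _) _; rewrite n1X -polyCN n1C cabN. Qed.

Definition mx1 z : R := Num.max 1 (cab z).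

Lemma mx1_ge1 z : 1 <= mx1 z. Proof. by rewrite /mx1 le_max lexx. Qed.
Lemma mx1_gt0 z : 0 < mx1 z. Proof. exact: lt_le_trans ltr01 (mx1_ge1 z). Qed.
Lemma cab_mx1 z : cab z <= mx1 z. Proof. by rewrite /mx1 le_max lexx orbT. Qed.

Lemma n1_horner p z n : (size p <= n.+1)%N -> cab p.[z] <= n1 p * mx1 z ^+ n.
Proof.
move=> sp; rewrite horner_coef; apply: le_trans (cab_sum _ _ _) _.
rewrite /n1 mulr_suml ler_sum // => i _; rewrite cabM cabX ler_wpM2l ?cab_ge0 //.
apply: (@le_trans _ _ (mx1 z ^+ i)).
 by rewrite lerXn2r ?nnegrE ?cab_ge0 ?cab_mx1 ?(ltW (mx1_gt0 _)).
rewrite ler_weXn2l ?mx1_ge1 //; rewrite -ltnS; exact: leq_trans (ltn_ord i) sp.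
Qed.

Definition croots p : seq R[i] := sval (closed_field_poly_normal p).

Lemma crootsE p : p = lead_coef p *: \prod_(z <- croots p) ('X - z%:P).
Proof. exact: (svalP (closed_field_poly_normal p)). Qed.


Lemma size_croots p : p != 0 -> size (croots p) = (size p).-1.
Proof.
move=> p0; rewrite [in RHS](crootsE p) size_scale ?lead_coef_eq0 //.
by rewrite size_prod_XsubC.
Qed.

Lemma mem_croots p z : p != 0 -> (z \in croots p) = root p z.
Proof.
by move=> p0; rewrite [in RHS](crootsE p) rootZ ?lead_coef_eq0 // root_prod_XsubC.
Qed.

Lemma croots_mup p z : p != 0 -> count_mem z (croots p) = mup z p.
Proof.
move=> p0; rewrite [in RHS](crootsE p) -mul_polyC mupMr ?mu_prod_XsubC //.
by rewrite rootC lead_coef_eq0.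
Qed.

Lemma croots_uniq c (s : seq R[i]) : c != 0 ->
 perm_eq (croots (c *: \prod_(z <- s) ('X - z%:P))) s.
Proof.
move=> c0; set p := _ *: _.
have lp : lead_coef p = c.
 by rewrite lead_coefZ (monicP (monic_prod_XsubC _ _ _)) mulr1.
apply: prod_XsubC_eq; apply: (scalerI c0); rewrite -{1}lp.
exact: (esym (crootsE p)).
Qed.

(** The Mahler measure, through its product over the roots. *)
Definition mah p : R := cab (lead_coef p) * \prod_(z <- croots p) mx1 z.

Lemma mah_prod c (s : seq R[i]) : c != 0 ->
 mah (c *: \prod_(z <- s) ('X - z%:P)) = cab c * \prod_(z <- s) mx1 z.
Proof.
move=> c0; rewrite /mah lead_coefZ (monicP (monic_prod_XsubC _ _ _)) mulr1.
by rewrite (perm_big _ (croots_uniq s c0)).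
Qed.

Lemma mahM p q : p != 0 -> q != 0 -> mah (p * q) = mah p * mah q.
Proof.
move=> p0 q0; rewrite {1}(crootsE p) {1}(crootsE q) -scalerAl -scalerAr scalerA -big_cat.
rewrite mah_prod ?mulf_neq0 ?lead_coef_eq0 // cabM big_cat /=.
by rewrite /mah mulrACA.
Qed.

Lemma mahC c : c != 0 -> mah c%:P = cab c.
Proof.
move=> c0; have -> : c%:P = c *: \prod_(z <- [::]) ('X - z%:P) by rewrite big_nil -mul_polyC mulr1.
by rewrite mah_prod // big_nil mulr1.
Qed.

Lemma mah_XsubC z : mah ('X - z%:P) = mx1 z.
Proof.
have -> : 'X - z%:P = 1 *: \prod_(z <- [:: z]) ('X - z%:P) by rewrite big_seq1 scale1r.
by rewrite mah_prod ?oner_eq0 // big_seq1 cab1 mul1r.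
Qed.

Lemma prod_mx1_ge1 (s : seq R[i]) : 1 <= \prod_(z <- s) mx1 z.
Proof.
elim/big_rec: _ => // z x _ h; rewrite -[1]mulr1.
by apply: ler_pM => //; rewrite ?mx1_ge1.
Qed.

Lemma mah_ge_lead p : cab (lead_coef p) <= mah p.
Proof. by rewrite /mah ler_peMr ?cab_ge0 ?prod_mx1_ge1. Qed.

Lemma mah_gt0 p : p != 0 -> 0 < mah p.
Proof. by move=> p0; apply: lt_le_trans (mah_ge_lead p); rewrite cab_gt0 lead_coef_eq0. Qed.

Lemma n1_le_mah p : p != 0 -> n1 p <= 2 ^+ (size p).-1 * mah p.
Proof.
move=> p0; rewrite {1}(crootsE p) n1Z /mah mulrCA ler_wpM2l ?cab_ge0 //.
rewrite -size_croots //; elim: (croots p) => [|z s IH].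
 by rewrite !big_nil n1_1 mulr1 expr0.
rewrite !big_cons /= exprS mulrACA; apply: le_trans (n1M _ _) _.
apply: ler_pM; rewrite ?n1_ge0 //; apply: le_trans (n1_XsubC _) _.
by rewrite mulr2n mulrDl mul1r lerD ?mx1_ge1 ?cab_mx1.
Qed.

(** Landau's inequality, with the roots in the closed unit disc kept and the others flipped; a sum
    of squares is at most the square of the sum. *)
Lemma mah_le_n1 p : p != 0 -> mah p <= n1 p.
Proof.
move=> p0; have := @landau _ (lead_coef p) (croots p) (fun a => cab a <= 1).
rewrite -crootsE size_croots // prednK ?size_poly_gt0 // => h.
have {h} : (mah p)%:C%C ^+ 2 <= n2 p (size p).
 apply: le_trans (h _); last first.
  by move=> a _; apply: contra => /eqP->; rewrite cab0 ler01.
 rewrite /mah rmorphM rmorph_prod cabE; apply: eq_le_ref; congr ((_ * _) ^+ 2).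
 apply: eq_bigr => a _; rewrite /mx1; case: (leP (cab a) 1) => h1.
  by rewrite rmorph1.
 by rewrite cabE.
have -> : n2 p (size p) = (\sum_(i < size p) cab p`_i ^+ 2)%:C%C.
 by rewrite /n2 rmorph_sum; apply: eq_bigr => i _; rewrite -normCK cabE rmorphXn.
rewrite -rmorphXn lecR => h; rewrite -(@ler_sqr R) ?nnegrE ?n1_ge0 ?(ltW (mah_gt0 p0)) //.
apply: le_trans h _; rewrite expr2 /n1 big_distrl /= ler_sum // => i _.
by rewrite expr2 ler_wpM2l ?cab_ge0 //; apply: coef_le_n1.
Qed.

End Cab.

(** Divided derivatives at [z] become coefficients of the translated polynomial, so that products
    and compositions are handled by coefficient bounds. *)
Lemma coef_shift (C : comNzRingType) (p : {poly C}) z k :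
 (p \Po ('X + z%:P))`_k = (p^`N(k)).[z].
Proof.
have mono n : (('X^n : {poly C}) \Po ('X + z%:P))`_k = (('X^n)^`N(k)).[z].
 rewrite comp_Xn_poly nderivnXn hornerMn hornerXn addrC exprDn coef_sum.
 rewrite (eq_bigr (fun i : 'I_n.+1 => (z ^+ (n - i) *+ 'C(n, i)) *+ (k == i :> nat))) => [|i _].
  have [h|h] := leqP k n; last first.
   rewrite bin_small // mulr0n big1 // => i _.
   have hi : (i <= n)%N by rewrite -ltnS.
   by rewrite (gtn_eqF (leq_ltn_trans hi h)).
  rewrite (bigD1 (Ordinal (h : (k < n.+1)%N))) //= eqxx mulr1n big1 ?addr0 // => i ni.
  by case: eqP => // e; case/eqP: ni; apply/val_inj.
 rewrite coefMn -polyC_exp coefCM coefXn eq_sym; case: eqP => [->|_]; first by rewrite mulr1 mulr1n.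
 by rewrite mulr0 mul0rn.
rewrite -[p]coefK poly_def raddf_sum /= coef_sum (linear_sum (nderivn k)) /= horner_sum.
by apply: eq_bigr => i _; rewrite linearZ /= coefZ nderivnZ hornerZ mono.
Qed.

(** * Resultants and small jets at many points *)

Section DetBound.
Variable C : numFieldType.

(** Leibniz expansion. The entry bound is a row factor times a column factor, so every permutation
    gives the same product. *)
Lemma det_bound n (M : 'M[C]_n) (b e : 'I_n -> C) :
 (forall i j, `|M i j| <= b i * e j) ->
 `|\det M| <= n`!%:R * (\prod_i b i * \prod_j e j).
Proof.
move=> h; rewrite /determinant; apply: le_trans (ler_norm_sum _ _ _) _.
apply: (@le_trans _ _ (\sum_(s : {perm 'I_n}) (\prod_i b i * \prod_j e j))); last first.
 by rewrite sumr_const card_Sn mulr_natl.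
apply: ler_sum => s _; rewrite normrM normrX normrN1 expr1n mul1r normr_prod.
rewrite [\prod_j e j](reindex_inj (@perm_inj _ s)) /= -big_split /=.
by apply: ler_prod => i _; rewrite normr_ge0 h.
Qed.

Lemma prod_divn (S t : nat) (f : nat -> C) : (0 < t)%N ->
 \prod_(0 <= c < S * t) f (c %/ t)%N = \prod_(0 <= l < S) f l ^+ t.
Proof.
move=> t0; elim: S => [|S IH]; first by rewrite mul0n !big_geq.
rewrite big_nat_recr //= -IH mulSnr (big_cat_nat (n := S * t)) ?leq_addr //=.
congr (_ * _); rewrite -{1}[(S * t)%N]add0n (addnC (S * t)) big_addn addnK.
rewrite big_nat (eq_bigr (fun => f S)) => [|i /andP[_ lti]]; last first.
 by rewrite addnC divnMDl // divn_small // addn0.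
by rewrite -big_nat prodr_const_nat subn0.
Qed.

End DetBound.

Section MI.
Variable C : numFieldType.
Variables (R1 R2 G : {poly C}) (S t : nat) (z : nat -> C).
Let r1 := (size R1).-1.
Let r2 := (size R2).-1.
Hypotheses (R1_neq0 : R1 != 0) (R2_neq0 : R2 != 0) (t_gt0 : (0 < t)%N).
Hypothesis St : (S * t <= r2 + r1)%N.

Let D := (r2 + r1)%N.

(** An index [c < S * t] stands for the derivative of order [c %% t] at the point [z (c %/ t)]. *)
Let y c := z (c %/ t)%N.
Let Nst (j : nat) : {poly C} := \prod_(0 <= c < j) ('X - (y c)%:P).
(** The Newton basis for the points, each repeated [t] times. From degree [S * t] on it is continued
    by multiples of the full product, on which all the jets in question vanish. *)
Let Nw (j : nat) : {poly C} :=
 if (j < S * t)%N then Nst j else 'X^j - 'X^j %% Nst (S * t).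
(** Jets of [U * G] for the first [S * t] indices, plain coefficients afterwards. The factor [G] is
    inserted because the cofactors [R1] and [R2] are not small themselves; only their products with
    [G] are. *)
Let Lam (c : nat) (U : {poly C}) : C :=
 if (c < S * t)%N then ((U * G)^`N(c %% t)).[y c] else U`_c.

Lemma Nst_monic j : Nst j \is monic.
Proof. by rewrite /Nst monic_prod // => i _; rewrite monicXsubC. Qed.

Lemma size_Nst j : size (Nst j) = j.+1.
Proof. by rewrite /Nst big_mkord size_prod_XsubC /index_enum -enumT size_enum_ord. Qed.

Lemma size_modNst j : (size ('X^j %% Nst (S * t)%N)%R <= S * t)%N.
Proof.
rewrite -ltnS -[(S * t).+1](size_Nst (S * t)).
by rewrite ltn_modp -size_poly_gt0 size_Nst.
Qed.

Lemma coef_Nw j k : (j <= k)%N -> (Nw j)`_k = (j == k)%:R.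
Proof.
rewrite /Nw; case: ltnP => h jk.
 have := Nst_monic j; rewrite monicE lead_coefE size_Nst /= => /eqP e.
 case: eqP => [<-|/eqP ne]; first by rewrite e.
 by rewrite nth_default // size_Nst ltn_neqAle ne.
rewrite coefB coefXn eq_sym [X in _ - X]nth_default ?subr0 //.
exact: leq_trans (size_modNst _) (leq_trans h jk).
Qed.

Lemma Lam_linear c : linear (Lam c : {poly C} -> C^o).
Proof.
move=> a u v; rewrite /Lam; case: ifP => _; last by rewrite coefD coefZ.
by rewrite mulrDl -scalerAl nderivnD nderivnZ hornerD hornerZ.
Qed.

Lemma Lam_poly c (U : {poly C}) n : (size U <= n)%N ->
 Lam c U = \sum_(i < n) U`_i * Lam c 'X^i.
Proof.
move=> sU; have hD u v : Lam c (u + v) = Lam c u + Lam c v.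
 by have := Lam_linear c 1 u v; rewrite !scale1r.
have h0 : Lam c 0 = 0.
 by have := hD 0 0; rewrite addr0 => /esym/eqP; rewrite -subr_eq0 addrK => /eqP.
have hZ a u : Lam c (a *: u) = a * Lam c u.
 by have := Lam_linear c a u 0; rewrite addr0 h0 addr0.
rewrite -{1}[U]coefK poly_def (big_morph (Lam c) hD h0).
rewrite (big_ord_widen n (fun i => Lam c (U`_i *: 'X^i)) sU) big_mkcond /=.
apply: eq_bigr => i _; case: ltnP => h; first by rewrite hZ.
by rewrite nth_default // mul0r.
Qed.

Lemma nderivn_dvd_root k x (U : {poly C}) : (('X - x%:P) ^+ k.+1 %| U) ->
 (U^`N(k)).[x] = 0.
Proof.
case/dvdpP => V ->; rewrite -coef_shift comp_polyM rmorphXn /= comp_polyB comp_polyX.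
by rewrite comp_polyC addrK coefMXn ltnSn.
Qed.

Lemma nderivn_mul_root k x (U : {poly C}) :
 ((('X - x%:P) ^+ k * U)^`N(k)).[x] = U.[x].
Proof.
rewrite -coef_shift comp_polyM rmorphXn /= comp_polyB comp_polyX comp_polyC addrK.
by rewrite coefXnM ltnn subnn coef_shift nderivn0.
Qed.

Lemma Nst_dvd i j : (i <= j)%N -> Nst i %| Nst j.
Proof. elim: j => [|j IH]; first by rewrite leqn0 => /eqP->.
rewrite leq_eqVlt => /orP[/eqP->//|/IH h].
by rewrite [Nst j.+1]/Nst big_nat_recr //= dvdp_mulr. Qed.

Lemma Nst_split c : Nst c = Nst (c %/ t * t) * ('X - (y c)%:P) ^+ (c %% t).
Proof.
rewrite /Nst (big_cat_nat (n := (c %/ t * t)%N)) //=; last exact: leq_trunc_div.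
congr (_ * _); rewrite big_nat (eq_bigr (fun=> 'X - (y c)%:P)) => [|i /andP[h1 h2]].
 by rewrite -big_nat prodr_const_nat [X in (X - _)%N](divn_eq c t) addKn.
congr ('X - _%:P); rewrite /y; congr z; apply/eqP; rewrite eqn_leq.
by rewrite leq_div2r ?(ltnW h2) //= leq_divRL.
Qed.

Lemma Lam_Nw_lt c j : (c < j)%N -> Lam c (Nw j) = 0.
Proof.
move=> cj; rewrite /Lam; case: ltnP => h; last first.
 rewrite /Nw ltnNge (leq_trans h (ltnW cj)) /= coefB coefXn (ltn_eqF cj).
 by rewrite nth_default ?subr0 // (leq_trans (size_modNst _)).
apply: nderivn_dvd_root; apply: dvdp_mulr; apply: (@dvdp_trans _ (Nst c.+1)).
 rewrite /Nst big_nat_recr //= -/(Nst c) Nst_split -mulrA -exprSr.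
 exact: dvdp_mull.
rewrite /Nw; case: ltnP => h'; first exact: Nst_dvd.
apply: (dvdp_trans (Nst_dvd h)); rewrite {1}(divp_eq 'X^j (Nst (S * t))) addrK.
exact: dvdp_mull.
Qed.

Lemma Lam_Nw_diag c : (c < D)%N -> Lam c (Nw c) =
 if (c < S * t)%N then (Nst (c %/ t * t)).[y c] * G.[y c] else 1.
Proof.
move=> cD; rewrite /Lam; case: ltnP => h; last first.
 by rewrite coef_Nw ?eqxx.
by rewrite /Nw h Nst_split mulrAC mulrC nderivn_mul_root hornerM.
Qed.

Let Nmx : 'M[C]_D := \matrix_(j, k) (Nw j)`_k.
Let Wmx : 'M[C]_D := \matrix_(j, c) Lam c 'X^j.

Lemma size_Nw j : (j < D)%N -> (size (Nw j) <= D)%N.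
Proof.
move=> jD; apply/leq_sizeP => k Dk; rewrite coef_Nw ?(ltnW (leq_trans jD Dk)) //.
by rewrite (ltn_eqF (leq_trans jD Dk)).
Qed.

Lemma Nst_horner l x : (Nst (l * t)).[x] = \prod_(0 <= l' < l) (x - z l') ^+ t.
Proof.
rewrite /Nst horner_prod (eq_bigr (fun c => x - z (c %/ t)%N)) => [|c _]; last first.
 by rewrite hornerXsubC.
by rewrite (prod_divn _ (fun l' => x - z l') t_gt0).
Qed.

(** A confluent Vandermonde determinant with weights [G]: the passage to the Newton basis is
    unitriangular and makes the matrix of functionals triangular, with diagonal given by
    [Lam_Nw_diag]. *)
Lemma det_Wmx : \det Wmx =
 \prod_(0 <= l < S) ((\prod_(0 <= l' < l) (z l - z l') ^+ t) * G.[z l]) ^+ t.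
Proof.
have dN : \det Nmx = 1.
 rewrite det_trig; last by apply/is_trig_mxP => i j ij; rewrite mxE coef_Nw ?(ltnW ij) // (ltn_eqF ij).
 by rewrite big1 // => i _; rewrite mxE coef_Nw // eqxx.
have -> : \det Wmx = \det (Nmx *m Wmx) by rewrite det_mulmx dN mul1r.
rewrite -det_tr det_trig; last first.
 apply/is_trig_mxP => i j ij; rewrite !mxE (eq_bigr (fun k : 'I_D => (Nw j)`_k * Lam i 'X^k)) => [|k _].
  by rewrite -Lam_poly ?size_Nw // Lam_Nw_lt.
 by rewrite !mxE.
rewrite (eq_bigr (fun c : 'I_D => if (c < S * t)%N then (Nst (c %/ t * t)).[y c] * G.[y c] else 1)); last first.
 move=> c _; rewrite !mxE (eq_bigr (fun k : 'I_D => (Nw c)`_k * Lam c 'X^k)) => [|k _].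
  by rewrite -Lam_poly ?size_Nw // Lam_Nw_diag.
 by rewrite !mxE.
rewrite -big_mkcond /= -(big_ord_widen D (fun c => (Nst (c %/ t * t)).[y c] * G.[y c]) St).
rewrite -(big_mkord xpredT (fun c => (Nst (c %/ t * t)).[y c] * G.[y c])).
pose f l := (\prod_(0 <= l' < l) (z l - z l') ^+ t) * G.[z l].
rewrite (eq_bigr (fun c => f (c %/ t)%N)) => [|c _]; last by rewrite Nst_horner.
exact: prod_divn.
Qed.

Variables (B1 B2 : C) (eps : nat -> C).
Hypotheses (B1_ge0 : 0 <= B1) (B2_ge0 : 0 <= B2).
Hypothesis coef1 : forall i, `|R1`_i| <= B1.
Hypothesis coef2 : forall i, `|R2`_i| <= B2.
Hypothesis jet1 : forall l k a, (l < S)%N -> (k < t)%N -> (a < r2)%N ->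
 `|(('X^a * R1 * G)^`N(k)).[z l]| <= B1 * eps l.
Hypothesis jet2 : forall l k a, (l < S)%N -> (k < t)%N -> (a < r1)%N ->
 `|(('X^a * R2 * G)^`N(k)).[z l]| <= B2 * eps l.

(** Multiplying the Sylvester matrix by [Wmx] turns [S * t] of its columns into jets of multiples of
    [R1 * G] and [R2 * G], which are small. The determinant of the product factors on one side and
    is bounded by [det_bound] on the other. *)
Lemma resultant_multipoint :
 `|resultant R1 R2| *
  \prod_(0 <= l < S) ((\prod_(0 <= l' < l) `|z l - z l'| ^+ t) * `|G.[z l]|) ^+ t
 <= D`!%:R * (B1 ^+ r2 * B2 ^+ r1 * \prod_(0 <= l < S) eps l ^+ t).
Proof.
pose rp (i : 'I_D) : {poly C} := match fintype.split i with inl k => 'X^k * R1 | inr k => 'X^k * R2 end.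
have srp i : (size (rp i) <= D)%N.
 rewrite /rp; case: splitP => k _.
  rewrite mulrC size_mulXn // /D -(prednK (_ : 0 < size R1)%N) ?size_poly_gt0 // -/r1.
  by have := ltn_ord k; rewrite -/r2 -/r1; lia.
 rewrite mulrC size_mulXn // /D -(prednK (_ : 0 < size R2)%N) ?size_poly_gt0 // -/r2.
 by have := ltn_ord k; rewrite -/r2 -/r1; lia.
have SE i j : Sylvester_mx R1 R2 i j = (rp i)`_j.
 rewrite Sylvester_mxE /rp; case: (fintype.split i) => k; rewrite coefXnM ltnNge;
 by case: leqP => _; rewrite ?mulr1n ?mulr0n.
pose b (i : 'I_D) := if fintype.split i is inl _ then B1 else B2.
pose e (c : 'I_D) := if (c < S * t)%N then eps (c %/ t)%N else 1.
have := @det_bound C D (Sylvester_mx R1 R2 *m Wmx) b e.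
have -> : \prod_i b i = B1 ^+ r2 * B2 ^+ r1.
 rewrite big_split_ord /=; congr (_ * _).
  rewrite (eq_bigr (fun=> B1)) => [|i _]; first by rewrite prodr_const card_ord.
  by rewrite /b; case: splitP => // j; have := ltn_ord i; rewrite /= => + e'; rewrite e'; lia.
 rewrite (eq_bigr (fun=> B2)) => [|i _]; first by rewrite prodr_const card_ord.
 by rewrite /b; case: splitP => // j; have := ltn_ord j; rewrite /= => + e'; rewrite -e'; lia.
have -> : \prod_j e j = \prod_(0 <= l < S) eps l ^+ t.
 rewrite /e -big_mkcond /= -(big_ord_widen D (fun c => eps (c %/ t)%N) St).
 by rewrite -(big_mkord xpredT (fun c => eps (c %/ t)%N)) prod_divn.
move=> h; have {h} := h _; rewrite det_mulmx normrM det_Wmx normr_prod.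
set P1 := \prod_(0 <= i < S) _; set P2 := \prod_(0 <= l < S) ((\prod_(0 <= l' < l) `|z l - z l'| ^+ t) * `|G.[z l]|) ^+ t.
have -> : P1 = P2.
 rewrite /P1 /P2; apply: eq_bigr => l _; rewrite normrX normrM normr_prod.
 by congr ((_ * _) ^+ t); apply: eq_bigr => l' _; rewrite normrX.
apply=> i c; rewrite mxE (eq_bigr (fun k : 'I_D => (rp i)`_k * Lam c 'X^k)) => [|k _]; last first.
 by rewrite SE mxE.
rewrite -Lam_poly // /Lam /e /b /rp; case: ltnP => hc.
 have hl : (c %/ t < S)%N by rewrite ltn_divLR.
 have hk : (c %% t < t)%N by rewrite ltn_mod.
 by case: (fintype.split i) => k; [apply: jet1 | apply: jet2].
case: (fintype.split i) => k; rewrite mulr1 coefXnM; case: ifP => _; rewrite ?normr0 //.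
Qed.

End MI.

Notation evr h x := (map_poly (ratr : rat -> _) h).[x].

(** * Algebraic numbers as residues modulo a minimal polynomial *)

Section RatEval.
Variable C : numFieldType.
Notation polyC := (map_poly (intr : int -> C)).
Implicit Types (Q P : {poly int}) (x y : C) (h f g : {poly rat}).

Lemma irrz_dvdQ Q h x : irrz Q -> root (polyC Q) x -> evr h x = 0 -> polyQ Q %| h.
Proof.
move=> iQ r e; have [P [a a0 hE]] := rat_poly_scale h.
have rP : root (polyC P) x.
 have a1 : (a%:~R : C) != 0 by rewrite intr_eq0.
 move/eqP: e; rewrite hE map_polyZ /= -polyF_ratr hornerZ.
 by rewrite mulf_eq0 fmorph_eq0 invr_eq0 intr_eq0 (negPf a0).
have [P' PE] := irrz_dvd iQ r rP; rewrite hE (PE : P = Q * P') rmorphM /=.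
by rewrite dvdpZr ?invr_eq0 ?intr_eq0 // dvdp_mulr.
Qed.

Lemma dvdQ_evr Q h x : root (polyC Q) x -> polyQ Q %| h -> evr h x = 0.
Proof.
move=> r /dvdpP [u ->]; rewrite rmorphM hornerM /= -polyF_ratr.
by rewrite (rootP r) mulr0.
Qed.

Lemma evr_modp Q h x : root (polyC Q) x -> evr (h %% polyQ Q) x = evr h x.
Proof.
move=> r; rewrite {2}(divp_eq h (polyQ Q)) rmorphD rmorphM /= hornerD hornerM.
by rewrite -polyF_ratr (rootP r) mulr0 add0r.
Qed.

Definition powmx Q f n : 'M[rat]_(n, (size Q).-1) :=
 \matrix_(i < n) poly_rV ((f ^+ i) %% polyQ Q).

Lemma evr_powmx Q f n x (u : 'rV[rat]_n) : irrz Q -> root (polyC Q) x ->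
 evr (rVpoly (u *m powmx Q f n)) x = evr (rVpoly u) (evr f x).
Proof.
move=> iQ r; have Q0 : polyQ Q != 0 by rewrite polyF_eq0 irrz_neq0.
have sm h : (size (h %% polyQ Q)%R <= (size Q).-1)%N.
 rewrite -ltnS prednK ?size_poly_gt0 ?irrz_neq0 // -(size_polyF rat Q).
 by rewrite ltn_modp.
rewrite mulmx_sum_row linear_sum /= raddf_sum /= horner_sum.
rewrite {2}/rVpoly poly_def raddf_sum /= horner_sum; apply: eq_bigr => i _.
rewrite linearZ /= rowK poly_rV_K // !map_polyZ /= !hornerZ evr_modp //.
by rewrite valK rmorphXn horner_exp map_polyXn hornerXn.
Qed.

(** The first [size Q] powers of [f(x)] are residues modulo [Q], hence live in dimension
    [(size Q).-1]; a linear relation between them is an equation for [f(x)] of degree at most that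
    of [Q]. *)
Lemma size_minpoly_le Q P f x : irrz Q -> irrz P -> root (polyC Q) x ->
 root (polyC P) (evr f x) -> (size P <= size Q)%N.
Proof.
move=> iQ iP rQ rP; rewrite leqNgt; apply/negP => lt.
have sQ : (0 < size Q)%N by rewrite size_poly_gt0 irrz_neq0.
have nf : ~~ row_free (powmx Q f (size Q)).
 by rewrite -kermx_eq0; apply/negP => /eqP k0;
   have := rank_leq_col (powmx Q f (size Q)); have := mxrank_ker (powmx Q f (size Q));
   rewrite k0 mxrank0; move: sQ; lia.
rewrite -kermx_eq0 in nf; have [v vk v0] := rowV0Pn nf.
have e : evr (rVpoly v) (evr f x) = 0.
 by rewrite -(evr_powmx _ _ iQ rQ) (sub_kermxP vk) linear0 rmorph0 horner0.
have := irrz_dvdQ iP rP e; have [h0|h0] := eqVneq (rVpoly v) 0.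
 by case/eqP: v0; rewrite -[v]rVpolyK h0 linear0.
move=> /(dvdp_leq h0); rewrite size_polyF leqNgt (leq_ltn_trans (size_poly _ _) lt) //.
Qed.

End RatEval.

(** * Integral numbers and coefficients of products *)

Section Integrality.
Variable C : numFieldType.
Notation polyC := (map_poly (intr : int -> C)).
Notation intg := (integralOver (intr : int -> C)).
Implicit Types (x y r : C) (f g h : {poly C}).

Definition intgp f := forall k, intg f`_k.

Lemma intg_int (n : int) : intg n%:~R. Proof. exact: integral_id. Qed.

Lemma intgpD f g : intgp f -> intgp g -> intgp (f + g).
Proof. by move=> hf hg k; rewrite coefD; apply: integral_add. Qed.

Lemma intgpB f g : intgp f -> intgp g -> intgp (f - g).
Proof. by move=> hf hg k; rewrite coefB; apply: integral_sub. Qed.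

Lemma intgpMX f : intgp f -> intgp ('X * f).
Proof. by move=> hf k; rewrite coefXM; case: ifP => _; [apply: integral0 | apply: hf]. Qed.

Lemma intgpZXn c n : intg c -> intgp (c *: 'X^n).
Proof.
move=> hc k; rewrite coefZ coefXn; case: eqP => _; rewrite ?mulr1 ?mulr0 //.
exact: integral0.
Qed.

Lemma intg_exp x n : intg x -> intg (x ^+ n).
Proof.
by move=> hx; elim: n => [|n IH]; [exact: integral1 | rewrite exprS; apply: integral_mul].
Qed.

Lemma intg_lead_root f n r : (size f <= n.+1)%N -> intgp f -> root f r -> intg (f`_n * r).
Proof.
move=> sf hf rf; case: n sf => [|n] sf.
 have := rf; rewrite (size1_polyC sf) rootC => /eqP ->; rewrite coefC eqxx mul0r; exact: integral0.
set b := f`_n.+1.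
(* The equation [f(r) = 0] multiplied by a power of the top coefficient [b] becomes a monic equation
   for [b * r]. *)
pose m : {poly C} := 'X^(n.+1) + \poly_(i < n.+1) (f`_i * b ^+ (n - i)).
apply: (@integral_root_monic _ _ _ _ m).
- rewrite monicE lead_coefDl ?lead_coefXn // size_polyXn; exact: size_poly.
- rewrite /root /m hornerD hornerXn horner_poly.
 have := rf; rewrite /root (horner_coef_wide _ sf) big_ord_recr /= => /eqP e.
 have -> : (b * r) ^+ n.+1 = b ^+ n * (b * r ^+ n.+1) by rewrite exprMn exprSr -mulrA.
 rewrite (eq_bigr (fun i : 'I_n.+1 => b ^+ n * (f`_i * r ^+ i))) => [|i _].
  by rewrite -mulr_sumr -mulrDr addrC e mulr0.
 have le : (i <= n)%N by rewrite -ltnS.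
 have -> : b ^+ n = b ^+ (n - i) * b ^+ i by rewrite -exprD subnK.
 by rewrite exprMn; ring.
- move=> c /(nthP 0) [i _ <-]; rewrite coefD coefXn coef_poly.
 apply: integral_add; first by case: eqP => _; [exact: integral1 | exact: integral0].
 case: ifP => _; last exact: integral0.
 by apply: integral_mul; [exact: hf | exact: intg_exp (hf _)].
Qed.

(** Here [r] need not be integral. The top coefficient of [g] is that of the product, and its
    product with [r] is integral by [intg_lead_root], so the top term can be subtracted and the size
    decreases. *)
Lemma intgp_divXsubC n g r : (size g <= n)%N -> intgp (('X - r%:P) * g) -> intgp g.
Proof.
elim: n g => [|n IH] g sg hf.
 by move: sg; rewrite leqn0 size_poly_eq0 => /eqP -> k; rewrite coef0; apply: integral0.
have fn : (('X - r%:P) * g)`_n.+1 = g`_n.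
 by rewrite mulrBl coefB coefXM coefCM [g`_n.+1]nth_default // mulr0 subr0.
have sf : (size (('X - r%:P) * g)%R <= n.+2)%N.
 by apply: leq_trans (size_polyMleq _ _) _; rewrite size_XsubC.
have hb : intg (g`_n * r).
 rewrite -fn; apply: intg_lead_root sf hf _.
 by rewrite rootM root_XsubC eqxx.
have hgn : intg g`_n by rewrite -fn; apply: hf.
have hg' : intgp (g - g`_n *: 'X^n).
 apply: IH.
  apply/leq_sizeP => j; rewrite leq_eqVlt coefB coefZ coefXn => /orP[/eqP<-|nj].
   by rewrite eqxx mulr1 subrr.
  by rewrite (gtn_eqF nj) mulr0 subr0 nth_default // (leq_trans sg).
 have -> : ('X - r%:P) * (g - g`_n *: 'X^n) =
  ('X - r%:P) * g - g`_n *: 'X^(n.+1) + (g`_n * r) *: 'X^n.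
  rewrite mulrBr -addrA; congr (_ + _); rewrite exprS -!mul_polyC polyCM; ring.
 apply: intgpD; last exact: intgpZXn.
 by apply: intgpB => //; apply: intgpZXn.
by rewrite -[g](subrK (g`_n *: 'X^n)); apply: intgpD => //; apply: intgpZXn.
Qed.

(** Dedekind's Prague theorem, proved by moving one linear factor at a time. *)
Lemma intgp_coef_prod (s : seq C) g k :
 intgp (g * \prod_(r <- s) ('X - r%:P)) ->
 intgp ((\prod_(r <- s) ('X - r%:P))`_k *: g).
Proof.
elim: s g k => [|r s IH] g k.
 rewrite big_nil mulr1 coef1 => hg; case: eqP => _; rewrite ?scale1r ?scale0r //.
 by move=> j; rewrite coef0; apply: integral0.
rewrite big_cons mulrA; set h := \prod_(j <- s) _ => hg.
have h1 j : intgp (h`_j *: g).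
 apply: (@intgp_divXsubC (size (h`_j *: g)) _ r) => //.
 by rewrite -scalerAr mulrC; apply: IH.
have h2 j : intgp ((r * h`_j) *: g).
 have -> : (r * h`_j) *: g = 'X * (h`_j *: g) - h`_j *: (g * ('X - r%:P)).
  by rewrite -!mul_polyC polyCM; ring.
 by apply: intgpB; [apply: intgpMX | apply: IH].
rewrite mulrBl coefB coefXM coefCM scalerBl; apply: intgpB; last exact: h2.
by case: ifP => _ //; rewrite scale0r => j; rewrite coef0; apply: integral0.
Qed.

Lemma intg_rat (x : rat) : intg (ratr x) -> exists n : int, x = n%:~R.
Proof.
case=> M mM rM; have X0 : 'X - x%:P != 0 by rewrite polyXsubC_eq0.
have [Q [cQ eQ]] := rat_poly_primitive X0.
have iQ : irrz Q.
 split=> //; have [h1 h2] := irredp_XsubC x; split; first by rewrite (eqp_size eQ).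
 move=> q sq; rewrite (eqp_dvdr _ eQ) => /(h2 _ sq) h.
 by apply: eqp_trans h _; rewrite eqp_sym.
have sQ : size Q = 2 by rewrite -(size_polyF rat) (eqp_size eQ) size_XsubC.
have rQx : root (polyQ Q) x by rewrite (eqp_root eQ) root_XsubC.
have rQ : root (polyC Q) (ratr x) by rewrite polyF_ratr fmorph_root.
have [P' ME] := irrz_dvd iQ rQ rM.
have : lead_coef Q * lead_coef P' = 1 by rewrite -lead_coefM -ME (monicP mM).
move=> /(congr1 (fun n : int => `|n|%N)); rewrite abszM => /eqP.
rewrite muln_eq1 => /andP[/eqP aQ _].
have lQ : lead_coef Q = Q`_1 by rewrite lead_coefE sQ.
move: rQx; rewrite /root horner_coef size_polyF sQ !big_ord_recl big_ord0 /= !coef_map /=.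
rewrite expr0 mulr1 addr0 expr1 -lQ => /eqP e.
have [l1|l1] : lead_coef Q = 1 \/ lead_coef Q = -1.
 by move: aQ; case: (lead_coef Q) => [[|[|n]]|[|n]] //= _; [left|right].
- exists (- Q`_0); move: e; rewrite l1 mul1r => /eqP; rewrite addrC addr_eq0 => /eqP ->.
 by rewrite rmorphN.
exists Q`_0; move: e; rewrite l1 rmorphN mulN1r => /eqP; rewrite subr_eq0 => /eqP <- //.
Qed.

End Integrality.

(** * The leading coefficient of the minimal polynomial of a power *)

Section PowerHeight.
Variable C : numClosedFieldType.
Notation polyC := (map_poly (intr : int -> C)).
Notation intg := (integralOver (intr : int -> C)).

Lemma bigop_gcd_ideal (I : Type) (s : seq I) (P : pred I) (F : I -> nat) (J : int -> Prop) :
 J 0 -> (forall a b, J a -> J b -> J (a + b)) -> (forall a b, J b -> J (a * b)) ->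
 (forall i, J (F i)%:Z) -> J (\big[gcdn/0]_(i <- s | P i) F i)%:Z.
Proof.
move=> J0 JD JM JF; elim/big_rec: _ => // i n _ Jn.
have [u [v E]] := Bezoutz (F i)%:Z n%:Z.
rewrite (_ : (gcdn (F i) n)%:Z = gcdz (F i)%:Z n%:Z) // -E.
by apply: JD; apply: JM.
Qed.

(** By Bezout, coefficients of content one generate the unit ideal. [J] will be the ideal of
    integers that make a given number integral. *)
Lemma irrz_ideal (Q : {poly int}) (J : int -> Prop) : zcontents Q = 1 ->
 J 0 -> (forall a b, J a -> J b -> J (a + b)) -> (forall a b, J b -> J (a * b)) ->
 (forall i, J Q`_i) -> J 1.
Proof.
move=> cQ J0 JD JM JQ.
have := @bigop_gcd_ideal _ (index_enum 'I_(size Q)) xpredT (fun i : 'I_(size Q) => `|(Q`_i)%R|%N) J J0 JD JM.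
have Jabs (i : 'I_(size Q)) : J (`|(Q`_i)%R|%N)%:Z.
 by rewrite abszE normrEsg; apply: JM.
move=> /(_ Jabs); set n := \big[_/_]_(_ <- _ | _) _ => Jn.
have : zcontents Q = sgz (lead_coef Q) * n%:Z by rewrite /zcontents.
by rewrite cQ => ->; apply: JM.
Qed.

Lemma Xn_sub_exp (k : nat) (a : C) (w : C) : (0 < k)%N -> k.-primitive_root w ->
 'X^k - (a ^+ k)%:P = \prod_(0 <= j < k) ('X - (w ^+ j * a)%:P).
Proof.
move=> k0 pw; have [->|a0] := eqVneq a 0.
 rewrite expr0n gtn_eqF // subr0 (eq_bigr (fun=> 'X)) ?prodr_const_nat ?subn0 //.
 by move=> j _; rewrite mulr0 subr0.
have e j : 'X - (w ^+ j * a)%:P = a *: (('X - (w ^+ j)%:P) \Po (a^-1 *: 'X)).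
 rewrite comp_polyB comp_polyX comp_polyC scalerBr scalerA divff // scale1r.
 by rewrite -mul_polyC -polyCM mulrC.
rewrite (eq_bigr (fun j => a *: (('X - (w ^+ j)%:P) \Po (a^-1 *: 'X)))) //.
rewrite big_mkord scaler_prod /= prodr_const card_ord.
rewrite -(big_mkord xpredT (fun j => ('X - (w ^+ j)%:P) \Po (a^-1 *: 'X))).
rewrite -rmorph_prod /= (factor_Xn_sub_1 pw) rmorphB rmorph1 /= comp_Xn_poly exprZn.
by rewrite scalerBr scalerA -exprMn divff // expr1n scale1r -mul_polyC mulr1.
Qed.

Lemma intg_root_unity (w : C) k : (0 < k)%N -> w ^+ k = 1 -> intg w.
Proof.
move=> k0 wk; exists ('X^k - 1); first by rewrite monicXnsubC.
by rewrite rmorphB /= map_polyXn rmorph1 /root !hornerE ?hornerXn wk subrr.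
Qed.

Lemma coef_scale_roots (u : C) (s : seq C) j : u != 0 ->
 (\prod_(r <- s) ('X - (u * r)%:P))`_j * u ^+ j =
 u ^+ size s * (\prod_(r <- s) ('X - r%:P))`_j.
Proof.
move=> u0; elim: s j => [|r s IH] j.
 by rewrite !big_nil expr0 mul1r coef1; case: j => [|j]; rewrite ?expr0 ?mulr1 ?mul0r.
rewrite !big_cons !mulrBl !coefB !coefXM !coefCM mulrBl -mulrA IH /= exprS.
case: j => [|j] /=; first by rewrite mul0r; ring.
by rewrite exprSr mulrA IH; ring.
Qed.

Lemma primitive_root_exists k : (0 < k)%N -> exists w : C, k.-primitive_root w.
Proof.
move=> k0; have [s E] := closed_field_poly_normal ('X^k - 1 : {poly C}).
rewrite lead_coefXnsubC // scale1r in E.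
have ss : size s = k.
 have := size_prod_XsubC s id; rewrite /= -E size_XnsubC // => -[].
 by move=> ->.
have us : uniq s.
 apply: count_mem_uniq => r; rewrite -mu_prod_XsubC -E.
 have p0 : 'X^k - 1 != 0 :> {poly C} by rewrite -size_poly_gt0 size_XnsubC.
 have rE : root ('X^k - 1) r = (r \in s) by rewrite E root_prod_XsubC.
 case: (boolP (r \in s)) => h; last by rewrite mupNroot // rE.
 apply/eqP; rewrite eqn_leq mup_leq // -XsubC_dvd // dvdp_XsubCl rE h andbT.
 apply/negP => /dvdpP [u] /(congr1 (fun p => p^`().[r])).
 rewrite expr2 mulrA derivM derivXsubC derivB derivXn derivC subr0 !hornerE /= subrr !mulr0 addr0.
 rewrite hornerMn hornerXn => /eqP; rewrite mulrn_eq0 (gtn_eqF k0) /= expf_eq0 => /andP[_ /eqP r0].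
 move: h; rewrite -rE r0 /root !hornerE ?hornerXn expr0n (gtn_eqF k0) sub0r oppr_eq0 oner_eq0.
 by [].
have : has k.-primitive_root s.
 apply: has_prim_root => //; last by rewrite ss.
 apply/allP => r rs; rewrite unity_rootE -subr_eq0.
 have : root ('X^k - 1) r by rewrite E root_prod_XsubC.
 by rewrite /root !hornerE ?hornerXn.
by case/hasP => w _ pw; exists w.
Qed.

(** With [a], [b] the leading coefficients of [Q], [P] and [w] a primitive [k]-th root of unity,
    [P(X^k)] is [b] times the product of the polynomials with roots [w^j r]. The Prague theorem
    makes [b / a^k] times any product of [k] coefficients of [Q] integral, and primitivity of [Q]
    removes these coefficients. *)
Lemma lead_coef_power (Q P : {poly int}) (k : nat) (x : C) g : (0 < k)%N ->
 irrz Q -> irrz P -> root (polyC Q) x -> root (polyC P) (x ^+ k) ->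
 size P = size Q -> x = evr g (x ^+ k) ->
 exists s : seq C, [/\ polyC Q = (lead_coef Q)%:~R *: \prod_(r <- s) ('X - r%:P),
  polyC P = (lead_coef P)%:~R *: \prod_(r <- s) ('X - (r ^+ k)%:P) &
  exists n : int, lead_coef P = n * lead_coef Q ^+ k].
Proof.
move=> k0 iQ iP rQ rP sPQ xg.
have [s QE] := closed_field_poly_normal (polyC Q); rewrite lead_coef_polyF in QE.
have a0 : (lead_coef Q)%:~R != 0 :> C by rewrite intr_eq0 lead_coef_eq0 irrz_neq0.
have sQs : size Q = (size s).+1.
 by rewrite -(size_polyF C) QE size_scale // size_prod_XsubC.
have rs r : (r \in s) = root (polyC Q) r by rewrite QE rootZ // root_prod_XsubC.
have us : uniq s.
 apply: count_mem_uniq => r; rewrite -mu_prod_XsubC.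
 have -> : mup r (\prod_(x <- s) ('X - x%:P)) = mup r (polyC Q).
  by rewrite QE -mul_polyC mupMr // rootC.
 case: (boolP (r \in s)) => h; first by rewrite irrz_mup // -rs.
 by rewrite mupNroot // -rs.
have conj h r : r \in s -> evr h x = 0 -> evr h r = 0.
 by rewrite rs => rr e; apply: (dvdQ_evr rr); apply: (irrz_dvdQ iQ rQ).
have Pk r : r \in s -> root (polyC P) (r ^+ k).
 move=> hr; have := conj (polyQ P \Po 'X^k) r hr.
 rewrite !map_comp_poly /= !map_polyXn !horner_comp !hornerXn -!polyF_ratr => h.
 by apply/eqP/h/eqP.
have gk r : r \in s -> evr g (r ^+ k) = r.
 move=> hr; have := conj (g \Po 'X^k - 'X) r hr.
 rewrite !rmorphB /= !map_comp_poly /= !map_polyXn !map_polyX !hornerE !horner_comp !hornerXn.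
 by rewrite -xg subrr => /(_ erefl)/eqP; rewrite subr_eq0 => /eqP.
have uk : uniq [seq r ^+ k | r <- s].
 by rewrite map_inj_in_uniq // => r r' hr hr' e; rewrite -(gk r hr) -(gk r' hr') e.
have PE : polyC P = (lead_coef P)%:~R *: \prod_(r <- s) ('X - (r ^+ k)%:P).
 rewrite -lead_coef_polyF -(big_map (fun r => r ^+ k) xpredT (fun r => 'X - r%:P)).
 apply: all_roots_prod_XsubC; first by rewrite size_map size_polyF sPQ.
  by apply/allP => y /mapP [r hr ->]; apply: Pk.
 by rewrite uniq_rootsE.
exists s; split=> //.
set a := lead_coef Q; set b := lead_coef P.
have [w pw] := primitive_root_exists k0.
pose h := \prod_(r <- s) ('X - r%:P).
pose H j := \prod_(r <- s) ('X - (w ^+ j * r)%:P).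
have E1 : (b%:~R : C)%:P * \prod_(0 <= j < k) H j = polyC P \Po 'X^k.
 rewrite PE linearZ /= mul_polyC; congr (_ *: _).
 rewrite rmorph_prod /= exchange_big /=; apply: eq_bigr => r _.
 by rewrite comp_polyB comp_polyX comp_polyC (Xn_sub_exp _ k0 pw).
have i1 : intgp ((b%:~R : C)%:P * \prod_(0 <= j < k) H j).
 rewrite E1; have -> : ('X^k : {poly C}) = polyC 'X^k by rewrite map_polyXn.
 by rewrite -map_comp_poly => i; rewrite coef_map; apply: intg_int.
(* The factors [H j] are replaced one by one by one of their coefficients. *)
have i2 (js : nat -> nat) l : (l <= k)%N ->
  intgp ((\prod_(0 <= j < l) (H j)`_(js j)) *: ((b%:~R : C)%:P * \prod_(l <= j < k) H j)).
 elim: l => [|l IH] lk; first by rewrite big_geq // scale1r.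
 have := IH (ltnW lk); rewrite (big_ltn lk) big_nat_recr //=.
 set p := \prod_(0 <= j < l) _; set T := \prod_(l.+1 <= j < k) _; set B := _%:P.
 have -> : p *: (B * (H l * T)) = (p *: (B * T)) * H l.
  by rewrite -scalerAl; congr (_ *: _); ring.
 move=> hI; have HE : H l = \prod_(r <- [seq w ^+ l * r | r <- s]) ('X - r%:P) by rewrite /H big_map.
 by rewrite mulrC -scalerA HE; apply: intgp_coef_prod; rewrite -HE; exact: hI.
have wk : w ^+ k = 1 := prim_expr_order pw.
have w0 : w != 0 by apply: contra_eq_neq wk => ->; rewrite expr0n (gtn_eqF k0) eq_sym oner_eq0.
have aC0 : (a%:~R : C) != 0 by rewrite intr_eq0 lead_coef_eq0 irrz_neq0.
have qh j : (Q`_j)%:~R = a%:~R * h`_j :> C by rewrite -[LHS]coef_map QE coefZ.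
(* Corresponding coefficients of [H j] and of [h] differ by a root of unity; [V] collects these
   units. *)
have i3 (js : nat -> nat) : intg (b%:~R * \prod_(0 <= j < k) h`_(js j)).
 have := i2 js k (leqnn k) 0%N; rewrite (@big_geq _ _ _ k k) // mulr1 coefZ coefC eqxx.
 rewrite (eq_bigr (fun j => (w ^+ j) ^+ size s * (w ^+ j) ^- js j * h`_(js j))) => [|j _]; last first.
  have u0 : w ^+ j != 0 by rewrite expf_neq0.
  apply: (mulIf (expf_neq0 (js j) u0)); rewrite [LHS](coef_scale_roots _ _ u0).
  by rewrite mulrAC mulfVK // expf_neq0.
 rewrite big_split /= => hi.
 set V := \prod_(0 <= i < k) (_ * _) in hi.
 have V1 : V ^+ k = 1.
  rewrite /V -prodrXl big1 // => j _.
  by rewrite exprMn exprVn -!exprM ![(_ * k)%N]mulnC !exprM wk !expr1n invr1 mulr1.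
 have V0 : V != 0 by apply: contra_eq_neq V1 => ->; rewrite expr0n (gtn_eqF k0) eq_sym oner_eq0.
 have -> : b%:~R * \prod_(0 <= j < k) h`_(js j) = V^-1 * (V * \prod_(0 <= i < k) h`_(js i) * b%:~R).
  by rewrite -mulrA mulKf // mulrC.
 apply: integral_mul hi; apply: (intg_root_unity k0).
 by rewrite exprVn V1 invr1.
set c0 : C := b%:~R / a%:~R ^+ k.
(* One position at a time, [irrz_ideal] replaces an arbitrary coefficient of [Q] by 1. *)
have i4 l : (l <= k)%N -> forall js : nat -> nat, intg (c0 * \prod_(0 <= j < k - l) (Q`_(js j))%:~R).
 elim: l => [|l IH] lk js.
  rewrite subn0 (eq_bigr (fun j => a%:~R * h`_(js j))) => [|j _]; last exact: qh.
  rewrite big_split /= prodr_const_nat subn0 mulrA /c0 mulfVK ?expf_neq0 //.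
 have kl : (k - l)%N = (k - l.+1).+1 by rewrite subnSK.
 pose X := c0 * \prod_(0 <= j < k - l.+1) (Q`_(js j))%:~R.
 have := @irrz_ideal Q (fun c => intg (X * c%:~R)) iQ.1.
 rewrite mulr1; apply.
 - by rewrite mulr0; apply: integral0.
 - by move=> u v hu hv; rewrite intrD mulrDr; apply: integral_add.
 - by move=> u v hv; rewrite intrM mulrCA; apply: integral_mul => //; apply: intg_int.
 move=> i; have := IH (ltnW lk) (fun j => if (j == k - l.+1)%N then i else js j).
 rewrite kl big_nat_recr //= eqxx mulrA /X; congr (intg (_ * _ * _)).
 by apply: eq_big_nat => j /andP[_ jl]; rewrite (ltn_eqF jl).
have i5 : intg (ratr (b%:~R / a%:~R ^+ k : rat)).
 have := i4 k (leqnn k) (fun=> 0%N); rewrite subnn big_geq // mulr1.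
 by rewrite /c0 fmorph_div rmorphXn /= !ratr_int.
have [n nE] := intg_rat i5; exists n; apply/eqP; rewrite -(eqr_int rat) intrM rmorphXn /= -nE.
by rewrite mulfVK // expf_neq0 // intr_eq0 lead_coef_eq0 irrz_neq0.
Qed.

End PowerHeight.

(** * Exceptional primes for the power map on the roots of a polynomial *)

Lemma prod_primes_gt0 (s : seq nat) : all prime s -> (0 < \prod_(q <- s) q)%N.
Proof. by move=> ap; rewrite big_seq prodn_cond_gt0 // => q /(allP ap)/prime_gt0. Qed.

Lemma coprime_prod_primes p (s : seq nat) : prime p -> all prime s -> p \notin s ->
 coprime (\prod_(q <- s) q) p.
Proof.
move=> pp ap; elim: s ap => [|q s IH] /=; first by rewrite big_nil coprime1n.
move=> /andP[pq /IH h]; rewrite inE negb_or big_cons coprimeMl => /andP[pq' /h ->].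
by rewrite andbT prime_coprime // dvdn_prime2 // eq_sym.
Qed.

Section BadPrimes.
Variable L : fieldExtType rat.
Implicit Types (z : L).

(** If adjoining one more prime to the exponent left the field unchanged, [z^k] would lie in
    [Q(z^p)], and a Bezout relation between [k] and [p] would put [z] there. So each prime at least
    halves the degree. *)
Lemma subfield_chain z (s : seq nat) : z != 0 -> uniq s -> all prime s ->
 (forall p, p \in s -> z \notin <<1; z ^+ p>>%VS) ->
 (2 ^ size s * \dim <<1; z ^+ (\prod_(p <- s) p)>> <= \dim <<1; z>>)%N.
Proof.
move=> z0; elim: s => [|p s IH] /=; first by rewrite big_nil mul1n.
move=> /andP[ps us] /andP[pp ap] hs; rewrite big_cons.
have {IH} := IH us ap (fun q hq => hs q (mem_behead (hq : q \in behead (p :: s)))).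
set k := (\prod_(q <- s) q)%N => IH.
have zU j : z ^+ j \is a GRing.unit by rewrite unitfE expf_neq0.
have k0 : (0 < k)%N by apply: prod_primes_gt0.
have cpk : coprime k p by apply: coprime_prod_primes.
have KK : (<<1; z ^+ (p * k)>> <= <<1; z ^+ k>>)%VS.
 by apply/FadjoinP; rewrite sub1v mulnC exprM rpredX // memv_adjoin.
have Kp : (<<1; z ^+ (p * k)>> <= <<1; z ^+ p>>)%VS.
 by apply/FadjoinP; rewrite sub1v exprM rpredX // memv_adjoin.
have ne : <<1; z ^+ (p * k)>>%VS != <<1; z ^+ k>>%VS.
 apply: contra (hs p (mem_head _ _)) => /eqP e.
 have hk : z ^+ k \in <<1; z ^+ p>>%VS by apply: (subvP Kp); rewrite e memv_adjoin.
 have [[u v] /= uv] := coprimeP p k0 cpk.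
 have zE : z = (z ^+ k) ^+ u / (z ^+ p) ^+ v.
  rewrite -!exprM; have -> : (k * u = p * v + 1)%N by lia.
  by rewrite exprD mulrAC mulfV ?mul1r ?expr1 ?expf_neq0.
 by rewrite {1}zE; apply: rpred_div; apply: rpredX => //; apply: memv_adjoin.
have dd : (\dim <<1; z ^+ (p * k)>>%VS %| \dim <<1; z ^+ k>>%VS)%N.
 exact: (@field_dimS _ _ <<1; z ^+ (p * k)>>%AS <<1; z ^+ k>>%AS).
have lt : (\dim <<1; z ^+ (p * k)>> < \dim <<1; z ^+ k>>)%N.
 by rewrite (ltn_leqif (dimv_leqif_eq KK)).
have aux (a b N x : nat) : (a %| b)%N -> (a < b)%N -> (N * b <= x)%N -> (N * 2 * a <= x)%N.
 move=> /dvdnP [c ->] lt0 h; apply: leq_trans h; rewrite -mulnA leq_mul2l; apply/orP; right.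
 rewrite leq_mul2r; apply/orP; right; rewrite ltnNge; apply/negP => c1.
 by move: lt0; rewrite ltnNge -{2}[a]mul1n leq_mul2r c1 orbT.
by rewrite expnSr; apply: (aux _ _ _ _ dd lt IH).
Qed.

(** The degree of [zeta] is [p - 1]: its minimal polynomial divides [1 + ... + X^(p-1)], and it has
    a primitive [p]-th root of unity in [algC] as a root, whose minimal polynomial is cyclotomic. *)
Lemma prime_root_dim (zeta : L) p : prime p -> zeta ^+ p = 1 -> zeta != 1 ->
 (p.-1 %| \dim (fullv : {vspace L}))%N.
Proof.
move=> pp zp z1; have p0 := prime_gt0 pp.
have /polyOver1P [r rE] := minPolyOver 1 zeta.
have rr : root (map_poly (in_alg L) r) zeta by rewrite -rE root_minPoly.
pose S : {poly rat} := \sum_(i < p) 'X^i.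
have SE : 'X^p - 1 = ('X - 1) * S by rewrite subrX1.
have sS : size S = p.
 have S0 : S != 0.
  apply: contra_eq_neq SE => ->; rewrite mulr0 -size_poly_eq0 size_XnsubC //.
 have := congr1 (size : {poly rat} -> nat) SE.
 rewrite size_XnsubC // mulrC -[1]/(1%:P) size_Mmonic ?monicXsubC // size_XsubC; lia.
have rS : r %| S.
 rewrite -(dvdp_map (in_alg L)) -rE; apply: minPoly_dvdp; first by apply/polyOver1P; exists S.
 have : root (map_poly (in_alg L) ('X^p - 1)) zeta.
  by rewrite rmorphB /= map_polyXn rmorph1 /root !hornerE zp subrr.
 rewrite SE rmorphM rootM => /orP [|//].
 by rewrite rmorphB /= map_polyX rmorph1 root_XsubC (negPf z1).
have sr : size r = (adjoin_degree 1 zeta).+1.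
 by rewrite -(size_map_poly (in_alg L)) -rE size_minPoly.
have [w rw] : exists w : algC, root (map_poly ratr r) w.
 apply: closed_rootP; rewrite size_map_poly sr; apply/eqP => -[] h.
 have := root_size_gt1 (monic_neq0 (monic_minPoly 1 zeta)) (root_minPoly 1 zeta).
 by rewrite size_minPoly h.
have wp : p.-primitive_root w.
 have Sw : root (map_poly ratr S) w by apply: (root_dvdp _ rw); rewrite dvdp_map.
 have wp1 : w ^+ p = 1.
  apply/eqP; rewrite -subr_eq0; have : root (map_poly ratr ('X^p - 1)) w.
   by rewrite SE rmorphM rootM Sw orbT.
  by rewrite rmorphB /= map_polyXn rmorph1 /root !hornerE.
 have [q] := prim_order_exists p0 wp1; case/primeP: pp => _ /(_ q) h hq /h.
 case/orP=> /eqP q1; last by rewrite -q1.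
 move: hq Sw; rewrite q1 => /prim_expr_order; rewrite expr1 => ->.
 rewrite /S rmorph_sum /root horner_sum /= (eq_bigr (fun=> 1)) => [|i _].
  by rewrite sumr_const card_ord pnatr_eq0 (gtn_eqF p0).
 by rewrite map_polyXn hornerXn expr1n.
have [q [qE qm qd]] := minCpolyP w.
have sq : size q = p.
 have := congr1 (size : {poly algC} -> nat) (minCpoly_cyclotomic wp).
 by rewrite qE size_map_poly size_cyclotomic totient_prime // prednK.
have qr : (size q <= size r)%N.
 by apply: dvdp_leq; rewrite -?qd // -size_poly_eq0 sr.
have rS' : (size r <= p)%N by rewrite -sS; apply: dvdp_leq => //; rewrite -size_poly_eq0 sS -lt0n.
have -> : p.-1 = \dim <<1; zeta>>%VS.
 rewrite dim_Fadjoin dimv1 muln1; move: qr rS'; rewrite sr sq; move: (adjoin_degree _ _) => a.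
 by move=> h1 h2; apply/eqP; rewrite eqn_leq -ltnS (ltn_predK p0) h1 -ltnS (ltn_predK p0) h2.
exact: (@field_dimS _ _ <<1; zeta>>%AS {:L}%AS (subvf _)).
Qed.

End BadPrimes.

(** For a root [z] of [Q]: the fields [Q(z^p)] and [Q(z)] coincide, and [Q(z)] has no [p]-th root of
    unity except 1. Both are written modulo [Q] and thus hold at all conjugates at once. *)
Definition good_prime (Q : {poly int}) (p : nat) : Prop :=
 (exists g : {poly rat}, polyQ Q %| (g \Po 'X^p) - 'X) /\
 (forall h : {poly rat}, polyQ Q %| h ^+ p - 1 -> polyQ Q %| h - 1).

(** Primes that fail the first condition are limited by [subfield_chain]; for those that fail the
    second, [p - 1] divides the degree by [prime_root_dim]. *)
Lemma bad_prime_count (Q : {poly int}) (s : seq nat) : irrz Q -> Q`_0 != 0 -> uniq s ->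
 all prime s -> (forall p, p \in s -> ~ good_prime Q p) ->
 (size s <= trunc_log 2 (size Q).-1 + size (divisors (size Q).-1))%N.
Proof.
move=> iQ Q00 us ps hs; have [L dL [z rz fz]] := irredp_FAdjoin iQ.2.
rewrite size_polyF in dL; set d := (size Q).-1 in dL *.
have d0 : (0 < d)%N by have := irrz_size_gt1 iQ; rewrite /d; lia.
have QdvdE (h : {poly rat}) : (map_poly (in_alg L) h).[z] = 0 -> polyQ Q %| h.
 move=> hz; apply/negP => /negP nd.
 have cp : coprimep (polyQ Q) h by rewrite irreducible_poly_coprime //; exact: iQ.2.
 move: cp; rewrite -(coprimep_map (in_alg L)) => /coprimep_root /(_ rz).
 by rewrite /root hz eqxx.
have z0 : z != 0.
 apply: contra Q00 => /eqP z0; move: rz; rewrite z0 /root horner_coef0 coef_map fmorph_eq0.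
 by rewrite coef_map /= intr_eq0.
pose A p := z \notin <<1; z ^+ p>>%VS.
rewrite -(count_predC A) leq_add // -size_filter.
 have := @subfield_chain L z [seq p <- s | A p] z0 (filter_uniq _ us).
 rewrite fz dL => h; apply: trunc_log_max => //.
 have {h} := h _ _; move: (\dim _) (adim_gt0 <<1; z ^+ \prod_(p <- [seq p <- s | A p]) p>>%AS) => D D0 h.
 apply: leq_trans (h _ _); first by rewrite leq_pmulr.
  by apply/allP => p; rewrite mem_filter => /andP[_ /(allP ps)].
 by move=> p; rewrite mem_filter => /andP[].
rewrite -(size_map predn); apply: uniq_leq_size.
 rewrite map_inj_in_uniq ?filter_uniq // => p q; rewrite !mem_filter => /andP[_ /(allP ps)/prime_gt0 p0].
 by move=> /andP[_ /(allP ps)/prime_gt0 q0]; lia.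
move=> e /mapP [p]; rewrite mem_filter => /andP[/= /negPn Ap hp] ->.
rewrite -dvdn_divisors // -dL; have pp := allP ps p hp.
have [h hh] : exists h : {poly rat}, ~ (polyQ Q %| h ^+ p - 1 -> polyQ Q %| h - 1).
 apply/existsNP => H; apply: (hs p hp); split=> //.
 have /Fadjoin_polyP [g /polyOver1P [g' ->] gE] := Ap.
 exists g'; apply: QdvdE; rewrite rmorphB /= map_comp_poly /= map_polyXn map_polyX.
 by rewrite !hornerE horner_comp hornerXn -gE subrr.
have [h1 h2] : polyQ Q %| h ^+ p - 1 /\ ~ (polyQ Q %| h - 1).
 by apply/not_implyP.
apply: (@prime_root_dim L (map_poly (in_alg L) h).[z]) => //.
 have := root_dvdp _ rz; rewrite /root => /(_ (map_poly (in_alg L) (h ^+ p - 1))).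
 rewrite dvdp_map rmorphB rmorphXn /= rmorph1 !hornerE => /(_ h1).
 by rewrite subr_eq0 => /eqP.
apply/eqP => e1; apply: h2; apply: QdvdE.
by rewrite rmorphB /= rmorph1 !hornerE e1 subrr.
Qed.

(** * Minimal polynomials of powers of roots *)

Section PowerImage.
Variable C : numClosedFieldType.
Notation polyC := (map_poly (intr : int -> C)).
Implicit Types (Q P B : {poly int}) (x y : C) (f g h : {poly rat}).

Lemma algebraic_minpoly x : algebraicOver (ratr : rat -> C) x -> exists Q, irrz Q /\ root (polyC Q) x.
Proof.
case=> p p0 rp; have [P [a a0 pE]] := rat_poly_scale p.
apply: (@exists_minpoly C P).
 by apply: contra_neq p0 => P0; rewrite pE P0 rmorph0 scaler0.
have c0 : ratr (a%:~R^-1) != 0 :> C by rewrite fmorphV invr_eq0 /= fmorph_eq0 intr_eq0.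
by move: rp; rewrite pE map_polyZ /= (rootZ _ _ c0) -polyF_ratr.
Qed.

Lemma minpoly_algebraic Q x : Q != 0 -> root (polyC Q) x -> algebraicOver (ratr : rat -> C) x.
Proof. by move=> Q0 rQ; exists (polyQ Q); rewrite ?polyF_eq0 // -polyF_ratr. Qed.

Lemma evr_algebraic h x : algebraicOver (ratr : rat -> C) x -> algebraicOver (ratr : rat -> C) (evr h x).
Proof. by move=> /integral_algebraic hx; apply/integral_algebraic; apply: integral_horner => // c /(nthP 0) [i _ <-]; rewrite coef_map; apply: integral_id. Qed.

Lemma evr_inv Q x h : irrz Q -> root (polyC Q) x -> exists g, (evr h x)^-1 = evr g x.
Proof.
move=> iQ rQ; have [h0|h0] := eqVneq (evr h x) 0.
 by exists 0; rewrite h0 invr0 rmorph0 horner0.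
have cp : coprimep (polyQ Q) h.
 rewrite irreducible_poly_coprime; last exact: iQ.2.
 by apply: contra h0 => /(dvdQ_evr rQ) ->.
have /Bezout_eq1_coprimepP [[u v] /= uv] := cp.
exists v; apply: (mulIf h0); rewrite mulVf //.
have := congr1 (fun q => evr q x) uv; rewrite rmorphD !rmorphM rmorph1 /= !hornerE.
by rewrite -polyF_ratr (rootP rQ) mulr0 add0r => ->.
Qed.

Lemma irrz_root_neq0 Q x : Q`_0 != 0 -> root (polyC Q) x -> x != 0.
Proof.
move=> Q0; apply: contraTneq => ->.
by rewrite /root horner_coef0 coef_map /= intr_eq0.
Qed.

Lemma good_image Q p x : irrz Q -> good_prime Q p -> root (polyC Q) x ->
 exists P g, [/\ irrz P, root (polyC P) (x ^+ p), size P = size Q & x = evr g (x ^+ p)].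
Proof.
move=> iQ [[g hg] _] rQ.
have xg : x = evr g (x ^+ p).
 have := dvdQ_evr rQ hg; rewrite rmorphB /= map_comp_poly /= map_polyXn map_polyX.
 by rewrite !hornerE horner_comp !hornerE => /eqP; rewrite subr_eq0 => /eqP.
have e1 : x ^+ p = evr 'X^p x by rewrite map_polyXn hornerXn.
have ax : algebraicOver (ratr : rat -> C) (x ^+ p).
 by rewrite e1; apply/evr_algebraic/(minpoly_algebraic (irrz_neq0 iQ)).
have [P [iP rP]] := algebraic_minpoly ax.
exists P, g; split=> //; apply/eqP; rewrite eqn_leq; apply/andP; split.
 by apply: (size_minpoly_le iQ iP rQ (f := 'X^p)); rewrite -e1.
by apply: (size_minpoly_le iP iQ rP (f := g)); rewrite -xg.
Qed.

(** A conjugation that sends [x'^p] to [x^p] sends [x'] to some [y] in [Q(x)] with [y^p = x^p]. The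
    quotient [y / x] is a [p]-th root of unity in [Q(x)], hence 1. *)
Lemma good_image_inj Q Q' P p x x' : irrz Q -> irrz Q' -> irrz P -> Q`_0 != 0 ->
 good_prime Q p -> good_prime Q' p -> root (polyC Q) x -> root (polyC Q') x' ->
 root (polyC P) (x ^+ p) -> root (polyC P) (x' ^+ p) -> Q = Q'.
Proof.
move=> iQ iQ' iP Q0 [gQ1 gQ2] gQ' rQ rQ' rP rP'.
have [_ [g' [_ _ _ xg']]] := good_image iQ' gQ' rQ'.
have conj h : evr h (x' ^+ p) = 0 -> evr h (x ^+ p) = 0.
 by move=> e; apply: (dvdQ_evr rP); apply: (irrz_dvdQ iP rP').
pose y := evr g' (x ^+ p).
have yp : y ^+ p = x ^+ p.
 have := conj (g' ^+ p - 'X); rewrite !rmorphB !rmorphXn /= !map_polyX !hornerE -/y.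
 by rewrite -xg' subrr => /(_ erefl)/eqP; rewrite subr_eq0 => /eqP.
have ry : root (polyC Q') y.
 have := conj (polyQ Q' \Po g'); rewrite !map_comp_poly /= !horner_comp -xg' -!polyF_ratr.
 by rewrite (rootP rQ') => /(_ erefl)/eqP.
have x0 := irrz_root_neq0 Q0 rQ.
have [u xu] := evr_inv 'X iQ rQ; rewrite map_polyX hornerX in xu.
pose h := (g' \Po 'X^p) * u.
have hE : evr h x = y / x.
 by rewrite /h rmorphM /= hornerM map_comp_poly /= map_polyXn horner_comp hornerXn -xu.
have h1 : evr (h ^+ p - 1) x = 0.
 by rewrite rmorphB rmorphXn rmorph1 !hornerE hE expr_div_n yp divff ?subrr // expf_neq0.
have := dvdQ_evr rQ (gQ2 _ (irrz_dvdQ iQ rQ h1)).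
rewrite rmorphB rmorph1 !hornerE hE => /eqP; rewrite subr_eq0 => /eqP e.
apply: (irrz_eq iQ iQ' rQ); suff -> : x = y by [].
by rewrite -[y](divfK x0) e mul1r.
Qed.

(** Roots of [y] of coprime orders [p] and [k] inside [Q(y)] combine, by a Bezout relation, into a
    root of order [p * k]. *)
Lemma common_power_root P y (s : seq nat) : irrz P -> root (polyC P) y -> y != 0 ->
 uniq s -> all prime s -> (forall p, p \in s -> exists h, evr h y ^+ p = y) ->
 exists h, evr h y ^+ (\prod_(p <- s) p)%N = y.
Proof.
move=> iP rP y0; elim: s => [|p s IH] /=.
 by move=> _ _ _; exists 'X; rewrite big_nil map_polyX hornerX.
move=> /andP[ps us] /andP[pp ap] hs; rewrite big_cons.
have [|h hE] := IH us ap _; first by move=> q hq; apply: hs; rewrite inE hq orbT.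
have [h' hE'] := hs p (mem_head _ _).
set k := (\prod_(q <- s) q)%N in hE *.
have k0 : (0 < k)%N by apply: prod_primes_gt0.
have cpk : coprime k p by apply: coprime_prod_primes.
have [[u v] /= uv] := coprimeP p k0 cpk.
have [w wE] := evr_inv h iP rP.
set z := evr h y in hE wE; set z' := evr h' y in hE'.
have z0 : z != 0 by apply: contra_neq y0 => e; rewrite -hE e expr0n (gtn_eqF k0).
(* With [u * k = v * p + 1], the number [z'^u / z^v] raised to the power [p * k] is
   [y^(u k) / y^(v p) = y]. *)
exists (h' ^+ u * w ^+ v).
rewrite rmorphM !rmorphXn /= !hornerE -wE -/z'.
rewrite exprMn -!exprM exprVn.
have -> : (u * (p * k) = p * (u * k))%N by lia.
have -> : (v * (p * k) = k * (v * p))%N by lia.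
rewrite (exprM z') hE' (exprM z) hE.
have -> : (u * k = v * p + 1)%N by lia.
by rewrite exprD expr1 mulrAC mulfV ?mul1r // expf_neq0.
Qed.

End PowerImage.

(** * Mahler measures under powers *)

Section MahlerPower.
Variable R : rcfType.
Notation polyC := (map_poly (intr : int -> R[i])).
Notation mz Q := (mah (polyC Q)).

Lemma mx1X (z : R[i]) k : mx1 (z ^+ k) = mx1 z ^+ k.
Proof.
rewrite /mx1 cabX; case: (leP (cab z) 1) => h.
 by rewrite max_l ?expr1n // exprn_ile1 // cab_ge0.
by rewrite max_r // exprn_ege1 // ltW.
Qed.

(** The roots of [P] are the [k]-th powers of those of [Q], and by [lead_coef_power] its leading
    coefficient is a non-zero multiple of the [k]-th power. *)
Lemma mahler_power (Q P : {poly int}) (k : nat) (x : R[i]) g : (0 < k)%N ->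
 irrz Q -> irrz P -> root (polyC Q) x -> root (polyC P) (x ^+ k) ->
 size P = size Q -> x = evr g (x ^+ k) -> mz Q ^+ k <= mz P.
Proof.
move=> k0 iQ iP rQ rP sPQ xg.
have [s [QE PE [n nE]]] := lead_coef_power k0 iQ iP rQ rP sPQ xg.
have Q0 : lead_coef Q != 0 by rewrite lead_coef_eq0 irrz_neq0.
have P0 : lead_coef P != 0 by rewrite lead_coef_eq0 irrz_neq0.
rewrite QE PE -(big_map (fun r => r ^+ k) xpredT (fun r => 'X - r%:P)).
rewrite !mah_prod ?intr_eq0 // big_map exprMn.
under [in leRHS]eq_bigr do rewrite mx1X.
rewrite prodrXl ler_wpM2r //.
 by rewrite exprn_ge0 // (le_trans ler01) // prod_mx1_ge1.
rewrite nE intrM rmorphXn /= cabM cabX ler_peMl ?exprn_ge0 ?cab_ge0 //.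
apply: cab_int_ge1; apply: contra_neq P0 => n0.
by rewrite nE n0 mul0r.
Qed.

Lemma good_mahler (Q P : {poly int}) p (x : R[i]) : irrz Q -> irrz P -> (0 < p)%N ->
 good_prime Q p -> root (polyC Q) x -> root (polyC P) (x ^+ p) ->
 size P = size Q /\ mz Q ^+ p <= mz P.
Proof.
move=> iQ iP p0 gp rQ rP; have [P' [g [iP' rP' sP xg]]] := good_image iQ gp rQ.
have PP := irrz_eq iP iP' rP rP'; rewrite PP; split=> //.
exact: (mahler_power p0 iQ iP' rQ rP' sP xg).
Qed.

(** If [P] is the image of some polynomial under every prime of [s], then [y] is a [k]-th power in
    [Q(y)] for the product [k] of these primes. The Mahler measure of [P] then grows with [k], which
    limits how many primes can share one image. *)
Lemma common_image_mahler (P : {poly int}) (y : R[i]) (s : seq nat) : irrz P ->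
 root (polyC P) y -> y != 0 -> uniq s -> all prime s ->
 (forall p, p \in s -> exists Q x, [/\ irrz Q, good_prime Q p, root (polyC Q) x & root (polyC P) (x ^+ p)]) ->
 exists B z k, [/\ irrz B, root (polyC B) z, z ^+ k = y & size B = size P] /\
  (2 ^ size s <= k)%N /\ mz B ^+ k <= mz P.
Proof.
move=> iP rP y0 us ap hs.
have [|h hE] := common_power_root iP rP y0 us ap.
 move=> p /hs [Q [x [iQ gp rQ rPx]]].
 have [_ [g [_ _ _ xg]]] := good_image iQ gp rQ.
 exists g; have := @dvdQ_evr _ P (g ^+ p - 'X) y rP _.
 have e0 : evr (g ^+ p - 'X) (x ^+ p) = 0.
  by rewrite rmorphB rmorphXn /= map_polyX !hornerE -xg subrr.
 move=> /(_ (irrz_dvdQ iP rPx e0)).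
 by rewrite rmorphB rmorphXn /= map_polyX !hornerE => /eqP; rewrite subr_eq0 => /eqP.
set k := (\prod_(p <- s) p)%N in hE.
have k2 : (2 ^ size s <= k)%N.
 rewrite /k; elim: (s) ap => [|p s' IH] /=; first by rewrite big_nil.
 by move=> /andP[/prime_gt1 p1 /IH ih]; rewrite big_cons expnS leq_mul.
have [B [iB rB]] := algebraic_minpoly (evr_algebraic h (minpoly_algebraic (irrz_neq0 iP) rP)).
have sB : size P = size B.
 apply/eqP; rewrite eqn_leq (size_minpoly_le iP iB rP rB) andbT.
 by apply: (size_minpoly_le iB iP rB (f := 'X^k)); rewrite map_polyXn hornerXn hE.
exists B, (evr h y), k; split=> //; split=> //.
apply: (@mahler_power B P k (evr h y) h) => //; rewrite ?hE //.
by rewrite (leq_trans _ k2) // expn_gt0.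
Qed.

End MahlerPower.

(** * Power sums of conjugates modulo a prime *)

Section PowerSums.
Variable C : numClosedFieldType.
Notation polyC := (map_poly (intr : int -> C)).
Notation intg := (integralOver (intr : int -> C)).

(** The sum is the trace of multiplication by [X^k] modulo [Q], a rational matrix that the
    Vandermonde matrix of the roots diagonalizes. *)
Lemma power_sum_rat (Q : {poly int}) (c : C) (s : seq C) k : irrz Q -> uniq s -> c != 0 ->
 polyC Q = c *: \prod_(r <- s) ('X - r%:P) -> exists a : rat, \sum_(r <- s) r ^+ k = ratr a.
Proof.
move=> iQ us c0 QE.
have rs r : r \in s -> root (polyC Q) r.
 by move=> hr; rewrite QE rootZ // root_prod_XsubC.
have sQ : size Q = (size s).+1.
 by rewrite -(size_polyF C) QE size_scale // size_prod_XsubC.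
set d := size s in sQ.
pose T : 'M[rat]_d := \matrix_(i < d) poly_rV ('X^(i + k) %% polyQ Q).
pose a : 'rV[C]_d := \row_j s`_j.
pose V := Vandermonde d a.
pose D : 'M[C]_d := diag_mx (\row_j s`_j ^+ k).
have VU : V \in unitmx.
 rewrite unitmxE unitfE det_Vandermonde; apply/prodf_neq0 => i _; apply/prodf_neq0 => j ij.
 by rewrite !mxE subr_eq0 nth_uniq // gtn_eqF.
have TV : map_mx ratr T *m V = V *m D.
 apply/matrixP => i j; rewrite mul_mx_diag !mxE.
 have rj : root (polyC Q) s`_j by apply/rs/mem_nth.
 have <- : evr ('X^(i + k) %% polyQ Q) s`_j = s`_j ^+ i * s`_j ^+ k.
  by rewrite evr_modp // map_polyXn hornerXn exprD.
 rewrite (@horner_coef_wide _ d); last first.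
  rewrite size_map_poly -ltnS -sQ -(size_polyF rat) ltn_modp polyF_eq0; exact: irrz_neq0.
 by apply: eq_bigr => l _; rewrite !mxE coef_map.
exists (\tr T); transitivity (\tr (map_mx (ratr : rat -> C) T)); last first.
 by rewrite /mxtrace rmorph_sum; apply: eq_bigr => i _; rewrite !mxE.
have -> : map_mx ratr T = V *m D *m invmx V by rewrite -TV mulmxK.
rewrite mxtrace_mulC mulmxA mulVmx // mul1mx mxtrace_diag (big_nth 0) big_mkord.
by apply: eq_bigr => i _; rewrite !mxE.
Qed.

Lemma frobenius_sum (ys : seq C) p : prime p -> (forall y, y \in ys -> intg y) ->
 exists c, intg c /\ (\sum_(y <- ys) y) ^+ p = \sum_(y <- ys) y ^+ p + p%:R * c.
Proof.
move=> pp; have p0 := prime_gt0 pp; elim: ys => [|y ys IH] hy.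
 exists 0; split; first exact: integral0.
 by rewrite !big_nil expr0n (gtn_eqF p0) mulr0 addr0.
have [|c [ic cE]] := IH; first by move=> z hz; apply: hy; rewrite inE hz orbT.
have iy : intg y by apply: hy; rewrite mem_head.
set Y := \sum_(z <- ys) z in cE *.
have iY : intg Y.
 rewrite /Y big_seq; apply: (big_ind intg); [exact: integral0 | exact: integral_add|].
 by move=> z hz; apply: hy; rewrite inE hz orbT.
pose e := \sum_(i < p.-1) ('C(p, i.+1) %/ p)%:R * (y ^+ (p - i.+1) * Y ^+ i.+1).
have ie : intg e.
 rewrite /e; apply: (big_ind intg); [exact: integral0 | exact: integral_add|].
 move=> i _; apply: integral_mul; first exact: integral_nat.
 by apply: integral_mul; apply: intg_exp.
exists (c + e); split; first exact: integral_add.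
suff key : (y + Y) ^+ p = y ^+ p + p%:R * e + Y ^+ p.
 rewrite !big_cons -/Y key cE; set Z := \sum_(_ <- _) _; move: (p%:R : C) (y ^+ p) Z => a b Z; ring.
rewrite exprDn -(big_mkord xpredT (fun i => y ^+ (p - i) * Y ^+ i *+ 'C(p, i))).
rewrite big_nat_recr //= (big_ltn p0) big_add1 big_mkord bin0 binn !mulr1n subn0 subnn expr0 mulr1 mul1r.
congr (_ + _ + _); rewrite /e mulr_sumr; apply: eq_bigr => i _.
have /dvdnP [b bE] : (p %| 'C(p, i.+1))%N.
 by apply: prime_dvd_bin => //; have := ltn_ord i; lia.
rewrite bE mulnK // mulrA -natrM mulrC [(p * b)%N]mulnC.
by rewrite -mulr_natl mulrC.
Qed.

Lemma fermat_int (a : int) p : prime p -> exists b : int, a ^+ p = a + p%:Z * b.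
Proof.
move=> pp; suff /dvdzP [b bE] : (p%:Z %| a ^+ p - a)%Z.
 by exists b; rewrite mulrC -bE addrC subrK.
rewrite (dvdz_pcharf (pchar_Fp pp)) intrB rmorphXn /=.
by have := expf_card (a%:~R : 'F_p); rewrite card_Fp // => ->; rewrite subrr.
Qed.

Lemma intg_unit_lead (Q : {poly int}) (r : C) : `|lead_coef Q| = 1 -> root (polyC Q) r -> intg r.
Proof.
move=> lc1 rr; set c : C := (lead_coef Q)%:~R.
have cc : c * c = 1.
 rewrite -intrM; suff -> : lead_coef Q * lead_coef Q = 1 by [].
 by rewrite -expr2 -real_normK ?num_real // lc1 expr1n.
have -> : r = c * (c * r) by rewrite mulrA cc mul1r.
apply: integral_mul; first exact: intg_int.
have := @intg_lead_root _ (polyC Q) (size Q).-1 r; rewrite coef_map /= -/c; apply=> //.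
 by rewrite size_polyF leqSpred.
by move=> j; rewrite coef_map; apply: intg_int.
Qed.

(** The [p]-th power of a sum of algebraic integers is the sum of their [p]-th powers modulo [p];
    Fermat's congruence for the integral power sum does the rest. *)
Lemma power_sum_congr (Q : {poly int}) (c : C) (s : seq C) k p : prime p -> irrz Q -> uniq s ->
 c != 0 -> polyC Q = c *: \prod_(r <- s) ('X - r%:P) -> (forall r, r \in s -> intg r) ->
 exists a b : int, \sum_(r <- s) r ^+ k = a%:~R /\
  \sum_(r <- s) r ^+ (k * p) = (a + p%:Z * b)%:~R.
Proof.
move=> pp iQ us c0 QE is_; have p0 := prime_gt0 pp.
have pC : p%:R != 0 :> C by rewrite pnatr_eq0 -lt0n.
have isum j : intg (\sum_(r <- s) r ^+ j).
 rewrite big_seq; apply: (big_ind intg); [exact: integral0 | exact: integral_add|].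
 by move=> r hr; apply/intg_exp/is_.
have hZ j : exists a : int, \sum_(r <- s) r ^+ j = a%:~R.
 have [a aE] := power_sum_rat j iQ us c0 QE; have := isum j; rewrite aE => /intg_rat [n ->].
 by exists n; rewrite ratr_int.
have [a aE] := hZ k; have [a' aE'] := hZ (k * p)%N.
have [|e [ie eE]] := @frobenius_sum [seq r ^+ k | r <- s] p pp.
 by move=> y /mapP [r hr ->]; apply/intg_exp/is_.
rewrite !big_map aE (eq_bigr (fun r => r ^+ (k * p))) in eE => [|r _]; last by rewrite exprM.
rewrite aE' in eE.
have [b bE] := fermat_int a pp.
have ee : e = ratr ((a ^+ p - a')%:~R / p%:R).
 apply: (mulfI pC); rewrite fmorph_div /= ratr_int ratr_nat mulrCA divff // mulr1.
 by rewrite intrB rmorphXn /= eE addrAC subrr add0r.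
move: ie; rewrite ee => /intg_rat [n nE].
exists a, (b - n); rewrite aE aE'; split=> //; congr (_%:~R).
have : (a ^+ p - a')%:~R = (n * p%:Z)%:~R :> rat.
 by rewrite intrM -nE -[(p%:Z)%:~R]/(p%:R) divfK // pnatr_eq0 -lt0n.
move/eqP; rewrite eqr_int bE => /eqP h; rewrite mulrBr.
by move: h; lia.
Qed.

(** Equal power sums make the sum of [h] over the roots equal to its sum over their [p]-th powers,
    for [size h] at most twice the number of roots. If [x^p] were not a root, the test polynomial
    [h] would vanish at all roots and at all [p]-th powers other than [x^p], but not at [x^p]. *)
Lemma power_permutes_roots (s : seq C) (p : nat) x : x \in s ->
 (forall k, (k < (size s).*2)%N -> \sum_(r <- s) r ^+ (k * p) = \sum_(r <- s) r ^+ k) ->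
 x ^+ p \in s.
Proof.
move=> xs hk; apply/negPn/negP => nx.
pose h := \prod_(r <- s) ('X - r%:P) * \prod_(r <- s | r ^+ p != x ^+ p) ('X - (r ^+ p)%:P).
have sh : (size h <= (size s).*2)%N.
 rewrite /h; apply: leq_trans (size_polyMleq _ _) _; rewrite size_prod_XsubC /=.
 rewrite -big_filter -(big_map (fun r => r ^+ p) xpredT (fun r => 'X - r%:P)) size_prod_XsubC size_map.
 rewrite size_filter -addnn leq_add2l -(count_predC (fun r => r ^+ p != x ^+ p) s).
 rewrite -addn1 leq_add2l -has_count; apply/hasP; exists x => //=; by rewrite eqxx.
have E : \sum_(r <- s) h.[r ^+ p] = \sum_(r <- s) h.[r].
 under eq_bigr do rewrite (horner_coef_wide _ sh).
 under [RHS]eq_bigr do rewrite (horner_coef_wide _ sh).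
 rewrite exchange_big [RHS]exchange_big /=; apply: eq_bigr => k _.
 rewrite -!mulr_sumr -hk //; congr (_ * _); apply: eq_bigr => r _.
 by rewrite mulnC exprM.
have E0 : \sum_(r <- s) h.[r] = 0.
 rewrite big_seq big1 // => r hr; apply/eqP; rewrite -/(root h r) rootM root_prod_XsubC hr //.
have hx : h.[x ^+ p] != 0.
 rewrite -/(root h (x ^+ p)) rootM root_prod_XsubC (negPf nx) /=.
 rewrite -big_filter -(big_map (fun r => r ^+ p) xpredT (fun r => 'X - r%:P)) root_prod_XsubC.
 by apply/mapP => -[r]; rewrite mem_filter => /andP[/eqP + _] e; rewrite e.
move: E; rewrite E0 (bigID (fun r => r ^+ p == x ^+ p)) /= [X in _ + X]big1_seq ?addr0; last first.
 move=> r /andP[rx hr]; apply/eqP; rewrite -/(root h _) rootM; apply/orP; right.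
 rewrite -big_filter -(big_map (fun r => r ^+ p) xpredT (fun r => 'X - r%:P)) root_prod_XsubC.
 by apply: map_f; rewrite mem_filter rx.
rewrite (eq_bigr (fun=> h.[x ^+ p])) => [|r /eqP -> //].
rewrite big_const_seq iter_addr_0 => /eqP; rewrite mulrn_eq0 (negPf hx) orbF.
by apply/negP; rewrite -lt0n -has_count; apply/hasP; exists x.
Qed.

Lemma permuted_torsion (s : seq C) (p : nat) x : (1 < p)%N -> x \in s -> x != 0 ->
 (forall y, y \in s -> y ^+ p \in s) -> exists2 k, (0 < k)%N & x ^+ k = 1.
Proof.
move=> p1 xs x0 hp.
have hj j : x ^+ (p ^ j) \in s.
 by elim: j => [|j IH]; rewrite ?expn0 ?expr1 // expnSr exprM hp.
have : ~~ uniq [seq x ^+ (p ^ j) | j <- iota 0 (size s).+1].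
 apply/negP => u; have := uniq_leq_size u (_ : {subset _ <= s}).
 rewrite size_map size_iota ltnn => h; suff : false by []; apply: h.
 by move=> y /mapP [j _ ->].
case/(uniqPn 1) => i [j [ij]]; rewrite size_map size_iota => jl.
rewrite !(nth_map 0%N) ?size_iota ?(ltn_trans ij) // !nth_iota ?(ltn_trans ij) // !add0n => e.
exists (p ^ j - p ^ i)%N; first by rewrite subn_gt0 ltn_exp2l.
have xi : x ^+ (p ^ i) != 0 by rewrite expf_neq0.
apply: (mulIf xi); rewrite -exprD subnK ?mul1r ?leq_exp2l //; exact: ltnW.
Qed.

End PowerSums.

(** * A lower bound for the Mahler measure of a non-torsion number *)

Section Dobrowolski.
Variable R : rcfType.
Notation polyC := (map_poly (intr : int -> R[i])).
Notation mz Q := (mah (polyC Q)).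

Lemma irrz_croots_uniq (Q : {poly int}) : irrz Q -> uniq (croots (polyC Q)).
Proof.
move=> iQ; have Q0 : polyC Q != 0 by rewrite polyF_eq0 irrz_neq0.
apply: count_mem_uniq => z; rewrite croots_mup // mem_croots //.
by case: (boolP (root _ z)) => [/(irrz_mup iQ) -> | /mupNroot ->].
Qed.

Lemma mz_ge1 (Q : {poly int}) : Q != 0 -> 1 <= mz Q.
Proof.
move=> Q0; apply: le_trans (mah_ge_lead _); rewrite lead_coef_polyF.
by apply: cab_int_ge1; rewrite lead_coef_eq0.
Qed.

(** Otherwise, with [d] the degree, all power sums up to exponent [2dp] are below [2d] in absolute
    value. Those of exponents [k] and [kp] are congruent modulo [p > 4d], hence equal; then the
    [p]-th power permutes the roots and [x] is torsion. *)
Lemma nontorsion_mahler (Q : {poly int}) (x : R[i]) p : irrz Q -> root (polyC Q) x -> x != 0 ->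
 (forall k, (0 < k)%N -> x ^+ k != 1) -> prime p -> (4 * (size Q).-1 < p)%N ->
 2%:R <= mz Q ^+ (2 * (size Q).-1 * p).
Proof.
move=> iQ rQ x0 nt pp dp; have p0 := prime_gt0 pp.
have Q0 := irrz_neq0 iQ; have M1 := mz_ge1 Q0.
have QC0 : polyC Q != 0 by rewrite polyF_eq0.
set d := (size Q).-1 in dp *; set M := mz Q in M1 *.
have d0 : (0 < d)%N by have := irrz_size_gt1 iQ; rewrite /d; lia.
set N := (2 * d * p)%N; have N0 : (0 < N)%N by rewrite !muln_gt0 d0 p0.
rewrite leNgt; apply/negP => MN.
have M0 : 0 <= M by apply: le_trans M1.
have MX j : (j <= N)%N -> M ^+ j < 2%:R.
 by move=> jN; apply: le_lt_trans MN; rewrite ler_weXn2l.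
have lc1 : `|lead_coef Q| = 1.
 apply/eqP; rewrite eq_le -[X in _ && X]gtz0_ge1 normr_gt0 lead_coef_eq0 Q0 andbT.
 rewrite leNgt; apply/negP => l2; have := MX 1%N N0; rewrite expr1 ltNge => /negP; apply.
 apply: le_trans (mah_ge_lead _); rewrite lead_coef_polyF cab_int -[2%:R]/(2%:~R) ler_int.
 by rewrite -[X in X <= _]/(1 + 1 : int) lez1D.
set c : R[i] := (lead_coef Q)%:~R.
have c0 : c != 0 by rewrite intr_eq0 lead_coef_eq0.
set s := croots (polyC Q).
have QE : polyC Q = c *: \prod_(r <- s) ('X - r%:P) by rewrite [LHS]crootsE lead_coef_polyF.
have us : uniq s := irrz_croots_uniq iQ.
have ss : size s = d by rewrite size_croots // size_polyF.
have rs (r : R[i]) : r \in s -> root (polyC Q) r by rewrite mem_croots.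
have is_ (r : R[i]) : r \in s -> integralOver (intr : int -> R[i]) r.
 by move=> /rs; apply: intg_unit_lead.
have mx1M r : r \in s -> mx1 r <= M.
 move=> hr; rewrite /M /mah -/s (big_rem r) //= lead_coef_polyF cab_int lc1 mul1r.
 by rewrite ler_peMr ?prod_mx1_ge1 // ltW // mx1_gt0.
have bd k : (k <= N)%N -> cab (\sum_(r <- s) r ^+ k) < (2 * d)%:R.
 move=> kN; apply: le_lt_trans (cab_sum _ _ _) _.
 apply: (@le_lt_trans _ _ (\sum_(r <- s) M ^+ k)).
  rewrite big_seq [leRHS]big_seq ler_sum // => r hr; rewrite cabX lerXn2r ?nnegrE ?cab_ge0 //.
  exact: le_trans (cab_mx1 r) (mx1M r hr).
 by rewrite big_const_seq iter_addr_0 count_predT ss natrM -[M ^+ k *+ d]mulr_natr ltr_pM2r ?ltr0n // MX.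
have eqs k : (k < (size s).*2)%N -> \sum_(r <- s) r ^+ (k * p) = \sum_(r <- s) r ^+ k.
 move=> ks; have [a [b [aE bE]]] := power_sum_congr k pp iQ us c0 QE is_.
 have kpN : (k * p <= N)%N by rewrite /N leq_mul2r; apply/orP; right; move: ks; rewrite ss; lia.
 have kN : (k <= N)%N by apply: leq_trans kpN; rewrite leq_pmulr.
 suff b0 : b = 0 by rewrite aE bE b0 mulr0 addr0.
 apply/eqP; apply: contraTT (dp) => b0; rewrite -leqNgt.
 have := ltrD (bd _ kpN) (bd _ kN); rewrite -natrD -mulnDl => /(le_lt_trans (cabB _ _)).
 rewrite aE bE -intrB addrC addKr cab_int -[_%:R]/((Posz _)%:~R) ltr_int normrM => h.
 have b1 : (1 <= `|b|)%R by rewrite -gtz0_ge1 normr_gt0.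
 have : (p%:Z <= `|p%:Z| * `|b|)%R by rewrite ger0_norm // -{1}[p%:Z]mulr1 ler_wpM2l.
 by move: h; lia.
have xs : x \in s by rewrite mem_croots.
have perm y : y \in s -> y ^+ p \in s by move=> ys; apply: power_permutes_roots.
have [k k0 /eqP] := permuted_torsion (prime_gt1 pp) xs x0 perm.
by apply/negP/nt.
Qed.

End Dobrowolski.

(** * Chebyshev's lower bound for primes; divisor and totient bounds *)

Section PrimeCounts.
Local Open Scope nat_scope.

Definition primes_upto n := [seq p <- iota 0 n.+1 | prime p].

Lemma mem_primes_upto n p : (p \in primes_upto n) = prime p && (p <= n).
Proof. by rewrite mem_filter mem_iota. Qed.

Lemma expn2_le_bin n : 2 ^ n <= 'C(n.*2, n).
Proof.
elim: n => // n IH; rewrite doubleS binS.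
have -> : 'C(n.*2.+1, n.+1) = 'C(n.*2.+1, n).
 have := @bin_sub n.*2.+1 n; rewrite (_ : n.*2.+1 - n = n.+1); last by lia.
 by apply; lia.
rewrite addnn expnS mul2n leq_double; apply: leq_trans IH _.
by case: (n) => // k; rewrite binS leq_addr.
Qed.

(** Legendre's formula: each power [p^k <= 2n] contributes at most 1 to the valuation of the central
    binomial coefficient. *)
Lemma logn_bin_le p n : prime p -> 0 < n -> p ^ logn p 'C(n.*2, n) <= n.*2.
Proof.
move=> pp n0; have p1 := prime_gt1 pp.
have b0 : 0 < 'C(n.*2, n) by rewrite bin_gt0; lia.
have := congr1 (logn p) (bin_fact (_ : n <= n.*2)); rewrite (_ : n.*2 - n = n); last lia.
move=> /(_ ltac:(lia)); rewrite !lognM ?muln_gt0 ?fact_gt0 // !logn_fact // addnn => E.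
pose T := trunc_log p n.*2.
apply: (@leq_trans (p ^ T)); last by apply: trunc_logP; lia.
rewrite leq_exp2l //.
suff : \sum_(1 <= k < n.*2.+1) n.*2 %/ p ^ k <= T + (\sum_(1 <= k < n.+1) n %/ p ^ k).*2 by lia.
have TN : T <= n.*2.
 have : p ^ T <= n.*2 by apply: trunc_logP; lia.
 by apply: leq_trans; apply: ltnW; apply: ltn_expl.
rewrite (big_cat_nat (n := T.+1)) //= [X in _ + X]big1_seq ?addn0; last first.
 move=> k; rewrite mem_index_iota => /andP[_ /andP[Tk _]]; apply: divn_small.
 by apply: leq_trans (trunc_log_ltn n.*2 p1) _; rewrite leq_exp2l.
apply: (@leq_trans (\sum_(1 <= k < T.+1) (1 + (n %/ p ^ k).*2))).
 apply: leq_sum => k _; have pk : 0 < p ^ k by rewrite expn_gt0 ltnW.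
 have h := divn_eq n (p ^ k); have hm := ltn_pmod n pk.
 rewrite -ltnS ltn_divLR //; move: (n %/ p ^ k) (n %% p ^ k) (p ^ k) h hm => q r P h hm; nia.
rewrite big_split /= sum_nat_const_nat subn1 muln1 leq_add2l.
rewrite -[X in _ <= X]muln2 big_distrl /=.
under [X in _ <= X]eq_bigr do rewrite muln2.
case: (leqP T n) => h; first by rewrite [X in _ <= X](big_cat_nat (n := T.+1)) //= leq_addr.
rewrite (big_cat_nat (n := n.+1)) //=; last by lia.
rewrite [X in _ + X]big1_seq ?addn0 // => k; rewrite mem_index_iota => /andP[_ /andP[nk _]].
by rewrite divn_small //; apply: leq_trans nk _; apply: ltnW; apply: ltn_expl.
Qed.

(** The central binomial coefficient is at least [2^n], only primes up to [2n] divide it, and each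
    of its prime powers is at most [2n]. *)
Lemma primes_upto_count N : 1 < N -> 2 ^ (N %/ 2) <= N ^ size (primes_upto N).
Proof.
move=> N1; set n := N %/ 2; have n0 : 0 < n by rewrite divn_gt0.
have nN : n.*2 <= N by rewrite -muln2; apply: leq_trunc_div.
apply: leq_trans (expn2_le_bin n) _.
set B := 'C(n.*2, n); have B0 : 0 < B by rewrite bin_gt0; lia.
have BE : B = \prod_(p <- primes B) p ^ logn p B.
 rewrite {1}(prod_prime_decomp B0) prime_decompE big_map /=; exact: eq_bigr.
have pB p : p \in primes B -> prime p && (p <= n.*2).
 rewrite mem_primes => /and3P [pp _ pB]; rewrite pp /=.
 move: pB; rewrite /B => pB.
 rewrite leqNgt; apply/negP => np.
 have : p %| n.*2 `! by rewrite -(bin_fact (_ : n <= n.*2)) ?dvdn_mulr //; lia.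
 rewrite -[X in _ %| X`!]/(n.*2) => h.
 have := logn_fact n.*2 pp; rewrite big1_seq => [|k]; last first.
  rewrite mem_index_iota => /andP[_ /andP[k1 _]]; apply: divn_small.
  by apply: leq_trans np _; rewrite -{1}[p]expn1 leq_exp2l // prime_gt1.
 move=> e; have := lognE p n.*2 `!; rewrite pp fact_gt0 h /= e; lia.
rewrite BE; apply: (@leq_trans (\prod_(p <- primes B) N)).
 rewrite big_seq [X in _ <= X]big_seq; apply: leq_prod => p /pB /andP[pp _].
 by apply: leq_trans nN; apply: logn_bin_le.
rewrite big_const_seq count_predT.
have -> k : iter k (muln N) 1 = N ^ k by elim: k => // k IH; rewrite iterS IH expnS.
rewrite leq_exp2l //; apply: uniq_leq_size; first exact: primes_uniq.
by move=> p /pB /andP[pp h]; rewrite mem_primes_upto pp (leq_trans h).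
Qed.

Lemma size_divisors n : size (divisors n) = \prod_(f <- prime_decomp n) f.2.+1.
Proof.
rewrite /divisors; elim: (prime_decomp n) => [|[p e] s IH] /=; first by rewrite big_nil.
rewrite big_cons /= -IH; move: (foldr _ _ s) => t; rewrite mulSn.
elim: e => [|e IHe] /=; first by rewrite mul0n addn0.
by rewrite size_merge size_cat size_map IHe mulSn; lia.
Qed.

Lemma size_divisors_primes n : size (divisors n) = \prod_(p <- primes n) (logn p n).+1.
Proof. by rewrite size_divisors prime_decompE big_map. Qed.

Lemma prod_primes_logn n : 0 < n -> n = \prod_(p <- primes n) p ^ logn p n.
Proof. by move=> n0; rewrite {1}(prod_prime_decomp n0) prime_decompE big_map. Qed.

Lemma succ_exp_le k e : 0 < k -> e.+1 ^ k <= k ^ k * 2 ^ e.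
Proof.
move=> k0; have h : e.+1 <= k * 2 ^ (e %/ k).
 apply: (@leq_trans (k * (e %/ k).+1)); first by rewrite mulnC ltn_ceil.
 by rewrite leq_mul2l ltn_expl ?orbT.
apply: leq_trans (_ : (k * 2 ^ (e %/ k)) ^ k <= _); first by rewrite leq_exp2r.
by rewrite expnMn leq_mul2l -expnM leq_exp2l // leq_trunc_div orbT.
Qed.

(** By multiplicativity: a prime [p >= 2^k] satisfies [(e+1)^k <= p^e], and each of the fewer than
    [2^k] smaller primes costs a factor of at most [k^k]. *)
Lemma divisors_bound k : 0 < k -> exists2 K, 0 < K & forall n, 0 < n -> size (divisors n) ^ k <= K * n.
Proof.
move=> k0; have kk0 : 0 < k ^ k by rewrite expn_gt0 k0.
exists ((k ^ k) ^ (2 ^ k)); first by rewrite expn_gt0 kk0.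
move=> n n0; pose c p := if p < 2 ^ k then k ^ k else 1.
have h p : prime p -> (logn p n).+1 ^ k <= c p * p ^ logn p n.
 move=> /prime_gt1 p1; rewrite /c; case: ltnP => hp.
  apply: leq_trans (succ_exp_le _ k0) _; rewrite leq_mul2l; apply/orP; right.
  by case: (logn p n) => // e; rewrite leq_exp2r.
 rewrite mul1n; apply: (@leq_trans ((2 ^ k) ^ logn p n)); last first.
  by case: (logn p n) => // e; rewrite leq_exp2r.
 by rewrite -expnM mulnC expnM leq_exp2r // ltn_expl.
rewrite size_divisors_primes [X in _ <= _ * X](prod_primes_logn n0).
have -> : (\prod_(p <- primes n) (logn p n).+1) ^ k = \prod_(p <- primes n) (logn p n).+1 ^ k.
 by apply: (big_morph (fun x => x ^ k)) => [x y|]; rewrite ?expnMn ?exp1n.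
apply: (@leq_trans (\prod_(p <- primes n) c p * \prod_(p <- primes n) p ^ logn p n)).
 rewrite -big_split /= big_seq [X in _ <= X]big_seq; apply: leq_prod => p.
 by rewrite mem_primes => /andP[pp _]; apply: h.
rewrite leq_mul2r; apply/orP; right.
rewrite /c -big_mkcond -big_filter big_const_seq count_predT.
have -> a j : iter j (muln a) 1 = a ^ j by elim: j => // j IH; rewrite iterS IH expnS.
rewrite leq_pexp2l //; rewrite -[X in _ <= X](size_iota 0); apply: uniq_leq_size.
 by rewrite filter_uniq // primes_uniq.
by move=> p; rewrite mem_filter mem_iota => /andP[-> _].
Qed.

Lemma le_totient_divisors n : 0 < n -> n <= totient n * size (divisors n).
Proof.
move=> n0; rewrite size_divisors_primes totientE // -big_split /= {1}(prod_primes_logn n0).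
rewrite big_seq [X in _ <= X]big_seq; apply: leq_prod => p hp.
have p1 : 1 < p by move: hp; rewrite mem_primes => /andP[/prime_gt1].
have : 0 < logn p n by rewrite logn_gt0.
case: (logn p n) => // e _; rewrite expnS /= mulnAC leq_mul2r; apply/orP; right.
by nia.
Qed.

End PrimeCounts.

(** * Multiplicities and weighted counting *)

Section Multiplicity.
Variable C : numFieldType.
Implicit Types (P : {poly C}) (y : C).

Lemma nderiv_mup P y t : P != 0 -> (forall j, (j < t)%N -> P^`N(j).[y] = 0) -> (t <= mup y P)%N.
Proof.
move=> P0 h; rewrite mup_geq //.
pose T := P \Po ('X + y%:P).
have TE : take_poly t T = 0.
 by apply/polyP => j; rewrite coef_take_poly coef0; case: ifP => // jt; rewrite coef_shift h.
have PT : P = T \Po ('X - y%:P).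
 by rewrite /T -comp_polyA comp_polyD comp_polyX comp_polyC subrK comp_polyXr.
rewrite PT -(poly_take_drop t T) TE add0r comp_polyM comp_Xn_poly; exact: dvdp_mull.
Qed.

(** For [x != 0] the polynomial [X^p - x^p] has a simple zero at [x], so each factor [X - x^p] of
    [P] accounts for exactly one order of vanishing. *)
Lemma mup_comp_Xn P x p : P != 0 -> x != 0 -> (0 < p)%N -> (mup x (P \Po 'X^p) <= mup (x ^+ p) P)%N.
Proof.
move=> P0 x0 p0; set y := x ^+ p.
have [m [Q nr PE]] := multiplicity_XsubC P y; rewrite P0 /= in nr.
have Q0 : Q != 0 by apply: contra_neq P0 => Q0; rewrite PE Q0 mul0r.
rewrite PE mupMr // mup_XsubCX eqxx.
have cE : ('X - y%:P) \Po 'X^p = 'X^p - y%:P by rewrite comp_polyB comp_polyX comp_polyC.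
rewrite comp_polyM rmorphXn /= cE mupMr; last by rewrite /root horner_comp hornerXn.
have XE : 'X^p - y%:P = ('X - x%:P) * (\sum_(i < p) 'X^(p.-1 - i) * (x ^+ i)%:P).
 by rewrite polyC_exp subrXX; congr (_ * _); apply: eq_bigr => i _; rewrite polyC_exp.
rewrite XE exprMn mupMl; last first.
 rewrite /root horner_exp expf_eq0 negb_and orbC; apply/orP; left.
 rewrite horner_sum (eq_bigr (fun=> x ^+ p.-1)) => [|i _].
  by rewrite sumr_const card_ord mulrn_eq0 negb_or -lt0n p0 expf_neq0.
 by rewrite !hornerE -exprD subnK // -ltnS prednK.
by rewrite mup_XsubCX eqxx.
Qed.

End Multiplicity.

Section FiberSum.
Variable R : realDomainType.

(** Double counting. [sP] will list the irreducible factors of [P] with multiplicity, and [L] the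
    pairs of a factor of the common divisor and a prime; every distinct image is charged at most
    [r0] times. *)
Lemma fiber_sum_le (T F : eqType) (L : seq T) (sP : seq F) (img : T -> F) (w : T -> R) (v : F -> R) (r0 : nat) :
 (forall x, x \in L -> img x \in sP) -> (forall f, f \in sP -> 0 <= v f) ->
 (forall x, x \in L -> w x <= (count_mem (img x) sP)%:R * v (img x)) ->
 (forall f, f \in sP -> (count (fun x => img x == f) L <= r0)%N) ->
 \sum_(x <- L) w x <= r0%:R * \sum_(f <- sP) v f.
Proof.
move=> hi v0 hw hf; pose g f := (count_mem f sP)%:R * v f.
have -> : \sum_(f <- sP) v f = \sum_(f <- undup sP) g f.
 rewrite -big_undup_iterop_count; apply: eq_bigr => f _; rewrite /g.
 by case: (count_mem f sP) => [|k]; rewrite /= ?mul0r // mulr_natl.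
apply: (@le_trans _ _ (\sum_(x <- L) \sum_(f <- undup sP | img x == f) g f)).
 rewrite big_seq [leRHS]big_seq; apply: ler_sum => x hx.
 under eq_bigl do rewrite eq_sym.
 by rewrite -big_filter filter_pred1_uniq ?undup_uniq ?mem_undup ?hi // big_seq1; apply: hw.
rewrite (exchange_big_dep predT) //= mulr_sumr big_seq [leRHS]big_seq; apply: ler_sum => f.
rewrite mem_undup => hf'; rewrite big_const_seq iter_addr_0 -[g f *+ _]mulr_natl ler_wpM2r ?ler_nat ?hf //.
by rewrite mulr_ge0 // v0.
Qed.

End FiberSum.

(** Otherwise all primes up to [N = 64 d^2] are at most [4d], and [primes_upto_count] gives
    [2^(32 d^2) <= N^(4d)], against [N <= 2^(4 + 2d)]. *)
Lemma prime_between d : (0 < d)%N -> exists p, [/\ prime p, (4 * d < p)%N & (p <= 64 * d ^ 2)%N].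
Proof.
move=> d0; pose N := (64 * d ^ 2)%N.
have [/hasP [p]|/hasPn h] := boolP (has (fun p => 4 * d < p)%N (primes_upto N)).
 by rewrite mem_primes_upto => /andP[pp pN] dp; exists p.
have d2 : (0 < d ^ 2)%N by rewrite expn_gt0 d0.
have N2 : (N %/ 2 = 32 * d ^ 2)%N by rewrite /N (_ : 64 = 32 * 2)%N // mulnAC mulnK.
have N1 : (1 < N)%N by rewrite /N; lia.
have := primes_upto_count N1; rewrite N2.
have sz : (size (primes_upto N) <= 4 * d)%N.
 rewrite -[leqRHS](size_iota 1); apply: uniq_leq_size; first by rewrite filter_uniq // iota_uniq.
 move=> p hp; have := h _ hp; move: hp; rewrite mem_primes_upto mem_iota -leqNgt => /andP[/prime_gt0 p0 _].
 by move=> hh; rewrite p0 add1n ltnS.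
have Nb : (N <= 2 ^ (4 + 2 * d))%N.
 have e : (4 + 2 * d = 6 + d.-1 * 2)%N by lia.
 rewrite /N e expnD leq_mul2l expnM leq_exp2r //=.
 by have := ltn_expl d.-1 (ltnSn 1); rewrite prednK.
move=> /leq_trans /(_ (leq_pexp2l (ltnW N1) sz)) /leq_trans.
have h4 : (N ^ (4 * d) <= 2 ^ ((4 + 2 * d) * (4 * d)))%N by rewrite [leqRHS]expnM leq_exp2r // muln_gt0.
move=> /(_ _ h4); rewrite leq_exp2l // => hh; exfalso; move: hh; rewrite expnS expn1; nia.
Qed.

(** * Degrees and Mahler measures of the non-torsion factors of a common divisor *)

Section GcdBound.
Variable R : realType.
Notation polyC := (map_poly (intr : int -> R[i])).
Notation mz Q := (mah (polyC Q)).
Implicit Types (P Q f : {poly int}) (x y z : R[i]).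

(** Zero is included: [X] has Mahler measure one like the cyclotomic polynomials, and is set aside
    with them. *)
Definition torsion_point z := z = 0 \/ exists2 k, (0 < k)%N & z ^+ k = 1.
Definition torsion_poly Q := exists2 x, root (polyC Q) x & torsion_point x.

Lemma torsion_pointX z k : (0 < k)%N -> torsion_point (z ^+ k) -> torsion_point z.
Proof.
move=> k0 [/eqP|[j j0 e]]; first by rewrite expf_eq0 k0 => /eqP; left.
by right; exists (k * j)%N; rewrite ?muln_gt0 ?k0 // exprM.
Qed.

Lemma lnmz_ge0 Q : Q != 0 -> 0 <= ln (mz Q).
Proof. by move=> Q0; exact: ln_ge0 (mz_ge1 R Q0). Qed.

Lemma polyC_neq0 Q : Q != 0 -> polyC Q != 0. Proof. by rewrite polyF_eq0. Qed.

Lemma lnmzM P Q : P != 0 -> Q != 0 -> ln (mz (P * Q)) = ln (mz P) + ln (mz Q).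
Proof.
move=> P0 Q0; rewrite rmorphM /= mahM ?polyC_neq0 //.
by rewrite lnM // posrE mah_gt0 // polyC_neq0.
Qed.

Lemma irrz_root Q : irrz Q -> exists x, root (polyC Q) x.
Proof.
move=> iQ; apply: closed_rootP; rewrite size_polyF; apply/eqP => s1.
by have := irrz_size_gt1 iQ; rewrite s1.
Qed.

(** By [common_image_mahler] the measure of [f] is at least a power [k >= 2^(size sp)] of that of
    some [B] of the same degree [d], and [nontorsion_mahler] keeps the measure of [B] away from 1.
    With a prime [p <= 64 d^2] from [prime_between], [2dp] is at most [128 d^3]. *)
Lemma fiber_bound f y (sp : seq nat) r0 n : irrz f -> root (polyC f) y -> ~ torsion_point y ->
 uniq sp -> all prime sp ->
 (forall p, p \in sp -> exists Q x, [/\ irrz Q, good_prime Q p, root (polyC Q) x & root (polyC f) (x ^+ p)]) ->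
 ((size f).-1 <= n)%N -> 128 * n%:R ^+ 3 * ln (mz f) < 2 ^+ r0 * ln 2 -> (size sp <= r0)%N.
Proof.
move=> iF rf nt us ps hs dn hr.
have y0 : y != 0 by apply/eqP => y0; apply: nt; left.
have [B [z [k [[iB rB zk sB] [k2 kB]]]]] := common_image_mahler iF rf y0 us ps hs.
have k0 : (0 < k)%N by apply: leq_trans k2; rewrite expn_gt0.
have ntz : ~ torsion_point z.
 move=> [z0|[j j0 zj]]; first by move: y0; rewrite -zk z0 expr0n (gtn_eqF k0) eqxx.
 by apply: nt; right; exists j => //; rewrite -zk exprAC zj expr1n.
have z0 : z != 0 by apply/eqP => z0; apply: ntz; left.
set d := (size f).-1 in dn; have d0 : (0 < d)%N by have := irrz_size_gt1 iF; rewrite /d; lia.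
have [p [pp dp pd]] := prime_between d0.
have dB : (size B).-1 = d by rewrite sB.
have := @nontorsion_mahler R B z p iB rB z0; rewrite dB => /(_ _ pp dp) h.
have {h} h : 2 <= mz B ^+ (2 * d * p).
 by apply: h => j j0; apply/eqP => zj; apply: ntz; right; exists j.
have B0 := irrz_neq0 iB; have mB := mz_ge1 R B0.
have mB0 : 0 < mz B by apply: lt_le_trans mB.
have lB := lnmz_ge0 B0.
have h1 : ln 2 <= (2 * d * p)%:R * ln (mz B).
 by rewrite mulr_natl -lnXn // ler_ln ?posrE ?exprn_gt0.
have h2 : k%:R * ln (mz B) <= ln (mz f).
 by rewrite mulr_natl -lnXn // ler_ln ?posrE ?exprn_gt0 // mah_gt0 // polyC_neq0 // irrz_neq0.
have lf := lnmz_ge0 (irrz_neq0 iF).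
have h3 : 2 ^+ size sp * ln 2 < 2 ^+ r0 * ln 2 :> R.
 apply: le_lt_trans hr.
 apply: (@le_trans _ _ (k%:R * ((2 * d * p)%:R * ln (mz B)))).
  apply: ler_pM => //; rewrite ?exprn_ge0 ?ln_ge0 ?ler1n //.
  by rewrite -natrX ler_nat.
 rewrite mulrCA; apply: (@le_trans _ _ ((2 * d * p)%:R * ln (mz f))); first by rewrite ler_wpM2l.
 apply: ler_wpM2r => //; rewrite -natrX -natrM ler_nat.
 have : (d ^ 3 <= n ^ 3)%N by rewrite leq_exp2r.
 move: pd; rewrite !expnS !expn0 !muln1 => pd dn3.
 apply: (@leq_trans (2 * d * (64 * (d * d)))%N); first by rewrite leq_mul2l pd orbT.
 apply: leq_trans (_ : (128 * (d * (d * d)) <= _)%N); first by apply/eq_leq; ring.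
 by rewrite leq_mul2l dn3 orbT.
have l2 : 0 < ln 2 :> R by rewrite ln_gt0 // ltr1n.
by move: h3; rewrite ltr_pM2r // ltr_eXn2l ?ltr1n // => /ltnW.
Qed.

Lemma deg_scaled_prod (c : int) (s : seq {poly int}) : c != 0 -> (forall q, q \in s -> q != 0) ->
 (size (c *: \prod_(q <- s) q)).-1 = (\sum_(q <- s) (size q).-1)%N.
Proof.
move=> c0 hs; rewrite size_scale //; elim: s hs => [|q s IH] hs.
 by rewrite !big_nil size_poly1.
have q0 : q != 0 by apply: hs; rewrite mem_head.
have hs' : forall f, f \in s -> f != 0 by move=> f hf; apply: hs; rewrite inE hf orbT.
have p0 : \prod_(f <- s) f != 0 by rewrite prodf_seq_neq0; apply/allP => f /hs' ->.
rewrite !big_cons -IH // size_mul //.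
have aux (a b : nat) : (0 < a)%N -> (0 < b)%N -> ((a + b).-2 = a.-1 + b.-1)%N by lia.
by apply: aux; rewrite size_poly_gt0.
Qed.

Lemma lnmz_prod (s : seq {poly int}) : (forall q, q \in s -> q != 0) ->
 ln (mz (\prod_(q <- s) q)) = \sum_(q <- s) ln (mz q).
Proof.
elim: s => [|q s IH] hs; first by rewrite !big_nil rmorph1 mahC ?oner_eq0 // cab1 ln1.
have q0 : q != 0 by apply: hs; rewrite mem_head.
have hs' : forall f, f \in s -> f != 0 by move=> f hf; apply: hs; rewrite inE hf orbT.
have p0 : \prod_(f <- s) f != 0 by rewrite prodf_seq_neq0; apply/allP => f /hs' ->.
by rewrite !big_cons lnmzM // IH.
Qed.

Lemma lnmz_scaled_prod (c : int) (s : seq {poly int}) : c != 0 -> (forall q, q \in s -> q != 0) ->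
 \sum_(q <- s) ln (mz q) <= ln (mz (c *: \prod_(q <- s) q)).
Proof.
move=> c0 hs; rewrite -mul_polyC lnmzM ?polyC_eq0 //; last first.
 by rewrite prodf_seq_neq0; apply/allP => f /hs ->.
by rewrite lnmz_prod // lerDr lnmz_ge0 // polyC_eq0.
Qed.

Lemma count_scaled_mup (c : int) (s : seq {poly int}) Q z : c != 0 ->
 (forall q, q \in s -> irrz q) -> irrz Q -> root (polyC Q) z ->
 mup z (polyC (c *: \prod_(q <- s) q)) = count_mem Q s.
Proof.
move=> c0 hs iQ rQ; rewrite -(count_irrz_mup hs iQ rQ) -mul_polyC rmorphM /= map_polyC.
by rewrite mupMr // rootC intr_eq0.
Qed.

Definition nontorsion_factors (s : seq {poly int}) := [seq q <- undup s | ~~ `[< torsion_poly q >]].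
Definition good_primes (E : seq nat) Q := [seq p <- E | `[< good_prime Q p >]].

(** A factor [q] of [G] and a prime good for it produce an irreducible factor of [P] with the same
    degree and with logarithmic Mahler measure at least [p] times larger. Few pairs share an image,
    so the totals over all pairs are controlled by [P]. *)
Lemma power_gcd_bound P (G : {poly int}) (s : seq {poly int}) (c : int) (E : seq nat) t r0 n : P != 0 -> ((size P).-1 <= n)%N ->
 c != 0 -> (forall q, q \in s -> irrz q) -> G = c *: \prod_(q <- s) q -> uniq E -> all prime E ->
 (0 < t)%N ->
 (forall p j, p \in E -> (j < t)%N -> exists A : {poly int}, P^`N(j) \Po 'X^p = G * A) ->
 128 * n%:R ^+ 3 * ln (mz P) < 2 ^+ r0 * ln 2 ->
 \sum_(q <- nontorsion_factors s) \sum_(p <- good_primes E q)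
   (maxn t (count_mem q s))%:R * (size q).-1%:R <= r0%:R * (size P).-1%:R :> R /\
 \sum_(q <- nontorsion_factors s) \sum_(p <- good_primes E q)
   (maxn t (count_mem q s))%:R * (p%:R * ln (mz q)) <= r0%:R * ln (mz P).
Proof.
move=> P0 dP c0 hs GE uE aE t0 hG hr.
have [c' [sP [c'0 hsP PE]]] := irrz_factorization P0.
set U := nontorsion_factors s.
pose L := [seq (q, p) | q <- U, p <- good_primes E q].
have LP (x : {poly int} * nat) : x \in L -> [/\ x.1 \in s, irrz x.1, ~ torsion_poly x.1, x.2 \in E & good_prime x.1 x.2].
 move=> /allpairsPdep [q [p [+ + ->]]] /=; rewrite mem_filter mem_undup => /andP[/asboolPn nt hq].
 by rewrite mem_filter => /andP[/asboolP gp hp]; split=> //; apply: hs.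
have hex (x : {poly int} * nat) : exists f, x \in L ->
  irrz f /\ exists2 z, root (polyC x.1) z & root (polyC f) (z ^+ x.2).
 case: (boolP (x \in L)) => [|_]; last by exists 0.
 move=> /LP [_ iq _ _ gp]; have [z rz] := irrz_root iq.
 by have [f [_ [iF rf _ _]]] := good_image iq gp rz; exists f => _; split=> //; exists z.
have [img himg] := choice hex.
(* The bound [t] holds because all derivatives of order below [t] vanish at [z^p]; the multiplicity
   of the factor in [G] passes to [P] through [mup_comp_Xn]. *)
have imgP (x : {poly int} * nat) : x \in L -> (maxn t (count_mem x.1 s) <= count_mem (img x) sP)%N.
 move=> hx; have [qs iq nt pE gp] := LP x hx; have [iF [z rz rf]] := himg x hx.
 have p0 : (0 < x.2)%N by apply/prime_gt0/(allP aE).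
 have z0 : z != 0 by apply/eqP => z0; apply: nt; exists z => //; left.
 have cG : count_mem x.1 s = mup z (polyC G) by rewrite GE (count_scaled_mup c0 hs iq rz).
 have rG : root (polyC G) z.
  by apply: contraLR qs => /mupNroot m0; rewrite -has_pred1 has_count cG m0.
 rewrite -(count_scaled_mup c'0 hsP iF rf) -PE geq_max; apply/andP; split.
  apply: nderiv_mup; first exact: polyC_neq0.
  move=> j jt; have [A AE] := hG _ _ pE jt.
  have := congr1 (fun q => (polyC q).[z]) AE; rewrite map_comp_poly /= map_polyXn horner_comp hornerXn.
  by rewrite rmorphM hornerM /= (rootP rG) mul0r nderivn_map.
 rewrite cG; have [A] := hG _ _ pE t0; rewrite nderivn0 => AE.
 apply: leq_trans (mup_comp_Xn (polyC_neq0 P0) z0 p0).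
 have PXE : polyC P \Po 'X^(x.2) = polyC G * polyC A.
  by rewrite -rmorphM /= -AE map_comp_poly /= map_polyXn.
 have PX0 : polyC P \Po 'X^(x.2) != 0.
  by rewrite comp_poly_eq0 ?polyC_neq0 // size_polyXn ltnS.
 rewrite PXE mupM ?leq_addr //; apply: contra_neq PX0; rewrite PXE => ->; by rewrite ?mul0r ?mulr0.
have imgS (x : {poly int} * nat) : x \in L -> img x \in sP.
 by move=> /imgP h; rewrite -has_pred1 has_count; apply: leq_trans h; rewrite leq_max t0.
(* In one fibre the prime determines the factor by [good_image_inj], so it is enough to count
   primes, which [fiber_bound] does. *)
have fib f : f \in sP -> (count (fun x : {poly int} * nat => img x == f) L <= r0)%N.
 move=> fs; have iF := hsP f fs; rewrite -size_filter; set Lf := [seq x <- L | img x == f].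
 have LfP (x : {poly int} * nat) : x \in Lf -> [/\ x \in L, [/\ irrz x.1, ~ torsion_poly x.1 & good_prime x.1 x.2], prime x.2 &
   exists2 z, root (polyC x.1) z & root (polyC f) (z ^+ x.2)].
  rewrite mem_filter => /andP[/eqP e hx]; have [_ iq nt pE gp] := LP x hx.
  by have [_ hz] := himg x hx; rewrite -e; split=> //; apply: (allP aE).
 case E0 : Lf => [//|x0 Lf0]; rewrite -E0.
 have [_ [iq0 nt0 gp0] pp0 [z0 rz0 rf0]] : _ := LfP x0 ltac:(by rewrite E0 mem_head).
 rewrite -(size_map snd); apply: (@fiber_bound f (z0 ^+ x0.2) _ r0 n) => //.
 - move=> h; apply: nt0; exists z0 => //; apply: (torsion_pointX (prime_gt0 pp0) h).
 - rewrite map_inj_in_uniq; last first.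
   move=> [q p] [q' p'] hx hx' /= pp; rewrite -{}pp in hx' *.
   have [_ [iq nt gp] _ [z rz rf]] := LfP _ hx.
   have [_ [iq' nt' gp'] _ [z' rz' rf']] := LfP _ hx'.
   congr (_, _); apply: (good_image_inj iq iq' iF _ gp gp' rz rz' rf rf').
   apply/eqP => q0; apply: nt; exists 0; last by left.
   by rewrite /root horner_coef0 coef_map /= q0.
  rewrite filter_uniq // allpairs_uniq_dep //.
  + by rewrite filter_uniq // undup_uniq.
  + by move=> q _; rewrite filter_uniq.
  by move=> [q p] [q' p'] _ _ /= [-> ->].
 - by apply/allP => p /mapP [x /LfP [_ _ pp _] ->].
 - move=> p /mapP [x /LfP [_ [iq _ gp] _ [z rz rf]] ->].
  by exists x.1, z.
 - apply: leq_trans dP; rewrite PE (deg_scaled_prod c'0); last by move=> q /hsP /irrz_neq0.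
  by rewrite (big_rem f) //= leq_addr.
 apply: le_lt_trans hr; apply: ler_wpM2l; first by rewrite mulr_ge0 // exprn_ge0.
 rewrite PE; apply: le_trans (lnmz_scaled_prod c'0 _); last by move=> q /hsP /irrz_neq0.
 rewrite (big_rem f) //= lerDl big_seq sumr_ge0 // => q /mem_rem /hsP /irrz_neq0; exact: lnmz_ge0.
have sPn q : q \in sP -> q != 0 by move=> /hsP /irrz_neq0.
have mg (x : {poly int} * nat) : x \in L -> size (img x) = size x.1 /\ mz x.1 ^+ x.2 <= mz (img x).
 move=> hx; have [qs iq nt pE gp] := LP x hx; have [iF [z rz rf]] := himg x hx.
 by apply: (good_mahler iq iF _ gp rz rf); apply/prime_gt0/(allP aE).
split.
 have := @fiber_sum_le R _ _ L sP img (fun x : {poly int} * nat => (maxn t (count_mem x.1 s))%:R * (size x.1).-1%:R)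
  (fun f : {poly int} => (size f).-1%:R) r0 imgS _ _ fib.
 rewrite big_allpairs_dep /= -natr_sum -(deg_scaled_prod c'0) // -PE; apply.
  by move=> f _; rewrite ler0n.
 move=> x hx; rewrite (mg x hx).1; apply: ler_wpM2r; first by rewrite ler0n.
 by rewrite ler_nat imgP.
have := @fiber_sum_le R _ _ L sP img (fun x : {poly int} * nat => (maxn t (count_mem x.1 s))%:R * (x.2%:R * ln (mz x.1)))
 (fun f : {poly int} => ln (mz f)) r0 imgS _ _ fib.
rewrite big_allpairs_dep /= => h; apply: le_trans (h _ _) _.
- by move=> f /sPn; apply: lnmz_ge0.
- move=> x hx; have [_ iq _ _ _] := LP x hx; have [iF _] := himg x hx.
 have q0 := lnmz_ge0 (irrz_neq0 iq).
 apply: ler_pM; rewrite ?ler0n ?mulr_ge0 ?ler_nat ?imgP //.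
 rewrite mulr_natl -lnXn ?mah_gt0 ?polyC_neq0 ?irrz_neq0 // ler_ln ?posrE ?exprn_gt0 ?mah_gt0 ?polyC_neq0 ?irrz_neq0 //.
 exact: (mg x hx).2.
by apply: ler_wpM2l; rewrite ?ler0n // PE lnmz_scaled_prod.
Qed.

End GcdBound.

(** * Simultaneous smallness at many points forces a small common divisor *)

Lemma fact_le_expn n : (n`! <= n ^ n)%N.
Proof.
elim: n => // n IH; rewrite factS expnS leq_mul2l; apply: leq_trans IH _.
by case: n => // n; rewrite leq_exp2r.
Qed.

Lemma resultant_polyF (F : numFieldType) (P Q : {poly int}) :
 (resultant P Q)%:~R = resultant (map_poly intr P) (map_poly intr Q) :> F.
Proof.
rewrite /resultant /Sylvester_mx !size_polyF.
rewrite -det_map_mx /= map_col_mx; congr (\det (col_mx _ _));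
 by apply: map_lin1_mx => v; rewrite map_poly_rV rmorphM /= map_rVpoly.
Qed.

Section Interpolation.
Variable R : realType.
Notation polyC := (map_poly (intr : int -> R[i])).
Notation mz Q := (mah (polyC Q)).
Implicit Types (P Q : {poly int}) (x y : R[i]) (p q f g G : {poly R[i]}).

Lemma no_common_root_resultant P Q : P != 0 -> Q != 0 ->
 (forall y, root (polyC P) y -> ~~ root (polyC Q) y) -> 1 <= cab (resultant (polyC P) (polyC Q)).
Proof.
move=> P0 Q0 h.
have r0 : resultant (polyC P) (polyC Q) != 0.
 rewrite resultant_eq0 -leqNgt; case: leqP => // sg; have /closed_rootP [y] : size (gcdp (polyC P) (polyC Q)) != 1%N by rewrite gtn_eqF.
 by rewrite root_gcd => /andP[/h/negPf ->].
by move: r0; rewrite -resultant_polyF intr_eq0 => r0; apply: cab_int_ge1.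
Qed.

(** Logarithmic form of [resultant_multipoint], the resultant being a non-zero integer. Each of the
    [S * t] jets gains [w] and loses [w'] to the value of [G] and [t * delta] to the distances
    between the points; the factorial accounts for the last term. *)
Lemma interpolation_bound P Q G S t D (z : nat -> R[i]) (b1 b2 w w' delta : R) : P != 0 -> Q != 0 ->
 (forall y, root (polyC P) y -> ~~ root (polyC Q) y) ->
 (0 < t)%N -> (S * t <= (size Q).-1 + (size P).-1)%N -> (0 < D)%N ->
 ((size P).-1 <= D)%N -> ((size Q).-1 <= D)%N ->
 n1 (polyC P) <= expR b1 -> n1 (polyC Q) <= expR b2 ->
 (forall l k a, (l < S)%N -> (k < t)%N -> (a < D)%N ->
  cab (('X^a * polyC P * G)^`N(k)).[z l] <= expR (b1 - w)) ->
 (forall l k a, (l < S)%N -> (k < t)%N -> (a < D)%N ->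
  cab (('X^a * polyC Q * G)^`N(k)).[z l] <= expR (b2 - w)) ->
 (forall l, (l < S)%N -> expR (- delta) <= \prod_(0 <= l' < l) cab (z l - z l')) ->
 (forall l, (l < S)%N -> expR (- w') <= cab G.[z l]) ->
 (S * t)%:R * (w - w' - t%:R * delta) <=
  (size Q).-1%:R * b1 + (size P).-1%:R * b2 + 2 * D%:R * ln (2 * D%:R).
Proof.
move=> P0 Q0 cop t0 St D0 dP dQ nP nQ jP jQ hd hG.
have PC0 : polyC P != 0 by rewrite polyF_eq0.
have QC0 : polyC Q != 0 by rewrite polyF_eq0.
have := @resultant_multipoint _ (polyC P) (polyC Q) G S t z PC0 QC0 t0.
rewrite !size_polyF => /(_ St (expR b1)%:C%C (expR b2)%:C%C (fun=> (expR (- w))%:C%C)).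
rewrite !lecR !expR_ge0 => /(_ isT isT) h.
have {h} h := h _ _ _ _.
have {}h : `|resultant (polyC P) (polyC Q)| *
  \prod_(0 <= l < S) (\prod_(0 <= l' < l) `|z l - z l'| ^+ t * `|G.[z l]|) ^+ t <=
  ((size Q).-1 + (size P).-1)`!%:R *
  ((expR b1)%:C%C ^+ (size Q).-1 * (expR b2)%:C%C ^+ (size P).-1 * \prod_(0 <= l < S) (expR (- w))%:C%C ^+ t).
 apply: h.
 - by move=> i; rewrite cabE lecR; apply: le_trans (coef_le_n1 _ _) nP.
 - by move=> i; rewrite cabE lecR; apply: le_trans (coef_le_n1 _ _) nQ.
 - by move=> l k a lS kt aD; rewrite cabE -rmorphM lecR -expRD; apply: jP => //; apply: leq_trans aD _.
 - by move=> l k a lS kt aD; rewrite cabE -rmorphM lecR -expRD; apply: jQ => //; apply: leq_trans aD _.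
set m := ((size Q).-1 + (size P).-1)%N in St h.
have mD : (m <= 2 * D)%N by rewrite /m mul2n -addnn leq_add.
have {}h : \prod_(0 <= l < S) ((\prod_(0 <= l' < l) cab (z l - z l')) ^+ t * cab G.[z l]) ^+ t <=
  m`!%:R * (expR b1 ^+ (size Q).-1 * expR b2 ^+ (size P).-1 * expR (- w) ^+ (S * t)).
 apply: (@le_trans _ _ (cab (resultant (polyC P) (polyC Q)) *
  \prod_(0 <= l < S) ((\prod_(0 <= l' < l) cab (z l - z l')) ^+ t * cab G.[z l]) ^+ t)).
  rewrite ler_peMl ?no_common_root_resultant // prodr_ge0 // => l _.
  by rewrite exprn_ge0 // mulr_ge0 ?cab_ge0 // exprn_ge0 // prodr_ge0 // => *; apply: cab_ge0.
 rewrite -lecR !rmorphM rmorph_prod rmorph_nat /= -cabE !rmorphXn /=.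
 rewrite prodr_const_nat subn0 -exprM [(t * S)%N]mulnC in h; apply: le_trans h.
 apply: eq_le_ref; congr (_ * _); apply: eq_bigr => l _.
 rewrite rmorphXn rmorphM rmorphXn rmorph_prod /= -cabE -prodrXl; congr ((_ * _) ^+ _).
have {}h : expR (- (w' + t%:R * delta) * (S * t)%:R) <= expR (((size Q).-1%:R * b1 + (size P).-1%:R * b2 +
  2 * D%:R * ln (2 * D%:R)) - w * (S * t)%:R).
 apply: le_trans (le_trans _ h) _.
  rewrite expRM_natr mulnC exprM -[X in (_ ^+ t) ^+ X]subn0 -prodr_const_nat.
  rewrite big_seq [leRHS]big_seq; apply: ler_prod => l; rewrite mem_index_iota => /andP[_ lS].
  rewrite exprn_ge0 ?expR_ge0 //= lerXn2r ?nnegrE ?expR_ge0 //.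
   by rewrite mulr_ge0 ?cab_ge0 // exprn_ge0 // prodr_ge0 // => *; apply: cab_ge0.
  rewrite opprD addrC expRD; apply: ler_pM; rewrite ?expR_ge0 ?hG //.
  rewrite -mulrN mulrC expRM_natr lerXn2r ?nnegrE ?expR_ge0 ?hd //.
  by rewrite prodr_ge0 // => *; apply: cab_ge0.
 rewrite expRD -mulNr expRM_natr mulrA; apply: ler_wpM2r; first by rewrite exprn_ge0 // expR_ge0.
 rewrite expRD mulrC expRD !expRM_natl; apply: ler_wpM2l; first by rewrite mulr_ge0 ?exprn_ge0 ?expR_ge0.
 rewrite -[2 * D%:R]natrM expRM_natl lnK ?posrE ?ltr0n ?muln_gt0 ?D0 // -natrX ler_nat.
 apply: leq_trans (_ : ((2 * D)`! <= _)%N); last exact: fact_le_expn.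
 exact: leq_fact.
by move: h; rewrite ler_expR; lra.
Qed.

Lemma degree_dvd_le (P Q : {poly int}) : P * Q != 0 -> ((size Q).-1 <= (size (P * Q)%R).-1)%N.
Proof.
rewrite mulf_eq0 negb_or => /andP[P0 Q0]; rewrite size_mul //.
have aux (a b : nat) : (0 < a)%N -> (b.-1 <= (a + b).-2)%N by lia.
by apply: aux; rewrite size_poly_gt0.
Qed.

(** A root common to all [F i] is removed together with its irreducible polynomial, which decreases
    the size of [F i0]. *)
Lemma common_factor (I : Type) (F : I -> {poly int}) i0 : F i0 != 0 ->
 exists (G : {poly int}) (A : I -> {poly int}), [/\ G != 0, forall i, F i = G * A i & forall y, exists i, ~~ root (polyC (A i)) y].
Proof.
have [n] := ubnP (size (F i0)); elim: n F => // n IH F; rewrite ltnS => sn F0.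
have [h|/existsNP [y hy]] := pselect (forall y, exists i, ~~ root (polyC (F i)) y).
 by exists 1, F; split=> // [|i]; rewrite ?mul1r // oner_eq0.
have {}hy i : root (polyC (F i)) y by apply/negPn/negP => r; apply: hy; exists i.
have [Q [iQ rQ]] := exists_minpoly F0 (hy i0).
have /choice [F' F'E] : forall i, exists f : {poly int}, F i = Q * f by move=> i; apply: (irrz_dvd iQ rQ).
have F'0 : F' i0 != 0 by apply: contra_neq F0 => e; rewrite F'E e mulr0.
have aux (a b : nat) : (0 < b)%N -> (1 < a)%N -> ((a + b).-1 <= n)%N -> (b < n)%N by lia.
have [|G [A [G0 GA hA]]] := IH F' _ F'0.
 move: sn; rewrite F'E (size_mul (irrz_neq0 iQ) F'0); apply: aux; first by rewrite size_poly_gt0.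
 exact: irrz_size_gt1.
exists (Q * G), A; split=> //; first by rewrite mulf_neq0 // irrz_neq0.
by move=> i; rewrite F'E GA mulrA.
Qed.

Lemma avoid_roots (qs : seq {poly R[i]}) M : (forall q, q \in qs -> q != 0) ->
 (\sum_(q <- qs) (size q).-1 < M)%N -> exists2 u, (u < M)%N & forall q, q \in qs -> ~~ root q u%:R.
Proof.
move=> q0 sM; pose h := \prod_(q <- qs) q.
have h0 : h != 0 by rewrite prodf_seq_neq0; apply/allP => q /q0 ->.
have sh : (size h <= M)%N.
 apply: leq_trans sM; rewrite /h; elim: (qs) => [|q s IH]; first by rewrite !big_nil size_poly1.
 rewrite !big_cons; apply: leq_trans (size_polyMleq _ _) _; move: IH.
 have aux (a b c : nat) : (b <= c.+1)%N -> ((a + b).-1 <= (a.-1 + c).+1)%N by lia.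
 exact: aux.
have [/hasP [u]|/hasPn hn] := boolP (has (fun u => ~~ root h u%:R) (iota 0 M)).
 rewrite mem_iota /= => uM r; exists u => // q hq; apply: contra r => r.
 by rewrite /h (big_rem q) //= rootM r.
have := @max_poly_roots _ h [seq u%:R | u <- iota 0 M] h0.
rewrite size_map size_iota ltnNge sh /= => e; suff : false by []; apply: e.
 by apply/allP => x /mapP [u /hn /negPn hu ->].
rewrite map_inj_uniq ?iota_uniq // => u v /eqP; rewrite eqr_nat => /eqP; exact.
Qed.

Lemma jet_mulXn f c k z (B : R) : (forall i, (i <= k)%N -> cab (f^`N(i)).[z] <= B) ->
 cab (('X^c * f)^`N(k)).[z] <= (1 + cab z) ^+ c * B.
Proof.
move=> hf; elim: c k hf => [|c IH] k hf; first by rewrite !expr0 !mul1r; apply: hf.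
have z0 := cab_ge0 z; rewrite exprS -mulrA mulrC.
have hk := IH k hf; case: k hf hk => [|k] hf hk.
 rewrite nderivn0 hornerM hornerX cabM mulrC exprS -mulrA; move: hk; rewrite nderivn0 => hk.
 apply: ler_pM => //; rewrite ?cab_ge0 //; lra.
have := nderivnMXaddC k ('X^c * f) 0; rewrite addr0 => ->.
rewrite hornerD hornerM hornerX; apply: le_trans (cabD _ _) _.
rewrite exprS mulrDl mul1r mulrDl; apply: lerD; first by apply: IH => i ik; apply: hf; lia.
by rewrite cabM mulrC -mulrA ler_wpM2l.
Qed.

(** If [G] were not small at any of the points, two coprime combinations of the cofactors [A i]
    would violate [interpolation_bound]. *)
Lemma gcd_small (I : eqType) (idx : seq I) (F A : I -> {poly int}) (G : {poly int}) i0 S t d D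
  (z : nat -> R[i]) (h w w' delta zeta : R) :
 i0 \in idx -> F i0 != 0 -> (forall i, i \in idx -> F i = G * A i) ->
 (forall y, exists2 i, i \in idx & ~~ root (polyC (A i)) y) ->
 (forall i, i \in idx -> (size (F i)).-1 <= d)%N -> (0 < t)%N -> (d + S * t <= D)%N -> (0 < D)%N ->
 0 <= h -> (forall i, i \in idx -> n1 (polyC (F i)) <= expR h) ->
 0 <= zeta -> (forall l, (l < S)%N -> 1 + cab (z l) <= expR zeta) ->
 (forall i l k, i \in idx -> (l < S)%N -> (k < t)%N -> cab ((polyC (F i))^`N(k)).[z l] <= expR (- w)) ->
 (forall l, (l < S)%N -> expR (- delta) <= \prod_(0 <= l' < l) cab (z l - z l')) ->
 let M := size idx in
 let b := d%:R * ln 2 + ln M%:R + M%:R * ln (D * M).+1%:R + h in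
 2 * D%:R * (b + ln (2 * D%:R)) < (S * t)%:R * (w - 2 * D%:R * zeta - w' - t%:R * delta) ->
 exists2 l, (l < S)%N & cab (polyC G).[z l] < expR (- w').
Proof.
move=> i0I F0 FGA hA dF t0 dD D0 h0 nF z0 hz jF hd M b hlt.
apply: contrapT => hn.
have hG l : (l < S)%N -> expR (- w') <= cab (polyC G).[z l].
 by move=> lS; rewrite leNgt; apply/negP => lt; apply: hn; exists l.
have M0 : (0 < M)%N by rewrite /M; case: (idx) i0I.
have lM0 : 0 <= ln M%:R :> R by rewrite ln_ge0 // ler1n.
have lU0 : 0 <= ln (D * M).+1%:R :> R by rewrite ln_ge0 // ler1n.
have l20 : 0 <= ln 2 :> R by rewrite ln_ge0 // ler1n.
have b0 : 0 <= b by rewrite /b !addr_ge0 // mulr_ge0.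
have lD0 : 0 <= ln (2 * D%:R) :> R by rewrite ln_ge0 // -natrM ler1n muln_gt0.
have St0 : (0 < S * t)%N.
 rewrite lt0n; apply/negP => /eqP St0; move: hlt; rewrite St0 mul0r ltNge => /negP; apply.
 by rewrite mulr_ge0 ?addr_ge0 // mulr_ge0.
have G0 : G != 0 by apply: contra_neq F0 => G0; rewrite FGA // G0 mul0r.
have A0 : A i0 != 0 by apply: contra_neq F0 => A0; rewrite FGA // A0 mulr0.
have dA i : i \in idx -> ((size (A i)).-1 <= d)%N.
 move=> hi; have [->|Ai0] := eqVneq (A i) 0; first by rewrite size_poly0.
 by apply: leq_trans (dF i hi); rewrite FGA // degree_dvd_le // mulf_neq0.
(* The power of [X] raises the degree, so that [S * t] does not exceed the size of the Sylvester
   matrix. *)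
pose R1 : {poly int} := 'X^(S * t) * A i0.
have R10 : R1 != 0 by rewrite mulf_neq0 // -size_poly_eq0 size_polyXn.
have dR1 : (size R1).-1 = (S * t + (size (A i0)).-1)%N.
 rewrite /R1 mulrC size_mulXn //; have := size_poly_gt0 (A i0); rewrite A0.
 by case: (size (A i0)) => // k _; rewrite addnS.
have R1D : ((size R1).-1 <= D)%N.
 by rewrite dR1 addnC; apply: leq_trans dD; rewrite leq_add2r dA.
(* The value at [y] of a combination of the cofactors, as a polynomial in the parameter. It is not
   zero because the cofactors have no common zero; a parameter [u <= D * M] then avoids its roots
   for every root [y] of [R1]. *)
pose q (y : R[i]) : {poly R[i]} := \poly_(j < M) (polyC (A (nth i0 idx j))).[y].
have q0 y : q y != 0.
 have [i hi] := hA y; rewrite /root => nr; apply: contra nr => /eqP/polyP/(_ (index i idx)).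
 by rewrite coef_poly index_mem hi nth_index // coef0 => ->.
have [||u uU hu] := @avoid_roots [seq q y | y <- croots (polyC R1)] (D * M).+1.
- by move=> f /mapP [y _ ->].
- rewrite ltnS big_map; apply: (@leq_trans (\sum_(y <- croots (polyC R1)) M)%N).
  by apply: leq_sum => y _; apply: leq_trans (leq_pred _) (size_poly _ _).
 by rewrite big_const_seq iter_addn_0 count_predT size_croots ?polyF_neq0 // size_polyF mulnC leq_mul2r R1D orbT.
pose R2 : {poly int} := \sum_(j < M) (u ^ j)%:Z *: A (nth i0 idx j).
have R2E y : (polyC R2).[y] = (q y).[u%:R].
 rewrite /R2 rmorph_sum horner_sum horner_poly; apply: eq_bigr => j _.
 by rewrite /= map_polyZ hornerZ mulrC -natrX.
have cop y : root (polyC R1) y -> ~~ root (polyC R2) y.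
 move=> r; rewrite /root R2E; apply: (hu (q y)); apply: map_f.
 by rewrite mem_croots ?polyF_neq0.
have R20 : R2 != 0.
 have r0 : root (polyC R1) 0.
  by rewrite /R1 rmorphM /= map_polyXn rootM /root hornerXn expr0n (gtn_eqF St0) eqxx.
 by apply: contraTneq (cop 0 r0) => ->; rewrite rmorph0 root0.
have R2d : ((size R2).-1 <= d)%N.
 rewrite -subn1 leq_subLR add1n; apply: leq_trans (size_sum _ _ _) _; apply/bigmax_leqP => j _.
 apply: leq_trans (size_scale_leq _ _) _; have := dA _ (mem_nth i0 (ltn_ord j)).
 by case: (size _).
have R2D : ((size R2).-1 <= D)%N by apply: leq_trans R2d (leq_trans (leq_addr _ _) dD).
have e2 : 2 ^+ d = expR (d%:R * ln 2) :> R by rewrite expRM_natl lnK // posrE.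
have eM : M%:R = expR (ln M%:R) :> R by rewrite lnK // posrE ltr0n.
have eU : ((D * M).+1%:R) ^+ M = expR (M%:R * ln (D * M).+1%:R) :> R by rewrite expRM_natl lnK // posrE ltr0n.
have mG : 1 <= mz G by apply: le_trans (mah_ge_lead _); rewrite lead_coef_polyF cab_int_ge1 // lead_coef_eq0.
(* [G] has Mahler measure at least 1, so a cofactor is bounded through the Mahler measure of its
   product with [G]; converting back to the length costs [2^d]. *)
have n1A (f : {poly int}) (B : R) : f != 0 -> ((size f).-1 <= d)%N -> n1 (polyC (G * f)) <= B ->
  n1 (polyC f) <= 2 ^+ d * B.
 move=> f0 df hB; apply: le_trans (n1_le_mah (@polyC_neq0 R _ f0)) _; rewrite size_polyF.
 apply: ler_pM; rewrite ?exprn_ge0 //; first by rewrite ltW // mah_gt0 // polyC_neq0.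
  by apply: ler_weXn2l => //; rewrite ler1n.
 apply: le_trans hB; apply: le_trans (mah_le_n1 (@polyC_neq0 R _ (mulf_neq0 G0 f0))).
 rewrite rmorphM /= (mahM (@polyC_neq0 R _ G0) (@polyC_neq0 R _ f0)) ler_peMl // ltW // mah_gt0 //.
 exact: polyC_neq0.
have nR1 : n1 (polyC R1) <= expR b.
 rewrite /R1 mulrC rmorphM /= map_polyXn n1Xn; apply: le_trans (n1A _ (expR h) A0 (dA _ i0I) _) _.
  by rewrite -FGA // nF.
 rewrite e2 -expRD ler_expR /b -!addrA lerD2l !addrA lerDr addr_ge0 // mulr_ge0 //.
have uj (j : 'I_M) : (u ^ j)%:R <= ((D * M).+1%:R) ^+ M :> R.
 rewrite -natrX ler_nat; apply: leq_trans (_ : ((D * M).+1 ^ j <= _)%N).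
  by case: (j : nat) => // k; rewrite leq_exp2r // ltnW.
 by rewrite leq_pexp2l // ltnW.
have GR2 : G * R2 = \sum_(j < M) (u ^ j)%:Z *: F (nth i0 idx j).
 by rewrite mulr_sumr; apply: eq_bigr => j _; rewrite -scalerAr -FGA // mem_nth.
have nR2 : n1 (polyC R2) <= expR b.
 apply: le_trans (n1A _ (M%:R * (((D * M).+1%:R) ^+ M * expR h)) R20 R2d _) _.
  rewrite GR2 rmorph_sum /=; apply: le_trans (n1_sum _ _ _) _.
  apply: (@le_trans _ _ (\sum_(j < M) (((D * M).+1%:R) ^+ M * expR h))); last first.
   by rewrite sumr_const card_ord -[X in X <= _]mulr_natl.
  apply: ler_sum => j _; rewrite map_polyZ n1Z cab_int; apply: ler_pM; rewrite ?ler0z ?n1_ge0 //.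
   exact: uj.
  by apply: nF; rewrite mem_nth.
 by rewrite e2 eU {1}eM -!expRD ler_expR /b !addrA.
have jX i l k c : i \in idx -> (l < S)%N -> (k < t)%N -> (c <= 2 * D)%N ->
  cab (('X^c * polyC (F i))^`N(k)).[z l] <= expR (2 * D%:R * zeta) * expR (- w).
 move=> hi lS kt cD.
 apply: le_trans (jet_mulXn (B := expR (- w)) c _) _.
  by move=> j jk; apply: jF => //; apply: leq_ltn_trans jk kt.
 apply: ler_wpM2r; first exact: expR_ge0.
 apply: (@le_trans _ _ (expR zeta ^+ c)).
  by rewrite lerXn2r ?nnegrE ?expR_ge0 ?hz // addr_ge0 // cab_ge0.
 rewrite -expRM_natl ler_expR; apply: ler_wpM2r => //.
 by rewrite -natrM ler_nat.
have ebw : expR (2 * D%:R * zeta) * expR (- w) <= expR (b - (w - 2 * D%:R * zeta)).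
 by rewrite -expRD ler_expR; move: b0; lra.
have := @interpolation_bound R1 R2 (polyC G) S t D z b b (w - 2 * D%:R * zeta) w' delta R10 R20 cop t0.
move=> /(_ _ D0 R1D R2D nR1 nR2 _ _ hd hG) H.
move: hlt; rewrite ltNge => /negP; apply; apply: le_trans (H _ _ _) _; last first.
- rewrite [leRHS]mulrDr lerD2r -mulrDl -natrD; apply: ler_wpM2r => //.
 by rewrite -natrM ler_nat mul2n -addnn leq_add.
- move=> l k a lS kt aD.
 have -> : 'X^a * polyC R2 * polyC G = \sum_(j < M) (u ^ j)%:Z%:~R *: ('X^a * polyC (F (nth i0 idx j))).
  rewrite -mulrA -rmorphM /= [R2 * G]mulrC GR2 rmorph_sum mulr_sumr; apply: eq_bigr => j _.
  by rewrite /= map_polyZ -scalerAr.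
 rewrite raddf_sum horner_sum; apply: le_trans (cab_sum _ _ _) _.
 apply: (@le_trans _ _ (\sum_(j < M) (((D * M).+1%:R) ^+ M * (expR (2 * D%:R * zeta) * expR (- w))))).
  apply: ler_sum => j _ /=; rewrite nderivnZ hornerZ cabM cab_int; apply: ler_pM; rewrite ?ler0z ?cab_ge0 //.
   exact: uj.
  by apply: jX => //; rewrite ?mem_nth // mul2n -addnn (leq_trans (ltnW aD)) // leq_addl.
 rewrite sumr_const card_ord -[X in X <= _]mulr_natl eU {1}eM -!expRD ler_expR /b.
 have : 0 <= d%:R * ln 2 :> R by rewrite mulr_ge0.
 move: h0; lra.
- move=> l k a lS kt aD; apply: le_trans ebw.
 have -> : 'X^a * polyC R1 * polyC G = 'X^(a + S * t) * polyC (F i0).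
  by rewrite FGA // /R1 !rmorphM /= map_polyXn exprD; ring.
 apply: jX => //; rewrite mul2n -addnn leq_add // ?(ltnW aD) //.
 exact: leq_trans (leq_addl _ _) dD.
- by rewrite dR1; apply: leq_trans (leq_addl _ _); rewrite leq_addr.
Qed.

End Interpolation.

(** * Jets of [P(X^p)], and the weight of a polynomial at a point *)

Lemma nderivn_nderivn (C : numFieldType) (p : {poly C}) j l :
 (p^`N(j))^`N(l) = p^`N(j + l) *+ 'C(j + l, j).
Proof.
have h : (p^`N(j))^`N(l) *+ (j`! * l`!) = p^`N(j + l) *+ 'C(j + l, j) *+ (j`! * l`!).
 have := bin_fact (leq_addr l j); rewrite addKn -mulrnA => ->; rewrite -nderivn_def.
 rewrite mulnC mulrnA -nderivn_def -derivnMn -nderivn_def /derivn -iterD addnC //.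
have N0 : (j`! * l`!)%:R != 0 :> C by rewrite pnatr_eq0 -lt0n muln_gt0 !fact_gt0.
apply/polyP => i; move/polyP/(_ i): h; rewrite !coefMn => h; apply: (mulfI N0).
by rewrite !mulr_natl.
Qed.

Lemma bin_le_expn2 n k : ('C(n, k) <= 2 ^ n)%N.
Proof.
elim: n k => [|n IH] [|k] //; first by rewrite bin0 expn_gt0.
by rewrite binS expnS mul2n -addnn leq_add.
Qed.

Section Weights.
Variable R : realType.
Notation polyC := (map_poly (intr : int -> R[i])).
Notation mz Q := (mah (polyC Q)).
Implicit Types (P Q : {poly int}) (x y z : R[i]) (p q f g : {poly R[i]}).

Lemma jet_comp_Xn p e j k t z (B : R) : (j < t)%N -> (k < t)%N ->
 (forall i, (i <= j + k)%N -> cab (p^`N(i)).[z ^+ e] <= B) ->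
 cab ((p^`N(j) \Po 'X^e)^`N(k)).[z] <= 16 ^+ t * (1 + cab z) ^+ (e * t) * B.
Proof.
move=> jt kt hB; rewrite -coef_shift; set c := z ^+ e.
have B0 : 0 <= B by apply: le_trans (hB 0%N isT); exact: cab_ge0.
pose T := p^`N(j) \Po ('X + c%:P).
pose V : {poly R[i]} := ('X + z%:P) ^+ e - c%:P.
have z1 : 1 <= 1 + cab z by rewrite lerDl cab_ge0.
have -> : (p^`N(j) \Po 'X^e) \Po ('X + z%:P) = T \Po V.
 rewrite /T -!comp_polyA comp_Xn_poly; congr (_ \Po _).
 by rewrite comp_polyD comp_polyX comp_polyC subrK.
have V0 : V`_0 = 0 by rewrite -horner_coef0 /V !hornerE ?add0r subrr.
pose V' := drop_poly 1 V.
have VE : V = V' * 'X.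
 rewrite -{1}(poly_take_drop 1 V) expr1 -[RHS]add0r; congr (_ + _).
 by apply/polyP => -[|i]; rewrite coef_take_poly //= coef0.
pose W := 2 * (1 + cab z) ^+ e.
have W1 : 1 <= W by have := exprn_ege1 e z1; rewrite /W; lra.
have nV : n1 V <= W.
 apply: le_trans (n1D _ _) _; rewrite -polyCN n1C cabN /W mulrDl mul1r; apply: lerD.
  apply: le_trans (n1_exp _ _) _; rewrite lerXn2r ?nnegrE ?n1_ge0 ?(le_trans ler01) //.
  by apply: le_trans (n1D _ _) _; rewrite n1X n1C.
 by rewrite /c cabX lerXn2r ?nnegrE ?cab_ge0 ?(le_trans ler01) // lerDr.
have coefV l : cab (V ^+ l)`_k <= if (l <= k)%N then W ^+ t else 0.
 case: leqP => lk.
  apply: le_trans (coef_le_n1 _ _) _; apply: le_trans (n1_exp _ _) _.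
  apply: (@le_trans _ _ (W ^+ l)); first by rewrite lerXn2r ?nnegrE ?n1_ge0 ?(le_trans ler01).
  by apply: ler_weXn2l => //; apply: leq_trans lk (ltnW kt).
 by rewrite VE exprMn coefMXn lk cab0.
have coefT l : (l <= k)%N -> cab T`_l <= 4 ^+ t * B.
 move=> lk; rewrite coef_shift nderivn_nderivn hornerMn -mulr_natl cabM cab_nat.
 apply: ler_pM; rewrite ?ler0n ?cab_ge0 //; last by apply: hB; rewrite leq_add2l.
 rewrite -natrX ler_nat; apply: leq_trans (bin_le_expn2 _ _) _.
 have -> : (4 ^ t = 2 ^ (2 * t))%N by rewrite expnM.
 by rewrite leq_exp2l // mul2n -addnn leq_add // ?(leq_trans lk) // ltnW.
rewrite comp_polyE coef_sum; apply: le_trans (cab_sum _ _ _) _.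
pose F i := if (i <= k)%N then 4 ^+ t * B * W ^+ t else 0.
have c0 : 0 <= 4 ^+ t * B * W ^+ t by rewrite !mulr_ge0 ?exprn_ge0 // (le_trans ler01).
have F0 i : 0 <= F i by rewrite /F; case: ifP.
apply: (@le_trans _ _ (\sum_(i < size T) F i)).
 apply: ler_sum => i _; rewrite /F coefZ cabM; have := coefV i; case: leqP => ik hV.
  by apply: ler_pM => //; rewrite ?cab_ge0 // coefT.
 have -> : cab (V ^+ i)`_k = 0 by apply/eqP; rewrite eq_le hV cab_ge0.
 by rewrite mulr0.
apply: (@le_trans _ _ (\sum_(0 <= i < t + size T) F i)).
 rewrite [leRHS](big_cat_nat (n := size T)) ?leq_addl //= big_mkord lerDl.
 by apply: sumr_ge0 => i _; apply: F0.
rewrite (big_cat_nat (n := t)) ?leq_addr //= [X in _ + X]big1_seq ?addr0; last first.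
 move=> i; rewrite mem_index_iota => /andP[_ /andP[ti _]]; rewrite /F leqNgt (leq_trans kt ti) //.
apply: (@le_trans _ _ (\sum_(0 <= i < t) 4 ^+ t * B * W ^+ t)).
 by apply: ler_sum => i _; rewrite /F; case: ifP.
rewrite sumr_const_nat subn0 -[X in X <= _]mulr_natl.
have tB : t%:R <= 2 ^+ t :> R by rewrite -natrX ler_nat ltnW // ltn_expl.
(* The constant 16 is [2 * 4 * 2]: the number [t] of terms, the binomial coefficients, and the
   factor 2 in [W]. *)
apply: (@le_trans _ _ (2 ^+ t * (4 ^+ t * B * W ^+ t))); first by rewrite ler_wpM2r.
rewrite /W exprMn -exprM (_ : 16 = 2 * 4 * 2 :> R); last by rewrite -!natrM.
by rewrite !exprMn; apply: eq_le_ref; ring.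
Qed.

(** The logarithmic gap in the trivial bound [M(Q) (2 max(1,|z|))^deg] for [|Q(z)|]. It is
    non-negative and additive over products, so the smallness of a product can be distributed over
    its factors. *)
Definition wt z Q : R := ln (mz Q) + (size Q).-1%:R * ln (2 * mx1 z) - ln (cab (polyC Q).[z]).

Lemma ln2mx1_ge0 z : 0 <= ln (2 * mx1 z).
Proof. by rewrite ln_ge0 //; have := mx1_ge1 z; lra. Qed.

Lemma ln2mx1E z : ln (2 * mx1 z) = ln 2 + ln (mx1 z).
Proof. by rewrite lnM // posrE ?mx1_gt0 // ltr0n. Qed.

Lemma horner_le_mz z Q : Q != 0 -> cab (polyC Q).[z] <= mz Q * (2 * mx1 z) ^+ (size Q).-1.
Proof.
move=> Q0; apply: le_trans (n1_horner (n := (size Q).-1) z _) _; first by rewrite size_polyF leqSpred.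
rewrite exprMn mulrA; apply: ler_wpM2r; first by rewrite exprn_ge0 // ltW // mx1_gt0.
by rewrite mulrC; have := n1_le_mah (@polyC_neq0 R _ Q0); rewrite size_polyF.
Qed.

Lemma cab_horner_wt z Q : Q != 0 -> ~~ root (polyC Q) z ->
 cab (polyC Q).[z] = expR (ln (mz Q) + (size Q).-1%:R * ln (2 * mx1 z) - wt z Q).
Proof. by move=> Q0 nr; rewrite /wt opprB addrC subrK lnK // posrE cab_gt0. Qed.

Lemma wt_ge0 z Q : Q != 0 -> ~~ root (polyC Q) z -> 0 <= wt z Q.
Proof.
move=> Q0 nr; have := horner_le_mz z Q0; rewrite {1}cab_horner_wt //.
have m2 : 0 < 2 * mx1 z by rewrite mulr_gt0 // mx1_gt0.
have e1 : mz Q = expR (ln (mz Q)) by rewrite lnK // posrE mah_gt0 // polyC_neq0.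
have e2 d : (2 * mx1 z) ^+ d = expR (d%:R * ln (2 * mx1 z)) by rewrite expRM_natl lnK.
by rewrite e2 [X in _ <= X * _]e1 -expRD ler_expR; lra.
Qed.

Lemma wtM z P Q : P != 0 -> Q != 0 -> ~~ root (polyC P) z -> ~~ root (polyC Q) z ->
 wt z (P * Q) = wt z P + wt z Q.
Proof.
move=> P0 Q0 rP rQ; rewrite /wt lnmzM // rmorphM /= hornerM cabM (@lnM R (cab _) (cab _)) ?posrE ?cab_gt0 //.
have -> : (size (P * Q)%R).-1 = ((size P).-1 + (size Q).-1)%N.
 have aux (a b : nat) : (0 < a)%N -> (0 < b)%N -> ((a + b).-2 = a.-1 + b.-1)%N by lia.
 by rewrite size_mul //; apply: aux; rewrite size_poly_gt0.
by rewrite natrD; ring.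
Qed.

Lemma wt_prod z (s : seq {poly int}) : (forall q : {poly int}, q \in s -> q != 0 /\ ~~ root (polyC q) z) ->
 wt z (\prod_(q <- s) q) = \sum_(q <- s) wt z q.
Proof.
elim: s => [|q s IH] hs.
 rewrite !big_nil /wt size_poly1 mul0r rmorph1 mahC ?oner_eq0 // hornerC cab1 ln1; ring.
have [q0 rq] := hs q (mem_head _ _).
have hs' (f : {poly int}) : f \in s -> f != 0 /\ ~~ root (polyC f) z by move=> hf; apply: hs; rewrite inE hf orbT.
rewrite !big_cons wtM ?IH //; first by rewrite prodf_seq_neq0; apply/allP => f /hs' [-> _].
rewrite rmorph_prod /root horner_prod prodf_seq_neq0; apply/allP => f /hs' [_ +].
by rewrite /root.
Qed.

(** The case of one point, one derivative and [G = 1] of [interpolation_bound]: two coprime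
    polynomials cannot both be very small at [z]. *)
Lemma resultant_wt z P Q : (0 < (size P).-1)%N -> (0 < (size Q).-1)%N ->
 ~~ root (polyC P) z -> ~~ root (polyC Q) z ->
 (forall y, root (polyC P) y -> ~~ root (polyC Q) y) ->
 Num.min (wt z P) (wt z Q) <= (size Q).-1%:R * ln (mz P) + (size P).-1%:R * ln (mz Q) +
  (size P).-1%:R * (size Q).-1%:R * (4 * ln (mx1 z) + 2 + 4 * ln (2 * ((size P).-1 + (size Q).-1)%:R)).
Proof.
move=> dP dQ rP rQ cop.
have P0 : P != 0 by apply: contraTneq dP => ->; rewrite size_poly0.
have Q0 : Q != 0 by apply: contraTneq dQ => ->; rewrite size_poly0.
set d1 := (size P).-1 in dP *; set d2 := (size Q).-1 in dQ *; set D := (d1 + d2)%N.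
have D0 : (0 < D)%N by rewrite addn_gt0 dP.
have m0 : 0 <= ln (mx1 z) by rewrite ln_ge0 // mx1_ge1.
pose b1 := ln (mz P) + d1%:R * ln 2; pose b2 := ln (mz Q) + d2%:R * ln 2.
pose w := Num.min (wt z P) (wt z Q) - 2 * D%:R * ln (mx1 z).
have e2 d : 2 ^+ d = expR (d%:R * ln 2) :> R by rewrite expRM_natl lnK // posrE.
have n1b T : T != 0 -> n1 (polyC T) <= expR (ln (mz T) + (size T).-1%:R * ln 2).
 move=> T0; rewrite expRD lnK ?posrE ?mah_gt0 ?polyC_neq0 // -e2 mulrC.
 by have := n1_le_mah (@polyC_neq0 R _ T0); rewrite size_polyF.
have jet T (a : nat) : T != 0 -> ~~ root (polyC T) z -> (a < D)%N -> ((size T).-1 <= D)%N ->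
  Num.min (wt z P) (wt z Q) <= wt z T ->
  cab ('X^a * polyC T * 1).[z] <= expR (ln (mz T) + (size T).-1%:R * ln 2 - w).
 move=> T0 rT aD TD hm; rewrite mulr1 hornerM hornerXn cabM cabX cab_horner_wt //.
 apply: (@le_trans _ _ (expR (a%:R * ln (mx1 z)) * expR (ln (mz T) + (size T).-1%:R * ln (2 * mx1 z) - wt z T))).
  apply: ler_wpM2r; first exact: expR_ge0.
  by rewrite expRM_natl lnK ?posrE ?mx1_gt0 // lerXn2r ?nnegrE ?cab_ge0 ?(ltW (mx1_gt0 z)) ?cab_mx1.
 rewrite -expRD ler_expR ln2mx1E /w.
 have h1 : a%:R * ln (mx1 z) <= D%:R * ln (mx1 z) by rewrite ler_wpM2r // ler_nat ltnW.
 have h2 : (size T).-1%:R * ln (mx1 z) <= D%:R * ln (mx1 z) by rewrite ler_wpM2r // ler_nat.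
 by rewrite mulrDr; move: h1 h2 hm; lra.
have := @interpolation_bound R P Q 1 1 1 D (fun=> z) b1 b2 w 0 0 P0 Q0 cop isT.
rewrite mul1n -/d1 -/d2 addn_gt0 dQ leq_addr leq_addl => /(_ isT D0 isT isT (n1b _ P0) (n1b _ Q0)).
move=> /(_ _ _ _ _)/wrap[].
- move=> _ k a _; rewrite ltnS leqn0 => /eqP -> aD; rewrite nderivn0; apply: jet => //.
  exact: leq_addr.
 by rewrite ge_min lexx.
- move=> _ k a _; rewrite ltnS leqn0 => /eqP -> aD; rewrite nderivn0; apply: jet => //.
  exact: leq_addl.
 by rewrite ge_min lexx orbT.
- by move=> l; rewrite ltnS leqn0 => /eqP ->; rewrite big_geq // oppr0 expR0.
- by move=> l _; rewrite hornerC cab1 oppr0 expR0.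
rewrite mul1r mulr0 !subr0 /w /b1 /b2 => h.
have D2 : D%:R <= 2 * d1%:R * d2%:R :> R by rewrite -!natrM ler_nat /D; nia.
have lD : 0 <= ln (2 * D%:R) :> R by rewrite ln_ge0 // -natrM ler1n muln_gt0.
have h1 := ler_wpM2r m0 D2; have h2 := ler_wpM2r lD D2.
have l2 : ln 2 <= 1 :> R.
 rewrite -[leRHS]expRK ler_ln ?posrE ?expR_gt0 //; have := expR_ge1Dx (1 : R); lra.
have dd : 0 <= d1%:R * d2%:R :> R by rewrite mulr_ge0.
have h3 := ler_wpM2l dd l2.
by move: h h1 h2 h3; rewrite !mulrDr; lra.
Qed.

End Weights.

(* Pushes the instance at [n] of a property [H] holding near infinity, where [n] was introduced by [near=>]. *)
Tactic Notation "near_have" ident(n) constr(H) :=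
 lazymatch type of H with @prop_near1 _ _ _ ?P _ =>
  let h := fresh in assert (h : P n); [near: n; exact: H | revert h; cbv beta]
 end.

Tactic Notation "lra_from" ne_constr_list_sep(H, ",") :=
 generalize H; repeat match goal with h : ?P |- _ => match type of P with Prop => clear h end end; lra.

(** * Powers of [n] and their comparison for large [n] *)

Section Growth.
Variable R : realType.
Implicit Types (a b c : R) (n : nat).

(** The power [n^a]. As [ln] is 0 at 0, its value at [n = 0] is 1, so it is positive for every
    [n]. *)
Definition pw n a : R := expR (a * ln n%:R).

Lemma pwD n a b : pw n (a + b) = pw n a * pw n b.
Proof. by rewrite /pw mulrDl expRD. Qed.

Lemma pwN n a : pw n (- a) = (pw n a)^-1.
Proof. by rewrite /pw mulNr expRN. Qed.

Lemma pw_gt0 n a : 0 < pw n a. Proof. exact: expR_gt0. Qed.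
Lemma pw_ge0 n a : 0 <= pw n a. Proof. exact: expR_ge0. Qed.
Lemma pw0 n : pw n 0 = 1. Proof. by rewrite /pw mul0r expR0. Qed.
Lemma pw1 n : (0 < n)%N -> pw n 1 = n%:R.
Proof. by move=> n0; rewrite /pw mul1r lnK // posrE ltr0n. Qed.

Lemma ln_nat_ge0 n : 0 <= ln n%:R :> R.
Proof. by case: n => [|n]; [rewrite ln0 | rewrite ln_ge0 // ler1n]. Qed.

Lemma ler_pw n a b : a <= b -> pw n a <= pw n b.
Proof. by move=> ab; rewrite ler_expR ler_wpM2r ?ln_nat_ge0. Qed.

Lemma pw_ge1 n a : 0 <= a -> 1 <= pw n a.
Proof. by move=> /(ler_pw n); rewrite pw0. Qed.

Lemma pwX n a k : pw n (k%:R * a) = pw n a ^+ k.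
Proof. by rewrite /pw -mulrA expRM_natl. Qed.

Lemma powR_pw n a : (0 < n)%N -> n%:R `^ a = pw n a.
Proof. by move=> n0; rewrite /powR pnatr_eq0 (gtn_eqF n0). Qed.

Lemma near_ge k : \forall n \near \oo, (k <= n)%N.
Proof. by exists k. Qed.

Lemma near_ge1 : \forall n \near \oo, (0 < n)%N.
Proof. by exists 1%N. Qed.

Lemma near_ln_ge c : \forall n \near \oo, c <= ln n%:R :> R.
Proof.
exists (Num.truncn (expR c)).+1 => // n /= hn.
have h : expR c < n%:R by apply: lt_le_trans (truncnS_gt _) _; rewrite ler_nat.
by rewrite -[c]expRK ler_ln ?posrE ?expR_gt0 ?(lt_trans (expR_gt0 c)) // ltW.
Qed.

Lemma near_pw c a b : a < b -> \forall n \near \oo, c * pw n a <= pw n b.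
Proof.
move=> ab; near=> n; have ba : 0 < b - a by rewrite subr_gt0.
have h : ln (`|c| + 1) / (b - a) <= ln n%:R by near: n; apply: near_ln_ge.
apply: (@le_trans _ _ ((`|c| + 1) * pw n a)).
 by apply: ler_wpM2r; [exact: pw_ge0 | have := ler_norm c; lra].
have -> : pw n b = pw n (b - a) * pw n a by rewrite -pwD subrK.
apply: ler_wpM2r; first exact: pw_ge0.
have c0 : 0 < `|c| + 1 by rewrite ltr_wpDl.
rewrite -[X in X <= _]lnK ?posrE // ler_expR.
by rewrite -ler_pdivrMl // mulrC.
Unshelve. all: by end_near. Qed.

Lemma near_pw_ge c b : 0 < b -> \forall n \near \oo, c <= pw n b.
Proof.
move=> b0; near=> n; have : c * pw n 0 <= pw n b by near: n; apply: near_pw.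
by rewrite pw0 mulr1.
Unshelve. all: by end_near. Qed.

Lemma near_ln c b : 0 < b -> \forall n \near \oo, c * ln n%:R <= pw n b.
Proof.
move=> b0; near=> n; have b2 : 0 < b / 2 by rewrite divr_gt0.
have h : (`|c| / (b / 2)) * pw n (b / 2) <= pw n b by near: n; apply: near_pw; lra.
apply: le_trans h; apply: (@le_trans _ _ (`|c| * ln n%:R)).
 by apply: ler_wpM2r; [exact: ln_nat_ge0 | exact: ler_norm].
rewrite -mulrA; apply: ler_wpM2l => //; rewrite mulrC ler_pdivlMr //.
by have := expR_ge1Dx (b / 2 * ln n%:R); rewrite /pw; lra.
Unshelve. all: by end_near. Qed.

(** Replacing [n] by [n+1] costs less than any positive power of [n]. Objects of consecutive levels
    are compared at this price. *)
Lemma near_pw_succ a e : 0 < e -> \forall n \near \oo,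
 (pw n.+1 a <= pw n (a + e)) /\ (pw n a <= pw n.+1 (a + e)).
Proof.
move=> e0; near=> n; have n0 : (0 < n)%N by near: n; apply: near_ge1.
have l1 : ln n%:R <= ln n.+1%:R :> R by rewrite ler_ln ?posrE ?ltr0n // ler_nat.
have l2 : ln n.+1%:R <= ln n%:R + ln 2 :> R.
 by rewrite -lnM ?posrE ?ltr0n // -natrM ler_ln ?posrE ?ltr0n ?muln_gt0 ?n0 // ler_nat; lia.
have h : `|a| * ln 2 / e <= ln n%:R by near: n; apply: near_ln_ge.
rewrite ler_pdivrMr // in h.
have lh : `|a| * ln n.+1%:R <= `|a| * (ln n%:R + ln 2) by rewrite ler_wpM2l.
have ll : `|a| * ln n%:R <= `|a| * ln n.+1%:R by rewrite ler_wpM2l.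
have l0 : 0 <= ln n%:R :> R := ln_nat_ge0 n.
have le : e * ln n%:R <= e * ln n.+1%:R by rewrite ler_wpM2l // ltW.
rewrite /pw !ler_expR; have [a0|a0] := lerP 0 a.
 by rewrite ger0_norm // in lh ll h; split; lra.
by rewrite ltr0_norm // in lh ll h; split; lra.
Unshelve. all: by end_near. Qed.

Lemma truncn_pw n a (k := Num.truncn (pw n a)) : k%:R <= pw n a /\ pw n a < k.+1%:R.
Proof. by rewrite /k; have := truncn_itv (pw_ge0 n a); move=> /andP[]. Qed.

End Growth.

(** * Torsion factors *)

Section TorsionPolynomials.
Variable C : numClosedFieldType.
Notation polyC := (map_poly (intr : int -> C)).

(** A root of [Q] in [algC] satisfies the same rational relations as [x], so it is a primitive
    [k]-th root of unity and [Q] corresponds to a cyclotomic polynomial. *)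
Lemma torsion_irrz (Q : {poly int}) (x : C) k : irrz Q -> root (polyC Q) x ->
 k.-primitive_root x ->
 [/\ (size Q).-1 = totient k, exists P : {poly int}, 'X^k - 1 = Q * P
  & forall j, coprime j k -> root (polyC Q) (x ^+ j)].
Proof.
move=> iQ rQ pk; have k0 := prim_order_gt0 pk.
have [w rw] : exists w : algC, root (map_poly (intr : int -> algC) Q) w.
 apply: closed_rootP; rewrite size_polyF; apply/eqP => s1.
 by have := irrz_size_gt1 iQ; rewrite s1.
have tr h : evr h x = 0 -> evr h w = 0 by move=> e; apply: (dvdQ_evr rw); apply: (irrz_dvdQ iQ rQ).
have tr' h : evr h w = 0 -> evr h x = 0 by move=> e; apply: (dvdQ_evr rQ); apply: (irrz_dvdQ iQ rw).
have wk j : (w ^+ j == 1) = (x ^+ j == 1).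
 have e (F : numFieldType) (y : F) : evr ('X^j - 1) y = y ^+ j - 1.
  by rewrite rmorphB /= map_polyXn rmorph1 !hornerE.
 by apply/eqP/eqP => /eqP; rewrite -subr_eq0 -e => /eqP h; apply/eqP; rewrite -subr_eq0 -e; apply/eqP; [apply: tr' | apply: tr].
have pw : k.-primitive_root w.
 by rewrite /primitive_root_of_unity k0; apply/forallP => i; rewrite unity_rootE wk -unity_rootE; have /andP[_ /forallP/(_ i)] := pk.
have [q [qE qm qd]] := minCpolyP w.
have qw : root (map_poly ratr q) w by rewrite qd.
have sq : size q = (totient k).+1.
 have := congr1 (size : {poly algC} -> nat) (minCpoly_cyclotomic pw).
 by rewrite qE size_map_poly size_cyclotomic.
have qQ : q %= polyQ Q.
 have [_ iQ2] := iQ.2; apply: iQ2; first by rewrite sq eqSS -lt0n totient_gt0.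
 by rewrite -qd -polyF_ratr.
split.
- by rewrite -(size_polyF rat) -(eqp_size qQ) sq.
- apply: primitive_dvdQ; first exact: iQ.1.
 rewrite rmorphB /= map_polyXn rmorph1; apply: (irrz_dvdQ iQ rQ).
 by rewrite rmorphB /= map_polyXn rmorph1 !hornerE (prim_expr_order pk) subrr.
move=> j cj.
have rj : root (map_poly ratr q) (w ^+ j).
 rewrite -qE (minCpoly_cyclotomic pw) root_cyclotomic //.
 by rewrite prim_root_exp_coprime.
have : evr (polyQ Q \Po 'X^j) w = 0.
 rewrite map_comp_poly /= map_polyXn horner_comp hornerXn; apply/eqP/(root_dvdp _ rj).
 by rewrite dvdp_map (eqp_dvdl _ qQ) dvdpp.
move=> /tr'; rewrite map_comp_poly /= map_polyXn horner_comp hornerXn -polyF_ratr.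
by move/eqP.
Qed.

End TorsionPolynomials.

Section Torsion.
Variable R : realType.
Notation polyC := (map_poly (intr : int -> R[i])).
Notation mz Q := (mah (polyC Q)).

Lemma cab_root1 (w : R[i]) k : (0 < k)%N -> w ^+ k = 1 -> cab w = 1.
Proof.
move=> k0 wk; have := cabX w k; rewrite wk cab1 => /esym/eqP.
by rewrite pexpr_eq1 ?cab_ge0 // => /eqP.
Qed.

Lemma mz_XnB1 k : (0 < k)%N -> mz ('X^k - 1) = 1.
Proof.
move=> k0; have e : polyC ('X^k - 1) = 'X^k - 1 by rewrite rmorphB /= map_polyXn rmorph1.
rewrite e /mah lead_coefXnsubC // cab1 mul1r big_seq big1 // => w.
rewrite mem_croots; last by rewrite -size_poly_eq0 size_XnsubC.
rewrite /root !hornerE subr_eq0 => /eqP wk.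
by rewrite /mx1 (cab_root1 k0 wk) maxxx.
Qed.

Lemma deg_XnB1 k : (0 < k)%N -> (size ('X^k - 1 : {poly int})).-1 = k.
Proof. by move=> k0; rewrite size_XnsubC. Qed.

Lemma XnB1_neq0 k : (0 < k)%N -> 'X^k - 1 != 0 :> {poly int}.
Proof. by move=> k0; rewrite -size_poly_eq0 size_XnsubC. Qed.

(** [X^k - 1] has Mahler measure one, and by additivity its weight is at least that of its factor
    [Q]. *)
Lemma torsion_factor_wt (Q P : {poly int}) (z : R[i]) k : (0 < k)%N -> 'X^k - 1 = Q * P ->
 z ^+ k != 1 -> cab (z ^+ k - 1) <= expR (k%:R * ln (2 * mx1 z) - wt z Q).
Proof.
move=> k0 E zk.
have QP0 : Q * P != 0 by rewrite -E XnB1_neq0.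
have [Q0 P0] : Q != 0 /\ P != 0 by move: QP0; rewrite mulf_eq0 negb_or => /andP.
have e : (polyC ('X^k - 1)).[z] = z ^+ k - 1.
 by rewrite rmorphB /= map_polyXn rmorph1 !hornerE.
have r0 : ~~ root (polyC ('X^k - 1)) z by rewrite /root e subr_eq0.
have [rQ rP] : ~~ root (polyC Q) z /\ ~~ root (polyC P) z.
 by move: r0; rewrite E rmorphM rootM negb_or => /andP.
rewrite -e cab_horner_wt ?XnB1_neq0 // mz_XnB1 // ln1 add0r deg_XnB1 // ler_expR lerD2l lerN2.
by rewrite E wtM // lerDl wt_ge0.
Qed.

Lemma torsion_order (Q : {poly int}) : irrz Q -> torsion_poly R Q -> Q`_0 != 0 ->
 exists (x : R[i]) k, root (polyC Q) x /\ k.-primitive_root x.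
Proof.
move=> iQ [x rx tx] Q0; have x0 := irrz_root_neq0 Q0 rx.
case: tx => [/eqP|[k k0 xk]]; first by rewrite (negPf x0).
by have [q pq _] := prim_order_exists k0 xk; exists x, q.
Qed.

Definition torsion_factors (s : seq {poly int}) :=
 [seq q <- undup s | `[< torsion_poly R q >] && (q`_0 != 0)].

(** The product of the primes in [E] is at least [2^(size E)], hence some prime of [E] does not
    divide the order [k]. For it [x^p] is conjugate to [x], so the factor itself, and not another
    image, divides [P]. *)
Lemma torsion_mult_bound (P G : {poly int}) (s : seq {poly int}) (c : int) (E : seq nat) t : P != 0 ->
 c != 0 -> (forall q, q \in s -> irrz q) -> G = c *: \prod_(q <- s) q -> uniq E -> all prime E ->
 (0 < t)%N ->
 (forall p j, p \in E -> (j < t)%N -> exists A : {poly int}, P^`N(j) \Po 'X^p = G * A) ->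
 (forall (q : {poly int}) (x : R[i]) (k : nat), q \in s -> root (polyC q) x -> k.-primitive_root x -> (k < 2 ^ size E)%N) ->
 (\sum_(q <- torsion_factors s) maxn t (count_mem q s) * (size q).-1
  <= (size P).-1)%N.
Proof.
move=> P0 c0 hs GE uE aE t0 hG hk.
have [c' [sP [c'0 hsP PE]]] := irrz_factorization P0.
set L := torsion_factors s.
have LP (q : {poly int}) : q \in L -> (maxn t (count_mem q s) <= count_mem q sP)%N.
 rewrite mem_filter mem_undup => /andP[/andP[/asboolP tq q0] qs].
 have iq := hs q qs; have [x [k [rx pk]]] := torsion_order iq tq q0.
 have [dq _ rj] := torsion_irrz iq rx pk.
 have k0 := prim_order_gt0 pk.
 have [p pE pk'] : exists2 p, p \in E & ~~ (p %| k)%N.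
  apply/hasP/negPn/negP; rewrite -all_predC => /allP al.
  have {}al p : p \in E -> (p %| k)%N by move=> /al /negPn.
  have := hk q x k qs rx pk; rewrite ltnNge => /negP; apply.
  have : (\prod_(p <- E) p %| k)%N.
   elim: (E) uE aE al => [|p E' IH] /=; first by rewrite big_nil dvd1n.
   move=> /andP[pE' uE'] /andP[pp aE'] al; rewrite big_cons Gauss_dvd.
    by rewrite al ?mem_head //= IH // => r hr; apply: al; rewrite inE hr orbT.
   by rewrite coprime_sym; apply: coprime_prod_primes.
  move=> /(dvdn_leq k0); apply: leq_trans.
  elim: (E) aE => [|p E' IH] /=; first by rewrite big_nil.
  by move=> /andP[/prime_gt1 p1 /IH ih]; rewrite big_cons expnS leq_mul.
 have pp := allP aE p pE; have p0 := prime_gt0 pp.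
 have rxp : root (polyC q) (x ^+ p) by apply: rj; rewrite prime_coprime.
 have x0 := irrz_root_neq0 q0 rx.
 have cG : count_mem q s = mup x (polyC G) by rewrite GE (count_scaled_mup c0 hs iq rx).
 have rG : root (polyC G) x.
  by apply: contraLR qs => /mupNroot m0; rewrite -has_pred1 has_count cG m0.
 rewrite -(count_scaled_mup c'0 hsP iq rxp) -PE geq_max; apply/andP; split.
  apply: nderiv_mup; first exact: polyC_neq0.
  move=> j jt; have [A AE] := hG _ _ pE jt.
  have := congr1 (fun q => (polyC q).[x]) AE; rewrite map_comp_poly /= map_polyXn horner_comp hornerXn.
  by rewrite rmorphM hornerM /= (rootP rG) mul0r nderivn_map.
 rewrite cG; have [A] := hG _ _ pE t0; rewrite nderivn0 => AE.
 apply: leq_trans (mup_comp_Xn (@polyC_neq0 R _ P0) x0 p0).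
 have PXE : polyC P \Po 'X^p = polyC G * polyC A.
  by rewrite -rmorphM /= -AE map_comp_poly /= map_polyXn.
 have PX0 : polyC P \Po 'X^p != 0.
  by rewrite comp_poly_eq0 ?polyC_neq0 // size_polyXn ltnS.
 rewrite PXE mupM ?leq_addr //; apply: contra_neq PX0; rewrite PXE => ->; by rewrite ?mul0r ?mulr0.
have := @fiber_sum_le int _ _ L sP id (fun q : {poly int} => (maxn t (count_mem q s) * (size q).-1)%:R)
 (fun q : {poly int} => (size q).-1%:R) 1.
rewrite mul1r -!natr_sum !natz => h; rewrite PE (deg_scaled_prod c'0); last by move=> q /hsP /irrz_neq0.
suff : ((\sum_(i <- L) maxn t (count_mem i s) * (size i).-1)%N%:Z <= (\sum_(i <- sP) (size i).-1)%N%:Z)%R by [].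
apply: h.
- move=> q /LP h; rewrite -has_pred1 has_count; apply: leq_trans h; by rewrite leq_max t0.
- by [].
- by move=> q /LP h; rewrite -natrM ler_nat leq_mul2r h orbT.
move=> f _; rewrite count_uniq_mem ?leq_b1 // filter_uniq // undup_uniq //.
Qed.

End Torsion.

(** * Many primes below a power of [n], few divisors *)

Section Bounds.
Variable R : realType.
Implicit Types (a b c e : R) (n : nat).

Lemma ln_le_pw n e X : 0 < X -> X <= pw n e -> ln X <= e * ln n%:R :> R.
Proof.
move=> X0 h; rewrite -[leRHS]expRK ler_ln ?posrE ?expR_gt0 //.
Qed.

Lemma ln2_ge : 1 / 2 <= ln 2 :> R.
Proof.
have h : expR (1 / 2) <= 2 :> R.
 have h := expR_ge1Dx (- (1 / 2) : R); rewrite expRN in h.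
 rewrite -[leLHS]invrK -[leRHS]invrK lef_pV2 ?posrE ?invr_gt0 ?expR_gt0 //; lra.
by rewrite -[leLHS]expRK ler_ln ?posrE ?expR_gt0.
Qed.

Lemma near_ln_pw c e k : 0 <= c -> 0 < k ->
 \forall n \near \oo, forall X, X <= pw n e -> c * ln X <= pw n k :> R.
Proof.
move=> c0 k0; near=> n => X hX.
have h : (c * `|e|) * ln n%:R <= pw n k by near: n; apply: near_ln.
have [X0|X0] := ltrP 0 X; last by rewrite ln0 // mulr0 pw_ge0.
apply: le_trans h; rewrite -mulrA; apply: ler_wpM2l => //; apply: le_trans (ln_le_pw X0 hX) _.
by apply: ler_wpM2r; [exact: ln_nat_ge0 | exact: ler_norm].
Unshelve. all: by end_near. Qed.

Lemma near_primes (al k : R) : 0 < k -> k < al -> \forall n \near \oo,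
 let E := [seq p <- primes_upto (Num.truncn (pw n al)) | pw n (al - k) <= p%:R] in
 pw n (al - k) <= (size E)%:R.
Proof.
move=> k0 kal; near=> n; rewrite /=; set A := Num.truncn _.
pose E := [seq p <- primes_upto A | pw n (al - k) <= p%:R]; rewrite -/E.
have [hA1 hA2] : A%:R <= pw n al /\ pw n al < A.+1%:R := truncn_pw n al.
have p4 : 4 <= pw n al by near: n; apply: near_pw_ge; lra.
have A2 : (1 < A)%N by rewrite -(ltr_nat R); move: hA2; rewrite -natr1; lra.
have := primes_upto_count A2; set pi := size _ => h.
have hl : ln (2 ^ (A %/ 2))%N%:R <= ln (A ^ pi)%N%:R :> R.
 by rewrite ler_ln ?posrE ?ltr0n ?expn_gt0 ?(ltnW A2) // ler_nat.
rewrite !natrX !lnXn ?ltr0n ?(ltnW A2) // -[X in X <= _]mulr_natl -[X in _ <= X]mulr_natl in hl.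
have lA : ln A%:R <= al * ln n%:R :> R by apply: ln_le_pw hA1; rewrite ltr0n ltnW.
have l2 := ln2_ge.
have hA4 : pw n al / 4 <= (A %/ 2)%:R * ln 2 * 2 :> R.
 have : A%:R <= 2 * (A %/ 2)%:R + 1 :> R.
  by rewrite -natrM natr1 ler_nat; have := divn_eq A 2; have := ltn_pmod A (isT : (0 < 2)%N); lia.
 move: hA2; rewrite -natr1; have : 0 <= (A %/ 2)%:R :> R by [].
 move: (A %/ 2)%:R => Q Q0 h1 h2; have := ler_wpM2l Q0 l2; lra.
have e1 : 16 * pw n (al - k) * (al * ln n%:R) <= pw n al.
 have e3 : (16 * al) * ln n%:R <= pw n k by near: n; apply: near_ln.
 have -> : pw n al = pw n (al - k) * pw n k by rewrite -pwD subrK.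
 by rewrite mulrC -mulrA mulrCA; have := ler_wpM2l (pw_ge0 n (al - k)) e3; lra.
have pi2 : 2 * pw n (al - k) <= pi%:R.
 have ln0 : 0 < al * ln n%:R :> R.
  rewrite mulr_gt0 //; first by lra.
  by apply: lt_le_trans ltr01 _; near: n; apply: near_ln_ge.
 rewrite -(ler_pM2r ln0); apply: (@le_trans _ _ (pi%:R * ln A%:R)); first by lra.
 by apply: ler_wpM2l.
have : (pi <= size E + Num.truncn (pw n (al - k)))%N.
 rewrite /pi -(count_predC (fun p => pw n (al - k) <= p%:R) (primes_upto A)) -size_filter leq_add2l -size_filter.
 rewrite -[leqRHS](size_iota 1); apply: uniq_leq_size.
  by rewrite !filter_uniq // iota_uniq.
 move=> p; rewrite mem_filter /= -ltNge mem_primes_upto mem_iota => /andP[lt /andP[/prime_gt0 p0 _]].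
 by rewrite p0 add1n ltnS truncn_ge_nat ?pw_ge0 // ltW.
rewrite -(ler_nat R) natrD; have [h1 _] := truncn_pw n (al - k); lra.
Unshelve. all: by end_near. Qed.

Lemma divisors_pw k : 0 < k -> exists K, 0 <= K /\ forall n, (0 < n)%N -> (size (divisors n))%:R <= K * pw n k :> R.
Proof.
move=> k0; pose j := (Num.truncn k^-1).+1.
have jk : j%:R^-1 <= k.
 by rewrite -[leRHS]invrK lef_pV2 ?posrE ?invr_gt0 ?ltr0n // ltW // truncnS_gt.
have [K K0 hK] := @divisors_bound j isT.
exists (expR (j%:R^-1 * ln K%:R)); split; first exact: expR_ge0.
move=> n n0; apply: (@le_trans _ _ (expR (j%:R^-1 * ln K%:R) * pw n j%:R^-1)); last first.
 by apply: ler_wpM2l; [exact: expR_ge0 | exact: ler_pw].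
rewrite /pw -expRD -mulrDr -lnM ?posrE ?ltr0n // -natrM.
have d1 : (0 < size (divisors n))%N by have := divisors_id n0; case: (divisors n).
have d0 : 0 < (size (divisors n))%:R :> R by rewrite ltr0n.
rewrite -[X in X <= _]lnK ?posrE // ler_expR mulrC ler_pdivlMr ?ltr0n // mulr_natr -lnXn // -natrX.
by rewrite ler_ln ?posrE ?ltr0n ?expn_gt0 ?muln_gt0 ?d1 ?K0 ?n0 // ler_nat hK.
Qed.

End Bounds.

(** * Interpolation at level [n] *)

Section Level.
Variables (R : realType) (m : nat) (xi : 'I_m -> R[i]).
Notation polyC := (map_poly (intr : int -> R[i])).
Notation mz Q := (mah (polyC Q)).
Variables (al vs sg be ta nu ka : R).

Ltac clr := clear -R m xi al vs sg be ta nu ka.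

Definition mon (i : 'I_m -> nat) : R[i] := \prod_(k < m) xi k ^+ i k.

(** Normalized form of a polynomial that the theorem excludes. The length replaces the height, at
    the cost of the number [n.+1] of coefficients. *)
Definition small_at n (P : {poly int}) := [/\ P != 0, ((size P).-1 <= n)%N,
  n1 (polyC P) <= n.+1%:R * expR (pw n be) &
 forall (i : 'I_m -> nat) j, (forall k, (i k)%:R <= pw n sg) -> j%:R < pw n ta ->
  cab (polyC P^`N(j)).[mon i] <= expR (- pw n nu)].

(** [lvA] bounds the primes and [lvx] the exponents of the grid. With [al + vs <= sg], the [p]-th
    powers of grid points stay in the range where [P] is small. *)
Definition lvA n := Num.truncn (pw n al).
Definition lvx n := Num.truncn (pw n vs).
(** A third of [n^ta], because the derivatives [P^[j]] are differentiated again: orders go up to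
    [2(t-1)], which must stay below [n^ta]. *)
Definition lvt n := (Num.truncn (pw n ta / 3)).+1.
Definition lvE n := [seq p <- primes_upto (lvA n) | pw n (al - ka) <= p%:R].

Definition monb : R := 1 + \sum_(k < m) (ln (1 + cab (xi k)) + ln (1 + (cab (xi k))^-1)).

Lemma monb_ge1 : 1 <= monb.
Proof.
rewrite /monb lerDl sumr_ge0 // => k _.
by rewrite addr_ge0 // ln_ge0 // lerDl ?invr_ge0 cab_ge0.
Qed.

Lemma cab_mon_le i x : (forall k, (i k <= x)%N) -> 1 + cab (mon i) <= expR (monb * x.+1%:R).
Proof.
move=> ix; pose L := \sum_(k < m) ln (1 + cab (xi k)).
have h : cab (mon i) <= expR (L * x%:R).
 rewrite /mon cab_prod /L mulr_suml expR_sum; apply: ler_prod => k _; rewrite cab_ge0 cabX /=.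
 have h1 : 1 <= 1 + cab (xi k) by rewrite lerDl cab_ge0.
 rewrite expRM_natr lnK ?posrE ?(lt_le_trans ltr01) //.
 apply: (@le_trans _ _ ((1 + cab (xi k)) ^+ i k)); last exact: ler_weXn2l.
 by rewrite lerXn2r ?nnegrE ?cab_ge0 ?(le_trans ler01) // lerDr.
have L0 : 0 <= L by apply: sumr_ge0 => k _; rewrite ln_ge0 // lerDl cab_ge0.
have Lm : 1 + L <= monb.
 rewrite /monb lerD2l /L; apply: ler_sum => k _; rewrite lerDl ln_ge0 // lerDl invr_ge0 cab_ge0 //.
have h2 : 1 <= expR (L * x%:R) by rewrite -[leLHS]expR0 ler_expR mulr_ge0.
apply: (@le_trans _ _ (expR 1 * expR (L * x%:R))).
 by have := expR_ge1Dx (1 : R); move: h h2; move: (expR (L * _)) => y h h2 h3; have := ler_wpM2r (le_trans ler01 h2) h3; lra.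
rewrite -expRD ler_expR; apply: (@le_trans _ _ ((1 + L) * x.+1%:R)); last by rewrite ler_wpM2r.
by rewrite -natr1; have : 0 <= x%:R :> R by []; nra.
Qed.

Lemma monX i p : mon i ^+ p = mon (fun k => (i k * p)%N).
Proof. by rewrite /mon -prodrXl; apply: eq_bigr => k _; rewrite exprM. Qed.

Lemma n1_comp_Xn (p : {poly R[i]}) e : n1 (p \Po 'X^e) <= n1 p.
Proof.
rewrite comp_polyE; apply: le_trans (n1_sum _ _ _) _; apply: ler_sum => i _.
by rewrite n1Z -exprM -[X in n1 X]mul1r n1Xn n1_1 mulr1.
Qed.

Lemma n1_nderivn (p : {poly R[i]}) n j : (size p <= n.+1)%N -> n1 (p^`N(j)) <= 2 ^+ n * n1 p.
Proof.
move=> sp; rewrite (@n1E _ _ n.+1); last by apply: leq_trans (size_poly _ _) _; apply: leq_trans sp; rewrite leq_subr.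
rewrite (@n1E _ p (j + n.+1)); last by apply: leq_trans sp _; rewrite leq_addl.
rewrite mulr_sumr big_split_ord /= addrC; apply: ler_wpDr; first by apply: sumr_ge0 => i _; rewrite mulr_ge0 ?exprn_ge0 ?cab_ge0.
apply: ler_sum => i _; rewrite coef_nderivn -[p`__ *+ _]mulr_natl cabM cab_nat.
have [h|h] := leqP (j + i) n; last by rewrite nth_default ?cab0 ?mulr0 // (leq_trans sp).
apply: ler_wpM2r; first exact: cab_ge0.
by rewrite -natrX ler_nat (leq_trans (bin_le_expn2 _ _)) // leq_exp2l.
Qed.

Lemma lvt_bounds n : 0 <= ta -> pw n ta / 3 <= (lvt n)%:R <= 2 * pw n ta.
Proof.
move=> ta0; have [h1 h2] : (Num.truncn (pw n ta / 3))%:R <= pw n ta / 3 /\ pw n ta / 3 < (lvt n)%:R.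
 have p0 : 0 <= pw n ta / 3 by rewrite divr_ge0 // pw_ge0.
 by have /andP[] := truncn_itv p0.
rewrite ltW //=; rewrite /lvt -natr1; have := pw_ge1 n ta0; lra.
Qed.

Definition seq_dvd (E : seq nat) n (P G : {poly int}) := forall p j, p \in E -> (j < lvt n)%N ->
 exists A : {poly int}, P^`N(j) \Po 'X^p = G * A.

Lemma size_nderivn_le (A : nzRingType) (p : {poly A}) j : (size p^`N(j) <= size p)%N.
Proof. exact: leq_trans (size_poly _ _) (leq_subr _ _). Qed.

(** [gcd_small] for [H] and all [P^[j](X^p)]: degrees are about [n^(1+al)], logarithmic coefficients
    about [n^be], and about [n^(om+ta)] jets of size [exp(-n^nu)] stand against them, whence the
    last condition on exponents. [E] is arbitrary so that the list with the single exponent 1 is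
    covered, and [H = 0] is allowed. *)
Lemma near_interp (E : nat -> seq nat) (om : R) : (\forall n \near \oo,
  [/\ exists p, p \in E n, uniq (E n) & forall p, p \in E n -> (0 < p <= lvA n)%N]) ->
 0 < ka -> 0 <= al -> 0 <= vs -> al + vs <= sg -> 0 <= ta ->
 1 + al <= be -> al + ta + ka <= be -> al + ta + vs < nu -> 1 + al + vs < nu ->
 om + ka + ta <= 1 + al -> 0 <= om + ta -> 1 + al + be < om - ka + ta + nu ->
 \forall n \near \oo, forall P (H : {poly int}), small_at n P ->
 ((size H).-1 <= n * lvA n)%N -> n1 (polyC H) <= expR (4 * pw n be) ->
 (forall i k, (forall j, (i j <= lvx n)%N) -> (k < lvt n)%N -> cab ((polyC H)^`N(k)).[mon i] <= expR (- pw n nu)) ->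
 exists G c s, [/\ c != 0, forall q, q \in s -> irrz q, G = c *: \prod_(q <- s) q, seq_dvd (E n) n P G /\ (exists A, H = G * A) &
  forall (S : nat) (Z : nat -> 'I_m -> nat),
   pw n (om - ka) <= S%:R -> S%:R <= pw n (om + ka) ->
   (forall l k, (l < S)%N -> (Z l k <= lvx n)%N) ->
   (forall l, (l < S)%N -> expR (- pw n (nu - ta - ka)) <=
     \prod_(0 <= l' < l) cab (mon (Z l) - mon (Z l'))) ->
   exists2 l, (l < S)%N & cab (polyC G).[mon (Z l)] < expR (- (pw n nu / 2))].
Proof.
move=> nearE k0 al0 vs0 avs ta0 b1 b2 n1' n2 om1 om0 key; near=> n => P H [P0 dP nP jP] dH nH jH.
have [hA _] := truncn_pw n al; rewrite -/(lvA n) in hA.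
have [hx _] := truncn_pw n vs; rewrite -/(lvx n) in hx.
have /andP[t1 t2] := lvt_bounds n ta0.
set A := lvA n in hA; set x := lvx n in hx; set t := lvt n in t1 t2.
have tpos : (0 < t)%N by [].
have n0 : (0 < n)%N by near: n; apply: near_ge1.
have [[p0 p0E] uE EP0] : [/\ exists p, p \in E n, uniq (E n) & forall p, p \in E n -> (0 < p <= lvA n)%N].
 by near: n.
have EP p : p \in E n -> (0 < p)%N /\ (p <= A)%N by move=> /EP0 /andP[].
(* The index with first component 0 is reserved for [H]; the elements of [E n] are positive. *)
pose F (i : nat * nat) := if i.1 is 0%N then H else P^`N(i.2) \Po 'X^(i.1).
have F0 : F (p0, 0%N) != 0.
 rewrite /F /=; case: p0 p0E (EP _ p0E).1 => [|p] // _ _.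
 by rewrite nderivn0 comp_poly_eq0 // size_polyXn.
have FE p j : p \in E n -> F (p, j) = P^`N(j) \Po 'X^p.
 by move=> /EP [pp _]; rewrite /F /=; case: p pp.
pose idx := (0, 0)%N :: [seq (p, j) | p <- E n, j <- iota 0 t].
have idxP i : i \in idx -> i = (0, 0)%N \/ [/\ F i = P^`N(i.2) \Po 'X^(i.1), i.1 \in E n & (i.2 < t)%N].
 rewrite inE => /predU1P[->|]; first by left.
 case/allpairsP => [[p j] [hp hj ->]]; right; split=> //; first exact: FE.
 by move: hj; rewrite mem_iota.
pose F' (i : seq_sub idx) := F (val i).
have memI p j : p \in E n -> (j < t)%N -> (p, j) \in idx.
 by move=> pE jt; rewrite inE; apply/orP; right; apply: (allpairs_f pair pE); rewrite mem_iota.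
have i0I : (p0, 0%N) \in idx by apply: memI.
have [G [B' [G0 FB' hB']]] := @common_factor R _ F' (SeqSub i0I) F0.
pose B i := if insub i is Some i' then B' i' else 0.
have FB i : i \in idx -> F i = G * B i.
 by move=> hi; rewrite /B insubT /= -FB' /F' /=.
have hB y : exists2 i, i \in idx & ~~ root (polyC (B i)) y.
 have [i hi] := hB' y; exists (val i); first exact: valP.
 by rewrite /B valK.
have [c [s [c0 hs GE]]] := irrz_factorization G0.
exists G, c, s; split=> //.
 split; last by exists (B (0, 0)%N); rewrite -FB // mem_head.
 by move=> p j pE jt; exists (B (p, j)); rewrite -FB ?FE // memI.
move=> S Z S1 S2 hZ hd.
have pge (a : R) : 0 <= pw n a by exact: pw_ge0.
have D0 : (0 < n * A)%N.
 by rewrite muln_gt0 n0 /=; apply: leq_trans (EP _ p0E).1 (EP _ p0E).2.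
pose D := (n * A + S * t)%N; pose h := n%:R * ln 2 + ln n.+1%:R + pw n be.
pose zeta := monb * x.+1%:R.
have m1 := monb_ge1.
have pn : pw n 1 = n%:R :> R by apply: pw1.
have l2 : ln 2 <= 1 :> R.
 rewrite -[leRHS]expRK ler_ln ?posrE ?expR_gt0 //; have := expR_ge1Dx (1 : R); clr; lra.
have l20 : 0 <= ln 2 :> R by rewrite ln_ge0 // ler1n.
have lnle (a : R) : 0 < a -> ln a <= a :> R.
 by move=> a0; have := expR_ge1Dx (ln a); rewrite lnK ?posrE //; clr; lra.
have zeta_le : zeta <= 2 * monb * pw n vs.
 have v1 := pw_ge1 n vs0; rewrite /zeta -natr1; have : x%:R + 1 <= 2 * pw n vs by lra_from hx, v1.
 by move=> /(ler_wpM2l (le_trans ler01 m1)); clr; lra.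
have At : A%:R * t%:R <= 2 * pw n (al + ta).
 by rewrite pwD; have := ler_pM (ler0n _ A) (ler0n _ t) hA t2; clr; lra.
have St : S%:R * t%:R <= 2 * pw n (1 + al).
 have h1 := ler_pM (ler0n _ S) (ler0n _ t) S2 t2; have h2 : pw n (om + ka) * pw n ta <= pw n (1 + al).
  by rewrite -pwD; apply: ler_pw; lra_from om1.
 by lra_from h1, h2.
have DR : D%:R <= 3 * pw n (1 + al).
 by rewrite /D natrD !natrM pwD pn; have := ler_wpM2l (ler0n R n) hA; move: St; rewrite pwD pn; clr; lra.
have Mle : (size idx)%:R <= 3 * pw n (al + ta).
 have h1 : 1 <= pw n (al + ta) by apply: pw_ge1; lra_from al0, ta0.
 suff : (size [seq (p, j) | p <- E n, j <- iota 0 t])%:R <= A%:R * t%:R :> R.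
  by rewrite [size idx]/= -natr1; lra_from h1, At.
 rewrite size_allpairs size_iota -natrM ler_nat leq_mul2r; apply/orP; right.
 rewrite -[leqRHS](size_iota 1); apply: uniq_leq_size uE _.
 by move=> p /EP [pp pA]; rewrite mem_iota pp add1n ltnS.
have Mpos : (0 < size idx)%N by [].
have h0 : 0 <= h.
 by rewrite /h !addr_ge0 ?mulr_ge0 // ln_ge0 // ler1n.
have hle : h <= 4 * pw n be.
 have h1 : pw n 1 <= pw n be by apply: ler_pw; lra_from al0, b1.
 have h2 : ln n.+1%:R <= n%:R + 1 :> R by rewrite natr1; apply: lnle; rewrite ltr0n.
 have h3 : 1 <= n%:R :> R by rewrite ler1n.
 by have h4 := ler_wpM2l (ler0n R n) l2; rewrite /h; move: h1 h2 h3 h4; rewrite pn; clr; lra.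
have small_ln (e X : R) : X <= pw n e -> e = 3 + 2 * al + ta -> ln X <= pw n ka.
 move=> hX ee; rewrite -[ln X]mul1r; move: X hX; rewrite ee; near: n; exact: near_ln_pw.
have p12 : 12 <= pw n 1 :> R by near: n; apply: near_pw_ge.
have lnU : ln (D * size idx).+1%:R <= pw n ka.
 apply: (small_ln _ _ _ erefl); rewrite -natr1 natrM.
 have h1 := ler_pM (ler0n _ D) (ler0n _ (size idx)) DR Mle.
 have -> : 3 + 2 * al + ta = (1 + al) + (al + ta) + 1 + 1 by ring.
 rewrite !(pwD _ (_ + _ : R)) in h1 *.
 have h2 : 1 <= pw n (1 + al + (al + ta)) by apply: pw_ge1; lra_from al0, ta0.
 rewrite !pwD in h1 h2 *; set X : R := D%:R * (size idx)%:R in h1 *.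
 move: h1 h2 p12; move: X (pw n 1) (pw n al) (pw n ta) => X u v w h1 h2 p12.
 have : X <= 9 * (u * v * (v * w)) by apply: le_trans h1 _; apply: eq_le_ref; ring.
 move: h2 p12; move: (u * v * (v * w)) => y h2 p12 h3.
 have y0 : 0 <= y := le_trans ler01 h2.
 have h4 := ler_wpM2l y0 p12; have h5 : 0 <= y * u by apply: le_trans h4; rewrite mulr_ge0.
 have h6 := ler_wpM2l h5 p12; lra_from h2, h3, h4, h6.
have lnD : ln (2 * D%:R) <= pw n ka.
 apply: (small_ln _ _ _ erefl).
 have h1 : pw n (1 + al) * pw n 1 <= pw n (3 + 2 * al + ta) by rewrite -pwD; apply: ler_pw; lra_from al0, ta0.
 by have := ler_wpM2l (pge (1 + al)) p12; generalize DR, h1, (pge (1 + al)); clr; lra.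
pose b := (n * A)%:R * ln 2 + ln (size idx)%:R + (size idx)%:R * ln (D * size idx).+1%:R + 4 * pw n be.
have ble : b <= 12 * pw n be.
 have q1 : (n * A)%:R * ln 2 <= pw n be.
  apply: le_trans (ler_pw n b1); rewrite natrM pwD pn.
  by apply: le_trans (ler_wpM2l _ l2) _; rewrite ?mulr_ge0 // mulr1 ler_wpM2l.
 have q2 : ln (size idx)%:R <= 3 * pw n be.
  apply: le_trans (lnle _ _) _; first by rewrite ltr0n.
  by have : pw n (al + ta) <= pw n be by [apply: ler_pw; lra_from b2, k0]; lra_from Mle.
 have q3 : (size idx)%:R * ln (D * size idx).+1%:R <= 3 * pw n be.
  apply: le_trans (ler_pM (ler0n _ _) _ Mle lnU) _; first by rewrite ln_ge0 // ler1n.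
  rewrite -mulrA -pwD; have : pw n (al + ta + ka) <= pw n be by apply: ler_pw.
  by clr; lra.
 by rewrite /b; generalize q1, q2, q3, (pge be); clr; lra.
have z0 : 0 <= zeta by rewrite /zeta mulr_ge0 // (le_trans ler01).
have jets i l k : i \in idx -> (l < S)%N -> (k < t)%N ->
  cab ((polyC (F i))^`N(k)).[mon (Z l)] <= expR (- (pw n nu - t%:R * ln 16 - A%:R * t%:R * zeta)).
 move=> hi lS kt; have [i0|[-> pE jt]] := idxP i hi.
  rewrite i0 /F /=; apply: le_trans (jH _ _ (hZ l ^~ lS) kt) _; rewrite ler_expR lerN2.
  have q1 : 0 <= t%:R * ln 16 :> R by rewrite mulr_ge0 // ln_ge0 // ler1n.
  have q2 : 0 <= A%:R * t%:R * zeta := mulr_ge0 (mulr_ge0 (ler0n _ A) (ler0n _ t)) z0.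
  by lra_from q1, q2.
 have [pp pA] := EP _ pE.
 rewrite map_comp_poly /= map_polyXn -nderivn_map.
 apply: le_trans (@jet_comp_Xn R _ _ _ _ _ _ (expR (- pw n nu)) jt kt _) _.
  move=> j jk; rewrite monX nderivn_map; apply: jP.
   move=> k'; rewrite natrM; apply: le_trans (_ : pw n vs * pw n al <= _).
    by apply: ler_pM => //; [apply: le_trans hx; rewrite ler_nat hZ | apply: le_trans hA; rewrite ler_nat].
   by rewrite -pwD; apply: ler_pw; rewrite addrC.
  apply: (@le_lt_trans _ _ (2 * (t.-1)%:R)).
   rewrite -natrM ler_nat; apply: leq_trans jk _; rewrite mul2n -addnn leq_add // -ltnS prednK //.
  rewrite /t /lvt /=; have /andP[h1 _] := truncn_itv (divr_ge0 (pge ta) (ler0n R 3)).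
  by have := pw_gt0 n ta; lra_from h1.
 have -> : expR (- (pw n nu - t%:R * ln 16 - A%:R * t%:R * zeta)) =
   expR (t%:R * ln 16) * expR (A%:R * t%:R * zeta) * expR (- pw n nu) by rewrite -!expRD; congr expR; ring.
 apply: ler_wpM2r; first exact: expR_ge0.
 rewrite expRM_natl lnK ?posrE //; apply: ler_wpM2l; first by rewrite exprn_ge0.
 rewrite -natrM expRM_natl; have hz := cab_mon_le (i := Z l) (fun k' => hZ l k' lS).
 apply: (@le_trans _ _ (expR zeta ^+ (i.1 * t))).
  by rewrite lerXn2r ?nnegrE ?expR_ge0 // addr_ge0 // cab_ge0.
 apply: ler_weXn2l; first by rewrite -[leLHS]expR0 ler_expR.
 by rewrite leq_mul2r pA orbT.
have := @gcd_small R _ idx F B G (p0, 0%N) S t (n * A) D (fun l => mon (Z l)) (4 * pw n be)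
 (pw n nu - t%:R * ln 16 - A%:R * t%:R * zeta) (pw n nu / 2) (pw n (nu - ta - ka)) zeta i0I F0 FB hB.
move=> /(_ _ tpos (leqnn _) _ (mulr_ge0 _ (pge be)) _ z0 _ jets hd)/wrap[].
- move=> i /idxP [->|[-> pE jt]]; first exact: dH.
 have [pp pA] := EP _ pE.
 have [->|Pj0] := eqVneq P^`N(i.2) 0; first by rewrite comp_poly0 size_poly0.
 rewrite size_comp_poly size_polyXn /= leq_mul // (leq_trans _ dP) //.
 by rewrite -!subn1 leq_sub2r // size_nderivn_le.
- by rewrite addn_gt0 D0.
- by [].
- move=> i /idxP [->|[-> pE jt]]; first exact: nH.
 apply: le_trans (_ : expR h <= _); last by rewrite ler_expR.
 rewrite map_comp_poly /= map_polyXn; apply: le_trans (n1_comp_Xn _ _) _.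
 rewrite -nderivn_map; apply: le_trans (n1_nderivn (n := n) _ _) _.
  by rewrite size_polyF; move: dP; case: (size P).
 rewrite /h !expRD expRM_natl lnK ?posrE // -mulrA; apply: ler_wpM2l; first by rewrite exprn_ge0.
 by rewrite lnK ?posrE ?ltr0n.
- by move=> l lS; apply: cab_mon_le => k; apply: hZ.
rewrite -/b => /=; apply.
(* By [f1] to [f4] each loss is at most [n^nu / 32]. With the half granted to [G], more than a
   quarter of [n^nu] remains for the main comparison [f5]. *)
have f1 : 32 * (2 * ln 16) * pw n ta <= pw n nu by near: n; apply: near_pw; lra_from al0, vs0, n1'.
have f2 : 32 * (4 * monb) * pw n (al + ta + vs) <= pw n nu by near: n; apply: near_pw.
have f3 : 32 * (12 * monb) * pw n (1 + al + vs) <= pw n nu by near: n; apply: near_pw.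
have f4 : 64 * pw n (nu - ka) <= pw n nu by near: n; apply: near_pw; lra_from k0.
have f5 : 2000 * pw n (1 + al + be) <= pw n (om - ka + ta + nu) by near: n; apply: near_pw.
have g1 : t%:R * ln 16 <= pw n nu / 32.
 by have : 0 <= ln 16 :> R by [rewrite ln_ge0 // ler1n]; move=> /ler_wpM2r /(_ _ _ t2); lra_from f1.
have g2 : A%:R * t%:R * zeta <= pw n nu / 32.
 have := ler_pM (mulr_ge0 (ler0n _ A) (ler0n _ t)) z0 At zeta_le.
 by move: f2; rewrite !(pwD _ _ vs); clr; lra.
have g3 : 2 * D%:R * zeta <= pw n nu / 32.
 have := ler_pM (ler0n _ D) z0 DR zeta_le.
 by move: f3; rewrite !(pwD _ _ vs); clr; lra.
have g4 : t%:R * pw n (nu - ta - ka) <= pw n nu / 32.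
 have := ler_wpM2r (pge (nu - ta - ka)) t2; rewrite -mulrA -pwD.
 have -> : ta + (nu - ta - ka) = nu - ka by ring.
 by lra_from f4.
have LHS : 2 * D%:R * (b + ln (2 * D%:R)) <= 78 * pw n (1 + al + be).
 have q : b + ln (2 * D%:R) <= 13 * pw n be.
  by have : pw n ka <= pw n be by [apply: ler_pw; lra_from b2, al0, ta0]; lra_from ble, lnD.
 have q0 : 0 <= 2 * D%:R :> R by rewrite mulr_ge0.
 apply: le_trans (ler_wpM2l q0 q) _.
 by rewrite (pwD _ _ be); have := ler_wpM2r (pge be) DR; clr; lra.
have RHS : pw n (om - ka + ta + nu) / 12 <= (S * t)%:R * (pw n nu / 4).
 rewrite natrM !(pwD _ _ nu) (pwD _ _ ta).
 have := ler_pM (pge _) (divr_ge0 (pge ta) (ler0n _ 3)) S1 t1.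
 by move=> /(ler_wpM2r (pge nu)); clr; lra.
have fin : (S * t)%:R * (pw n nu / 4) <= (S * t)%:R *
  (pw n nu - t%:R * ln 16 - A%:R * t%:R * zeta - 2 * D%:R * zeta - pw n nu / 2 - t%:R * pw n (nu - ta - ka)).
 by apply: ler_wpM2l => //; generalize g1, g2, g3, g4, (pge nu); clr; lra.
rewrite -/b; apply: le_lt_trans LHS _; apply: lt_le_trans fin; apply: lt_le_trans RHS.
have := pw_gt0 n (1 + al + be); lra_from f5.
Unshelve. all: by end_near. Qed.

End Level.

(** * Sizes of the factors of the common divisor *)

Section Level.
Variables (R : realType) (m : nat) (xi : 'I_m -> R[i]).
Notation polyC := (map_poly (intr : int -> R[i])).
Notation mz Q := (mah (polyC Q)).
Variables (al vs sg be ta nu ka : R).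

Ltac clr := clear -R m xi al vs sg be ta nu ka.
Notation small_at := (small_at xi sg be ta nu).
Notation lvE := (lvE al ka).
Notation seq_dvd n := (seq_dvd ta (lvE n) n).
Notation lvA := (lvA al).
Notation lvt := (lvt ta).

Lemma ln2_le1 : ln 2 <= 1 :> R.
Proof.
rewrite -[leRHS]expRK ler_ln ?posrE ?expR_gt0 //; have := expR_ge1Dx (1 : R); clr; lra.
Qed.

Lemma lvE_prop n p : p \in lvE n -> [/\ prime p, (p <= lvA n)%N & pw n (al - ka) <= p%:R].
Proof. by rewrite mem_filter mem_primes_upto => /andP[h /andP[]]. Qed.

Lemma factor_deg n (P G : {poly int}) c (s : seq {poly int}) q : P != 0 -> ((size P).-1 <= n)%N ->
 G = c *: \prod_(q <- s) q -> seq_dvd n P G -> (exists p, p \in lvE n) -> q \in s ->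
 ((size q).-1 <= n * lvA n)%N.
Proof.
move=> P0 dP GE dvd [p pE] qs; have [pp pA _] := lvE_prop pE.
have [T] := dvd p 0%N pE isT; rewrite nderivn0 GE (big_rem q) //= => TE.
have PX0 : P \Po 'X^p != 0 by rewrite comp_poly_eq0 // size_polyXn ltnS prime_gt0.
have E : P \Po 'X^p = (c *: \prod_(j <- rem q s) j * T) * q.
 by rewrite TE scalerAr -!mulrA [q * _]mulrC -!mulrA [T * q]mulrC.
have := @degree_dvd_le (c *: \prod_(j <- rem q s) j * T) q; rewrite -E => /(_ PX0) /leq_trans; apply.
by rewrite size_comp_poly size_polyXn /= leq_mul.
Qed.

Lemma lnmz_small n P : small_at n P -> ln (mz P) <= ln n.+1%:R + pw n be.
Proof.
move=> [P0 _ nP _]; rewrite -[pw n be]expRK -lnM ?posrE ?expR_gt0 ?ltr0n //.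
have m0 : 0 < mz P by rewrite mah_gt0 // polyC_neq0.
have e0 : 0 < n.+1%:R * expR (pw n be) by rewrite mulr_gt0 ?expR_gt0.
rewrite ler_ln ?posrE //; exact: le_trans (mah_le_n1 (@polyC_neq0 R _ P0)) nP.
Qed.

(** [power_gcd_bound] with at least about [n^(al-ka)] good primes per factor and [r0] about [n^ka].
    The degree sum is divided by the number of primes; the Mahler sum gains once more the size of
    the primes. *)
Lemma near_factor_bounds : 0 < ka -> 4 * ka < al -> al <= 1 -> 1 <= be ->
 \forall n \near \oo, forall (P G : {poly int}) (c : int) (s : seq {poly int}), small_at n P -> c != 0 ->
 (forall q, q \in s -> irrz q) -> G = c *: \prod_(q <- s) q -> seq_dvd n P G ->
 [/\ \sum_(q <- nontorsion_factors R s) (maxn (lvt n) (count_mem q s))%:R * (size q).-1%:R <= pw n (1 - al + 3 * ka),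
   \sum_(q <- nontorsion_factors R s) (maxn (lvt n) (count_mem q s))%:R * ln (mz q) <= pw n (be - 2 * al + 4 * ka)
  & (\sum_(q <- torsion_factors R s) maxn (lvt n) (count_mem q s) * (size q).-1 <= n)%N].
Proof.
move=> k0 kal al1 be1.
have [K1 [K10 hK1]] := @divisors_pw R (ka / 4) ltac:(rewrite divr_gt0 //).
have [K2 [K20 hK2]] := @divisors_pw R (1 / 2) ltac:(rewrite divr_gt0 //).
near=> n => P G c s sm c0 hs GE dvd; have [P0 dP nP _] := sm.
have pge (a : R) : 0 <= pw n a by exact: pw_ge0.
have tpos : (0 < lvt n)%N by [].
have n0 : (0 < n)%N by near: n; apply: near_ge1.
have pn : pw n 1 = n%:R :> R by apply: pw1.
have hE : pw n (al - ka) <= (size (lvE n))%:R by near: n; apply: near_primes => //; lra_from k0, kal.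
have Eex : exists p, p \in lvE n.
 case: (lvE n) hE => [|p E' _]; last by exists p; rewrite mem_head.
 by rewrite leNgt pw_gt0.
have uE : uniq (lvE n) by rewrite !filter_uniq // iota_uniq.
have aE : all prime (lvE n) by apply/allP => p /lvE_prop [].
have [hA _] := truncn_pw n al; rewrite -/(lvA n) in hA.
have nA : (n * lvA n)%:R <= pw n 2 :> R.
 have -> : 2 = 1 + 1 :> R by [].
 rewrite natrM (pwD n 1 1) pn; apply: ler_wpM2l => //; apply: le_trans hA _.
 by rewrite -pn; apply: ler_pw.
have dq q : q \in s -> (size q).-1%:R <= pw n 2 :> R.
 by move=> qs; apply: le_trans nA; rewrite ler_nat; apply: (factor_deg P0 dP GE dvd).
(* [2^r0] exceeds every fixed power of [n], as [fiber_bound] demands, while [r0] costs only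
   [n^ka]. *)
pose r0 := Num.truncn (pw n ka).
have [r01 r02] : r0%:R <= pw n ka /\ pw n ka < r0.+1%:R := truncn_pw n ka.
rewrite -natr1 in r02.
have l2 := @ln2_ge R; have l21 := ln2_le1.
have lmP : ln (mz P) <= 2 * pw n be.
 apply: le_trans (lnmz_small sm) _.
 have h1 : ln n.+1%:R <= n%:R :> R.
  by have := expR_ge1Dx (ln n.+1%:R : R); rewrite lnK ?posrE // -natr1; clr; lra.
 have h2 : pw n 1 <= pw n be by apply: ler_pw.
 by rewrite pn in h2; lra_from h1, h2.
have lmP0 := lnmz_ge0 R P0.
have pw_r0 : pw n (5 + be) <= 2 ^+ r0.
 have h : (2 * (5 + be)) * ln n%:R <= pw n ka / 2.
  have : (4 * (5 + be)) * ln n%:R <= pw n ka by near: n; apply: near_ln.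
  by clr; lra.
 have h4 : 4 <= pw n ka by near: n; apply: near_pw_ge.
 rewrite -[X in X ^+ _]lnK ?posrE // -expRM_natl /pw ler_expR.
 have h5 : r0%:R * (1 / 2) <= r0%:R * ln 2 :> R by apply: ler_wpM2l.
 by lra_from h, h4, h5, r02.
have cond : 128 * n%:R ^+ 3 * ln (mz P) < 2 ^+ r0 * ln 2.
 have big1000 : 1000 <= pw n 2 :> R by near: n; apply: near_pw_ge.
 have e3 : n%:R ^+ 3 = pw n 3 :> R by rewrite -pn -pwX mulr1.
 have h1 : 128 * n%:R ^+ 3 * ln (mz P) <= 256 * pw n (3 + be).
  by rewrite e3 (pwD n 3 be); have := ler_wpM2l (pge 3) lmP; clr; lra.
 have h2 : 1000 * pw n (3 + be) <= 2 ^+ r0.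
  apply: le_trans pw_r0; have -> : 5 + be = 2 + (3 + be) by ring.
  by rewrite (pwD n 2); apply: ler_wpM2r.
 have h3 : 2 ^+ r0 * (1 / 2) <= 2 ^+ r0 * ln 2 :> R by apply: ler_wpM2l; rewrite ?exprn_ge0.
 apply: (le_lt_trans h1); apply: lt_le_trans h3.
 by move: h2 (pw_gt0 n (3 + be)); move: (2 ^+ r0) (pw n (3 + be)) => X y; clr; lra.
have [B1 B2] := @power_gcd_bound R P G s c (lvE n) (lvt n) r0 n P0 dP c0 hs GE uE aE tpos dvd cond.
(* Bad primes number at most a logarithm plus a divisor count of the degree, hence at most [2 n^ka],
   negligible against [n^(al-ka)]. *)
have half q : q \in nontorsion_factors R s -> (size (lvE n))%:R / 2 <= (size (good_primes (lvE n) q))%:R :> R.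
 rewrite mem_filter mem_undup => /andP[/asboolPn nt qs]; have iq := hs q qs.
 have q0 : q`_0 != 0.
  apply/eqP => q0; apply: nt; exists 0; last by left.
  by rewrite /root horner_coef0 coef_map /= q0.
 pose bad := [seq p <- lvE n | ~~ `[< good_prime q p >]].
 have bc : (size bad <= trunc_log 2 (size q).-1 + size (divisors (size q).-1))%N.
  apply: bad_prime_count => //; first by rewrite filter_uniq.
   by apply/allP => p; rewrite mem_filter => /andP[_ /(allP aE)].
  by move=> p; rewrite mem_filter => /andP[/asboolPn].
 have d0 : (0 < (size q).-1)%N by have := irrz_size_gt1 iq; case: (size q) => [|[]].
 have dR : (size q).-1%:R <= pw n 2 :> R by apply: dq.
 have ld : ln (size q).-1%:R <= 2 * ln n%:R :> R by apply: ln_le_pw; rewrite ?ltr0n.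
 have t1 : (trunc_log 2 (size q).-1)%:R <= pw n ka :> R.
  have h : (trunc_log 2 (size q).-1)%:R * ln 2 <= ln (size q).-1%:R :> R.
   rewrite mulr_natl -lnXn // -natrX ler_ln ?posrE ?ltr0n ?expn_gt0 // ler_nat.
   by apply: trunc_logP.
  have h2 : 4 * ln n%:R <= pw n ka by near: n; apply: near_ln.
  have h3 : (trunc_log 2 (size q).-1)%:R * (1 / 2) <= (trunc_log 2 (size q).-1)%:R * ln 2 :> R by apply: ler_wpM2l.
  by lra_from h, h2, h3, ld.
 have t2 : (size (divisors (size q).-1))%:R <= pw n ka :> R.
  apply: le_trans (hK1 _ d0) _; apply: (@le_trans _ _ (K1 * pw n (ka / 2))).
   apply: ler_wpM2l => //; rewrite /pw ler_expR.
   by have := ler_wpM2l (ltW k0) ld; clr; lra.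
  by near: n; apply: near_pw; lra_from k0.
 have t3 : 4 * pw n ka <= pw n (al - ka) by near: n; apply: near_pw; lra_from kal, k0.
 have e : (size (lvE n))%:R = (size (good_primes (lvE n) q))%:R + (size bad)%:R :> R.
  by rewrite -natrD -(count_predC (fun p => `[< good_prime q p >]) (lvE n)) -!size_filter.
 have : (size bad)%:R <= (trunc_log 2 (size q).-1)%:R + (size (divisors (size q).-1))%:R :> R.
  by rewrite -natrD ler_nat.
 by lra_from t1, t2, t3, e, hE.
have Epos : 0 < (size (lvE n))%:R :> R by apply: lt_le_trans hE; exact: pw_gt0.
have ne0 : pw n (al - ka) != 0 by rewrite gt_eqF // pw_gt0.
split.
- set X := \sum_(q <- _) _.
 have h : pw n (al - ka) / 2 * X <= pw n ka * n%:R.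
  apply: (@le_trans _ _ (r0%:R * (size P).-1%:R)); last by apply: ler_pM => //; rewrite ler_nat.
  apply: le_trans B1; rewrite /X mulr_sumr big_seq [leRHS]big_seq; apply: ler_sum => q hq.
  rewrite big_const_seq count_predT iter_addr_0 -[leRHS]mulr_natl.
  apply: ler_wpM2r; first by rewrite mulr_ge0.
  by apply: le_trans (half q hq); lra_from hE.
 have h2 : 2 * pw n (1 - al + 2 * ka) <= pw n (1 - al + 3 * ka).
  by near: n; apply: near_pw; lra_from k0.
 apply: le_trans h2; rewrite -(ler_pM2l (pw_gt0 n (al - ka))) mulrCA -pwD.
 have -> : al - ka + (1 - al + 2 * ka) = ka + 1 by ring.
 by rewrite (pwD n ka 1) pn; lra_from h.
- set X := \sum_(q <- _) _.
 have h : pw n (al - ka) / 2 * (pw n (al - ka) * X) <= pw n ka * (2 * pw n be).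
  apply: (@le_trans _ _ (r0%:R * ln (mz P))); last by apply: ler_pM.
  apply: le_trans B2; rewrite /X mulr_sumr mulr_sumr big_seq [leRHS]big_seq; apply: ler_sum => q hq.
  have lq : 0 <= ln (mz q).
   by move: hq; rewrite mem_filter mem_undup => /andP[_ /hs /irrz_neq0]; apply: lnmz_ge0.
  set M : R := (maxn _ _)%:R; have M0 : 0 <= M by [].
  apply: (@le_trans _ _ (\sum_(p <- good_primes (lvE n) q) pw n (al - ka) * (M * ln (mz q)))).
   rewrite big_const_seq count_predT iter_addr_0 -[leRHS]mulr_natl.
   apply: ler_wpM2r; first by rewrite !mulr_ge0.
   by apply: le_trans (half q hq); lra_from hE.
  rewrite big_seq [leRHS]big_seq; apply: ler_sum => p; rewrite mem_filter => /andP[_ /lvE_prop [_ _ hp]].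
  by rewrite mulrCA; apply: ler_wpM2l => //; apply: ler_wpM2r.
 have h2 : 4 * pw n (be - 2 * al + 3 * ka) <= pw n (be - 2 * al + 4 * ka).
  by near: n; apply: near_pw; lra_from k0.
 apply: le_trans h2; rewrite -(ler_pM2l (pw_gt0 n (al - ka))) -(ler_pM2l (pw_gt0 n (al - ka))).
 rewrite [X in _ <= _ * X]mulrCA -pwD [leRHS]mulrCA -pwD.
 have -> : al - ka + (al - ka + (be - 2 * al + 3 * ka)) = ka + be by ring.
 by rewrite (pwD n ka be); lra_from h.
apply: leq_trans dP; apply: (@torsion_mult_bound R P G s c (lvE n) (lvt n) P0 c0 hs GE uE aE tpos dvd).
(* The totient of the order [k] is a degree and so at most [n^2]. Since [k] is at most its totient
   times its number of divisors, [k] is polynomially bounded, hence below [2^(size E)]. *)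
move=> q x k qs rx pk; have iq := hs q qs; have [dt _ _] := torsion_irrz iq rx pk.
have kk := prim_order_gt0 pk.
rewrite -(ltr_nat R) natrX.
have h1 : k%:R <= pw n 2 * (K2 * pw k (1 / 2)) :> R.
 apply: (@le_trans _ _ ((totient k)%:R * (size (divisors k))%:R)).
  by rewrite -natrM ler_nat le_totient_divisors.
 by apply: ler_pM => //; [rewrite -dt dq | apply: hK2].
have pk2 : k%:R = pw k (1 / 2) * pw k (1 / 2) :> R.
 by rewrite -pwD (_ : 1 / 2 + 1 / 2 = 1 :> R) ?pw1 //; clr; lra.
have h2 : pw k (1 / 2) <= pw n 2 * K2.
 by rewrite -(ler_pM2r (pw_gt0 k (1 / 2))) -pk2 -mulrA.
have h3 : k%:R <= (K2 ^+ 2) * pw n 4 :> R.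
 rewrite pk2; apply: le_trans (ler_pM (pw_ge0 _ _) (pw_ge0 _ _) h2 h2) _.
 rewrite (_ : 4 = 2 + 2 :> R); last by rewrite -natrD.
 by rewrite (pwD n 2 2); apply: eq_le_ref; ring.
apply: le_lt_trans h3 _.
have h4 : (K2 ^+ 2 + 1) * pw n 4 <= pw n 5 by near: n; apply: near_pw; rewrite ltr_nat.
have h5 : pw n 5 <= 2 ^+ size (lvE n) :> R.
 rewrite -[X in X ^+ _]lnK ?posrE // -expRM_natl /pw ler_expR.
 have h6 : 10 * ln n%:R <= pw n (al - ka) by near: n; apply: near_ln; lra_from kal, k0.
 have h7 : (size (lvE n))%:R * (1 / 2) <= (size (lvE n))%:R * ln 2 :> R by apply: ler_wpM2l => //; apply: ltW.
 by lra_from h6, h7, hE.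
apply: lt_le_trans h5; apply: lt_le_trans h4.
by rewrite mulrDl mul1r ltrDl pw_gt0.
Unshelve. all: by end_near. Qed.

End Level.

(** * Numbers close to roots of unity *)

Section NearOne.
Variable R : realType.
Implicit Types (u v z w : R[i]) (e : R).

Lemma cab_ge z e : cab (z - 1) <= e -> 1 - e <= cab z.
Proof.
move=> h; have := cabD (1 - z) z; rewrite subrK cab1 cab_distC; lra.
Qed.

Lemma near1_bigprod (I : eqType) (r : seq I) (F : I -> R[i]) e : 0 <= e ->
 (forall i, i \in r -> cab (F i - 1) <= e) -> 2 * (size r)%:R * e <= 1 ->
 cab (\prod_(i <- r) F i - 1) <= 2 * (size r)%:R * e.
Proof.
move=> e0; elim: r => [|a r IH] h hs; first by rewrite big_nil subrr cab0 mulr0 mul0r.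
have E1 : (size r).+1%:R = (size r)%:R + 1 :> R by rewrite natr1.
rewrite big_cons /= E1 in hs *.
have k0 : 0 <= (size r)%:R :> R by [].
have {}IH := IH (fun i ir => h i (mem_behead (s := a :: r) ir)).
have ha := h a (mem_head _ _).
set p := \prod_(i <- r) F i in IH *.
have -> : F a * p - 1 = (F a - 1) * (p - 1) + (F a - 1) + (p - 1) by ring.
apply: le_trans (cabD _ _) _; apply: le_trans (lerD (cabD _ _) (lexx _)) _; rewrite cabM.
have hp : cab (p - 1) <= 2 * (size r)%:R * e by apply: IH; move: hs k0 e0; clear; move: (size r)%:R => s; nra.
have := ler_pM (cab_ge0 _) (cab_ge0 _) ha hp; have := cab_ge0 (p - 1); move: ha hp hs k0 e0.
by move: (cab (F a - 1)) (cab (p - 1)) (size r)%:R; clear; intros; nra.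
Qed.

Lemma near1X u e N : 0 <= e -> cab (u - 1) <= e -> 2 * N%:R * e <= 1 ->
 cab (u ^+ N - 1) <= 2 * N%:R * e.
Proof.
move=> e0 h hN; have := @near1_bigprod _ (nseq N tt) (fun=> u) e e0 (fun _ _ => h).
by rewrite size_nseq big_const_seq count_predT size_nseq iter_mulr_1; apply.
Qed.

Lemma near1_div u v e : cab (u - 1) <= e -> cab (v - 1) <= e -> e <= 1 / 2 ->
 cab (u / v - 1) <= 4 * e.
Proof.
move=> hu hv he; have hv2 := cab_ge hv.
have v0 : v != 0 by rewrite -cab_gt0; lra.
have -> : u / v - 1 = ((u - 1) - (v - 1)) / v by rewrite mulrBl !mulrBl divff //; ring.
rewrite cabM cabV ler_pdivrMr ?cab_gt0 //; have := cabB (u - 1) (v - 1).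
by have : 0 <= e := le_trans (cab_ge0 _) hu; move: hu hv he hv2; move: (cab _) (cab _) (cab v) (cab _); clear; intros; nra.
Qed.

Lemma log_deriv (s : seq R[i]) z : (forall r, r \in s -> z != r) ->
 let p := \prod_(r <- s) ('X - r%:P) in p^`().[z] / p.[z] = \sum_(r <- s) (z - r)^-1.
Proof.
move=> hs /=; elim: s hs => [|a s IH] hs; first by rewrite !big_nil derivC horner0 mul0r.
rewrite !big_cons derivM !hornerE derivB derivX derivC subr0 !hornerE.
have {}IH := IH (fun i ir => hs i (mem_behead (s := a :: s) ir)).
set p := \prod_(j <- s) _ in IH *.
have p0 : p.[z] != 0.
 rewrite /p horner_prod prodf_seq_neq0; apply/allP => r rs /=.
 by rewrite !hornerE subr_eq0 hs // inE rs orbT.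
have a0 : z - a != 0 by rewrite subr_eq0 hs // mem_head.
rewrite -IH; field; by rewrite a0 p0.
Qed.

(** The logarithmic derivative is the sum of [1 / (z - r)]; if all roots were farther away, this sum
    would be too small. *)
Lemma near_root c (s : seq R[i]) z : (0 < size s)%N -> c != 0 ->
 let p := c *: \prod_(r <- s) ('X - r%:P) in
 exists2 r, r \in s & cab (z - r) * cab p^`().[z] <= (size s)%:R * cab p.[z].
Proof.
move=> s0 c0 /=; set p0 := \prod_(r <- s) _.
suff [r rs h] : exists2 r, r \in s & cab (z - r) * cab p0^`().[z] <= (size s)%:R * cab p0.[z].
 exists r => //; rewrite derivZ !hornerZ !cabM mulrCA [leRHS]mulrCA.
 by apply: ler_wpM2l; rewrite ?cab_ge0.
have [/hasP [r rs /eqP <-]|/hasPn hz] := boolP (has (eq_op^~ z) s).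
 by exists r => //; rewrite subrr cab0 mul0r mulr_ge0 ?cab_ge0.
have hz' r : r \in s -> z != r by move=> /hz; rewrite eq_sym.
have := log_deriv hz'; rewrite /= -/p0 => ld.
have pz : p0.[z] != 0.
 rewrite /p0 horner_prod prodf_seq_neq0; apply/allP => r rs /=.
 by rewrite !hornerE subr_eq0 hz'.
apply: contrapT => hn.
have hr r : r \in s -> (size s)%:R * cab p0.[z] < cab (z - r) * cab p0^`().[z].
 by move=> rs; rewrite ltNge; apply/negP => le; apply: hn; exists r.
have p1 : 0 < cab p0^`().[z].
 rewrite lt_def cab_ge0 andbT; apply/eqP => e0.
 case: (s) s0 hr => // a ? _ /(_ a (mem_head _ _)); rewrite e0 mulr0 ltNge.
 by rewrite mulr_ge0 // cab_ge0.
have P0 : 0 < cab p0.[z] by rewrite cab_gt0.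
have S0 : 0 < (size s)%:R :> R by rewrite ltr0n.
suff : cab p0^`().[z] / cab p0.[z] < \sum_(r <- s) cab p0^`().[z] / ((size s)%:R * cab p0.[z]).
 rewrite big_const_seq count_predT iter_addr_0 -[X in _ < X]mulr_natl.
 suff -> : (size s)%:R * (cab p0^`().[z] / ((size s)%:R * cab p0.[z])) = cab p0^`().[z] / cab p0.[z] by rewrite ltxx.
 by field; rewrite !gt_eqF.
rewrite -cabV -cabM ld; apply: le_lt_trans (cab_sum _ _ _) _.
have : s != [::] by case: (s) s0.
have : forall r, r \in s -> cab (z - r)^-1 < cab p0^`().[z] / ((size s)%:R * cab p0.[z]).
 move=> r rs; have zr : 0 < cab (z - r) by rewrite cab_gt0 subr_eq0 hz'.
 by rewrite cabV -[ltLHS]mul1r ltr_pdivrMr // mulrAC ltr_pdivlMr ?mulr_gt0 // mul1r [ltRHS]mulrC; exact: hr.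
move: (_ / _) => b; clear; case: s => // a s h _; rewrite !big_cons; apply: ltr_leD; first by apply: h; rewrite mem_head.
rewrite big_seq [leRHS]big_seq; apply: ler_sum => r rs; apply/ltW/h; by rewrite inE rs orbT.
Qed.

(** [near_root] for [X^k - 1]: the factor [k] of the derivative cancels the number of roots, so the
    estimate does not depend on [k]. *)
Lemma root_unity_near z k e : (0 < k)%N -> cab (z ^+ k - 1) <= e -> e <= 1 / 2 ->
 exists w, w ^+ k = 1 /\ cab (z / w - 1) <= 3 * e.
Proof.
move=> k0 hz he; have [v pv] := @primitive_root_exists (R[i]) k k0.
have := @Xn_sub_exp _ k 1 v k0 pv; rewrite expr1n => E.
have := @near_root 1 [seq v ^+ j * 1 | j <- index_iota 0 k] z.
rewrite scale1r big_map -E size_map size_iota subn0 => /(_ k0 (oner_neq0 _)) [w /mapP [j _ ->]].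
rewrite mulr1 derivB derivXn derivC subr0 !hornerE; set w' := v ^+ j => hw.
have w1 : w' ^+ k = 1 by rewrite /w' exprAC (prim_expr_order pv) expr1n.
exists w'; split=> //.
have cw : cab w' = 1 := cab_root1 k0 w1.
have w0 : w' != 0 by rewrite -cab_gt0 cw.
have -> : z / w' - 1 = (z - w') / w' by rewrite mulrBl divff.
rewrite cabM cabV cw invr1 mulr1.
rewrite hornerMn hornerXn -mulr_natl cabM cab_nat mulrCA ler_pM2l ?ltr0n // in hw.
have := cab_ge hz => zk; rewrite cabX in zk.
have z0 : 0 < cab z.
 rewrite lt_def cab_ge0 andbT; apply/eqP => z0; move: zk; rewrite z0 expr0n gtn_eqF //=; lra.
have zle : cab z <= 3 / 2.
 have [z1|z1] := lerP (cab z) 1; first by lra.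
 have h1 : cab z <= cab z ^+ k by rewrite -[leLHS]expr1 ler_eXn2l.
 have : cab z ^+ k <= 1 + e by have := cabD (z ^+ k - 1) 1; rewrite subrK cab1 cabX; lra.
 by lra.
have h2 : cab (z - w') * cab z ^+ k <= cab (z ^+ k - 1) * cab z.
 by rewrite -(prednK k0) exprSr mulrA (prednK k0) -cabX; apply: ler_wpM2r => //; exact: ltW.
have e0 : 0 <= e := le_trans (cab_ge0 _) hz.
have h3 : cab (z ^+ k - 1) * cab z <= e * (3 / 2) by apply: ler_pM; rewrite ?cab_ge0.
have h4 : cab (z - w') * (1 / 2) <= cab (z - w') * cab z ^+ k by apply: ler_wpM2l; [exact: cab_ge0 | lra].
lra.
Qed.

(** If [z] is not 1, the sum of [z^j] over [j < K] vanishes, although every term is closer to 1 than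
    distance 1. *)
Lemma sep_unity z K : (0 < K)%N -> z ^+ K = 1 -> K%:R * cab (z - 1) < 1 -> z = 1.
Proof.
move=> K0 zK h; apply/eqP; rewrite -subr_eq0; apply/negPn/negP => z1.
have : \sum_(j < K) z ^+ j = 0.
 by apply: (mulfI z1); rewrite mulr0 -subrX1 zK subrr.
have cz := cab_root1 K0 zK.
have hj j : cab (z ^+ j - 1) <= j%:R * cab (z - 1).
 elim: j => [|j IH]; first by rewrite expr0 subrr cab0 mul0r.
 have -> : z ^+ j.+1 - 1 = z * (z ^+ j - 1) + (z - 1) by rewrite exprS; ring.
 by apply: le_trans (cabD _ _) _; rewrite cabM cz -natr1; lra.
move=> s0; have : cab (\sum_(j < K) (1 - z ^+ j)) = K%:R.
 by rewrite sumrB s0 subr0 sumr_const card_ord cab_nat.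
have : cab (\sum_(j < K) (1 - z ^+ j)) < K%:R.
 apply: le_lt_trans (cab_sum _ _ _) _.
 apply: (@le_lt_trans _ _ (\sum_(j < K) K%:R * cab (z - 1))).
  apply: ler_sum => j _; rewrite cab_distC; apply: le_trans (hj j) _.
  by apply: ler_wpM2r; rewrite ?cab_ge0 // ler_nat ltnW.
 by rewrite sumr_const card_ord -[ltLHS]mulr_natr -[ltRHS]mul1r ltr_pM2r // ltr0n.
by move=> + E; rewrite E ltxx.
Qed.

End NearOne.

(** * Pigeonhole arguments in the grid *)

(** Cut each line in direction [j] into intervals of length [L]; a set larger than the number of
    intervals has two points in one of them. *)
Lemma axis_pair m N (B : {set {ffun 'I_m -> 'I_N}}) (j : 'I_m) L :
 (0 < L)%N -> ((N %/ L).+1 * N ^ m.-1 < #|B|)%N ->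
 exists i i', [/\ i \in B, i' \in B, (i j < i' j)%N, (i' j - i j <= L)%N & forall k, k != j -> i k = i' k].
Proof.
case: m B j => [? []//|m] B j L0 hB.
pose f (i : {ffun 'I_m.+1 -> 'I_N}) := (inord (i j %/ L) : 'I_(N %/ L).+1, [ffun k => i (lift j k)]).
have [/injectiveP inj|/injectivePn] := boolP (injectiveb (fun i : {i | i \in B} => f (val i))).
 have := leq_card _ inj; rewrite card_prod card_ffun !card_ord card_sig => h.
 by move: hB; rewrite ltnNge /= h.
case=> i [i' ne [e1 e2]].
have div_eq : (val i j %/ L = val i' j %/ L)%N.
 move/(congr1 (@nat_of_ord _)): e1; rewrite !inordK //.
  by rewrite ltnS leq_div2r // ltnW.
 by rewrite ltnS leq_div2r // ltnW.
have off k : k != j -> val i k = val i' k.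
 move=> kj; have [k' ->|] := unliftP j k; last by move=> e; rewrite e eqxx in kj.
 by move/ffunP: e2 => /(_ k'); rewrite !ffunE.
have nej : (val i j : nat) != val i' j.
 apply: contra_neq ne => e; apply/val_inj/ffunP => k.
 by have [->|/off //] := eqVneq k j; apply: val_inj.
have dist (a b : nat) : (a %/ L = b %/ L -> a < b -> b - a <= L)%N.
 by move=> e _; rewrite (divn_eq a L) (divn_eq b L) e subnDl (leq_trans (leq_subr _ _)) // ltnW // ltn_pmod.
by case: (ltngtP (val i j) (val i' j)) nej => // lt _; [exists (val i), (val i') | exists (val i'), (val i)];
 split=> //; rewrite ?(valP i) ?(valP i') //; [apply: dist | apply: dist | move=> k /off ->].
Qed.

Lemma pigeonhole_seq (T : finType) (B : {set T}) (f : T -> nat) (l : seq nat) :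
 (forall i, i \in B -> f i \in l) -> (0 < #|B|)%N ->
 exists q, (#|B| <= size l * #|[set i in B | f i == q]|)%N.
Proof.
move=> hf B0; apply: contrapT => hn.
have h q : (size l * #|[set i in B | f i == q]| < #|B|)%N by rewrite ltnNge; apply/negP => le; apply: hn; exists q.
have : (#|B| <= \sum_(q <- l) #|[set i in B | f i == q]|)%N.
 move: hf B0; clear h hn; elim: l B => [|a l IH] B hf B0.
  by move: B0; rewrite lt0n; apply: contraNT => _; apply/eqP/eq_card0 => i; apply/negP => /hf.
 rewrite big_cons -(cardsID [set i | f i == a] B) leq_add //.
  by rewrite subset_leq_card //; apply/fintype.subsetP => i; rewrite !inE.
 have [->//|D0] := posnP #|B :\: [set i | f i == a]|.
 apply: leq_trans (IH _ _ D0) _.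
  by move=> i; rewrite !inE => /andP[/negPf ne /hf]; rewrite inE ne.
 apply: leq_sum => q _; rewrite subset_leq_card //; apply/fintype.subsetP => i.
 by rewrite !inE => /andP[/andP[_ ->] ->].
have [/size0nil l0|sl] := posnP (size l); first by rewrite l0 big_nil leqNgt B0.
move=> le; have := leq_mul (leqnn (size l)) le; rewrite big_distrr /= => le2.
have : (\sum_(q <- l) size l * #|[set i in B | f i == q]| <= \sum_(q <- l) #|B|.-1)%N.
 by apply: leq_sum => q _; have := h q; lia.
rewrite big_const_seq count_predT iter_addn_0 => le3.
by have := leq_trans le2 le3; rewrite mulnC leq_pmul2r // leqNgt ltn_predL B0.
Qed.

(** One constant [T] that dominates every product of [m], [x], [W], [U] by which an error is
    multiplied in [approx_torsion]. *)
Lemma box_const_bounds m x W U (T := (m.+1 * x.+1 * (W * U) ^ 2)%N) : (0 < W)%N -> (0 < U)%N ->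
 [/\ (U <= T)%N, (W * U <= T)%N, (x * (W * U) <= T)%N, (m * x * (W * U) <= T)%N
  & (m * x * (W * U) * U <= T)%N] /\ ((m * x * (W * U) * U * W <= T)%N /\ (U * W <= T)%N).
Proof.
move=> W0 U0; rewrite /T; set p := (m.+1 * x.+1)%N.
have p1 : (0 < p)%N by rewrite muln_gt0.
have pmx : (m * x <= p)%N by rewrite leq_mul.
have px : (x <= p)%N by apply: leq_trans (leqnSn x) _; rewrite leq_pmull.
have wu : (0 < W * U)%N by rewrite muln_gt0 W0.
have e2 : ((W * U) ^ 2 = (W * U) * (W * U))%N by rewrite expnS expn1.
have h1 : (W * U <= (W * U) ^ 2)%N by rewrite e2 leq_pmulr.
have h2 : (W * U * U <= (W * U) ^ 2)%N by rewrite e2 leq_mul2l leq_pmull ?orbT.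
have h3 : (W * U * U * W = (W * U) ^ 2)%N by rewrite e2 -mulnA [(U * W)%N]mulnC.
have h4 : (W * U <= p * (W * U) ^ 2)%N by apply: leq_trans h1 _; rewrite leq_pmull.
have h5 : (U * W <= p * (W * U) ^ 2)%N by rewrite mulnC.
split; [split=> // | split=> //].
- by apply: leq_trans h4; rewrite leq_pmull.
- exact: leq_mul px h1.
- exact: leq_mul pmx h1.
- by rewrite -mulnA; apply: leq_mul pmx h2.
- by rewrite -[(m * x * _ * U)%N]mulnA -[(m * x * _ * W)%N]mulnA h3 leq_mul2r pmx orbT.
Qed.

(** * From many nearly torsion monomials to nearly torsion [xi_j] *)

Section ApproxTorsion.
Variables (R : realType) (m : nat) (xi : 'I_m -> R[i]).
Hypothesis xi0 : forall j, xi j != 0.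

Lemma mon_neq0 i : mon xi i != 0.
Proof. by apply/prodf_neq0 => j _; rewrite expf_neq0. Qed.

Lemma mon_axis (i i' : 'I_m -> nat) j : (i j <= i' j)%N -> (forall k, k != j -> i k = i' k) ->
 mon xi i' = mon xi i * xi j ^+ (i' j - i j).
Proof.
move=> le ne; rewrite /mon (bigD1 j) //= [X in _ = X * _](bigD1 j) //= -[in LHS](subnKC le) exprD -!mulrA [_ * (_ ^+ (_ - _))]mulrC.
by congr (_ * (_ * _)); apply: eq_bigr => k kj; rewrite ne.
Qed.

(** Two rounds are needed. The first, with large exponents, only locates each [xi_j] near a root of
    unity and so attaches an exact root of unity to every grid point. The second groups the points
    by its order [q], a divisor of [k i], and repeats the argument with the short exponent [q]. *)
Lemma approx_torsion (x L U V : nat) (B : {set {ffun 'I_m -> 'I_x.+1}}) (k : {ffun 'I_m -> 'I_x.+1} -> nat)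
  (g : nat -> R) (e0 : R) (z := fun i : {ffun 'I_m -> 'I_x.+1} => mon xi (fun j => i j)) (W := ((L * (U * U)) ^ m)%N) :
 (0 < L)%N -> (0 < V)%N ->
 (forall i, i \in B -> (0 < k i <= U)%N) ->
 (forall i q, i \in B -> (q %| k i)%N -> cab (z i ^+ k i - 1) <= g q) -> 0 <= e0 -> (forall q, (0 < q)%N -> g q <= e0) ->
 4000 * (m.+1 * x.+1 * (W * U) ^ 2)%:R * e0 <= 1 ->
 (forall d, (0 < d <= W)%N -> (size (divisors d) <= V)%N) ->
 (V * ((x.+1 %/ L).+1 * x.+1 ^ m.-1) < #|B|)%N ->
 exists q (kp : 'I_m -> nat), [/\ (0 < q)%N, exists2 i, i \in B & (q %| k i)%N &
  forall j, (0 < kp j <= L)%N /\ cab (xi j ^+ (kp j * q) - 1) <= 24 * q%:R * g q].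
Proof.
move=> L0 V0 kB zB e00 ge0 C dV hB.
have B0 : (0 < #|B|)%N by apply: leq_ltn_trans hB.
have hB1 : ((x.+1 %/ L).+1 * x.+1 ^ m.-1 < #|B|)%N by apply: leq_ltn_trans hB; rewrite leq_pmull.
have U0 : (0 < U)%N by have /card_gt0P [i /kB /andP[h1 h2]] := B0; apply: leq_trans h1 h2.
have W0 : (0 < W)%N by rewrite expn_gt0 !muln_gt0 L0 U0.
have zB0 i : i \in B -> cab (z i ^+ k i - 1) <= e0.
 by move=> iB; apply: le_trans (zB i 1%N iB (dvd1n _)) (ge0 _ _).
have [[c1 c2 c3 c4 c5] [c6 c7]] := box_const_bounds m x W0 U0.
set T := (_ * _ * _)%N in C c1 c2 c3 c4 c5 c6 c7; have T0 : (0 < T)%N := leq_trans U0 c1.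
(* Constants accumulate up to [4 * 2 * 192 = 1536] before an error must stay below 1; this margin
   leaves room. *)
pose d : R := 1 / 4000.
have cle (a : nat) : (a <= T)%N -> a%:R * e0 <= d.
 by move=> aT; apply: (@le_trans _ _ (T%:R * e0)); [apply: ler_wpM2r; rewrite // ler_nat | rewrite /d; lra].
have := cle _ c7; rewrite natrM => {c7}c7.
have := cle _ c6; rewrite !natrM => {c6}c6.
have := cle _ c5; rewrite !natrM => {c5}c5.
have := cle _ c4; rewrite !natrM => {c4}c4.
have := cle _ c3; rewrite !natrM => {c3}c3.
have := cle _ c2; rewrite natrM => {c2}c2.
have {}c1 := cle _ c1.
have c0 : 1%:R * e0 <= d by exact: (cle _ T0).
have d0 : d = 1 / 4000 by [].
move: d d0 {cle} c0 c1 c2 c3 c4 c5 c6 c7 => d d0 c0 c1 c2 c3 c4 c5 c6 c7.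
have UR1 : 1 <= U%:R :> R by rewrite ler1n.
have WR1 : 1 <= W%:R :> R by rewrite ler1n.
have pairs (B' : {set {ffun 'I_m -> 'I_x.+1}}) j : ((x.+1 %/ L).+1 * x.+1 ^ m.-1 < #|B'|)%N ->
  exists i i' kp, [/\ i \in B', i' \in B', (0 < kp <= L)%N & xi j ^+ kp = z i' / z i].
 move=> h; have [i [i' [iB iB' lt le ne]]] := axis_pair j L0 h.
 exists i, i', (i' j - i j)%N; split=> //; first by rewrite subn_gt0 lt.
 rewrite /z (@mon_axis (fun j => i j) (fun j => i' j) j (ltnW lt)) ?[_ * xi j ^+ _]mulrC ?mulfK ?mon_neq0 //.
 by move=> l lj; rewrite ne.
have hU (i : {ffun 'I_m -> 'I_x.+1}) : i \in B -> (k i)%:R <= U%:R :> R by move=> /kB /andP[_]; rewrite ler_nat.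
(* Two points of [B] that differ only in direction [j] have quotient a small power of [xi j];
   raising it to both orders brings it near 1. *)
have coarse1 j : exists Nj, (0 < Nj <= L * (U * U))%N /\ cab (xi j ^+ Nj - 1) <= 8 * U%:R * e0.
 have [i [i' [kp [iB iB' /andP[kp0 kpL] E]]]] := pairs B j hB1.
 have /andP[k0 kU] := kB i iB; have /andP[k0' kU'] := kB i' iB'.
 exists (kp * (k i * k i'))%N; rewrite !muln_gt0 kp0 k0 k0' !leq_mul //; split=> //.
 rewrite exprM E expr_div_n [X in _ / X]exprM [X in X / _]exprM exprAC.
 have := hU i iB; have := hU i' iB'; move=> u' u.
 have h2 (v : R[i]) (n : nat) : cab (v - 1) <= e0 -> n%:R <= U%:R :> R -> cab (v ^+ n - 1) <= 2 * U%:R * e0.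
  move=> hv hn; have nn : 2 * n%:R * e0 <= 2 * U%:R * e0 by rewrite ler_wpM2r // ler_wpM2l.
  by apply: (le_trans _ nn); apply: near1X => //; clear -nn c1 d0; lra.
 have -> : 8 * U%:R * e0 = 4 * (2 * U%:R * e0) :> R by ring.
 apply: near1_div; [| |clear -c1 d0; lra].
  by apply: h2 => //; apply: zB0.
 by apply: h2 => //; apply: zB0.
have [Nj NjP] := boolp.choice coarse1.
pose M0 := (\prod_j Nj j)%N.
have M00 : (0 < M0)%N by rewrite prodn_gt0 // => j; have [/andP[]] := NjP j.
have M0W : (M0 <= W)%N.
 rewrite /W -[in leqRHS](card_ord m) -prod_nat_const; apply: leq_prod => j _; by have [/andP[]] := NjP j.
have M0R : M0%:R <= W%:R :> R by rewrite ler_nat.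
pose e1 := 48 * (W%:R * U%:R * e0).
have e10 : 0 <= e1 by rewrite /e1 !mulr_ge0.
have near_om j : exists w, w ^+ M0 = 1 /\ cab (xi j / w - 1) <= e1.
 have [_ h] := NjP j.
 have e8 : 0 <= 8 * U%:R * e0 by rewrite !mulr_ge0.
 have : cab (xi j ^+ M0 - 1) <= 16 * (W%:R * U%:R * e0).
  have dv : (Nj j %| M0)%N by rewrite /M0 (bigD1 j) //= dvdn_mulr.
  rewrite -(divnK dv) mulnC exprM.
  have qW : (M0 %/ Nj j)%:R <= W%:R :> R by rewrite ler_nat (leq_trans (leq_div _ _)).
  have q2 : 2 * (M0 %/ Nj j)%:R * (8 * U%:R * e0) <= 16 * (W%:R * U%:R * e0).
   have := ler_wpM2r e8 qW; clear; move: (M0 %/ Nj j)%:R => a; lra.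
  by apply: (le_trans _ q2); apply: near1X => //; clear -q2 c2 d0; lra.
 move/(root_unity_near M00) => /(_ _) [|w [w1 w2]]; first by clear -c2 d0; lra.
 by exists w; split=> //; apply: le_trans w2 _; rewrite /e1; clear; lra.
have [om omP] := boolp.choice near_om.
have om0 j : om j != 0 by rewrite -cab_gt0 (cab_root1 M00 (omP j).1).
pose u j := xi j / om j; pose zo (i : {ffun 'I_m -> 'I_x.+1}) := mon om (fun j => i j).
pose mu (i : {ffun 'I_m -> 'I_x.+1}) := mon u (fun j => i j).
have zE i : z i = zo i * mu i.
 by rewrite /z /zo /mu /mon -big_split; apply: eq_bigr => j _ /=; rewrite -exprMn /u mulrC divfK.
have zo0 i : zo i != 0 by apply/prodf_neq0 => j _; rewrite expf_neq0.
have zoM i : zo i ^+ M0 = 1.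
 by rewrite /zo monX /mon big1 // => j _; rewrite mulnC exprM (omP j).1 expr1n.
pose e2 := 192 * (m%:R * x%:R * (W%:R * U%:R) * e0).
have e20 : 0 <= e2 by rewrite /e2 !mulr_ge0.
have mu1 i : cab (mu i - 1) <= e2.
 have s1 : size (index_enum 'I_m) = m by rewrite -[RHS](card_ord m) cardT /= enumT.
 have := @near1_bigprod R _ (index_enum 'I_m) (fun j => u j ^+ i j) (2 * x%:R * e1).
 rewrite s1 => /(_ _ _ _)/wrap[].
 - by rewrite !mulr_ge0.
 - move=> j _; have ix : 2 * (i j)%:R * e1 <= 2 * x%:R * e1.
   by rewrite ler_wpM2r // ler_wpM2l // ler_nat -ltnS.
  apply: (le_trans _ ix); apply: near1X => //; first exact: (omP j).2.
  by move: ix c3 d0; rewrite /e1; clear; lra.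
 - by rewrite /e1; lra_from c4, d0.
 by move=> /le_trans; apply; rewrite /e2 /e1; clear; lra.
(* [zo i ^+ k i] is an [M0]-th root of unity closer to 1 than [1 / M0]. *)
have zok i : i \in B -> zo i ^+ k i = 1.
 move=> iB; apply: (@sep_unity R _ M0) => //; first by rewrite exprAC zoM expr1n.
 have muk : cab (mu i ^+ k i - 1) <= 2 * U%:R * e2.
  have nn : 2 * (k i)%:R * e2 <= 2 * U%:R * e2 by rewrite ler_wpM2r // ler_wpM2l // hU.
  by apply: (le_trans _ nn); apply: near1X => //; move: nn c5 d0; rewrite /e2; clear; lra.
 have mui0 : mu i != 0 by apply/prodf_neq0 => j _; rewrite expf_neq0 // mulf_neq0 ?invr_neq0.
 have -> : zo i ^+ k i = z i ^+ k i / mu i ^+ k i by rewrite zE exprMn mulfK // expf_neq0.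
 have h : cab (z i ^+ k i / mu i ^+ k i - 1) <= 4 * (2 * U%:R * e2 + e0).
  apply: near1_div; last by move: c0 c5 d0; rewrite /e2; clear; lra.
   by apply: le_trans (zB0 i iB) _; rewrite lerDr !mulr_ge0.
  by apply: le_trans muk _; rewrite lerDl.
 apply: le_lt_trans (ler_pM (ler0n _ _) (cab_ge0 _) M0R h) _.
 move: c6 c7 d0 (ler_wpM2r e00 UR1) ; rewrite /e2; clear -W0 e00 U0.
 have := ler_wpM2l (ler0n R W) (ler_wpM2r e00 (_ : 1 <= U%:R)); rewrite ler1n => /(_ U0).
 by move: (m%:R) (x%:R) (W%:R) (U%:R) => a b w u; intros; nra.
have fine i q : i \in B -> (q %| k i)%N -> cab (z i / zo i - 1) <= 3 * g q.
 move=> iB qk; have /andP[k0 kU] := kB i iB.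
 have q0 : (0 < q)%N by rewrite (dvdn_gt0 k0).
 have gd : g q <= 1 / 2 by have := ge0 q q0; lra_from c0, d0.
 have [w [w1 w2]] := root_unity_near k0 (zB i q iB qk) gd.
 have w00 : w != 0 by rewrite -cab_gt0 (cab_root1 k0 w1).
 suff <- : w = zo i by [].
 have : w / zo i = 1.
  apply: (@sep_unity R _ (k i)) => //; first by rewrite expr_div_n w1 zok // divr1.
  have -> : w / zo i = (z i / zo i) / (z i / w).
   by have zi0 : z i != 0 := mon_neq0 _; field; rewrite w00 zo0 zi0.
  have h : cab (z i / zo i / (z i / w) - 1) <= 4 * (e2 + 3 * e0).
   apply: near1_div.
   - by rewrite zE [_ * mu i]mulrC mulfK //; apply: le_trans (mu1 i) _; rewrite lerDl mulr_ge0.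
   - by apply: le_trans w2 _; have := ge0 q q0; lra_from e20.
   by move: c0 c4 d0; rewrite /e2; clear; lra.
  apply: le_lt_trans (ler_pM (ler0n _ _) (cab_ge0 _) (hU i iB) h) _.
  by move: c5 c1 d0; rewrite /e2; clear; lra.
 by move=> h; rewrite -[LHS](divfK (zo0 i)) h mul1r.
(* The exact order divides both [M0] and [k i]. It takes at most [V] values, so that one value still
   leaves enough points for [axis_pair]. *)
have ordk i : exists q, i \in B -> [/\ (q.-primitive_root (zo i))%R, (q %| M0)%N & (q %| k i)%N].
 have [iB|_] := boolP (i \in B); last by exists 0%N.
 have [q pq qM] := prim_order_exists M00 (zoM i); exists q => _; split=> //.
 by rewrite (prim_order_dvd pq) zok.
have [q qP] := boolp.choice ordk.
have [||q0 hq] := @pigeonhole_seq _ B q (divisors M0).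
- by move=> i /qP [_ qM _]; rewrite -dvdn_divisors.
- exact: B0.
pose B' := [set i in B | q i == q0].
have hB' : ((x.+1 %/ L).+1 * x.+1 ^ m.-1 < #|B'|)%N.
 rewrite -(ltn_pmul2l V0); apply: leq_trans hB _; apply: leq_trans hq _.
 by rewrite leq_mul2r dV ?orbT // M00.
have [i1] : exists i, i \in B' by apply/card_gt0P; apply: leq_ltn_trans hB'.
rewrite inE => /andP[i1B /eqP qi1]; have [pr _ qk] := qP i1 i1B; rewrite qi1 in pr qk.
have q00 : (0 < q0)%N := prim_order_gt0 pr.
have fin j : exists kp, (0 < kp <= L)%N /\ cab (xi j ^+ (kp * q0) - 1) <= 24 * q0%:R * g q0.
 have [i [i' [kp [iB iB' kpL E]]]] := pairs B' j hB'; exists kp; split=> //.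
 have zq l : l \in B' -> cab (z l ^+ q0 - 1) <= 6 * q0%:R * g q0.
  rewrite inE => /andP[lB /eqP ql]; have [prl _ qkl] := qP l lB; rewrite ql in prl qkl.
  have -> : z l ^+ q0 = (z l / zo l) ^+ q0 by rewrite expr_div_n (prim_expr_order prl) divr1.
  have g0 : 0 <= g q0 by apply: le_trans (zB l q0 lB qkl); apply: cab_ge0.
  have -> : 6 * q0%:R * g q0 = 2 * q0%:R * (3 * g q0) by ring.
  apply: near1X; [by rewrite mulr_ge0 | exact: fine |].
  have q0U : q0%:R <= U%:R :> R by apply: le_trans (hU l lB); rewrite ler_nat dvdn_leq //; have /andP[] := kB l lB.
  have := ler_pM (ler0n _ q0) g0 q0U (ge0 _ q00); lra_from c1, d0.
 rewrite exprM E expr_div_n.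
 have -> : 24 * q0%:R * g q0 = 4 * (6 * q0%:R * g q0) by ring.
 apply: near1_div; [exact: zq | exact: zq |].
 have q0U : q0%:R <= U%:R :> R by apply: le_trans (hU i1 i1B); rewrite ler_nat dvdn_leq //; have /andP[] := kB i1 i1B.
 have g0 : 0 <= g q0 by apply: le_trans (zB i1 q0 i1B qk); apply: cab_ge0.
 have := ler_pM (ler0n _ q0) g0 q0U (ge0 _ q00); lra_from c1, d0.
have [kp kpP] := boolp.choice fin.
by exists q0, kp; split=> //; exists i1.
Qed.

End ApproxTorsion.

(** * Exponentially small errors and totients *)

Section Asymptotics.
Variable R : realType.
Implicit Types (a b c e : R) (n : nat).

Lemma near_exp c C b : 0 < b -> \forall n \near \oo, C * pw n c * expR (- pw n b) <= 1.
Proof.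
move=> b0; near=> n.
have h1 : (2 * c) * ln n%:R <= pw n b by near: n; apply: near_ln.
have h2 : 2 * C <= pw n b by near: n; apply: near_pw_ge.
have h3 : C <= expR C by have := expR_ge1Dx C; lra.
apply: (@le_trans _ _ (expR C * pw n c * expR (- pw n b))).
 by rewrite ler_wpM2r ?expR_ge0 // ler_wpM2r ?pw_ge0.
by rewrite -!expRD -[leRHS]expR0 ler_expR; clear -h1 h2; lra.
Unshelve. all: by end_near. Qed.

Lemma near_totient ka : 0 < ka -> \forall n \near \oo, forall k, (0 < k)%N -> (totient k <= n)%N ->
 k%:R <= pw n 3 :> R /\ k%:R <= (totient k)%:R * pw n ka :> R.
Proof.
move=> k0.
have [K1 [K10 hK1]] := @divisors_pw R (ka / 6) ltac:(rewrite divr_gt0 //).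
have [K2 [K20 hK2]] := @divisors_pw R (1 / 2) ltac:(rewrite divr_gt0 //).
near=> n => k kk tn.
have n0 : (0 < n)%N by near: n; apply: near_ge1.
have td : k%:R <= (totient k)%:R * (size (divisors k))%:R :> R by rewrite -natrM ler_nat le_totient_divisors.
have pk2 : k%:R = pw k (1 / 2) * pw k (1 / 2) :> R.
 by rewrite -pwD (_ : 1 / 2 + 1 / 2 = 1 :> R) ?pw1 //; clear; lra.
have h2 : pw k (1 / 2) <= n%:R * K2.
 rewrite -(ler_pM2r (pw_gt0 k (1 / 2))) -pk2 -mulrA; apply: le_trans td _.
 by apply: ler_pM => //; [rewrite ler_nat | exact: hK2].
have k3 : k%:R <= pw n 3 :> R.
 apply: (@le_trans _ _ (K2 ^+ 2 * pw n 2)).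
  rewrite pk2; apply: le_trans (ler_pM (pw_ge0 _ _) (pw_ge0 _ _) h2 h2) _.
  rewrite (_ : 2 = 1 + 1 :> R) // (pwD n 1 1) pw1 //; apply: eq_le_ref; ring.
 by near: n; apply: near_pw; rewrite ltr_nat.
split=> //; apply: le_trans td _; apply: ler_wpM2l => //; apply: le_trans (hK1 _ kk) _.
have lk : ln k%:R <= 3 * ln n%:R :> R by apply: ln_le_pw => //; rewrite ltr0n.
have h3 : K1 * pw n (ka / 2) <= pw n ka by near: n; apply: near_pw; clear -k0; lra.
apply: le_trans h3; apply: ler_wpM2l => //; rewrite /pw ler_expR.
by have := ler_wpM2l (ltW k0) lk; clear; lra.
Unshelve. all: by end_near. Qed.

End Asymptotics.

(** * The torsion case at level [n] *)

Section Level.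
Variables (R : realType) (m : nat) (xi : 'I_m -> R[i]).
Variables (vs ta nu ka : R).
Hypothesis xi0 : forall j, xi j != 0.

Ltac clr := clear -R m xi vs ta nu ka.
Notation lvx := (lvx vs).
Notation lvt := (lvt ta).
Notation om := (m%:R * vs).

(** One [M], essentially at most [n^(1-ta)], serves all [xi j], with a precision that grows with
    [M]. For [n > 0] the condition becomes weaker as the slack increases. *)
Definition tors_at ka n := exists M, [/\ (0 < M)%N, M%:R * (lvt n)%:R <= pw n (1 + ka) &
 forall j, cab (xi j ^+ M - 1) <= expR (- (M%:R * pw n (nu - 1 - ka)))].

(** [approx_torsion] with orders up to [n^3], intervals of length about [n^(4 ka)] and at most
    [n^ka] divisors. In the slack, [5 m ka] pays for the product of the [m] interval exponents and
    the rest for the passage from totients to orders. *)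
Lemma near_torsion : (0 < m)%N -> 0 < ka -> ka <= 1 / 4 -> 4 * ka <= vs -> 3 * ka < nu - 1 ->
 \forall n \near \oo, forall (B : {set {ffun 'I_m -> 'I_(lvx n).+1}}) (k : _ -> nat),
 (forall i, i \in B -> [/\ (0 < k i)%N, (totient (k i) * lvt n <= n)%N &
   cab (mon xi (fun j => i j) ^+ k i - 1) <= expR (- ((totient (k i))%:R * pw n (nu - 1) / 32))]) ->
 pw n (om - 2 * ka) <= #|B|%:R -> tors_at ((5 * m%:R + 4) * ka) n.
Proof.
move=> m0 k0 k1 kv knu.
pose c := 11 * m%:R + 1 : R.
have c0 : 0 < c by rewrite /c; have : 0 <= m%:R :> R by []; clr; lra.
have [K1 [K10 hK1]] := @divisors_pw R (ka / (2 * c)) ltac:(rewrite divr_gt0 ?mulr_gt0 //).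
pose b := nu - 1 - 2 * ka.
near=> n => B k kB hB.
have n0 : (0 < n)%N by near: n; apply: near_ge1.
have tot k' : (0 < k')%N -> (totient k' <= n)%N -> k'%:R <= pw n 3 :> R /\ k'%:R <= (totient k')%:R * pw n ka.
 by move: k'; near: n; exact: near_totient.
have tposn : (0 < lvt n)%N by [].
have tn i : i \in B -> (totient (k i) <= n)%N.
 by move=> /kB [_ h _]; apply: leq_trans h; rewrite leq_pmulr.
have p2 : 2 <= pw n ka by near: n; apply: near_pw_ge.
have pge (a : R) : 0 <= pw n a by exact: pw_ge0.
have [hx _] := truncn_pw n vs; rewrite -/(lvx n) in hx.
have [U1 _] := truncn_pw n (3 : R); set U := Num.truncn _ in U1.
have [L1 L2] := truncn_pw n (4 * ka); set L := (Num.truncn (pw n (4 * ka))).+1 in L2.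
have [V1 V2] := truncn_pw n ka; set V := Num.truncn _ in V1 V2.
set x := lvx n in hx *.
have L3 : L%:R <= pw n (5 * ka).
 rewrite /L -natr1 (_ : 5 * ka = 4 * ka + ka); last by ring.
 rewrite (pwD n (4 * ka)); have := @pw_ge1 R n (4 * ka) ltac:(lra_from k0).
 have := ler_wpM2l (pge (4 * ka)) p2; lra_from L1.
have L5 : L%:R <= pw n 5 :> R by apply: le_trans L3 _; apply: ler_pw; lra_from k1.
set W := ((L * (U * U)) ^ m)%N.
have WR : W%:R <= pw n (11 * m%:R) :> R.
 rewrite natrX mulrC pwX; apply: lerXn2r; rewrite ?nnegrE // !natrM.
 rewrite (_ : 11 = 5 + (3 + 3) :> R); last by clr; lra.
 rewrite (pwD n 5 (3 + 3)) (pwD n 3 3); apply: ler_pM => //; first by rewrite mulr_ge0.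
 exact: ler_pM.
pose g q := expR (- (q%:R * pw n b)).
have gE q : (0 < q)%N -> g q <= expR (- pw n b).
 by move=> q0; rewrite /g ler_expR lerN2 -[leLHS]mul1r ler_wpM2r // ler1n.
have h32 : 32 * pw n b <= pw n (nu - 1 - ka) by near: n; apply: near_pw; rewrite /b; lra_from k0.
have gB i q : i \in B -> (q %| k i)%N -> cab (mon xi (fun j => i j) ^+ k i - 1) <= g q.
 move=> iB qk; have [ki _ h] := kB i iB; apply: le_trans h _.
 rewrite ler_expR lerN2; have [_ hk] := tot _ ki (tn i iB).
 have qki : q%:R <= (k i)%:R :> R by rewrite ler_nat dvdn_leq.
 have e : pw n (nu - 1) = pw n ka * pw n (nu - 1 - ka) by rewrite -pwD; congr pw; clr; lra.
 rewrite e; have := ler_wpM2r (pge (nu - 1 - ka)) (le_trans qki hk).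
 by have := ler_wpM2l (ler0n R q) h32; clr; lra.
have e00 : 0 <= expR (- pw n b) by exact: expR_ge0.
have NR : x.+1%:R <= 2 * pw n vs.
 by rewrite -natr1; have := @pw_ge1 R n vs ltac:(lra_from k0, kv); lra_from hx.
have [|||||q [kp [q0 [i iB qi] kpP]]] := @approx_torsion R m xi xi0 x L U V B k g (expR (- pw n b)) isT _ _ gB e00 gE.
- by rewrite /V truncn_gt0 (le_trans _ p2) // ler1n.
- move=> i /[dup] iB /kB [ki _ _]; rewrite ki /=; rewrite truncn_ge_nat ?pw_ge0 //.
 by have [] := tot _ ki (tn i iB).
- rewrite -/W natrM (natrX _ (W * U)) !natrM.
 have hY : W%:R * U%:R <= pw n (c + 2).
  rewrite (_ : c + 2 = 11 * m%:R + 3); last by rewrite /c; clr; lra.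
  by rewrite (pwD n (11 * m%:R)) ler_pM.
 have h2 : 8000 * m.+1%:R * pw n (vs + (c + 2) + (c + 2)) * expR (- pw n b) <= 1.
  by near: n; apply: near_exp; rewrite /b; lra_from knu, k0.
 have h3 := ler_pM (ler0n _ _) (mulr_ge0 (mulr_ge0 (ler0n _ _) (ler0n _ _)) (mulr_ge0 (ler0n _ _) (ler0n _ _)))
  NR (ler_pM (mulr_ge0 (ler0n _ _) (ler0n _ _)) (mulr_ge0 (ler0n _ _) (ler0n _ _)) hY hY).
 rewrite (pwD n (vs + (c + 2))) (pwD n vs (c + 2)) in h2.
 apply: le_trans h2; apply: ler_wpM2r => //; have := ler_wpM2l (ler0n R m.+1) h3.
 by move: (m.+1%:R) (x.+1%:R) (W%:R) (U%:R) (pw n (c + 2)) (pw n vs); clr; intros; lra.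
- move=> d /andP[d0 dW]; rewrite truncn_ge_nat ?pw_ge0 //; apply: le_trans (hK1 _ d0) _.
 have h3 : K1 * pw n (ka / 2) <= pw n ka by near: n; apply: near_pw; lra_from k0.
 apply: le_trans h3; apply: ler_wpM2l => //; rewrite {1}/pw ler_expR.
 have dR : d%:R <= pw n c.
  by apply: le_trans (ler_pw n (_ : 11 * m%:R <= c)); [apply: le_trans WR; rewrite ler_nat | rewrite /c lerDl].
 have ld : ln d%:R <= c * ln n%:R :> R by apply: ln_le_pw => //; rewrite ltr0n.
 apply: le_trans (ler_wpM2l _ ld) _; first by rewrite divr_ge0 ?mulr_ge0 // ltW.
 by rewrite mulrA ler_wpM2r ?ln_nat_ge0 //; apply: eq_le_ref; field; rewrite gt_eqF.
- rewrite -(ltr_nat R) !natrM natrX; apply: lt_le_trans hB.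
 have h1 : (x.+1 %/ L).+1%:R <= 3 * pw n (vs - 4 * ka).
  have h2 : (x.+1 %/ L)%:R * L%:R <= x.+1%:R :> R by rewrite -natrM ler_nat leq_trunc_div.
  have h3 : (x.+1 %/ L)%:R * pw n (4 * ka) <= 2 * pw n vs.
   by apply: le_trans NR; apply: le_trans h2; apply: ler_wpM2l => //; exact: ltW.
  have h4 : (x.+1 %/ L)%:R <= 2 * pw n (vs - 4 * ka).
   rewrite -(ler_pM2r (pw_gt0 n (4 * ka))) -mulrA -pwD subrK //.
  by rewrite -natr1; have := @pw_ge1 R n (vs - 4 * ka) ltac:(lra_from kv); lra_from h4.
 have h2 : x.+1%:R ^+ m.-1 <= 2 ^+ m.-1 * pw n (m.-1%:R * vs).
  by rewrite pwX -exprMn lerXn2r ?nnegrE // mulr_ge0.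
 have h3 : V%:R * ((x.+1 %/ L).+1%:R * x.+1%:R ^+ m.-1) <= 3 * 2 ^+ m.-1 * pw n (om - 3 * ka).
  have -> : om - 3 * ka = ka + (vs - 4 * ka + m.-1%:R * vs).
   rewrite -{1}(prednK m0) -natr1; ring.
  rewrite !(pwD n ka) (pwD n (vs - 4 * ka)).
  have := ler_pM (ler0n _ _) (exprn_ge0 _ (ler0n _ _)) h1 h2.
  by move=> /(ler_pM (ler0n _ _) (mulr_ge0 (ler0n _ _) (exprn_ge0 _ (ler0n _ _))) V1); clr; lra.
 apply: le_lt_trans h3 _.
 have h5 : (3 * 2 ^+ m.-1 + 1) * pw n (om - 3 * ka) <= pw n (om - 2 * ka).
  by near: n; apply: near_pw; lra_from k0.
 by apply: lt_le_trans h5; rewrite [ltRHS]mulrDl mul1r ltrDl pw_gt0.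
set P := (\prod_j kp j)%N.
have kp0 j : (0 < kp j)%N by have [/andP[]] := kpP j.
have PL : P%:R <= pw n (5 * m%:R * ka).
 apply: (@le_trans _ _ (L%:R ^+ m)).
  rewrite -natrX ler_nat -[in leqRHS](card_ord m) -prod_nat_const.
  by apply: leq_prod => j _; have [/andP[]] := kpP j.
 rewrite (_ : 5 * m%:R * ka = m%:R * (5 * ka)); last by ring.
 by rewrite pwX lerXn2r ?nnegrE.
have [ki kt _] := kB i iB; have [hk3 hk] := tot _ ki (tn i iB).
have qki : q%:R <= (k i)%:R :> R by rewrite ler_nat dvdn_leq.
exists (q * P)%N; split.
- by rewrite muln_gt0 q0 prodn_gt0.
- have h1 : (totient (k i))%:R * (lvt n)%:R <= pw n 1 :> R by rewrite pw1 // -natrM ler_nat.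
 have -> : 1 + (5 * m%:R + 4) * ka = (1 + ka) + 5 * m%:R * ka + 3 * ka by ring.
 rewrite natrM !(pwD n (_ + _ : R)) (pwD n 1 ka).
 have h3 : 1 <= pw n (3 * ka) by apply: pw_ge1; lra_from k0.
 have h4 : q%:R * (lvt n)%:R <= pw n 1 * pw n ka.
  have h5 := ler_wpM2r (ler0n _ (lvt n)) (le_trans qki hk).
  by apply: le_trans h5 _; rewrite mulrAC ler_wpM2r.
 have h5 : q%:R * P%:R * (lvt n)%:R <= pw n 1 * pw n ka * pw n (5 * m%:R * ka).
  by rewrite mulrAC ler_pM // mulr_ge0.
 by apply: le_trans h5 _; rewrite ler_peMr // !mulr_ge0.
move=> j; have [_ hj] := kpP j.
set P' := (\prod_(l | l != j) kp l)%N.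
have PE : P = (kp j * P')%N by rewrite /P (bigD1 j).
have P'L : P'%:R <= pw n (5 * m%:R * ka) by apply: le_trans PL; rewrite ler_nat PE leq_pmull.
rewrite PE (_ : q * (kp j * P') = kp j * q * P')%N; last by rewrite mulnA [(q * _)%N]mulnC.
rewrite exprM.
have b0 : 0 < b - ka by rewrite /b; lra_from knu.
have hq : q%:R <= pw n 3 := le_trans qki hk3.
have g0 : 0 <= g q by exact: expR_ge0.
have h0 : 48 * pw n (5 * m%:R * ka + 3) * expR (- pw n (b - ka)) <= 1 by near: n; apply: near_exp; rewrite /b; lra_from knu.
have h1 : 2 * P'%:R * (24 * q%:R * g q) <= 48 * pw n (5 * m%:R * ka + 3) * g q.
 rewrite (pwD n _ 3); have := ler_wpM2r g0 (ler_pM (ler0n _ _) (ler0n _ _) P'L hq); clr; lra.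
have hb : 2 * pw n (b - ka) <= pw n b by near: n; apply: near_pw; lra_from k0.
have q1 : 1 <= q%:R :> R by rewrite ler1n.
have h2 : 48 * pw n (5 * m%:R * ka + 3) * g q <= expR (- (q%:R * pw n (b - ka))).
 have : g q <= expR (- pw n (b - ka)) * expR (- (q%:R * pw n (b - ka))).
  rewrite -expRD ler_expR; have := ler_wpM2l (ler0n R q) hb.
  by have := ler_wpM2r (pge (b - ka)) q1; clr; lra.
 move=> /(ler_wpM2l (mulr_ge0 (ler0n R 48) (pge (5 * m%:R * ka + 3)))) /le_trans; apply.
 by rewrite mulrA -[leRHS]mul1r ler_wpM2r ?expR_ge0.
apply: (le_trans (near1X _ hj _)).
- by rewrite !mulr_ge0.
- apply: le_trans h1 _; apply: le_trans h2 _; rewrite -[leRHS]expR0 ler_expR oppr_le0 mulr_ge0 //.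
apply: le_trans h1 _; apply: le_trans h2 _; rewrite ler_expR lerN2.
have hPY : P%:R * pw n (nu - 1 - (5 * m%:R + 4) * ka) <= pw n (b - ka).
 have -> : b - ka = (5 * m%:R * ka) + (nu - 1 - (5 * m%:R + 4) * ka) + ka by rewrite /b; ring.
 rewrite (pwD n (5 * m%:R * ka + (nu - 1 - (5 * m%:R + 4) * ka)) ka) (pwD n (5 * m%:R * ka)).
 apply: (@le_trans _ _ (pw n (5 * m%:R * ka) * pw n (nu - 1 - (5 * m%:R + 4) * ka))); first by apply: ler_wpM2r.
 by rewrite ler_peMr ?mulr_ge0 // pw_ge1 // ltW.
rewrite (_ : kp j * q * P' = q * P)%N; last by rewrite PE mulnA [(q * _)%N]mulnC.
by rewrite natrM -mulrA ler_wpM2l.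
Unshelve. all: by end_near. Qed.
End Level.

(** * Jets of powers; the factor [X] *)

Section PowerJet.
Variable R : realType.
Notation polyC := (map_poly (intr : int -> R[i])).
Notation mz Q := (mah (polyC Q)).
Implicit Types (z : R[i]) (h f g : {poly R[i]}).

(* Each term of the expansion of (h^N)(X + z) contributing to X^k has more than N - t factors h(z). *)
Lemma power_jet h z N t k (G : R) : (k < t)%N -> (t <= N)%N -> cab h.[z] <= 1 ->
 n1 (h \Po ('X + z%:P)) <= G -> 1 <= G ->
 cab ((h ^+ N)^`N(k)).[z] <= 2 ^+ N * G ^+ t * cab h.[z] ^+ (N - t).
Proof.
move=> kt tN hz hG G1; have G0 := le_trans ler01 G1.
rewrite -coef_shift rmorphXn /=; set f := h \Po _ in hG *.
have c0E : f`_0 = h.[z] by rewrite /f coef_shift nderivn0.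
pose g := drop_poly 1 f.
have fE : f = (h.[z])%:P + g * 'X.
 rewrite -{1}(poly_take_drop 1 f) expr1 -/g; congr (_ + _); apply/polyP => i.
 by rewrite coef_take_poly coefC -c0E; case: i.
have gG : n1 g <= G.
 apply: le_trans hG; rewrite (@n1E _ g (size f)); last first.
  by rewrite size_drop_poly leq_subr.
 rewrite (@n1E _ f (size f).+1) ?leqnSn // big_ord_recl /= addrC ler_wpDr ?cab_ge0 //.
 by apply: ler_sum => i _; rewrite coef_drop_poly addn1.
have -> : 2 ^+ N * G ^+ t * cab h.[z] ^+ (N - t) = \sum_(l < N.+1) 'C(N, l)%:R * (G ^+ t * cab h.[z] ^+ (N - t)).
 rewrite -mulr_suml -mulrA; congr (_ * _); rewrite -[2 in LHS]/(1 + 1) exprDn.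
 by apply: eq_bigr => l _; rewrite !expr1n mulr1.
rewrite {1}fE exprDn coef_sum; apply: le_trans (cab_sum _ _ _) _; apply: ler_sum => l _.
rewrite coefMn -[_ *+ _]mulr_natl cabM cab_nat ler_wpM2l // exprMn mulrA coefMXn.
have [lk|lk] := ltnP k l; first by rewrite cab0 mulr_ge0 ?exprn_ge0 ?cab_ge0.
rewrite -polyC_exp coefCM cabM cabX mulrC.
apply: ler_pM; rewrite ?cab_ge0 ?exprn_ge0 ?cab_ge0 //.
 apply: le_trans (coef_le_n1 _ _) _; apply: le_trans (n1_exp _ _) _.
 apply: (@le_trans _ _ (G ^+ l)); first by rewrite lerXn2r ?nnegrE ?n1_ge0.
 by rewrite ler_weXn2l // (leq_trans lk) // ltnW.
by rewrite ler_wiXn2l ?cab_ge0 // leq_sub2l // (leq_trans lk) // ltnW.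
Qed.

Lemma n1_shift_XnB1 z M : n1 (('X^M - 1 : {poly R[i]}) \Po ('X + z%:P)) <= 2 * (1 + cab z) ^+ M.
Proof.
rewrite comp_polyB comp_Xn_poly comp_polyC; apply: le_trans (n1D _ _) _.
rewrite -scaleN1r n1Z cabN cab1 mul1r n1_1.
have h : n1 (('X + z%:P) ^+ M) <= (1 + cab z) ^+ M.
 apply: le_trans (n1_exp _ _) _; rewrite lerXn2r ?nnegrE ?n1_ge0 ?addr_ge0 ?cab_ge0 //.
 by apply: le_trans (n1D _ _) _; rewrite n1X n1C.
have : 1 <= (1 + cab z) ^+ M by rewrite exprn_ege1 // lerDl cab_ge0.
lra.
Qed.

Lemma wt_scaled_prod z (c : int) (s : seq {poly int}) : c != 0 ->
 (forall q : {poly int}, q \in s -> q != 0 /\ ~~ root (polyC q) z) ->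
 wt z (c *: \prod_(q <- s) q) = \sum_(q <- s) wt z q.
Proof.
move=> c0 hs; rewrite -mul_polyC wtM.
- rewrite wt_prod // /wt map_polyC /= hornerC mahC ?intr_eq0 // size_polyC c0 mul0r addr0 subrr add0r //.
- by rewrite polyC_eq0.
- by rewrite prodf_seq_neq0; apply/allP => q qs /=; rewrite (hs q qs).1.
- by rewrite map_polyC /root hornerC /= intr_eq0.
rewrite rmorph_prod /root horner_prod prodf_seq_neq0; apply/allP => q qs /=.
exact: (hs q qs).2.
Qed.

Lemma irrzX : irrz 'X.
Proof.
split; first by rewrite zcontents_monic ?monicX.
by rewrite map_polyX -[X in irreducible_poly X]subr0; apply: irredp_XsubC.
Qed.

Lemma wtX_le z : z != 0 -> wt z 'X <= ln 2 + ln (1 + cab z) + ln (1 + (cab z)^-1).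
Proof.
move=> z0; have cz : 0 < cab z by rewrite cab_gt0.
rewrite /wt map_polyX hornerX size_polyX mul1r ln2mx1E.
have -> : mah ('X : {poly R[i]}) = 1.
 by rewrite -[X in mah X]subr0 mah_XsubC /mx1 cab0 max_l.
rewrite ln1 add0r; have h1 : ln (mx1 z) <= ln (1 + cab z).
 rewrite ler_ln ?posrE ?mx1_gt0 ?addr_gt0 // /mx1 ge_max lerDl lerDr cab_ge0 ler01 //.
have h2 : - ln (cab z) <= ln (1 + (cab z)^-1).
 by rewrite -lnV ?posrE // ler_ln ?posrE ?addr_gt0 ?invr_gt0 // lerDr.
lra.
Qed.

End PowerJet.

(** * The alternative at one level: torsion or good factors *)

Section Level.
Variables (R : realType) (m : nat) (xi : 'I_m -> R[i]).
Variables (al vs sg be ta nu ka : R).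
Hypothesis xi0 : forall j, xi j != 0.
Notation polyC := (map_poly (intr : int -> R[i])).
Notation mz Q := (mah (polyC Q)).
Notation om := (m%:R * vs).
Notation T n := {ffun 'I_m -> 'I_(lvx vs n).+1}.
Notation zeta i := (mon xi (fun j => nat_of_ord (i j))).
Notation algebraic z := (algebraicOver (ratr : rat -> R[i]) z).

Ltac clr := clear -R m xi al vs sg be ta nu ka.

Lemma ln_cab_mon (xs : 'I_m -> R[i]) i x : (forall k, (i k <= x)%N) ->
 ln (1 + cab (mon xs i)) <= monb xs * x.+1%:R.
Proof.
move=> ix; rewrite -[leRHS]expRK ler_ln ?posrE ?expR_gt0 //; first exact: cab_mon_le.
by rewrite (lt_le_trans ltr01) // lerDl cab_ge0.
Qed.

(** The condition on distances in [near_interp], stated for all finite lists so that it applies to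
    any choice and order of the points. *)
Definition separated n := forall (s : seq (T n)) (i : T n), uniq s -> i \notin s ->
 expR (- pw n (nu - ta - ka)) <= \prod_(i' <- s) cab (zeta i - zeta i').

(** The bounds on degree and Mahler measure are those of [near_factor_bounds] divided by the
    multiplicity [n^ta]. The exponents of the weight are obtained by dividing [n^nu] by the
    undivided bounds. *)
Definition good_factor n z := exists Q : {poly int}, [/\ irrz Q, ~~ root (polyC Q) z,
 (size Q).-1%:R <= pw n (1 - al - ta + 5 * ka), ln (mz Q) <= pw n (be - 2 * al - ta + 5 * ka) &
 (size Q).-1%:R * pw n (nu - 1 + al - 5 * ka) + ln (mz Q) * pw n (nu - be + 2 * al - 5 * ka) <= wt z Q].

(** [H] is [X^M - 1] to the power [e + t]: the [t] extra factors are spent on derivatives, and the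
    others give [exp(- n^(nu+kp) / 2)], far below [exp(- n^nu)]. *)
Lemma near_torsion_poly kp : 0 < ka -> 0 < kp -> 2 * kp < al -> 0 <= ta -> 0 < vs -> 1 + al + vs < nu -> 1 + al <= be ->
 \forall n \near \oo, tors_at xi ta nu kp n -> exists H : {poly int}, [/\ H != 0,
  (forall y, root (polyC H) y -> y != 0 /\ torsion_point y),
  ((size H).-1 <= n * lvA al n)%N, n1 (polyC H) <= expR (4 * pw n be) &
  forall i k, (forall j, (i j <= lvx vs n)%N) -> (k < lvt ta n)%N ->
   cab ((polyC H)^`N(k)).[mon xi i] <= expR (- pw n nu)].
Proof.
move=> k0 kp0 kpal ta0 vs0 n1' b1; pose y := nu - 1 - kp.
have y0 : 0 < y - kp by rewrite /y; lra_from n1', kpal, vs0.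
near=> n => -[M [M0 Mt hM]].
have n0 : (0 < n)%N by near: n; apply: near_ge1.
have pge (a : R) : 0 <= pw n a by exact: pw_ge0.
set t := lvt ta n in Mt *; set x := lvx vs n.
have [hx _] := truncn_pw n vs; rewrite -/(lvx vs n) -/x in hx.
(* Chosen so that [M * e] is about [n^(1 + 2 kp)]: this exceeds [n] enough to win over the slack,
   yet leaves the degree of [H] below that of [P(X^p)]-type polynomials. *)
pose e := (Num.truncn (pw n (1 + 2 * kp) / M%:R)).+1.
have MR : 0 < M%:R :> R by rewrite ltr0n.
have [e1 e2] : e%:R <= pw n (1 + 2 * kp) / M%:R + 1 /\ pw n (1 + 2 * kp) / M%:R <= e%:R.
 have /andP[h1 h2] := @truncn_itv R (pw n (1 + 2 * kp) / M%:R) (divr_ge0 (pge _) (ler0n _ _)).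
 by rewrite /e -{1}natr1 lerD2r h1 ltW.
have Me1 : M%:R * e%:R <= pw n (1 + 2 * kp) + M%:R.
 by have := ler_wpM2l (ltW MR) e1; rewrite mulrDr mulr1 mulrCA divff ?mulr1 // gt_eqF.
have Me2 : pw n (1 + 2 * kp) <= M%:R * e%:R by rewrite [M%:R * _]mulrC -ler_pdivrMr.
have t1 : 1 <= t%:R :> R by rewrite ler1n.
have M1 : 1 <= M%:R :> R by rewrite ler1n.
have Mle : M%:R <= pw n (1 + kp) by apply: le_trans Mt; rewrite ler_peMr.
have p12 : pw n (1 + kp) <= pw n (1 + 2 * kp) by apply: ler_pw; lra_from kp0.
have degH : M%:R * (e + t)%:R <= 3 * pw n (1 + 2 * kp).
 by rewrite natrD mulrDr; lra_from Me1, Mt, Mle, p12.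
have NR : (e + t)%:R <= 3 * pw n (1 + 2 * kp) by apply: le_trans degH; rewrite ler_peMl.
have XE : polyC ('X^M - 1) = 'X^M - 1 by rewrite rmorphB /= map_polyXn rmorph1.
have hE (v : R[i]) : ('X^M - 1 : {poly R[i]}).[v] = v ^+ M - 1 by rewrite !hornerE.
exists (('X^M - 1) ^+ (e + t)); split.
- by rewrite expf_neq0 // XnB1_neq0.
- move=> v; rewrite rmorphXn /= XE /root horner_exp expf_eq0 => /andP[_].
 rewrite hE subr_eq0 => /eqP yM.
 split; last by right; exists M.
 by apply: contra_eq_neq yM => ->; rewrite expr0n gtn_eqF //= eq_sym oner_eq0.
- have h : (size (('X^M - 1 : {poly int}) ^+ (e + t))%R).-1 = (M * (e + t))%N by rewrite size_exp deg_XnB1.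
 rewrite h -(ler_nat R) !natrM; apply: le_trans degH _.
 have [_ hA] := truncn_pw n al; rewrite -/(lvA al n) -natr1 in hA.
 have h2 : 2 <= pw n al by near: n; apply: near_pw_ge; lra_from kpal, kp0.
 have h3 : 6 * pw n (1 + 2 * kp) <= pw n (1 + al) by near: n; apply: near_pw; lra_from kpal.
 have : pw n al / 2 <= (lvA al n)%:R by lra_from hA, h2.
 by move=> /(ler_wpM2l (ler0n R n)); rewrite (pwD n 1 al) pw1 // in h3; lra_from h3.
- rewrite rmorphXn /= XE; apply: le_trans (n1_exp _ _) _.
 have h : n1 ('X^M - 1 : {poly R[i]}) <= 2.
  apply: le_trans (n1D _ _) _.
  by rewrite -scaleN1r n1Z cabN cab1 mul1r -[X in n1 X]mul1r n1Xn n1_1; clr; lra.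
 apply: (@le_trans _ _ (2 ^+ (e + t))); first by rewrite lerXn2r ?nnegrE ?n1_ge0.
 rewrite -[X in X ^+ _]lnK ?posrE // -expRM_natl ler_expR.
 have h3 : 3 * pw n (1 + 2 * kp) <= pw n be by near: n; apply: near_pw; lra_from kpal, b1.
 have := ler_wpM2l (ler0n R (e + t)) (@ln2_le1 R); have := pge be; lra_from NR, h3.
move=> i k ix kt; rewrite rmorphXn /= XE; set z := mon xi i.
have x1 : x.+1%:R <= 2 * pw n vs by rewrite -natr1; have := pw_ge1 n (ltW vs0); lra_from hx.
pose ep := expR (- (M%:R * pw n y)).
have ep0 : 0 <= ep by exact: expR_ge0.
have hbd : 4 * m%:R * x%:R * expR (- (M%:R * pw n y / 2)) <= 1.
 have h1 : 2 * pw n (y - kp) <= pw n y by near: n; apply: near_pw; lra_from kp0.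
 have h2 : 4 * m%:R * pw n vs * expR (- pw n (y - kp)) <= 1 by near: n; apply: near_exp; exact: y0.
 apply: le_trans h2; apply: ler_pM; rewrite ?expR_ge0 ?mulr_ge0 //; first by rewrite ler_wpM2l // mulr_ge0.
 by rewrite ler_expR; have := ler_wpM2r (pge y) M1; lra_from h1.
have epE : ep = expR (- (M%:R * pw n y / 2)) * expR (- (M%:R * pw n y / 2)).
 by rewrite -expRD /ep; congr expR; clr; lra.
have ep12 : expR (- (M%:R * pw n y / 2)) <= 1 by rewrite -[leRHS]expR0 ler_expR oppr_le0 divr_ge0 // mulr_ge0.
have hbd2 : 4 * m%:R * x%:R * ep <= expR (- (M%:R * pw n y / 2)).
 by rewrite epE mulrA; have := ler_wpM2r (expR_ge0 (- (M%:R * pw n y / 2))) hbd; rewrite mul1r.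
have c0 : cab ('X^M - 1 : {poly R[i]}).[z] <= expR (- (M%:R * pw n y / 2)).
 rewrite hE /z monX /mon; have s1 : size (index_enum 'I_m) = m by rewrite -[RHS](card_ord m) cardT /= enumT.
 have [m0|m0] := posnP m.
  by rewrite big1 ?subrr ?cab0 ?expR_ge0 // => j; have := ltn_ord j; rewrite {2}m0.
 have mR : 1 <= m%:R :> R by rewrite ler1n.
 have := @near1_bigprod R _ (index_enum 'I_m) (fun j => xi j ^+ (i j * M)) (2 * x%:R * ep).
 have xep : 0 <= x%:R * ep by rewrite mulr_ge0.
 have xm := ler_wpM2r xep mR.
 rewrite s1 => /(_ _ _ _)/wrap[].
 - by rewrite !mulr_ge0.
 - move=> j _; rewrite mulnC exprM.
  have ixe : 2 * (i j)%:R * ep <= 2 * x%:R * ep by rewrite ler_wpM2r // ler_wpM2l // ler_nat.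
  by apply: (le_trans _ ixe); apply: near1X => //; lra_from ixe, hbd2, ep12, xm, xep.
 - by lra_from hbd2, ep12.
 by move=> /le_trans; apply; lra_from hbd2.
have c1 : cab ('X^M - 1 : {poly R[i]}).[z] <= 1 := le_trans c0 ep12.
have z1 : 1 <= 1 + cab z by rewrite lerDl cab_ge0.
have G1 : 1 <= 2 * (1 + cab z) ^+ M.
 by have := exprn_ege1 M z1; clr; lra.
apply: le_trans (power_jet kt (leq_addl e t) c1 (n1_shift_XnB1 z M) G1) _; rewrite addnK.
have hz : 1 + cab z <= expR (monb xi * x.+1%:R) by apply: cab_mon_le.
have m1 := monb_ge1 xi.
have l2 := @ln2_le1 R.
have two (N : nat) : 2 ^+ N <= expR N%:R :> R.
 rewrite -[X in X ^+ _]lnK ?posrE // -expRM_natl ler_expR.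
 by have := ler_wpM2l (ler0n R N) l2; rewrite mulr1.
have p2 : (2 * (1 + cab z) ^+ M) ^+ t <= expR (pw n (1 + kp) + 2 * monb xi * pw n (vs + (1 + kp))).
 rewrite exprMn expRD -exprM; apply: ler_pM; rewrite ?exprn_ge0 ?(le_trans ler01 z1) //.
  by apply: le_trans (two t) _; rewrite ler_expR; apply: le_trans Mt; rewrite ler_peMl.
 apply: (@le_trans _ _ (expR (monb xi * x.+1%:R) ^+ (M * t))).
  by rewrite lerXn2r ?nnegrE ?expR_ge0 // (le_trans ler01 z1).
 rewrite -expRM_natl ler_expR natrM (pwD n vs).
 have h1 : monb xi * x.+1%:R <= 2 * monb xi * pw n vs.
  by have := ler_wpM2l (le_trans ler01 m1) x1; clr; lra.
 have h2 : 0 <= monb xi * x.+1%:R by rewrite mulr_ge0 // (le_trans ler01 m1).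
 have := ler_pM (mulr_ge0 (ler0n R M) (ler0n R t)) h2 Mt h1.
 by clr; lra.
have p3 : cab ('X^M - 1 : {poly R[i]}).[z] ^+ e <= expR (- (pw n (nu + kp) / 2)).
 apply: (@le_trans _ _ (expR (- (M%:R * pw n y / 2)) ^+ e)).
  by rewrite lerXn2r ?nnegrE ?cab_ge0 ?expR_ge0.
 rewrite -expRM_natl ler_expR.
 have -> : nu + kp = (1 + 2 * kp) + y by rewrite /y; ring.
 by rewrite (pwD n (1 + 2 * kp)); have := ler_wpM2r (pge y) Me2; clr; lra.
have p1 := two (e + t)%N.
apply: (@le_trans _ _ (expR (e + t)%:R * expR (pw n (1 + kp) + 2 * monb xi * pw n (vs + (1 + kp))) * expR (- (pw n (nu + kp) / 2)))).
 have Gt : 0 <= (2 * (1 + cab z) ^+ M) ^+ t by apply: exprn_ge0; apply: le_trans G1.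
 apply: ler_pM; [by apply: mulr_ge0 => //; apply: exprn_ge0 | by apply: exprn_ge0; apply: cab_ge0 | | exact: p3].
 by apply: ler_pM => //; apply: exprn_ge0.
rewrite -!expRD ler_expR.
have f1 : 12 * pw n (1 + 2 * kp) <= pw n nu by near: n; apply: near_pw; lra_from kpal, n1', vs0.
have f2 : (8 * monb xi) * pw n (vs + (1 + kp)) <= pw n nu by near: n; apply: near_pw; lra_from kpal, n1', kp0.
have f3 : 16 * pw n nu <= pw n (nu + kp) by near: n; apply: near_pw; lra_from kp0.
by have := pge nu; lra_from f1, f2, f3, NR, p12.
Unshelve. all: by end_near. Qed.

(** The common divisor is small at most grid points, and its weight there splits into a torsion and
    a non-torsion part. If the torsion part matters at many points, [near_torsion] applies;
    otherwise a good factor exists at most points. The polynomial [H] opens the gap between [kp] and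
    [2 * kp] in the alternative. *)
Lemma near_core (kp := (5 * m%:R + 4) * ka) : (0 < m)%N -> 0 < ka -> 4 * kp < al -> al <= 1 -> 4 * ka <= vs ->
 al + vs <= sg -> 0 <= ta -> ta <= 1 -> 1 + al <= be -> al + ta + ka <= be -> 1 + al + vs < nu ->
 om + ka + ta <= 1 + al -> 1 + al + be < om - ka + ta + nu ->
 (forall x, (#|[set i : {ffun 'I_m -> 'I_x.+1} | `[< algebraic (zeta i) >]]%SET| <= x.+1 ^ m.-1)%N) ->
 \forall n \near \oo, forall P, small_at xi sg be ta nu n P -> separated n ->
 tors_at xi ta nu kp n \/ (~ tors_at xi ta nu (2 * kp) n /\
  #|(~: [set i : T n | `[< good_factor n (zeta i) >]])%SET|%:R <= pw n (om - ka / 2)).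
Proof.
move=> m0 k0 kpal al1 kvs avs ta0 ta1 b1 b2 n1' om1 key hAlg.
have mR : 1 <= m%:R :> R by rewrite ler1n.
have kk : 9 * ka <= kp.
 by rewrite /kp; have := ler_wpM2r (ltW k0) mR; clr; lra.
have kp0 : 0 < kp by lra_from kk, k0.
have vs0 : 0 < vs by lra_from k0, kvs.
have al0 : 0 < al by lra_from kp0, kpal.
have om0 : 0 <= om by rewrite mulr_ge0 // ltW.
have ome : om = m.-1%:R * vs + vs by rewrite -{1}(prednK m0) -natr1; ring.
pose xi' j := (xi j)^-1.
near=> n => P sm sep.
have pge (a : R) : 0 <= pw n a by exact: pw_ge0.
have n0 : (0 < n)%N by near: n; apply: near_ge1.
have pn : pw n 1 = n%:R :> R by apply: pw1.
have hE : pw n (al - ka) <= (size (lvE al ka n))%:R by near: n; apply: near_primes => //; lra_from k0, kk, kpal.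
(* The choice [H = 0] imposes nothing on the common divisor; under weak torsion [H] forces all
   factors of the divisor to be torsion. *)
have [H [dH nH jH [HT HN]]] : exists H : {poly int}, [/\ ((size H).-1 <= n * lvA al n)%N, n1 (polyC H) <= expR (4 * pw n be),
  (forall i k, (forall j, (i j <= lvx vs n)%N) -> (k < lvt ta n)%N -> cab ((polyC H)^`N(k)).[mon xi i] <= expR (- pw n nu)) &
  (tors_at xi ta nu (2 * kp) n -> H != 0 /\ forall y, root (polyC H) y -> y != 0 /\ torsion_point y) /\ (~ tors_at xi ta nu (2 * kp) n -> H = 0)].
 have [h|h] := pselect (tors_at xi ta nu (2 * kp) n); last first.
  exists 0; rewrite size_poly0 rmorph0 n1_0 expR_ge0; split=> // i k _ _.
  by rewrite linear0 horner0 cab0 expR_ge0.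
 have : tors_at xi ta nu (2 * kp) n -> exists H : {poly int}, [/\ H != 0,
  (forall y, root (polyC H) y -> y != 0 /\ torsion_point y),
  ((size H).-1 <= n * lvA al n)%N, n1 (polyC H) <= expR (4 * pw n be) &
  forall i k, (forall j, (i j <= lvx vs n)%N) -> (k < lvt ta n)%N ->
   cab ((polyC H)^`N(k)).[mon xi i] <= expR (- pw n nu)].
  near: n; apply: near_torsion_poly => //; lra_from kp0, kpal.
 by move=> /(_ h) [H [H0 hr dH nH jH]]; exists H.
have [G [c [s [c0 hs GE [dvd [A' HA]] MI]]]] : exists G c s, [/\ c != 0, forall q, q \in s -> irrz q, G = c *: \prod_(q <- s) q,
  seq_dvd ta (lvE al ka n) n P G /\ (exists A, H = G * A) &
  forall (S : nat) (Z : nat -> 'I_m -> nat),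
   pw n (om - ka) <= S%:R -> S%:R <= pw n (om + ka) ->
   (forall l k, (l < S)%N -> (Z l k <= lvx vs n)%N) ->
   (forall l, (l < S)%N -> expR (- pw n (nu - ta - ka)) <=
     \prod_(0 <= l' < l) cab (mon xi (Z l) - mon xi (Z l'))) ->
   exists2 l, (l < S)%N & cab (polyC G).[mon xi (Z l)] < expR (- (pw n nu / 2))].
 move: P H sm dH nH jH {sep HT HN}; near: n; apply: near_interp => //.
 - near=> n; split.
  + have h : pw n (al - ka) <= (size (lvE al ka n))%:R by near: n; apply: near_primes => //; lra_from k0, kk, kpal.
   case: (lvE al ka n) h => [|p E' _]; last by exists p; rewrite mem_head.
   by rewrite leNgt pw_gt0.
  + by rewrite !filter_uniq // iota_uniq.
  by move=> p /lvE_prop [/prime_gt0 -> ->].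
 - exact: ltW.
 - exact: ltW.
 - by lra_from n1', ta1, vs0.
 - by rewrite addr_ge0.
have [B1 B2 B3] : [/\ \sum_(q <- nontorsion_factors R s) (maxn (lvt ta n) (count_mem q s))%:R * (size q).-1%:R <= pw n (1 - al + 3 * ka),
   \sum_(q <- nontorsion_factors R s) (maxn (lvt ta n) (count_mem q s))%:R * ln (mz q) <= pw n (be - 2 * al + 4 * ka)
  & (\sum_(q <- torsion_factors R s) maxn (lvt ta n) (count_mem q s) * (size q).-1 <= n)%N].
 move: P G c s sm c0 hs GE dvd {MI HA sep}; near: n; apply: near_factor_bounds => //.
  by lra_from kk, kpal, k0.
 by lra_from b1, al0.
pose W := [set i : T n | cab (polyC G).[zeta i] < expR (- (pw n nu / 2))]%SET.
pose Alg := [set i : T n | `[< algebraic (zeta i) >]]%SET.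
have [hx hx2] := truncn_pw n vs; rewrite -/(lvx vs n) in hx hx2.
have NR : (lvx vs n).+1%:R <= 2 * pw n vs.
 by rewrite -natr1; have := pw_ge1 n (ltW vs0); lra_from hx.
(* Otherwise enough points outside [W] could be fed into the interpolation statement [MI], which
   makes [G] small at one of them. *)
have hW : #|(~: W)%SET|%:R <= pw n (om - ka).
 rewrite leNgt; apply/negP => lt; pose S := (Num.truncn (pw n (om - ka))).+1.
 have [S1 S2] := truncn_pw n (om - ka); rewrite -/S in S2.
 have SW : (S <= #|(~: W)%SET|)%N by rewrite -(ltr_nat R); apply: le_lt_trans lt.
 pose i0 : T n := [ffun _ => ord0]; pose Zs l := nth i0 (enum (~: W)%SET) l.
 have Zin l : (l < S)%N -> Zs l \in (~: W)%SET.
  by move=> lS; rewrite -mem_enum mem_nth // -cardE (leq_trans lS).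
 have inj a b : (a < S)%N -> (b < S)%N -> Zs a = Zs b -> a = b.
  by move=> aS bS /eqP; rewrite nth_uniq ?enum_uniq -?cardE ?(leq_trans _ SW) // => /eqP.
 have [||||l lS] := MI S (fun l j => Zs l j).
 - exact: ltW.
 - rewrite /S -natr1; have h1 : 2 * pw n (om - ka) <= pw n (om + ka) by near: n; apply: near_pw; lra_from k0.
  have h2 : 2 <= pw n (om + ka) by near: n; apply: near_pw_ge; lra_from k0, om0.
  by lra_from S1, h1, h2.
 - by move=> l k _; rewrite -ltnS.
 - move=> l lS; have := sep [seq Zs l' | l' <- index_iota 0 l] (Zs l); rewrite big_map; apply.
   rewrite map_inj_in_uniq ?iota_uniq // => a b; rewrite !mem_index_iota /= => al' bl'.
   by apply: inj; [exact: ltn_trans al' lS | exact: ltn_trans bl' lS].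
  apply/mapP => -[l']; rewrite mem_index_iota /= => l'l /(inj _ _ lS (ltn_trans l'l lS)) e.
  by move: l'l; rewrite e ltnn.
 by move=> h; have := Zin l lS; rewrite !inE h.
have A1 : #|Alg|%:R <= 2 ^+ m.-1 * pw n (om - vs).
 apply: (@le_trans _ _ ((lvx vs n).+1%:R ^+ m.-1)); first by rewrite -natrX ler_nat; exact: hAlg.
 have -> : om - vs = m.-1%:R * vs by rewrite ome; ring.
 by rewrite pwX -exprMn lerXn2r ?nnegrE // mulr_ge0.
have nz i q : i \notin Alg -> q \in s -> q != 0 /\ ~~ root (polyC q) (zeta i).
 rewrite inE => /asboolPn ia qs; have q0 := irrz_neq0 (hs q qs); split=> //.
 by apply/negP => r; apply: ia; apply: minpoly_algebraic r.
pose F (i : T n) q := wt (zeta i) q *+ count_mem q s.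
pose NS i := \sum_(q <- nontorsion_factors R s) F i q.
pose TS i := \sum_(q <- torsion_factors R s) F i q.
have F0 i q : i \notin Alg -> q \in s -> 0 <= F i q.
 by move=> ia qs; have [q0 rq] := nz i q ia qs; rewrite mulrn_wge0 // wt_ge0.
(* Half of [n^nu] comes from the smallness of [G]; the factor [X], which belongs to neither sum,
   takes at most an eighth. *)
have splitS i : i \in W -> i \notin Alg -> pw n nu * (3 / 8) <= NS i + TS i.
 move=> iW ia; have nzi q := nz i q ia.
 have h1 : pw n nu / 2 <= \sum_(q <- s) wt (zeta i) q.
  rewrite -(wt_scaled_prod c0 nzi) -GE /wt.
  have G0 : G != 0.
   by rewrite GE -mul_polyC mulf_neq0 ?polyC_eq0 // prodf_seq_neq0; apply/allP => q /nzi [].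
  have := lnmz_ge0 R G0; have := mulr_ge0 (ler0n R (size G).-1) (ln2mx1_ge0 (zeta i)).
  have : pw n nu / 2 <= - ln (cab (polyC G).[zeta i]).
   have [Gz|Gz] := ltrP 0 (cab (polyC G).[zeta i]).
    rewrite lerNr -[leRHS]expRK ler_ln ?posrE ?expR_gt0 //; move: iW; rewrite inE; exact: ltW.
   suff : ~~ root (polyC G) (zeta i) by rewrite /root -cab_gt0 ltNge Gz.
   rewrite GE map_polyZ rmorph_prod /root hornerZ horner_prod mulf_neq0 ?intr_eq0 //.
   by rewrite prodf_seq_neq0; apply/allP => q /nzi [].
  by clr; lra.
 have h2 : \sum_(q <- s) wt (zeta i) q = \sum_(q <- undup s) F i q.
  rewrite -big_undup_iterop_count; apply: eq_bigr => q _.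
  by rewrite Monoid.iteropE /F; elim: (count_mem q s) => // k IH; rewrite mulrS -IH.
 have h3 : \sum_(q <- undup s) F i q <= NS i + TS i + F i 'X.
  rewrite (bigID (fun q => ~~ `[< torsion_poly R q >])) /= -addrA /NS /TS /nontorsion_factors /torsion_factors !big_filter lerD2l.
  rewrite (bigID (fun q : {poly int} => q`_0 != 0)) /=.
  under eq_bigl => q do rewrite negbK.
  rewrite lerD2l; under eq_bigl => q do rewrite !negbK.
  rewrite big_mkcond /=; have : \sum_(q <- undup s) (if q == 'X then F i 'X else 0) <= F i 'X.
   rewrite -big_mkcond /= -big_filter; have [Xs|Xs] := boolP ('X \in undup s).
    by rewrite filter_pred1_uniq ?undup_uniq // big_seq1.
   rewrite big1_seq.
    by rewrite /F (count_memPn _) // -mem_undup.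
   by move=> q /=; rewrite mem_filter => /andP[/eqP -> Xs']; rewrite Xs' in Xs.
  apply: le_trans; rewrite big_seq [leRHS]big_seq; apply: ler_sum => q; rewrite mem_undup => qs.
  case: ifPn => [/andP[_ /eqP q0]|_].
   have -> : q = 'X by apply: (@irrz_eq R[i] q 'X 0 (hs q qs) irrzX); rewrite ?map_polyX /root ?hornerX // horner_coef0 coef_map /= q0.
   by rewrite eqxx.
  case: ifPn => // /eqP e; rewrite -e; exact: F0.
 have hX : F i 'X <= pw n nu / 8.
  rewrite /F; have [Xs|Xs] := boolP ('X \in s); last by rewrite (count_memPn Xs) mulr0n divr_ge0.
  have z0 : zeta i != 0 := mon_neq0 xi0 _.
  have e1 : ln (1 + cab (zeta i)) <= monb xi * (lvx vs n).+1%:R.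
   by apply: ln_cab_mon => k; rewrite -ltnS.
  have e2 : ln (1 + (cab (zeta i))^-1) <= monb xi' * (lvx vs n).+1%:R.
   have -> : (cab (zeta i))^-1 = cab (mon xi' (fun j => i j)).
    by rewrite -cabV; congr cab; rewrite /mon -prodfV; apply: eq_bigr => j _; rewrite exprVn.
   by apply: ln_cab_mon => k; rewrite -ltnS.
  have cX : (count_mem ('X : {poly int}) s)%:R <= pw n 1 * pw n al.
   have [p pE] : exists p, p \in lvE al ka n.
    case: (lvE al ka n) hE => [|p E' _]; last by exists p; rewrite mem_head.
    by rewrite leNgt pw_gt0.
   have [pp pA _] := lvE_prop pE; have [P0 dP _ _] := sm.
   have [A2] := dvd p 0%N pE isT; rewrite nderivn0 => E2.
   have PX0 : P \Po 'X^p != 0 by rewrite comp_poly_eq0 // size_polyXn ltnS prime_gt0.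
   have dG : ((size G).-1 <= n * lvA al n)%N.
    have := @degree_dvd_le A2 G; rewrite mulrC -E2 => /(_ PX0) /leq_trans; apply.
    by rewrite size_comp_poly size_polyXn /= leq_mul.
   have [hA _] := truncn_pw n al; rewrite -/(lvA al n) in hA.
   apply: (@le_trans _ _ (n * lvA al n)%:R); last by rewrite natrM pn ler_wpM2l.
   rewrite ler_nat; apply: leq_trans dG; rewrite GE deg_scaled_prod //; last by move=> q /nzi [].
   have cE : count_mem ('X : {poly int}) s = (\sum_(q <- s) (q == 'X))%N.
    by rewrite -sum1_count big_mkcond; apply: eq_bigr => q _ /=; case: eqP.
   rewrite cE big_seq [leqRHS]big_seq; apply: leq_sum => q qs.
   by have := irrz_size_gt1 (hs q qs); case: (q == 'X); case: (size q) => [|[]].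
  have w0 : wt (zeta i) 'X <= (4 * (monb xi + monb xi')) * pw n vs.
   apply: le_trans (wtX_le z0) _; have m1 := monb_ge1 xi; have m2 := monb_ge1 xi'; have l2 := @ln2_le1 R.
   have := ler_wpM2l (le_trans ler01 m1) NR; have := ler_wpM2l (le_trans ler01 m2) NR; have v1 := pw_ge1 n (ltW vs0).
   by have := ler_wpM2l (le_trans ler01 m1) v1; generalize e1, e2, l2, m1, m2, v1; clr; move: (_.+1%:R); intros; nra.
  have f : 8 * (4 * (monb xi + monb xi')) * pw n (1 + al + vs) <= pw n nu by near: n; apply: near_pw.
  rewrite -mulr_natl; have := ler_pM (ler0n R (count_mem ('X : {poly int}) s)) (wt_ge0 _ _) cX w0.
  rewrite (pwD n (1 + al) vs) (pwD n 1 al) in f.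
  have [q1 q2] := nzi 'X Xs; move=> /(_ q1 q2); lra_from f.
 by lra_from h1, h2, h3, hX.
have [t1 t2] : pw n ta / 3 <= (lvt ta n)%:R /\ True.
 by have /andP[h _] := lvt_bounds n ta0.
(* Points at which the torsion factors carry at least an eighth of [n^nu]; elsewhere at least a
   quarter is left for the others. *)
pose BT := [set i : T n | [&& i \in W, i \notin Alg & pw n nu / 8 <= TS i]]%SET.
have hk (i : T n) : exists k, i \in BT -> [/\ (0 < k)%N, (totient k * lvt ta n <= n)%N &
   cab (zeta i ^+ k - 1) <= expR (- ((totient k)%:R * pw n (nu - 1) / 32))].
 have [|_] := boolP (i \in BT); last by exists 0%N.
 rewrite inE => /and3P[iW ia iT].
 (* Averaging: the degrees of the torsion factors, counted with multiplicity, add up to at most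
    [n]. *)
 have [q qt hq] : exists2 q, q \in torsion_factors R s & (size q).-1%:R * (pw n (nu - 1) / 16) < wt (zeta i) q.
  apply: contrapT => hn; suff : TS i <= pw n nu / 16.
   by have := pw_gt0 n nu; lra_from iT.
  apply: (@le_trans _ _ ((\sum_(q <- torsion_factors R s) maxn (lvt ta n) (count_mem q s) * (size q).-1)%:R * (pw n (nu - 1) / 16))).
   rewrite natr_sum mulr_suml /TS big_seq [leRHS]big_seq; apply: ler_sum => q qt.
   rewrite /F -[leLHS]mulr_natl natrM -mulrA; apply: (@le_trans _ _ ((count_mem q s)%:R * ((size q).-1%:R * (pw n (nu - 1) / 16)))).
    by apply: ler_wpM2l => //; rewrite leNgt; apply/negP => lt; apply: hn; exists q.
   by apply: ler_wpM2r; [rewrite mulr_ge0 // divr_ge0 | rewrite ler_nat leq_maxr].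
  apply: (@le_trans _ _ (n%:R * (pw n (nu - 1) / 16))).
   by apply: ler_wpM2r; rewrite ?divr_ge0 // ler_nat.
  by rewrite mulrA -pn -pwD (_ : 1 + (nu - 1) = nu) //; ring.
 move: (qt); rewrite mem_filter mem_undup => /andP[/andP[/asboolP tq q0] qs].
 have [v [k [rv pk]]] := torsion_order (hs q qs) tq q0.
 have [dk [P0 E] _] := torsion_irrz (hs q qs) rv pk.
 have kk0 := prim_order_gt0 pk; exists k => _.
 have tn : (totient k * lvt ta n <= n)%N.
  apply: leq_trans B3; rewrite (big_rem q) //= -dk mulnC; apply: leq_trans (leq_addr _ _).
  by rewrite leq_mul2r leq_maxl orbT.
 split=> //; have zk : zeta i ^+ k != 1.
  apply: contraNneq ia => e; rewrite inE; apply/asboolP.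
  apply: (@minpoly_algebraic _ ('X^k - 1)); first exact: XnB1_neq0.
  by rewrite rmorphB /= map_polyXn rmorph1 /root !hornerE e subrr.
 apply: le_trans (torsion_factor_wt kk0 E zk) _; rewrite ler_expR.
 have [_ hkn] : k%:R <= pw n 3 :> R /\ k%:R <= (totient k)%:R * pw n ka :> R.
  have tn' : (totient k <= n)%N by apply: leq_trans tn; rewrite leq_pmulr.
  by move: k kk0 tn' {E zk dk pk tn}; near: n; apply: near_totient.
 have m1 := monb_ge1 xi.
 have lz : ln (2 * mx1 (zeta i)) <= 3 * monb xi * pw n vs.
  have h1 : ln (mx1 (zeta i)) <= monb xi * (lvx vs n).+1%:R.
   apply: le_trans (_ : ln (1 + cab (zeta i)) <= _); last by apply: ln_cab_mon => j; rewrite -ltnS.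
   rewrite ler_ln ?posrE ?mx1_gt0 ?(lt_le_trans ltr01) ?lerDl ?cab_ge0 //.
   by rewrite /mx1 ge_max lerDl lerDr cab_ge0 ler01.
  rewrite ln2mx1E; have l2 := @ln2_le1 R; have v1 := pw_ge1 n (ltW vs0).
  by have := ler_wpM2l (le_trans ler01 m1) NR; have := ler_pM ler01 ler01 m1 v1; lra_from h1, l2.
 have f : 32 * (3 * monb xi) * pw n (ka + vs) <= pw n (nu - 1) by near: n; apply: near_pw; lra_from n1', kpal, kk, k0.
 have h2 := ler_pM (ler0n R k) (ln2mx1_ge0 (zeta i)) hkn lz.
 rewrite (pwD n ka) in f; have h3 := ler_wpM2l (ler0n R (totient k)) f.
 by rewrite dk in hq; lra_from h2, h3, hq.
have [k hk'] := boolp.choice hk.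
have [hB|hB] := lerP (pw n (om - 2 * ka)) #|BT|%:R.
 left; move: (BT) k hk' hB; near: n; apply: near_torsion => //.
  by lra_from kk, kpal, al1, k0.
 by lra_from n1', kk, kpal, k0, vs0.
pose U := ((~: W) :|: Alg :|: BT)%SET.
have UR : #|U|%:R <= pw n (om - ka / 2).
 have h1 : 8 * pw n (om - ka) <= pw n (om - ka / 2) by near: n; apply: near_pw; lra_from k0.
 have h2 : 8 * 2 ^+ m.-1 * pw n (om - vs) <= pw n (om - ka / 2) by near: n; apply: near_pw; lra_from k0, kvs.
 have h3 : 8 * pw n (om - 2 * ka) <= pw n (om - ka / 2) by near: n; apply: near_pw; lra_from k0.
 have : #|U|%:R <= #|(~: W)%SET|%:R + #|Alg|%:R + #|BT|%:R :> R.
  rewrite -!natrD ler_nat; apply: leq_trans (leq_card_setU _ _).1 _; rewrite leq_add2r; exact: (leq_card_setU _ _).1.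
 by generalize hW, A1, hB, h1, h2, h3, (pw_ge0 n (om - ka / 2)); clr; lra.
have NSU i : i \notin U -> [/\ i \in W, i \notin Alg & pw n nu / 4 <= NS i].
 rewrite !finset.in_setU !negb_or finset.in_setC negbK => /andP[/andP[iW ia]].
 rewrite [i \in BT]inE iW ia /= -ltNge => lt; split=> //.
 by have := splitS i iW ia; lra_from lt.
have [tt|ntt] := pselect (tors_at xi ta nu (2 * kp) n).
 have [H0 hr] := HT tt; exfalso.
 (* All roots of [G] are roots of [H], hence torsion. Then no point can lie outside [U], although
    [U] is much smaller than the grid. *)
 have NS0 i : NS i = 0.
  rewrite /NS big1_seq // => q; rewrite mem_filter mem_undup => /andP[_ /andP[/asboolPn nt qs]]; exfalso; apply: nt.
  have [v rv] := irrz_root R (hs q qs); exists v => //; apply: (hr v _).2.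
  have -> : H = q * (c *: \prod_(j <- rem q s) j * A') by rewrite HA GE (big_rem q) //= scalerAr mulrA.
  by rewrite rmorphM /root hornerM (eqP rv) mul0r.
 have Uall : #|U| = ((lvx vs n).+1 ^ m)%N.
  rewrite -[in RHS](card_ord (lvx vs n).+1) -[X in (_ ^ X)%N](card_ord m) -card_ffun; apply: eq_card => i.
  rewrite [RHS]inE; apply/negPn/negP => /NSU [_ _]; rewrite NS0; have := pw_gt0 n nu; clr; lra.
 have h1 : 2 * pw n (om - ka / 2) <= pw n om by near: n; apply: near_pw; lra_from k0.
 have h2 : pw n om <= #|U|%:R by rewrite Uall natrX pwX lerXn2r ?nnegrE // ltW.
 by have := pw_gt0 n (om - ka / 2); lra_from h1, h2, UR.
right; split=> //; apply: le_trans UR; rewrite ler_nat subset_leq_card //; apply/fintype.subsetP => i.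
rewrite finset.in_setC => hg; apply/negPn/negP => /NSU [iW ia hNS]; move: hg; rewrite inE => /asboolP; apply.
set a := pw n (nu - 1 + al - 5 * ka); set b := pw n (nu - be + 2 * al - 5 * ka).
have lm0 q : q \in s -> 0 <= ln (mz q) by move=> /hs /irrz_neq0 /(lnmz_ge0 R).
(* If every factor had less than this weight, the two sums bounded by [near_factor_bounds] would
   give less than [n^nu / 4] in total. *)
have [q qt hq] : exists2 q, q \in nontorsion_factors R s & (size q).-1%:R * a + ln (mz q) * b <= wt (zeta i) q.
 apply: contrapT => hn; suff : NS i <= pw n (nu - 2 * ka) + pw n (nu - ka).
  have h1 : 16 * pw n (nu - 2 * ka) <= pw n nu by near: n; apply: near_pw; lra_from k0.
  have h2 : 16 * pw n (nu - ka) <= pw n nu by near: n; apply: near_pw; lra_from k0.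
  by have := pw_gt0 n nu; lra_from h1, h2, hNS.
 have e1 : nu - 2 * ka = (1 - al + 3 * ka) + (nu - 1 + al - 5 * ka) by ring.
 have e2 : nu - ka = (be - 2 * al + 4 * ka) + (nu - be + 2 * al - 5 * ka) by ring.
 rewrite e1 e2 (pwD n (1 - al + 3 * ka)) (pwD n (be - 2 * al + 4 * ka)) -/a -/b.
 apply: le_trans (lerD (ler_wpM2r (pge _) B1) (ler_wpM2r (pge _) B2)); rewrite -/a -/b.
 rewrite !mulr_suml -big_split /= /NS big_seq [leRHS]big_seq; apply: ler_sum => q qt.
 have qs : q \in s by move: qt; rewrite mem_filter mem_undup => /andP[].
 rewrite /F -[leLHS]mulr_natl -!mulrA -mulrDr; apply: (@le_trans _ _ ((count_mem q s)%:R * ((size q).-1%:R * a + ln (mz q) * b))).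
  by apply: ler_wpM2l => //; rewrite leNgt; apply/negP => /ltW lt; apply: hn; exists q.
 apply: ler_wpM2r; last by rewrite ler_nat leq_maxr.
 by apply: addr_ge0; apply: mulr_ge0 => //; [exact: pge | exact: lm0 | exact: pge].
move: (qt); rewrite mem_filter mem_undup => /andP[_ qs].
have [q0 rq] := nz i q ia qs; exists q; split=> //; first exact: hs.
- have h1 : (lvt ta n)%:R * (size q).-1%:R <= pw n (1 - al + 3 * ka).
  apply: le_trans B1; rewrite (big_rem q) //= -[leLHS]addr0 lerD //.
   by rewrite ler_wpM2r // ler_nat leq_maxl.
  by apply: sumr_ge0 => ? _; rewrite mulr_ge0.
 have h2 : 3 * pw n (1 - al + 3 * ka - ta) <= pw n (1 - al - ta + 5 * ka) by near: n; apply: near_pw; lra_from k0.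
 apply: le_trans h2; rewrite -(ler_pM2r (pw_gt0 n ta)) -mulrA -pwD subrK.
 by have := ler_wpM2r (ler0n R (size q).-1) t1; lra_from h1.
- have h1 : (lvt ta n)%:R * ln (mz q) <= pw n (be - 2 * al + 4 * ka).
  apply: le_trans B2; rewrite (big_rem q) //= -[leLHS]addr0 lerD //.
   by rewrite ler_wpM2r ?lm0 // ler_nat leq_maxl.
  rewrite big_seq; apply: sumr_ge0 => q' /mem_rem; rewrite mem_filter mem_undup => /andP[_ q's].
  by rewrite mulr_ge0 ?lm0.
 have h2 : 3 * pw n (be - 2 * al + 4 * ka - ta) <= pw n (be - 2 * al - ta + 5 * ka) by near: n; apply: near_pw; lra_from k0.
 apply: le_trans h2; rewrite -(ler_pM2r (pw_gt0 n ta)) -mulrA -pwD subrK.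
 by have := ler_wpM2r (lm0 q qs) t1; lra_from h1.
Unshelve. all: by end_near. Qed.

End Level.

(** * Approximants at a fixed point through all levels *)

Section Approximants.
Variable R : realType.
Notation polyC := (map_poly (intr : int -> R[i])).
Notation mz Q := (mah (polyC Q)).
Implicit Types (z : R[i]) (D H a b l : R) (Q : {poly int}).

(** Two separate gains [a] and [b]: in a resultant with [Q'] the degree of [Q] is multiplied by
    [ln M(Q')], and [ln M(Q)] by the degree of [Q']. *)
Definition approximant z D H a b n Q := [/\ irrz Q, ~~ root (polyC Q) z,
 (size Q).-1%:R <= pw n D, ln (mz Q) <= pw n H &
 (size Q).-1%:R * pw n a + ln (mz Q) * pw n b <= wt z Q].

Lemma irrz_deg_gt0 Q : irrz Q -> (0 < (size Q).-1)%N.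
Proof. by move=> /irrz_size_gt1; case: (size Q) => [|[]]. Qed.

Lemma approximant_le z D H a b D' H' a' b' n Q : D <= D' -> H <= H' -> a' <= a -> b' <= b ->
 approximant z D H a b n Q -> approximant z D' H' a' b' n Q.
Proof.
move=> hD hH ha hb [iQ rQ dQ lQ wQ]; split=> //.
- by apply: le_trans dQ _; apply: ler_pw.
- by apply: le_trans lQ _; apply: ler_pw.
apply: le_trans wQ; apply: lerD; first by rewrite ler_wpM2l // ler_pw.
by rewrite ler_wpM2l ?ler_pw // lnmz_ge0 // irrz_neq0.
Qed.

Lemma near_approximant_succ D H a b e : 0 < e -> \forall n \near \oo, forall z Q,
 approximant z D H a b n.+1 Q -> approximant z (D + e) (H + e) (a - e) (b - e) n Q.
Proof.
move=> e0; near=> n => z Q [iQ rQ dQ lQ wQ].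
have [sD _] : pw n.+1 D <= pw n (D + e) /\ pw n D <= pw n.+1 (D + e) by near: n; apply: near_pw_succ.
have [sH _] : pw n.+1 H <= pw n (H + e) /\ pw n H <= pw n.+1 (H + e) by near: n; apply: near_pw_succ.
have [_ sa] : pw n.+1 (a - e) <= pw n (a - e + e) /\ pw n (a - e) <= pw n.+1 (a - e + e) by near: n; apply: near_pw_succ.
have [_ sb] : pw n.+1 (b - e) <= pw n (b - e + e) /\ pw n (b - e) <= pw n.+1 (b - e + e) by near: n; apply: near_pw_succ.
rewrite !subrK in sa sb; split=> //; [exact: le_trans sD | exact: le_trans sH |].
apply: le_trans wQ; apply: lerD; first by rewrite ler_wpM2l.
by rewrite ler_wpM2l // lnmz_ge0 // irrz_neq0.
Unshelve. all: by end_near. Qed.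

(** Term by term: [H' < a] pays for the product of the degree of [Q] with [ln M(Q')], [D' < b] for
    that of [ln M(Q)] with the degree of [Q'], and [D' + l < a] for the product of the degrees. *)
Lemma near_resultant_lt D H a b D' H' l : 0 <= l -> H' < a -> D' + l < a -> D' < b ->
 \forall n \near \oo, forall z Q Q', ln (mx1 z) <= pw n l -> approximant z D H a b n Q ->
 (size Q').-1%:R <= pw n D' -> ln (mz Q') <= pw n H' ->
 (size Q').-1%:R * ln (mz Q) + (size Q).-1%:R * ln (mz Q') +
  (size Q).-1%:R * (size Q').-1%:R * (4 * ln (mx1 z) + 2 + 4 * ln (2 * ((size Q).-1 + (size Q').-1)%:R)) < wt z Q.
Proof.
move=> l0 h1 h2 h3; pose e := (a - D' - l) / 2; have e0 : 0 < e by rewrite /e; lra.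
pose E := Num.max D D' + 1.
near=> n => z Q Q' zl [iQ rQ dQ lQ wQ] dQ' lQ'.
apply: lt_le_trans wQ.
have lm0 : 0 <= ln (mz Q) by rewrite lnmz_ge0 // irrz_neq0.
have d0 : 0 < (size Q).-1%:R :> R by rewrite ltr0n irrz_deg_gt0.
have pge (c : R) : 0 <= pw n c by exact: pw_ge0.
have hl : ln (2 * ((size Q).-1 + (size Q').-1)%:R) <= pw n e.
 rewrite -[leLHS]mul1r; have : 2 * ((size Q).-1 + (size Q').-1)%:R <= pw n E.
  have f : 4 * pw n (Num.max D D') <= pw n E by near: n; apply: near_pw; rewrite /E ltrDl.
  apply: le_trans f; rewrite natrD.
  have : pw n D <= pw n (Num.max D D') by apply: ler_pw; rewrite le_max lexx.
  have : pw n D' <= pw n (Num.max D D') by apply: ler_pw; rewrite le_max lexx orbT.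
  by lra_from dQ, dQ'.
 by move: (_ * _); near: n; apply: near_ln_pw.
have X : 4 * ln (mx1 z) + 2 + 4 * ln (2 * ((size Q).-1 + (size Q').-1)%:R) <= 10 * pw n (l + e).
 have q1 : pw n l <= pw n (l + e) by apply: ler_pw; rewrite lerDl ltW.
 have q2 : pw n e <= pw n (l + e) by apply: ler_pw; rewrite lerDr.
 have q3 : 1 <= pw n (l + e) by apply: pw_ge1; rewrite addr_ge0 // ltW.
 by lra_from zl, hl, q1, q2, q3.
have f1 : 4 * pw n H' <= pw n a by near: n; apply: near_pw.
have f2 : 40 * pw n (D' + (l + e)) <= pw n a by near: n; apply: near_pw; rewrite /e; lra.
have f3 : pw n D' <= pw n b by apply: ler_pw; exact: ltW.
have g1 : (size Q').-1%:R * ln (mz Q) <= ln (mz Q) * pw n b.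
 by rewrite mulrC ler_wpM2l // (le_trans dQ').
have g2 : (size Q').-1%:R * (4 * ln (mx1 z) + 2 + 4 * ln (2 * ((size Q).-1 + (size Q').-1)%:R)) <= pw n a / 4.
 have : (size Q').-1%:R * (10 * pw n (l + e)) <= pw n D' * (10 * pw n (l + e)) by rewrite ler_wpM2r ?mulr_ge0.
 have := ler_wpM2l (ler0n R (size Q').-1) X; rewrite (pwD n D') in f2; lra_from f2.
have g3 : ln (mz Q') <= pw n a / 4 by lra_from lQ', f1.
have g4 := ler_wpM2l (ltW d0) (lerD g3 g2); have g5 := mulr_gt0 d0 (pw_gt0 n a).
move: g1 g4 g5; clear; rewrite -mulrA; set Y := _ * (_ + _ + _); lra.
Unshelve. all: by end_near. Qed.

Lemma near_approximant_eq D H a b D' H' a' b' l : 0 <= l -> H' < a -> D' + l < a -> D' < b ->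
 H < a' -> D + l < a' -> D < b' -> \forall n \near \oo, forall z Q Q', ln (mx1 z) <= pw n l ->
 approximant z D H a b n Q -> approximant z D' H' a' b' n Q' -> Q = Q'.
Proof.
move=> l0 h1 h2 h3 h4 h5 h6; near=> n => z Q Q' zl aQ aQ'.
have [iQ rQ dQ lQ _] := aQ; have [iQ' rQ' dQ' lQ' _] := aQ'.
apply: contrapT => ne; have ny y : root (polyC Q) y -> ~~ root (polyC Q') y.
 by move=> r; apply/negP => r'; apply: ne; apply: (irrz_eq iQ iQ' r r').
have := resultant_wt (irrz_deg_gt0 iQ) (irrz_deg_gt0 iQ') rQ rQ' ny.
have b1 : (size Q').-1%:R * ln (mz Q) + (size Q).-1%:R * ln (mz Q') +
  (size Q).-1%:R * (size Q').-1%:R * (4 * ln (mx1 z) + 2 + 4 * ln (2 * ((size Q).-1 + (size Q').-1)%:R)) < wt z Q.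
 by move: z Q Q' zl aQ dQ' lQ' {aQ' iQ' iQ rQ dQ lQ rQ' ne ny}; near: n; apply: near_resultant_lt.
have b2 : (size Q).-1%:R * ln (mz Q') + (size Q').-1%:R * ln (mz Q) +
  (size Q').-1%:R * (size Q).-1%:R * (4 * ln (mx1 z) + 2 + 4 * ln (2 * ((size Q').-1 + (size Q).-1)%:R)) < wt z Q'.
 by move: z Q' Q zl aQ' dQ lQ {aQ iQ iQ' rQ dQ' lQ' rQ' ne ny b1}; near: n; apply: near_resultant_lt.
rewrite [(size Q').-1%:R * (size Q).-1%:R]mulrC [((size Q').-1 + _)%N]addnC [_ * ln (mz Q') + _]addrC in b2.
by rewrite leNgt lt_min b1 b2.
Unshelve. all: by end_near. Qed.

Lemma near_const (T : Type) (u : nat -> T) : (\forall n \near \oo, u n.+1 = u n) -> exists v, \forall n \near \oo, u n = v.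
Proof.
case=> N _ h; exists (u N); exists N => // n /= /subnK <-.
elim: (n - N)%N => // k IH; rewrite addSn h //=; apply: leq_addl.
Qed.

Lemma near_shift (P : nat -> Prop) : (\forall n \near \oo, P n) -> \forall n \near \oo, P n.+1.
Proof. by case=> N _ h; exists N => // n /= Nn; apply: h; apply: leqW. Qed.

Lemma near_choice (T : Type) (v0 : T) (P : nat -> T -> Prop) : (\forall n \near \oo, exists v, P n v) ->
 exists u, \forall n \near \oo, P n (u n).
Proof.
move=> h; have /boolp.choice [u hu] : forall n, exists v, (exists v, P n v) -> P n v.
 by move=> n; have [[v hv]|hn] := boolp.EM (exists v, P n v); [exists v | exists v0].
by exists u; apply: filterS h => n; exact: hu.
Qed.

Lemma wt_not_unbounded z Q a : 0 < a -> ~ (\forall n \near \oo, pw n a <= wt z Q).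
Proof.
move=> a0 h; have h2 : \forall n \near \oo, wt z Q + 1 <= pw n a by apply: near_pw_ge.
have [n [h3 h4]] := filter_ex (filterI h h2); have := le_trans h4 h3; lra.
Qed.

Lemma approximant_wt z D H a b n Q : approximant z D H a b n Q -> pw n a <= wt z Q.
Proof.
case=> iQ rQ _ _; apply: le_trans; rewrite -[leLHS]addr0 lerD //.
 by rewrite ler_peMl ?pw_ge0 // ler1n irrz_deg_gt0.
by rewrite mulr_ge0 ?pw_ge0 // lnmz_ge0 // irrz_neq0.
Qed.

(** Approximants of consecutive levels are both very small at [z], hence equal; so one polynomial
    serves at all large levels, although its weight at [z] is a fixed number. *)
Lemma approximant_chain (S : finType) (D H a b : S -> R) z (st : nat -> S) (Q : nat -> {poly int}) :
 (\forall n \near \oo, approximant z (D (st n)) (H (st n)) (a (st n)) (b (st n)) n (Q n)) ->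
 (\forall n \near \oo, forall s s', (s, s') = (st n, st n.+1) \/ (s', s) = (st n, st n.+1) ->
   [/\ H s' < a s, D s' < a s & D s' < b s]) ->
 (forall s, 0 < a s) -> False.
Proof.
move=> hA hadj a0.
(* Finitely many states allow a uniform margin [e], which pays for rewriting an approximant of level
   [n+1] at level [n]. Inequalities that fail for a pair of states contribute the harmless value
   1. *)
have gap : exists2 e, 0 < e & forall s s' : S, [/\ H s' < a s, D s' < a s & D s' < b s] ->
  [/\ H s' + 4 * e < a s, D s' + 4 * e < a s & D s' + 4 * e < b s] /\ e < a s.
 pose F (p : S * S) : R := Num.min (a p.1) (Num.min (if H p.2 < a p.1 then a p.1 - H p.2 else 1)
  (Num.min (if D p.2 < a p.1 then a p.1 - D p.2 else 1) (if D p.2 < b p.1 then b p.1 - D p.2 else 1))).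
 have F0 p : 0 < F p.
  by rewrite /F !lt_min a0 /=; apply/and3P; split; case: ifP => //; rewrite subr_gt0.
 have [e e0 he] : exists2 e, 0 < e & forall p, e < F p.
  have : exists2 e, 0 < e & forall p, p \in enum {: S * S} -> e < F p.
   elim: (enum _) => [|p l [e e0 IH]]; first by exists 1.
   exists (Num.min e (F p / 2)); first by rewrite lt_min e0 divr_gt0.
   move=> p'; rewrite inE => /predU1P[->|/IH h]; first by rewrite gt_min; apply/orP; right; have := F0 p; lra.
   by rewrite gt_min h.
  by case=> e e0 he; exists e => // p; apply: he; rewrite mem_enum.
 exists (e / 8); first by rewrite divr_gt0.
 move=> s s' [h1 h2 h3]; have := he (s, s'); rewrite /F /= h1 h2 h3 !lt_min => /and4P[q1 q2 q3 q4].
 by split; [split|]; lra.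
case: gap => e e0 he.
have link : \forall n \near \oo, forall s s', [/\ H s' < a s, D s' < a s & D s' < b s] ->
  [/\ H s < a s', D s < a s' & D s < b s'] -> forall Q Q', approximant z (D s) (H s) (a s) (b s) n Q ->
  approximant z (D s') (H s') (a s') (b s') n.+1 Q' -> Q = Q'.
 suff : forall p : S * S, \forall n \near \oo, [/\ H p.2 < a p.1, D p.2 < a p.1 & D p.2 < b p.1] ->
  [/\ H p.1 < a p.2, D p.1 < a p.2 & D p.1 < b p.2] -> forall Q Q', approximant z (D p.1) (H p.1) (a p.1) (b p.1) n Q ->
  approximant z (D p.2) (H p.2) (a p.2) (b p.2) n.+1 Q' -> Q = Q'.
  by move=> /filter_forall; apply: filterS => n h s s'; exact: (h (s, s')).
 move=> [s s'] /=.
 have [h|h] := pselect [/\ H s' < a s, D s' < a s & D s' < b s]; last by near=> n => /h.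
 have [h'|h'] := pselect [/\ H s < a s', D s < a s' & D s < b s']; last by near=> n => _ /h'.
 have [[q1 q2 q3] q4] := he _ _ h; have [[r1 r2 r3] r4] := he _ _ h'.
 near=> n => _ _ Q1 Q2 h1 h2.
 have h3 : approximant z (D s' + e) (H s' + e) (a s' - e) (b s' - e) n Q2.
  suff : forall z' Q', approximant z' (D s') (H s') (a s') (b s') n.+1 Q' ->
   approximant z' (D s' + e) (H s' + e) (a s' - e) (b s' - e) n Q' by apply.
  by near: n; apply: near_approximant_succ.
 have zl : ln (mx1 z) <= pw n e by near: n; apply: near_pw_ge.
 suff : forall z' Q Q', ln (mx1 z') <= pw n e -> approximant z' (D s) (H s) (a s) (b s) n Q ->
  approximant z' (D s' + e) (H s' + e) (a s' - e) (b s' - e) n Q' -> Q = Q' by apply; eassumption.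
 near: n; apply: near_approximant_eq; clear -e0 q1 q2 q3 q4 r1 r2 r3 r4; lra.
have Qc : \forall n \near \oo, Q n.+1 = Q n.
 have hA' := near_shift hA.
 near=> n; near_have n link => hl; near_have n hadj => had.
 apply/esym/(hl (st n) (st n.+1)); [by apply: had; left | by apply: had; right | by near: n | by near: n].
have [Q0 hQ0] := near_const Qc.
apply: (@wt_not_unbounded z Q0 e e0); near=> n.
have <- : Q n = Q0 by near: n.
have hn : approximant z (D (st n)) (H (st n)) (a (st n)) (b (st n)) n (Q n) by near: n.
apply: le_trans (approximant_wt hn); apply: ler_pw.
near_have n hadj => had.
by have [_ /ltW] := he _ _ (had (st n) (st n.+1) (or_introl erefl)).
Unshelve. all: by end_near. Qed.

End Approximants.

(** * The case [sigma = 0] *)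

Section SigmaZero.
Variables (R : realType) (m : nat) (xi : 'I_m -> R[i]).
Variables (be ta nu ka : R).
Notation polyC := (map_poly (intr : int -> R[i])).
Notation mz Q := (mah (polyC Q)).
Notation algebraic z := (algebraicOver (ratr : rat -> R[i]) z).
Ltac clr := clear -R m xi be ta nu ka.

Lemma lvx0 n : lvx (0 : R) n = 1%N. Proof. by rewrite /lvx pw0 truncn1. Qed.

Lemma near_single_point k : ~ algebraic (xi k) -> 0 < ka -> 0 <= ta -> ta + ka <= 1 -> 1 <= be ->
 1 + be + ka < ta + nu -> \forall n \near \oo, forall P, small_at xi 0 be ta nu n P ->
 exists Q, approximant (xi k) (1 - ta + ka) (be - ta + ka) (nu - 1 - ka) (nu - be - ka) n Q.
Proof.
move=> tr k0 ta0 tk b1 key; near=> n => P sm.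
have pge (a : R) : 0 <= pw n a by exact: pw_ge0.
have n0 : (0 < n)%N by near: n; apply: near_ge1.
have pn : pw n 1 = n%:R :> R by apply: pw1.
have A1E : lvA (0 : R) n = 1%N := lvx0 n.
have [G [c [s [c0 hs GE [dvd _] MI]]]] : exists G c s, [/\ c != 0, forall q, q \in s -> irrz q, G = c *: \prod_(q <- s) q,
  seq_dvd ta [:: 1%N] n P G /\ (exists A, 0 = G * A) &
  forall (S : nat) (Z : nat -> 'I_m -> nat),
   pw n (0 - ka) <= S%:R -> S%:R <= pw n (0 + ka) ->
   (forall l k, (l < S)%N -> (Z l k <= lvx (0 : R) n)%N) ->
   (forall l, (l < S)%N -> expR (- pw n (nu - ta - ka)) <=
     \prod_(0 <= l' < l) cab (mon xi (Z l) - mon xi (Z l'))) ->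
   exists2 l, (l < S)%N & cab (polyC G).[mon xi (Z l)] < expR (- (pw n nu / 2))].
 have hI : forall P (H : {poly int}), small_at xi 0 be ta nu n P -> ((size H).-1 <= n * lvA (0 : R) n)%N -> n1 (polyC H) <= expR (4 * pw n be) ->
  (forall i k, (forall j, (i j <= lvx (0 : R) n)%N) -> (k < lvt ta n)%N -> cab ((polyC H)^`N(k)).[mon xi i] <= expR (- pw n nu)) ->
  exists G c s, [/\ c != 0, forall q, q \in s -> irrz q, G = c *: \prod_(q <- s) q,
  seq_dvd ta [:: 1%N] n P G /\ (exists A, H = G * A) &
  forall (S : nat) (Z : nat -> 'I_m -> nat),
   pw n (0 - ka) <= S%:R -> S%:R <= pw n (0 + ka) ->
   (forall l k, (l < S)%N -> (Z l k <= lvx (0 : R) n)%N) ->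
   (forall l, (l < S)%N -> expR (- pw n (nu - ta - ka)) <=
     \prod_(0 <= l' < l) cab (mon xi (Z l) - mon xi (Z l'))) ->
   exists2 l, (l < S)%N & cab (polyC G).[mon xi (Z l)] < expR (- (pw n nu / 2))].
  near: n; apply: (@near_interp _ _ xi 0 0 0 be ta nu ka (fun=> [:: 1%N]) 0) => //; try by (lra_from k0, ta0, tk, b1, key).
  near=> n; split=> //; first by exists 1%N.
  by move=> p; rewrite inE => /eqP ->; have -> : lvA (0 : R) n = 1%N := lvx0 n.
 apply: hI => //; rewrite ?size_poly0 ?rmorph0 ?n1_0 ?expR_ge0 // => i k' _ _.
 by rewrite linear0 horner0 cab0 expR_ge0.
have hz : mon xi (fun j => (j == k) : nat) = xi k.
 by rewrite /mon (bigD1 k) //= eqxx expr1 big1 ?mulr1 // => j /negPf ->.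
have [||||l _] := MI 1%N (fun _ j => (j == k) : nat).
- by rewrite sub0r -[leRHS](pw0 R n); apply: ler_pw; lra_from k0.
- by rewrite add0r pw_ge1 // ltW.
- by move=> l j _; rewrite lvx0; case: (j == k).
- by move=> l; rewrite ltnS leqn0 => /eqP ->; rewrite big_geq // -[leRHS]expR0 ler_expR oppr_le0.
rewrite hz; set z := xi k in tr * => Gz.
have nz q : q \in s -> q != 0 /\ ~~ root (polyC q) z.
 move=> qs; have q0 := irrz_neq0 (hs q qs); split=> //.
 by apply/negP => r; apply: tr; apply: minpoly_algebraic r.
have lm0 q : q \in s -> 0 <= ln (mz q) by move=> /hs /irrz_neq0 /(lnmz_ge0 R).
have G0 : G != 0 by rewrite GE -mul_polyC mulf_neq0 ?polyC_eq0 // prodf_seq_neq0; apply/allP => q /nz [].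
have Gr : 0 < cab (polyC G).[z].
 rewrite cab_gt0 GE map_polyZ rmorph_prod hornerZ horner_prod mulf_neq0 ?intr_eq0 //.
 by rewrite prodf_seq_neq0; apply/allP => q /nz [].
have h1 : pw n nu / 2 <= \sum_(q <- s) wt z q.
 rewrite -(wt_scaled_prod c0 nz) -GE /wt.
 have := lnmz_ge0 R G0; have := mulr_ge0 (ler0n R (size G).-1) (ln2mx1_ge0 z).
 have : pw n nu / 2 <= - ln (cab (polyC G).[z]).
  by rewrite lerNr -[leRHS]expRK ler_ln ?posrE ?expR_gt0 // ltW.
 by clr; lra.
have [P0 dP _ _] := sm.
have [A0 PE] : exists A0, P = G * A0.
 by have [A0] := dvd 1%N 0%N (mem_head _ _) isT; rewrite nderivn0 expr1 comp_polyXr => ->; exists A0.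
have A00 : A0 != 0 by apply: contra_neq P0 => e; rewrite PE e mulr0.
have dG : \sum_(q <- s) (size q).-1%:R <= n%:R :> R.
 rewrite -natr_sum ler_nat; apply: leq_trans dP; rewrite PE mulrC.
 rewrite -(deg_scaled_prod c0) => [|q /nz [] //]; rewrite -GE; apply: degree_dvd_le.
 by rewrite mulrC -PE.
have lmP : ln (mz P) <= 2 * pw n be.
 apply: le_trans (lnmz_small sm) _.
 have q1 : ln n.+1%:R <= n%:R :> R.
  by have := expR_ge1Dx (ln n.+1%:R : R); rewrite lnK ?posrE // -natr1; clr; lra.
 have q2 : pw n 1 <= pw n be by apply: ler_pw.
 by rewrite pn in q2; lra_from q1, q2.
have lG : \sum_(q <- s) ln (mz q) <= 2 * pw n be.
 apply: le_trans lmP; rewrite PE lnmzM // -[leLHS]addr0 lerD ?lnmz_ge0 // GE.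
 by apply: lnmz_scaled_prod => // q /nz [].
have [q qs hq] : exists2 q, q \in s & (size q).-1%:R * pw n (nu - 1 - ka) + ln (mz q) * pw n (nu - be - ka) <= wt z q.
 apply: contrapT => hn; suff : \sum_(q <- s) wt z q <= n%:R * pw n (nu - 1 - ka) + 2 * pw n be * pw n (nu - be - ka).
  rewrite -pn -pwD -mulrA -pwD (_ : 1 + (nu - 1 - ka) = nu - ka); last by ring.
  rewrite (_ : be + (nu - be - ka) = nu - ka); last by ring.
  have h2 : 16 * pw n (nu - ka) <= pw n nu by near: n; apply: near_pw; lra_from k0.
  by have := pw_gt0 n nu; lra_from h1, h2.
 apply: le_trans (lerD (ler_wpM2r (pge _) dG) (ler_wpM2r (pge _) lG)).
 rewrite !mulr_suml -big_split /= big_seq [leRHS]big_seq; apply: ler_sum => q qs.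
 by rewrite leNgt; apply/negP => /ltW lt; apply: hn; exists q.
have iq := hs q qs; have [q0 rq] := nz q qs.
have [c' [s' [c'0 hs' PE']]] := irrz_factorization P0.
(* [G] divides all [P^[j]] with [j < t], so [P] vanishes to order [t] at each root of [q]. *)
have tq : (lvt ta n <= count_mem q s')%N.
 have [y ry] := irrz_root R iq; rewrite -(count_scaled_mup c'0 hs' iq ry) -PE'.
 apply: nderiv_mup; first exact: polyC_neq0.
 move=> j jt; have [B] := dvd 1%N j (mem_head _ _) jt; rewrite expr1 comp_polyXr => E.
 rewrite nderivn_map E GE (big_rem q) //= scalerAr -mulrA rmorphM hornerM; move/rootP: ry => ->.
 by rewrite mul0r.
have [t1 _] : pw n ta / 3 <= (lvt ta n)%:R /\ True by have /andP[] := lvt_bounds n ta0.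
have tF (f : {poly int} -> R) : (forall q, q \in s' -> 0 <= f q) -> (lvt ta n)%:R * f q <= \sum_(q <- s') f q.
 move=> f0; rewrite (bigID (pred1 q)) /= -[leLHS]addr0 lerD //; last first.
  by rewrite big_seq_cond; apply: sumr_ge0 => q' /andP[/f0].
 rewrite (eq_bigr (fun=> f q)) => [|q' /eqP -> //].
 rewrite big_const_seq iter_addr_0 -[leRHS]mulr_natl ler_wpM2r ?ler_nat //.
 by apply: f0; rewrite -has_pred1 has_count (leq_trans _ tq).
exists q; split=> //.
- have h2 : (lvt ta n)%:R * (size q).-1%:R <= n%:R :> R.
  apply: le_trans (tF (fun q => (size q).-1%:R) _) _ => //.
  rewrite -natr_sum ler_nat; apply: leq_trans dP; rewrite PE' deg_scaled_prod // => q' /hs' /irrz_neq0 //.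
 have h3 : 3 * pw n (1 - ta) <= pw n (1 - ta + ka) by near: n; apply: near_pw; lra_from k0.
 apply: le_trans h3; rewrite -(ler_pM2r (pw_gt0 n ta)) -mulrA -pwD subrK pn.
 by have := ler_wpM2r (ler0n R (size q).-1) t1; lra_from h2.
- have l's q' : q' \in s' -> 0 <= ln (mz q') by move=> /hs' /irrz_neq0 /(lnmz_ge0 R).
 have h2 : (lvt ta n)%:R * ln (mz q) <= 2 * pw n be.
  apply: le_trans (tF (fun q => ln (mz q)) l's) _; apply: le_trans lmP.
  by rewrite [in leRHS]PE'; apply: lnmz_scaled_prod => // q' /hs' /irrz_neq0.
 have h3 : 6 * pw n (be - ta) <= pw n (be - ta + ka) by near: n; apply: near_pw; lra_from k0.
 apply: le_trans h3; rewrite -(ler_pM2r (pw_gt0 n ta)) -mulrA -pwD subrK.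
 by have := ler_wpM2r (lm0 q qs) t1; lra_from h2.
Unshelve. all: by end_near. Qed.

End SigmaZero.

Lemma sigma0_absurd (R : realType) m (xi : 'I_m -> R[i]) (be ta nu : R) k :
 ~ algebraicOver (ratr : rat -> R[i]) (xi k) -> 0 <= ta -> ta < 1 -> 1 <= be -> 1 + be - ta < nu ->
 ~ (\forall n \near \oo, exists P, small_at xi 0 be ta nu n P).
Proof.
move=> tr ta0 ta1 b1 key hP.
pose ka := Num.min (1 - ta) (nu + ta - 1 - be) / 4.
have [k0 [k1 k2]] : 0 < ka /\ 4 * ka <= 1 - ta /\ 4 * ka <= nu + ta - 1 - be.
 rewrite /ka; have h1 : Num.min (1 - ta) (nu + ta - 1 - be) <= 1 - ta by rewrite ge_min lexx.
 have h2 : Num.min (1 - ta) (nu + ta - 1 - be) <= nu + ta - 1 - be by rewrite ge_min lexx orbT.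
 have : 0 < Num.min (1 - ta) (nu + ta - 1 - be) by rewrite lt_min !subr_gt0 ta1 /=; lra.
 by lra.
have hA : \forall n \near \oo, exists Q, approximant (xi k) (1 - ta + ka) (be - ta + ka) (nu - 1 - ka) (nu - be - ka) n Q.
 have h : \forall n \near \oo, forall P, small_at xi 0 be ta nu n P ->
  exists Q, approximant (xi k) (1 - ta + ka) (be - ta + ka) (nu - 1 - ka) (nu - be - ka) n Q.
  by apply: near_single_point => //; lra.
 near=> n; have [P sP] : exists P, small_at xi 0 be ta nu n P by near: n.
 by have := sP; move: P {sP}; near: n.
have [Q hQ] : exists Q : nat -> {poly int}, \forall n \near \oo,
  approximant (xi k) (1 - ta + ka) (be - ta + ka) (nu - 1 - ka) (nu - be - ka) n (Q n).
 case: hA => N _ h; have : forall n, exists q, (N <= n)%N -> approximant (xi k) (1 - ta + ka) (be - ta + ka) (nu - 1 - ka) (nu - be - ka) n q.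
  by move=> n; have [/h [q hq]|_] := leqP N n; [exists q | exists 0].
 by case/boolp.choice => Q hQ; exists Q; exists N => // n; exact: hQ.
apply: (@approximant_chain R unit (fun=> 1 - ta + ka) (fun=> be - ta + ka) (fun=> nu - 1 - ka) (fun=> nu - be - ka) (xi k) (fun=> tt) Q hQ).
 by near=> n => s s' _; split; clear -k0 k1 k2 b1 ta0; lra.
by move=> _; lra.
Unshelve. all: by end_near. Qed.

(** * Norms to [Q(th)] by matrices over the integer polynomials *)

Definition evz (F : comNzRingType) (th : F) : {poly int} -> F := horner_eval th \o map_poly intr.
HB.instance Definition _ (F : comNzRingType) (th : F) := GRing.RMorphism.on (evz th).

Section Systems.
Variables (F : fieldType) (m : nat) (th : F) (xi : 'I_m -> F).
Local Notation ev := (evz th).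
Local Notation evm := (map_mx (evz th)).
Hypothesis tr : forall p, ev p = 0 -> p = 0.

(** The entries of [e] span a module over [Z[th]] on which multiplication by [c * xi k] acts through
    [B k]. The denominator [c] keeps all matrices over integer polynomials. *)
Definition module_system D (e : 'cV[F]_D) (c : {poly int}) (B : 'I_m -> 'M[{poly int}]_D) :=
 [/\ e != 0, c != 0 & forall k, (ev c * xi k) *: e = evm (B k) *m e].

Definition free_system D (e : 'cV[F]_D) := forall r : 'rV[{poly int}]_D, evm r *m e = 0 -> r = 0.

(* A relation over Z[th] between the entries of e eliminates one of them. *)
Lemma free_module_system D (e : 'cV[F]_D) c B : module_system e c B ->
 exists D' (e' : 'cV[F]_D') c' B', module_system e' c' B' /\ free_system e'.
Proof.
elim: D e c B => [|D IH] e c B [e0 c0 h].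
 by case/negP: e0; apply/eqP/matrixP => -[].
have [fr|/existsNP [r /not_implyP [re r0]]] := pselect (free_system e).
 by exists D.+1, e, c, B.
have [j0 rj] : exists j, r 0 j != 0.
 apply: contrapT => hn; apply: r0; apply/rowP => j; rewrite mxE.
 by apply/eqP/negPn/negP => nz; apply: hn; exists j.
have re0 : ev (r 0 j0) * e j0 0 + \sum_l ev (r 0 (lift j0 l)) * e (lift j0 l) 0 = 0.
 have := congr1 (fun M : 'M_(1, 1) => M 0 0) re; rewrite !mxE (bigD1_ord j0) //= mxE => E.
 by rewrite -[RHS]E; congr (_ + _); apply: eq_bigr => l _; rewrite mxE.
have rel : ev (r 0 j0) * e j0 0 = - \sum_l ev (r 0 (lift j0 l)) * e (lift j0 l) 0.
 by apply/eqP; rewrite -addr_eq0 re0.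
apply: (IH (\col_l e (lift j0 l) 0) (c * r 0 j0)
 (fun k => \matrix_(l, l') (r 0 j0 * B k (lift j0 l) (lift j0 l') - B k (lift j0 l) j0 * r 0 (lift j0 l')))).
split; last 1 first.
- move=> k; apply/matrixP => l i; rewrite ord1 !mxE.
 have := h k => /matrixP/(_ (lift j0 l) 0); rewrite !mxE (bigD1_ord j0) //= !mxE => hl.
 transitivity (ev (r 0 j0) * (ev c * xi k * e (lift j0 l) 0)); first by rewrite rmorphM; ring.
 rewrite hl mulrDr mulrCA rel mulrN !mulr_sumr -sumrN -big_split /=.
 by apply: eq_bigr => l' _; rewrite !mxE rmorphB !rmorphM; ring.
- apply: contra e0 => /eqP /matrixP h0; apply/eqP/matrixP => l i; rewrite ord1 !mxE.
 have hl l' : e (lift j0 l') 0 = 0 by have := h0 l' 0; rewrite !mxE.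
 have [l' ->|->] := unliftP j0 l; first exact: hl.
 have : ev (r 0 j0) * e j0 0 = 0 by rewrite rel big1 ?oppr0 // => l' _; rewrite hl mulr0.
 by move=> /eqP; rewrite mulf_eq0 => /orP[/eqP /tr /eqP|/eqP //]; rewrite (negPf rj).
by rewrite mulf_neq0.
Qed.

Definition alg_over_th (x : F) := exists (p : nat -> {poly int}) n, [/\ (0 < n)%N, p n != 0 & \sum_(i < n.+1) ev (p i) * x ^+ i = 0].

Lemma alg_common_degree : (forall k, alg_over_th (xi k)) -> exists n (p : 'I_m -> nat -> {poly int}),
 (0 < n)%N /\ forall k, p k n != 0 /\ \sum_(i < n.+1) ev (p k i) * xi k ^+ i = 0.
Proof.
move=> h; have /boolp.choice [f hf] : forall k, exists pn : (nat -> {poly int}) * nat,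
  [/\ (0 < pn.2)%N, pn.1 pn.2 != 0 & \sum_(i < pn.2.+1) ev (pn.1 i) * xi k ^+ i = 0].
 by move=> k; have [p [n hp]] := h k; exists (p, n).
pose N := (\sum_k (f k).2).+1.
have leN k : ((f k).2 <= N)%N by apply: leq_trans (leqnSn _); rewrite (bigD1 k) //= leq_addr.
(* Each equation is multiplied by a power of [xi k] to reach the common degree [N], so its
   coefficients are shifted and padded by 0. *)
exists N, (fun k i => if (i < N - (f k).2)%N then 0 else (f k).1 (i - (N - (f k).2))%N); split=> // k.
have [n0 pn0 s0] := hf k; set d := (N - (f k).2)%N.
have Nd : N = (d + (f k).2)%N by rewrite /d subnK.
rewrite {1 2}Nd addKn ltnNge leq_addr /=; split=> //.
rewrite -(big_mkord xpredT (fun i => ev (if (i < d)%N then 0 else (f k).1 (i - d)%N) * xi k ^+ i)).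
rewrite Nd -addnS (big_cat_nat (n := d)) ?leq_addr //= big_nat_cond big1 ?add0r => [|i /andP[/andP[_ ->] _]]; last by rewrite rmorph0 mul0r.
rewrite -{1}[d]add0n big_addn [(d + _)%N]addnC addnK big_mkord.
transitivity (xi k ^+ d * \sum_(i < (f k).2.+1) ev ((f k).1 i) * xi k ^+ i); last by rewrite s0 mulr0.
rewrite mulr_sumr.
by apply: eq_bigr => i _; rewrite ltnNge leq_addl /= addnK exprD mulrA mulrC.
Qed.

(** Take the monomials with bounded exponents. Multiplication by [xi k] raises an exponent or, at
    the top, is rewritten by the equation of [xi k]; [c] is the product of all leading
    coefficients. *)
Lemma exists_module_system : (forall k, alg_over_th (xi k)) ->
 exists D (e : 'cV[F]_D) c B, module_system e c B.
Proof.
case/alg_common_degree => n [p [n0 hp]].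
case: n n0 hp => // n _ hp; pose J := {ffun 'I_m -> 'I_n.+1}.
pose mo (a : J) := \prod_k xi k ^+ a k.
pose upd (a : J) k (i : 'I_n.+1) : J := [ffun l => if l == k then i else a l].
pose ck k := \prod_(l | l != k) p l n.+1.
pose c := \prod_l p l n.+1.
have cE k : c = p k n.+1 * ck k by rewrite /c (bigD1 k).
have moE a k : mo a = xi k ^+ a k * \prod_(l | l != k) xi l ^+ a l by rewrite /mo (bigD1 k).
have moU a k i : mo (upd a k i) = xi k ^+ i * \prod_(l | l != k) xi l ^+ a l.
 rewrite (moE _ k) ffunE eqxx; congr (_ * _); apply: eq_bigr => l /negPf lk; by rewrite ffunE lk.
have upd_inj a k : injective (upd a k).
 by move=> i j /ffunP/(_ k); rewrite !ffunE eqxx.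
pose b k (a a' : J) : {poly int} := \sum_(i < n.+1)
 (if (a k < n)%N then (if (i == (a k).+1 :> nat) then c else 0) else - (ck k * p k i)) * (a' == upd a k i)%:R.
have hb k a : ev c * xi k * mo a = \sum_a' ev (b k a a') * mo a'.
 have -> : \sum_a' ev (b k a a') * mo a' = \sum_(i < n.+1)
   ev (if (a k < n)%N then (if (i == (a k).+1 :> nat) then c else 0) else - (ck k * p k i)) * mo (upd a k i).
  under eq_bigr => a' _ do rewrite /b rmorph_sum mulr_suml.
  rewrite exchange_big /=; apply: eq_bigr => i _.
  rewrite (bigD1 (upd a k i)) //= eqxx mulr1 big1 ?addr0 // => a' /negPf ne.
  by rewrite ne mulr0 rmorph0 mul0r.
 have [an|an] := ltnP (a k) n.
  rewrite (bigD1 (Ordinal (an : ((a k).+1 < n.+1)%N))) //= eqxx big1 ?addr0.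
   by rewrite moU (moE a k) /= exprS; ring.
  by move=> i /negPf ni; rewrite ifF ?rmorph0 ?mul0r //; apply: negbTE; apply: contraFneq ni => e; apply/eqP/val_inj.
 have akn : a k = n :> nat by apply/eqP; rewrite eqn_leq an -ltnS ltn_ord.
 have [_] := hp k; rewrite big_ord_recr /= => /eqP; rewrite addr_eq0 => /eqP hk.
 rewrite (moE a k) akn (cE k) rmorphM; set Pr := \prod_(l | _) _.
 transitivity (ev (ck k) * Pr * (ev (p k n.+1) * xi k ^+ n.+1)); first by rewrite exprS; ring.
 move/eqP: hk; rewrite -eqr_oppLR => /eqP <-; rewrite mulrN -mulNr mulr_sumr; apply: eq_bigr => i _.
 by rewrite moU rmorphN rmorphM -/Pr; ring.
exists #|{: J}|, (\col_i mo (enum_val i)), c, (fun k => \matrix_(i, j) b k (enum_val i) (enum_val j)).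
split.
- apply/negP => /eqP /matrixP /(_ (enum_rank ([ffun=> ord0] : J)) 0); rewrite !mxE enum_rankK /mo.
 by rewrite big1 => [/eqP|k _]; rewrite ?oner_eq0 // ffunE expr0.
- by apply/prodf_neq0 => k _; case: (hp k).
move=> k; apply/matrixP => i j; rewrite ord1 !mxE hb (reindex_onto (@enum_val J {: J}) enum_rank) /=; last by move=> a _; rewrite enum_rankK.
by apply: eq_big => [l|l _]; rewrite ?enum_valK ?eqxx // !mxE.
Qed.


Variables (D : nat) (e : 'cV[F]_D.+1) (c : {poly int}) (B : 'I_m -> 'M[{poly int}]_D.+1).
Hypotheses (sys : module_system e c B) (fre : free_system e).

(** The complementary power of [c] gives all monomials the same denominator [c^V], so that their
    matrices can be added. *)
Definition mon_mx (V : nat) (a : 'I_m -> nat) : 'M[{poly int}]_D.+1 :=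
 c ^+ (V - \sum_k a k) *: \prod_k B k ^+ a k.

Lemma mon_mxE V a : (\sum_k a k <= V)%N -> evm (mon_mx V a) *m e = (ev c ^+ V * \prod_k xi k ^+ a k) *: e.
Proof.
have [_ _ h] := sys; move=> aV.
have hX k j : evm (B k ^+ j) *m e = (ev c * xi k) ^+ j *: e.
 elim: j => [|j IH]; first by rewrite !expr0 map_mx1 mul1mx scale1r.
 by rewrite !exprSr -mulmxE map_mxM -mulmxA -h -scalemxAr IH scalerA mulrC.
have hP (r : seq 'I_m) : evm (\prod_(k <- r) B k ^+ a k) *m e = (\prod_(k <- r) (ev c * xi k) ^+ a k) *: e.
 elim: r => [|k r IH]; first by rewrite !big_nil map_mx1 mul1mx scale1r.
 by rewrite !big_cons -mulmxE map_mxM -mulmxA IH -scalemxAr hX scalerA mulrC.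
rewrite /mon_mx map_mxZ -scalemxAl hP scalerA rmorphXn /=; congr (_ *: _).
rewrite -{2}(subnK aV) exprD -mulrA; congr (_ * _); rewrite -prodrXr -big_split /=.
by apply: eq_bigr => k _; rewrite exprMn.
Qed.

Variables (V s : nat) (q : 'I_s -> int) (a : 'I_s -> 'I_m -> nat).
Hypothesis aV : forall l, (\sum_k a l k <= V)%N.
Let lam := \sum_l (q l)%:~R * \prod_k xi k ^+ a l k.
Definition lin_mx := \sum_l (q l)%:P *: mon_mx V (a l).

Lemma evC (n : int) : ev n%:P = n%:~R.
Proof. by rewrite /evz /= map_polyC /= /horner_eval hornerC. Qed.

Lemma lin_mxE : evm lin_mx *m e = (ev c ^+ V * lam) *: e.
Proof.
rewrite /lin_mx map_mx_sum mulmx_suml /lam mulr_sumr scaler_suml; apply: eq_bigr => l _.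
by rewrite map_mxZ /= evC -scalemxAl mon_mxE // scalerA mulrCA.
Qed.

(** A vector in the kernel would be a relation over [Z[th]] between the entries of [e], because [e]
    is an eigenvector with non-zero eigenvalue. *)
Lemma det_lin_mx_neq0 : lam != 0 -> \det lin_mx != 0.
Proof.
move=> l0; apply/negP => /det0P [v v0 vM]; case/negP: v0; apply/eqP/fre.
have : evm v *m (evm lin_mx *m e) = 0 by rewrite mulmxA -map_mxM vM map_mx0 mul0mx.
rewrite lin_mxE -scalemxAr => /eqP; rewrite scaler_eq0 => /orP[|/eqP //].
have [_ c0 _] := sys; rewrite mulf_eq0 (negPf l0) orbF expf_eq0 => /andP[_ /eqP /tr /eqP].
by rewrite (negPf c0).
Qed.

(** Multiplication by the adjugate: the determinant contains [lam] as a factor, so it inherits its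
    smallness. *)
Lemma det_lin_mxE l0 : ev (\det lin_mx) * e l0 0 = ev c ^+ V * lam * \sum_l ev (\adj lin_mx l0 l) * e l 0.
Proof.
have : evm (\adj lin_mx) *m (evm lin_mx *m e) = ev (\det lin_mx) *: e.
 by rewrite mulmxA -map_mxM mul_adj_mx map_scalar_mx mul_scalar_mx.
rewrite lin_mxE -scalemxAr => /matrixP/(_ l0 0); rewrite !mxE => <-; congr (_ * _).
by apply: eq_bigr => l _; rewrite mxE.
Qed.

End Systems.

(** * Size of these norms *)

Section NormBound.
Variable R : realType.
Notation polyC := (map_poly (intr : int -> R[i])).
Notation mz Q := (mah (polyC Q)).

Definition bounded_mx n p (M : 'M[{poly int}]_(n, p)) (d : nat) (h : R) :=
 forall i j, (size (M i j) <= d.+1)%N /\ n1 (polyC (M i j)) <= h.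

Lemma bounded_mx_mul n (M N : 'M[{poly int}]_n) d d' h h' : bounded_mx M d h -> bounded_mx N d' h' ->
 bounded_mx (M *m N) (d + d') (n%:R * h * h').
Proof.
move=> hM hN i j; rewrite mxE; split.
 apply: leq_trans (size_sum _ _ _) _; apply/bigmax_leqP => k _; apply: leq_trans (size_polyMleq _ _) _.
 by have := leq_add (hM i k).1 (hN k j).1; rewrite addSn addnS; case: (_ + _)%N.
rewrite rmorph_sum; apply: le_trans (n1_sum _ _ _) _.
apply: (@le_trans _ _ (\sum_(k < n) h * h')).
 apply: ler_sum => k _; rewrite rmorphM; apply: le_trans (n1M _ _) _.
 by apply: ler_pM; rewrite ?n1_ge0 ?(hM i k).2 ?(hN k j).2.
by rewrite sumr_const card_ord -[leLHS]mulr_natl mulrA.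
Qed.

Lemma bounded_det n (M : 'M[{poly int}]_n) d h : bounded_mx M d h ->
 (size (\det M) <= (n * d).+1)%N /\ n1 (polyC (\det M)) <= n`!%:R * h ^+ n.
Proof.
move=> hM; rewrite /determinant; split.
 apply: leq_trans (size_sum _ _ _) _; apply/bigmax_leqP => sg _.
 apply: leq_trans (_ : size (\prod_i M i (sg i))%R <= _)%N.
  by case: (odd_perm sg); rewrite ?expr0 ?mul1r // expr1 mulN1r size_polyN.
 apply: leq_trans (size_prod_leq _ _) _; rewrite leq_subLR cardT size_enum_ord addnS ltnS -mulnS.
 rewrite -[in leqRHS](card_ord n) -sum_nat_const; apply: leq_sum => i _; exact: (hM _ _).1.
rewrite rmorph_sum; apply: le_trans (n1_sum _ _ _) _.
apply: (@le_trans _ _ (\sum_(sg : 'S_n) h ^+ n)); last by rewrite sumr_const card_Sn mulr_natl.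
apply: ler_sum => sg _; rewrite rmorphM rmorphXn rmorphN1 rmorph_prod; apply: le_trans (n1M _ _) _.
have -> : n1 ((- 1 : {poly R[i]}) ^+ sg) = 1.
 by case: (odd_perm sg); rewrite ?expr0 ?expr1 ?n1_1 // -scaleN1r n1Z cabN cab1 n1_1 mulr1.
rewrite mul1r; apply: le_trans (n1_prod _ _ _) _.
rewrite -[in leRHS](card_ord n) -prodr_const; apply: ler_prod => i _.
by rewrite n1_ge0 (hM _ _).2.
Qed.

Lemma cab_evz_le (p : {poly int}) th d h : (size p <= d.+1)%N -> n1 (polyC p) <= h -> cab (evz th p) <= h * mx1 th ^+ d.
Proof.
move=> sp hp; apply: (@le_trans _ _ (n1 (polyC p) * mx1 th ^+ d)).
 by apply: n1_horner; rewrite size_polyF.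
by rewrite ler_wpM2r // exprn_ge0 // (le_trans ler01) // mx1_ge1.
Qed.

Variables (m D : nat) (th : R[i]) (xi : 'I_m -> R[i]) (e : 'cV[R[i]]_D.+1) (c : {poly int}) (B : 'I_m -> 'M[{poly int}]_D.+1).
Hypotheses (tr : forall p, evz th p = 0 -> p = 0) (sys : module_system th xi e c B) (fre : free_system th e).
Variables (d : nat) (h : R).
Hypotheses (h1 : 1 <= h) (hB : forall k, bounded_mx (B k) d h) (hc1 : (size c <= d.+1)%N) (hc2 : n1 (polyC c) <= h).
Let H := D.+1%:R * h.

Let H0 : 0 <= H. Proof. by rewrite mulr_ge0 // (le_trans ler01). Qed.
Let hH : h <= H. Proof. by rewrite ler_peMl ?ler1n // (le_trans ler01). Qed.

Lemma bounded_mon_mx V a : (\sum_k a k <= V)%N -> bounded_mx (mon_mx c B V a) (V * d) (H ^+ V).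
Proof.
move=> aV.
have hX k j N d' h' : bounded_mx N d' h' -> bounded_mx (B k ^+ j * N) (j * d + d') (H ^+ j * h').
 elim: j => [|j IH] hN; first by rewrite !expr0 mul0n add0n !mul1r.
 by rewrite !exprS -mulrA mulSn -addnA -mulrA; apply: bounded_mx_mul (hB k) (IH hN).
have hP (r : seq 'I_m) : bounded_mx (\prod_(k <- r) B k ^+ a k) ((\sum_(k <- r) a k) * d) (H ^+ (\sum_(k <- r) a k)).
 elim: r => [|k r IH]; last by rewrite !big_cons mulnDl exprD; apply: hX.
 rewrite !big_nil mul0n expr0 => i j; rewrite mxE; case: (i == j); rewrite ?size_poly1 ?size_poly0 ?rmorph0 ?rmorph1 ?n1_1 ?n1_0 ?ler01 //.
have hcX j (p : {poly int}) d' h' : (size p <= d'.+1)%N -> n1 (polyC p) <= h' -> (size (c ^+ j * p)%R <= (j * d + d').+1)%N /\ n1 (polyC (c ^+ j * p)) <= H ^+ j * h'.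
 elim: j => [|j IH] sp np; first by rewrite mul1r mul0n expr0 mul1r.
 have [IH1 IH2] := IH sp np; rewrite !exprS -[c * _ * p]mulrA -[H * _ * h']mulrA; split.
  apply: leq_trans (size_polyMleq _ _) _; have := leq_add hc1 IH1; rewrite addSn addnS mulSn -addnA.
  by case: (_ + _)%N.
 rewrite rmorphM; apply: le_trans (n1M _ _) _; apply: ler_pM; rewrite ?n1_ge0 //; exact: le_trans hH.
rewrite /mon_mx => i j; rewrite mxE; have [P1 P2] := hP (index_enum 'I_m) i j.
by have := hcX (V - \sum_k a k)%N _ _ _ P1 P2; rewrite -mulnDl subnK // -exprD subnK.
Qed.

Variables (V s : nat) (q : 'I_s -> int) (a : 'I_s -> 'I_m -> nat).
Hypothesis aV : forall l, (\sum_k a l k <= V)%N.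
Let Qs : R := \sum_l `|q l|%:~R.

Lemma bounded_lin_mx : bounded_mx (lin_mx c B V q a) (V * d) (Qs * H ^+ V).
Proof.
move=> i j; rewrite /lin_mx summxE; split.
 apply: leq_trans (size_sum _ _ _) _; apply/bigmax_leqP => l _; rewrite mxE mul_polyC.
 by apply: leq_trans (size_scale_leq _ _) _; exact: (bounded_mon_mx (aV l) i j).1.
rewrite rmorph_sum /Qs mulr_suml; apply: le_trans (n1_sum _ _ _) _; apply: ler_sum => l _.
rewrite mxE rmorphM /= map_polyC; apply: le_trans (n1M _ _) _; rewrite n1C /= cab_int.
by rewrite ler_wpM2l ?ler0z // (bounded_mon_mx (aV l) i j).2.
Qed.

Lemma bounded_adj i j : (size (\adj (lin_mx c B V q a) i j) <= (D * (V * d)).+1)%N /\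
 n1 (polyC (\adj (lin_mx c B V q a) i j)) <= D`!%:R * (Qs * H ^+ V) ^+ D.
Proof.
rewrite mxE /cofactor; have := @bounded_det D (row' j (col' i (lin_mx c B V q a))) (V * d) (Qs * H ^+ V).
case=> [i' j'|b1 b2]; first by rewrite !mxE; exact: bounded_lin_mx.
split.
 by rewrite -signr_odd; case: (odd _); rewrite ?expr0 ?mul1r // expr1 mulN1r size_polyN.
rewrite -signr_odd rmorphM rmorphXn rmorphN1; apply: le_trans (n1M _ _) _.
have -> : n1 ((- 1 : {poly R[i]}) ^+ odd (j + i)) = 1.
 by case: (odd _); rewrite ?expr0 ?expr1 ?n1_1 // -scaleN1r n1Z cabN cab1 n1_1 mulr1.
by rewrite mul1r.
Qed.

End NormBound.

Section NormExists.
Variables (R : realType) (m : nat) (th : R[i]) (xi : 'I_m -> R[i]).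
Notation polyC := (map_poly (intr : int -> R[i])).
Notation mz Q := (mah (polyC Q)).

Lemma mx_bound n p (M : 'M[{poly int}]_(n, p)) : exists d h, 1 <= h /\ @bounded_mx R n p M d h.
Proof.
exists (\sum_i \sum_j size (M i j))%N, (1 + \sum_i \sum_j n1 (polyC (M i j))); split.
 by rewrite lerDl; apply: sumr_ge0 => i _; apply: sumr_ge0 => j _; apply: n1_ge0.
move=> i j; rewrite (bigD1 i) //= [in X in (_ <= X)%N /\ _](bigD1 j) //=; split.
 by rewrite -addnA -addnS leq_addr.
rewrite (bigD1 i) //= [\sum_(j <  p) _](bigD1 j) //= -[leLHS]add0r lerD // -addrA lerDl addr_ge0 //.
 by apply: sumr_ge0 => k _; apply: n1_ge0.
by apply: sumr_ge0 => k _; apply: sumr_ge0 => l _; apply: n1_ge0.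
Qed.

Lemma bounded_mx_le n p (M : 'M[{poly int}]_(n, p)) d d' (h h' : R) : (d <= d')%N -> h <= h' ->
 bounded_mx M d h -> bounded_mx M d' h'.
Proof.
move=> dd hh hM i j; have [h1 h2] := hM i j; split; last exact: le_trans hh.
by apply: leq_trans h1 _.
Qed.

Lemma ln_prod_le (K G Q : R) V n N : 1 <= K -> 1 <= G -> 1 <= Q -> (n <= N)%N ->
 ln (K * G ^+ V * Q ^+ n) <= ln K + V%:R * ln G + N%:R * ln Q.
Proof.
move=> K1 G1 Q1 nN; have pos (x : R) : 1 <= x -> 0 < x by apply: lt_le_trans.
have [K0 G0 Q0] : [/\ 0 < K, 0 < G & 0 < Q] by split; apply: pos.
rewrite lnM ?posrE ?mulr_gt0 ?exprn_gt0 // lnM ?posrE ?exprn_gt0 // !lnXn // -[ln G *+ V]mulr_natl -[ln Q *+ n]mulr_natl lerD2l.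
by rewrite ler_wpM2r ?ln_ge0 // ler_nat.
Qed.

(* The norm from Q(th, xi) to Q(th) of a value of an integer polynomial at xi. *)
Lemma norm_bound : (forall p, evz th p = 0 -> p = 0) -> (forall k, alg_over_th th (xi k)) ->
 exists C : R, 0 < C /\ forall V s (q : 'I_s -> int) (a : 'I_s -> 'I_m -> nat),
  (0 < V)%N -> (forall l, (\sum_k a l k <= V)%N) ->
  let lam := \sum_l (q l)%:~R * mon xi (a l) in let Qs : R := \sum_l `|q l|%:~R in lam != 0 ->
  exists N : {poly int}, [/\ N != 0, (size N).-1%:R <= C * V%:R, ln (mz N) <= C * (V%:R + ln Qs)
   & ln (cab (evz th N)) <= ln (cab lam) + C * (V%:R + ln Qs)].
Proof.
move=> tr halg; have [D0 [e0 [c0 [B0 sys0]]]] := exists_module_system halg.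
have [D [e [c [B [sys fre]]]]] := free_module_system tr sys0.
case: D e c B sys fre => [|D] e c B sys fre.
 by case: sys => /negP []; apply/eqP/matrixP => -[].
have /boolp.choice [f hf] : forall k, exists dh : nat * R, 1 <= dh.2 /\ bounded_mx (B k) dh.1 dh.2.
 by move=> k; have [d [h hh]] := mx_bound (B k); exists (d, h).
have [enz cnz hsys] := sys.
have [l0 el0] : exists l, e l 0 != 0.
 apply: contrapT => hn; case/negP: enz; apply/eqP/colP => l; rewrite mxE; apply/eqP/negPn/negP => nz.
 by apply: hn; exists l.
pose d := (size c + \sum_k (f k).1)%N; pose h : R := 1 + n1 (polyC c) + \sum_k (f k).2.
have f0 k : 0 <= (f k).2 by apply: le_trans (hf k).1.
have sf0 : 0 <= \sum_k (f k).2 by apply: sumr_ge0 => k _.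
have h1 : 1 <= h by rewrite /h -addrA lerDl addr_ge0 ?n1_ge0.
have hB k : bounded_mx (B k) d h.
 apply: bounded_mx_le (hf k).2; first by rewrite /d (bigD1 k) //= addnCA leq_addr.
 rewrite /h (bigD1 k) //= addrCA lerDl addr_ge0 ?addr_ge0 ?n1_ge0 //.
 by apply: sumr_ge0 => l _.
have hc1 : (size c <= d.+1)%N by rewrite /d -addnS leq_addr.
have hc2 : n1 (polyC c) <= h by rewrite /h addrAC lerDr addr_ge0.
pose H := D.+1%:R * h; pose mu := mx1 th; pose E := \sum_l cab (e l 0) / cab (e l0 0).
have hH : h <= H by rewrite ler_peMl ?ler1n // (le_trans ler01).
have H1 : 1 <= H := le_trans h1 hH.
have mu1 : 1 <= mu := mx1_ge1 th.
have E0 : 0 <= E by apply: sumr_ge0 => l _; rewrite divr_ge0 ?cab_ge0.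
have hE1 : 1 <= 1 + E by rewrite lerDl.
(* [G] is the cost per unit of [V]: one value of [c] at [th], and the determinant and adjugate
   bounds with their degrees. [K] collects the factorial and the ratios of the entries of [e]. *)
pose K : R := D.+1`!%:R * (1 + E); pose G := (h * mu ^+ d) * (H ^+ D.+1 * mu ^+ (D * d)).
have fa1 (n : nat) : 1 <= n`!%:R :> R by rewrite ler1n fact_gt0.
have K1 : 1 <= K by rewrite -[leLHS]mulr1 ler_pM // lerDl.
have G1 : 1 <= G.
 have p1 (x : R) n : 1 <= x -> 1 <= x ^+ n by move=> ?; apply: exprn_ege1.
 by rewrite -[leLHS]mulr1 ler_pM //; rewrite -[leLHS]mulr1 ler_pM // p1.
have lK : 0 <= ln K by rewrite ln_ge0.
have lG : 0 <= ln G by rewrite ln_ge0.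
exists (ln K + ln G + D.+1%:R + D.+1%:R * d%:R); split.
 have D0' : 0 < D.+1%:R :> R by rewrite ltr0n.
 by have := mulr_ge0 (ltW D0') (ler0n R d); lra_from lK, lG, D0'.
move=> V s q a V0 aV lam Qs lam0.
have Q1 : 1 <= Qs.
 have [l ql] : exists l, q l != 0.
  apply: contrapT => hn; case/negP: lam0; apply/eqP; rewrite /lam big1 // => l _.
  have [->|ql] := eqVneq (q l) 0; first by rewrite mul0r.
  by case: hn; exists l.
 rewrite /Qs (bigD1 l) //= -[leLHS]addr0 lerD //; last by apply: sumr_ge0 => k _; rewrite ler0z.
 by rewrite (ler_int R 1) -gtz0_ge1 normr_gt0.
have lQ : 0 <= ln Qs by rewrite ln_ge0.
set M := lin_mx c B V q a.
have bM := bounded_lin_mx h1 hB hc1 hc2 q aV; rewrite -/H -/Qs -/M in bM.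
have [b1 b2] := bounded_det bM.
have N0 : \det M != 0 by exact: (det_lin_mx_neq0 tr sys fre aV lam0).
have V1 : 1 <= V%:R :> R by rewrite ler1n.
have final (x : R) : x <= ln K + V%:R * ln G + D.+1%:R * ln Qs -> x <= (ln K + ln G + D.+1%:R + D.+1%:R * d%:R) * (V%:R + ln Qs).
 move=> /le_trans; apply; have D0' : 0 <= D.+1%:R :> R by []. have d0' : 0 <= d%:R :> R by [].
 have V0' : 0 <= V%:R :> R by [].
 have := mulr_ge0 D0' d0'; move: (D.+1%:R) (d%:R) (V%:R) V1 V0' lQ lK lG D0' d0'.
 move: (ln K) (ln G) (ln Qs) => k g qq D1 d1 v; clear => *.
 have t1 := mulr_ge0 (mulr_ge0 (_ : 0 <= D1) (_ : 0 <= d1)) (_ : 0 <= v + qq).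
 have t2 : k <= k * (v + qq) by rewrite ler_peMr //; lra.
 have : 0 <= D1 * d1 * (v + qq) by apply: t1 => //; lra.
 have : 0 <= g * qq by rewrite mulr_ge0.
 have : 0 <= D1 * v by rewrite mulr_ge0.
 by lra.
have pos (x : R) : 1 <= x -> 0 < x by apply: lt_le_trans.
have lnKGQ n : (n <= D.+1)%N -> ln (K * G ^+ V * Qs ^+ n) <= ln K + V%:R * ln G + D.+1%:R * ln Qs.
 by move=> nD; exact: (ln_prod_le V K1 G1 Q1 nD).
exists (\det M); split=> //.
- apply: (@le_trans _ _ (D.+1 * (V * d))%:R); first by rewrite ler_nat; case: (size _) b1.
 rewrite !natrM; have D0' : 0 <= D.+1%:R :> R by []. have d0' : 0 <= d%:R :> R by []. have v0 : 0 <= V%:R :> R by [].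
 have := mulr_ge0 lK v0; have := mulr_ge0 lG v0; have := mulr_ge0 D0' v0; clear; lra.
- apply: final; apply: le_trans (lnKGQ D.+1 (leqnn _)).
 rewrite ler_ln ?posrE ?mah_gt0 ?polyC_neq0 ?mulr_gt0 ?exprn_gt0 ?pos //.
 apply: le_trans (mah_le_n1 (polyC_neq0 R N0)) _; apply: le_trans b2 _.
 rewrite exprMn [Qs ^+ _ * _]mulrC mulrA; apply: ler_wpM2r; first by rewrite exprn_ge0 // (le_trans ler01).
 apply: ler_pM => //; rewrite ?exprn_ge0 ?exprn_ge0 ?(le_trans ler01) //.
  by rewrite /K ler_peMr // lerDl.
 rewrite -exprM mulnC exprM lerXn2r ?nnegrE ?exprn_ge0 ?(le_trans ler01) //.
 rewrite /G mulrCA ler_peMr ?exprn_ge0 ?(le_trans ler01 H1) //.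
 by rewrite -[leLHS]mulr1 ler_pM // ?exprn_ege1 // -[leLHS]mulr1 ler_pM // exprn_ege1.
have hdet := det_lin_mxE sys q aV l0; rewrite -/M in hdet.
have c_el0 : 0 < cab (e l0 0) by rewrite cab_gt0.
have hA : cab (\sum_l evz th (\adj M l0 l) * e l 0) <= D`!%:R * (Qs * H ^+ V) ^+ D * mu ^+ (D * (V * d)) * (E * cab (e l0 0)).
 apply: le_trans (cab_sum _ _ _) _; rewrite {1}/E mulr_suml mulr_sumr; apply: ler_sum => l _.
 rewrite divfK ?gt_eqF // cabM ler_wpM2r ?cab_ge0 //.
 by have [a1 a2] := bounded_adj h1 hB hc1 hc2 q aV l0 l; exact: cab_evz_le a1 a2.
have hc : cab (evz th c) <= h * mu ^+ d by exact: cab_evz_le hc1 hc2.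
have mu0 : 0 <= mu := le_trans ler01 mu1.
have h0 : 0 <= h := le_trans ler01 h1.
have H0 : 0 <= H := le_trans ler01 H1.
have Q0 : 0 <= Qs := le_trans ler01 Q1.
have hdet2 : cab (evz th (\det M)) <= cab lam * (K * G ^+ V * Qs ^+ D).
 rewrite -(ler_pM2r c_el0) -cabM hdet !cabM cabX.
 apply: (@le_trans _ _ ((h * mu ^+ d) ^+ V * cab lam * (D`!%:R * (Qs * H ^+ V) ^+ D * mu ^+ (D * (V * d)) * (E * cab (e l0 0))))).
  apply: ler_pM; rewrite ?cab_ge0 ?mulr_ge0 ?exprn_ge0 ?cab_ge0 //.
  by rewrite ler_wpM2r ?cab_ge0 // lerXn2r ?nnegrE ?cab_ge0 ?mulr_ge0 ?exprn_ge0.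
 have -> : (h * mu ^+ d) ^+ V * cab lam * (D`!%:R * (Qs * H ^+ V) ^+ D * mu ^+ (D * (V * d)) * (E * cab (e l0 0))) =
  cab lam * ((D`!%:R * E) * ((h * mu ^+ d) * (H ^+ D * mu ^+ (D * d))) ^+ V * Qs ^+ D) * cab (e l0 0).
  rewrite !exprMn -!exprM [(V * D)%N]mulnC -mulnA [(d * V)%N]mulnC; ring.
 rewrite ler_wpM2r ?cab_ge0 // ler_wpM2l ?cab_ge0 // ler_wpM2r ?exprn_ge0 //.
 apply: ler_pM; rewrite ?mulr_ge0 ?exprn_ge0 ?mulr_ge0 ?exprn_ge0 //.
  by apply: ler_pM => //; [rewrite ler_nat leq_fact | rewrite lerDr].
 rewrite lerXn2r ?nnegrE ?mulr_ge0 ?exprn_ge0 ?mulr_ge0 ?exprn_ge0 //.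
 rewrite ler_wpM2l ?mulr_ge0 ?exprn_ge0 // ler_wpM2r ?exprn_ge0 //.
 by rewrite exprS ler_peMl ?exprn_ge0.
have dz : 0 < cab (evz th (\det M)).
 by rewrite cab_gt0; apply: contra N0 => /eqP /tr ->.
have lz : 0 < cab lam by rewrite cab_gt0.
have KG0 : 0 < K * G ^+ V * Qs ^+ D by rewrite mulr_gt0 ?mulr_gt0 ?exprn_gt0 ?(lt_le_trans ltr01).
apply: (@le_trans _ _ (ln (cab lam) + ln (K * G ^+ V * Qs ^+ D))).
 by rewrite -(lnM (x := cab lam)) ?posrE // ler_ln ?posrE // mulr_gt0.
by rewrite lerD2l; apply: final; apply: lnKGQ; exact: leqnSn.
Qed.

End NormExists.

Section PickFactor.
Variable R : realType.
Notation polyC := (map_poly (intr : int -> R[i])).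
Notation mz Q := (mah (polyC Q)).

(** Weight, degree and logarithmic Mahler measure all add up over the irreducible factors, so some
    factor is at least as good as the average. *)
Lemma pick_factor th (N : {poly int}) (A B : R) : (forall p, evz th p = 0 -> p = 0) -> N != 0 ->
 0 <= A -> 0 <= B -> (size N).-1%:R * A + ln (mz N) * B < - ln (cab (evz th N)) ->
 exists Q, [/\ irrz Q, ~~ root (polyC Q) th, ((size Q).-1 <= (size N).-1)%N, ln (mz Q) <= ln (mz N) &
  (size Q).-1%:R * A + ln (mz Q) * B <= wt th Q].
Proof.
move=> tr N0 A0 B0 lt; have [c [s [c0 hs NE]]] := irrz_factorization N0.
have nz q : q \in s -> q != 0 /\ ~~ root (polyC q) th.
 move=> qs; have q0 := irrz_neq0 (hs q qs); split=> //.
 by apply/negP => /eqP e; case/eqP: q0; apply: tr.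
have lm0 q : q \in s -> 0 <= ln (mz q) by move=> /nz [/(lnmz_ge0 R)].
have sw : - ln (cab (evz th N)) <= \sum_(q <- s) wt th q.
 rewrite -(wt_scaled_prod c0 nz) -NE /wt; have := lnmz_ge0 R N0.
 by have := mulr_ge0 (ler0n R (size N).-1) (ln2mx1_ge0 th); rewrite /evz /= /horner_eval; lra.
have dN : \sum_(q <- s) (size q).-1%:R = (size N).-1%:R :> R.
 by rewrite -natr_sum NE deg_scaled_prod // => q /nz [].
have lN : \sum_(q <- s) ln (mz q) <= ln (mz N).
 by rewrite NE; apply: lnmz_scaled_prod => // q /nz [].
have [q qs hq] : exists2 q, q \in s & (size q).-1%:R * A + ln (mz q) * B <= wt th q.
 apply: contrapT => hn; suff : \sum_(q <- s) wt th q <= (size N).-1%:R * A + ln (mz N) * B by lra_from lt, sw.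
 apply: le_trans (lerD (lexx _) (ler_wpM2r B0 lN)); rewrite -dN !mulr_suml -big_split /=.
 rewrite big_seq [leRHS]big_seq; apply: ler_sum => q qs; rewrite leNgt; apply/negP => /ltW h.
 by apply: hn; exists q.
exists q; split=> //; first exact: hs.
- exact: (nz q qs).2.
- by rewrite -(ler_nat R) -dN (big_rem q) //= lerDl sumr_ge0.
apply: le_trans lN; rewrite (big_rem q) //= lerDl big_seq; apply: sumr_ge0 => q' /mem_rem; exact: lm0.
Qed.

End PickFactor.

(** * Approximants at [th] from collisions and from good factors *)

Section Level.
Variables (R : realType) (m : nat) (xi : 'I_m -> R[i]).
Variables (al vs be ta nu ka : R).
Hypothesis xi0 : forall j, xi j != 0.
Notation polyC := (map_poly (intr : int -> R[i])).
Notation mz Q := (mah (polyC Q)).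
Notation om := (m%:R * vs).
Notation T n := {ffun 'I_m -> 'I_(lvx vs n).+1}.
Notation zeta i := (mon xi (fun j => nat_of_ord (i j))).
Ltac clr := clear -R m xi al vs be ta nu ka.

(** Doubling the slack pays for the change of level in either direction. Together with the gap in
    [near_core] this separates torsion levels from good ones. *)
Lemma near_tors_succ kp : 0 < kp -> 0 <= ta -> \forall n \near \oo,
 (tors_at xi ta nu kp n -> tors_at xi ta nu (2 * kp) n.+1) /\
 (tors_at xi ta nu kp n.+1 -> tors_at xi ta nu (2 * kp) n).
Proof.
move=> k0 ta0; near=> n; pose e := kp / 4; have e0 : 0 < e by rewrite divr_gt0.
have /andP[t1 t2] := lvt_bounds n ta0; have /andP[t3 t4] := lvt_bounds n.+1 ta0.
have [s1 s2] : pw n.+1 ta <= pw n (ta + e) /\ pw n ta <= pw n.+1 (ta + e) by near: n; apply: near_pw_succ; rewrite divr_gt0.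
have [s3 s4] : pw n.+1 (1 + kp) <= pw n (1 + kp + e) /\ pw n (1 + kp) <= pw n.+1 (1 + kp + e) by near: n; apply: near_pw_succ; rewrite divr_gt0.
have [s5 s6] : pw n.+1 (nu - 1 - 2 * kp) <= pw n (nu - 1 - 2 * kp + kp) /\ pw n (nu - 1 - 2 * kp) <= pw n.+1 (nu - 1 - 2 * kp + kp) by near: n; apply: near_pw_succ.
have E : nu - 1 - 2 * kp + kp = nu - 1 - kp by ring.
rewrite E in s5 s6.
have pge (k : nat) (a : R) : 0 <= pw k a by exact: pw_ge0.
have f1 : 6 <= pw n e by near: n; apply: near_pw_ge; rewrite divr_gt0.
have f2 : 6 <= pw n.+1 e by apply: le_trans f1 _; rewrite /pw ler_expR ler_wpM2l ?(ltW e0) // ler_ln ?posrE ?ltr0n ?ler_nat //; near: n; apply: near_ge1.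
split=> -[M [M0 Mt hM]]; exists M; (split; first exact: M0).
- have h : (lvt ta n.+1)%:R <= (lvt ta n)%:R * (pw n e * pw n.+1 e).
  have q : pw n (ta + e) <= 3 * (lvt ta n)%:R * pw n e by rewrite (pwD n ta); have := ler_wpM2r (pge n e) t1; clr; lra.
  have q2 := ler_wpM2l (mulr_ge0 (ler0n R (lvt ta n)) (pge n e)) f2.
  by lra_from q, q2, t4, s1.
 apply: le_trans (ler_wpM2l (ler0n R M) h) _.
 rewrite (mulrA M%:R).
 apply: le_trans (ler_wpM2r (mulr_ge0 (pge n e) (pge _ e)) Mt) _.
 rewrite mulrA -pwD; have [s7 s8] : pw n.+1 (1 + kp + e) <= pw n (1 + kp + e + e) /\ pw n (1 + kp + e) <= pw n.+1 (1 + kp + e + e) by near: n; apply: near_pw_succ; rewrite divr_gt0.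
 apply: le_trans (ler_wpM2r (pge _ e) s8) _; rewrite -pwD; apply: ler_pw.
 by rewrite /e; lra_from k0.
- move=> j; apply: le_trans (hM j) _; rewrite ler_expR lerN2.
 by rewrite ler_wpM2l // -E.
- have h : (lvt ta n)%:R <= (lvt ta n.+1)%:R * (pw n.+1 e * pw n e).
  have q : pw n.+1 (ta + e) <= 3 * (lvt ta n.+1)%:R * pw n.+1 e by rewrite (pwD n.+1 ta); have := ler_wpM2r (pge n.+1 e) t3; clr; lra.
  have q2 := ler_wpM2l (mulr_ge0 (ler0n R (lvt ta n.+1)) (pge n.+1 e)) f1.
  by lra_from q, q2, t2, s2.
 apply: le_trans (ler_wpM2l (ler0n R M) h) _.
 rewrite (mulrA M%:R).
 apply: le_trans (ler_wpM2r (mulr_ge0 (pge _ e) (pge _ e)) Mt) _.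
 rewrite mulrA -pwD; have [s7 s8] : pw n.+1 (1 + kp + e) <= pw n (1 + kp + e + e) /\ pw n (1 + kp + e) <= pw n.+1 (1 + kp + e + e) by near: n; apply: near_pw_succ; rewrite divr_gt0.
 apply: le_trans (ler_wpM2r (pge _ e) s7) _; rewrite -pwD; apply: ler_pw.
 by rewrite /e; lra_from k0.
move=> j; apply: le_trans (hM j) _; rewrite ler_expR lerN2 ler_wpM2l //.
Unshelve. all: by end_near. Qed.

Lemma near_collision : 0 < ka -> 0 < vs -> 0 < nu - ta - om - 2 * ka -> \forall n \near \oo,
 ~ separated xi vs ta nu ka n -> exists i i' : T n, i != i' /\
  cab (zeta i - zeta i') <= expR (- pw n (nu - ta - om - 2 * ka)).
Proof.
move=> k0 vs0 key; near=> n => hs; apply: contrapT => hn; apply: hs => s i us iS.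
pose w := pw n (nu - ta - om - 2 * ka).
have h i' : i' \in s -> expR (- w) <= cab (zeta i - zeta i').
 move=> i's; rewrite leNgt; apply/negP => /ltW lt; apply: hn; exists i, i'; split=> //.
 by apply: contraNneq iS => ->.
have : expR (- w) ^+ size s <= \prod_(i' <- s) cab (zeta i - zeta i').
 elim: s {us iS} h => [|a s IH] h; first by rewrite big_nil expr0.
 rewrite big_cons exprS; apply: ler_pM; rewrite ?exprn_ge0 ?expR_ge0 ?h ?mem_head //.
 by apply: IH => i' i's; apply: h; rewrite inE i's orbT.
apply: le_trans; rewrite -expRM_natl ler_expR mulrN lerN2.
have ss : (size s)%:R <= 2 ^+ m * pw n om.
 have h1 : (size s <= (lvx vs n).+1 ^ m)%N.
  by rewrite -(card_uniqP us) (leq_trans (max_card _)) // card_ffun !card_ord.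
 apply: (@le_trans _ _ ((lvx vs n).+1%:R ^+ m)); first by rewrite -natrX ler_nat.
 rewrite pwX -exprMn lerXn2r ?nnegrE // ?mulr_ge0 ?pw_ge0 //.
 have [hx _] := truncn_pw n vs; rewrite -/(lvx vs n) in hx.
 by rewrite -natr1; have := pw_ge1 n (ltW vs0); lra_from hx.
apply: le_trans (ler_wpM2r (pw_ge0 n _) ss) _; rewrite /w -mulrA -pwD.
have -> : om + (nu - ta - om - 2 * ka) = nu - ta - 2 * ka by ring.
by near: n; apply: near_pw; lra_from k0.
Unshelve. all: by end_near. Qed.

(** The [xi j] are near [M]-th roots of unity. For [y] maximal with [y^m <= M] there are more than
    [M] monomials with exponents up to [y], so two of them are near the same root; [M] is about
    [n^(1-ta)] at most. *)
Lemma near_tors_collision kp : (0 < m)%N -> 0 < kp -> 0 <= ta -> ta <= 1 -> kp <= 1 / 2 -> 2 * kp < nu - 1 -> \forall n \near \oo,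
 tors_at xi ta nu kp n -> exists (y : nat) (i i' : 'I_m -> nat), [/\ y%:R <= pw n ((1 - ta) / m%:R + 2 * kp),
  forall k, (i k <= y)%N && (i' k <= y)%N, exists k, i k != i' k &
  cab (mon xi i - mon xi i') <= expR (- pw n (nu - 1 - 2 * kp))].
Proof.
move=> m0 k0 ta0 ta1 k1 knu; have mR : 0 < m%:R :> R by rewrite ltr0n.
have mR1 : 1 <= m%:R :> R by rewrite ler1n.
near=> n => -[M [M0 Mt hM]].
have pge (a : R) : 0 <= pw n a by exact: pw_ge0.
have [y hy1 hy2] : exists2 y, (y ^ m <= M)%N & (M < y.+1 ^ m)%N.
 have ex : exists y, (y ^ m <= M)%N by exists 0%N; rewrite exp0n.
 have ym y : (y <= y ^ m)%N by case: y => [|y] //; rewrite -{1}[y.+1]expn1 leq_pexp2l.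
 have bd y : (y ^ m <= M)%N -> (y <= M)%N by apply: leq_trans; exact: ym.
 have [y hy hmax] := ex_maxnP ex bd; exists y => //; rewrite ltnNge; apply/negP => /hmax; by rewrite ltnn.
have ML : M%:R <= 3 * pw n (1 - ta + kp).
 have /andP[t1 _] := lvt_bounds n ta0.
 rewrite -(ler_pM2r (pw_gt0 n ta)) -mulrA -pwD (_ : 1 - ta + kp + ta = 1 + kp); last by ring.
 by have := ler_wpM2l (ler0n R M) t1; lra_from Mt.
have yb : y%:R <= pw n ((1 - ta) / m%:R + 2 * kp).
 have h : y%:R ^+ m <= pw n ((1 - ta) / m%:R + 2 * kp) ^+ m.
  rewrite -pwX; apply: (@le_trans _ _ M%:R); first by rewrite -natrX ler_nat.
  apply: le_trans ML _; have f : 3 * pw n (1 - ta + kp) <= pw n (1 - ta + 2 * kp) by near: n; apply: near_pw; lra_from k0.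
  apply: le_trans f _; apply: ler_pw; rewrite mulrDr mulrCA divff ?mulr1 ?gt_eqF // lerD2l.
  by rewrite ler_peMl // mulr_ge0 // ltW.
 by rewrite -(@ler_pXn2r _ m) ?nnegrE.
pose ep := expR (- (M%:R * pw n (nu - 1 - kp))).
have ep0 : 0 <= ep by exact: expR_ge0.
have M1 : 1 <= M%:R :> R by rewrite ler1n.
have ep1 : ep <= expR (- pw n (nu - 1 - kp)).
 by rewrite ler_expR lerN2 ler_peMl.
have bnd : 1000 * m%:R * pw n 2 * ep <= expR (- pw n (nu - 1 - 2 * kp)).
 have f1 : 1000 * m%:R * pw n 2 * expR (- pw n (nu - 1 - 2 * kp)) <= 1 by near: n; apply: near_exp; lra_from knu.
 have f2 : 2 * pw n (nu - 1 - 2 * kp) <= pw n (nu - 1 - kp) by near: n; apply: near_pw; lra_from k0.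
 apply: (@le_trans _ _ (1000 * m%:R * pw n 2 * (expR (- pw n (nu - 1 - 2 * kp)) * expR (- pw n (nu - 1 - 2 * kp))))).
  rewrite ler_wpM2l ?mulr_ge0 // (le_trans ep1) // -expRD ler_expR; lra_from f2.
 by rewrite mulrA -[leRHS]mul1r ler_wpM2r ?expR_ge0.
have e1 : expR (- pw n (nu - 1 - 2 * kp)) <= 1 by rewrite -[leRHS]expR0 ler_expR oppr_le0.
have p2 : 1 <= pw n 2 :> R by apply: pw_ge1.
have b12 : 1000 * ep <= 1.
 have q : 1 <= m%:R * pw n 2 :> R by have := ler_pM ler01 ler01 mR1 p2; rewrite mulr1.
 by have := ler_wpM2l ep0 q; lra_from bnd, e1.
have near_om j : exists w, w ^+ M = 1 /\ cab (xi j / w - 1) <= 3 * ep.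
 by apply: (root_unity_near M0 (hM j)); rewrite -/ep; lra_from b12.
have [om' omP] := boolp.choice near_om.
have om0 j : om' j != 0 by rewrite -cab_gt0 (cab_root1 M0 (omP j).1).
pose J := {ffun 'I_m -> 'I_y.+1}.
have [v pv] := @primitive_root_exists (R[i]) M M0.
have mM (i : J) : mon om' (fun j => i j) ^+ M = 1.
 by rewrite monX /mon big1 // => j _; rewrite mulnC exprM (omP j).1 expr1n.
have /boolp.choice [f hf] : forall i : J, exists k : 'I_M, mon om' (fun j => i j) = v ^+ k.
 move=> i; have [k kE] := (prim_rootP pv (mM i)); by exists k.
have [i [i' [ii' fE]]] : exists i i', i != i' /\ f i = f i'.
 have [/injectiveP inj|/injectivePn [i [i' ii' fE]]] := boolP (injectiveb f); last by exists i, i'.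
 by have := leq_card _ inj; rewrite card_ffun !card_ord leqNgt hy2.
exists y, (fun j => nat_of_ord ((i : J) j)), (fun j => nat_of_ord ((i' : J) j)); split=> //.
- by move=> k; apply/andP; split; rewrite -ltnS ltn_ord.
- apply: contrapT => hn; case/eqP: ii'; apply/ffunP => k; apply: val_inj; apply/eqP/negPn/negP => ne.
 by apply: hn; exists k.
have oE : mon om' (fun j => i j) = mon om' (fun j => i' j) by rewrite !hf fE.
pose u j := xi j / om' j.
have zE (l : J) : mon xi (fun j => l j) = mon om' (fun j => l j) * mon u (fun j => l j).
 by rewrite /mon -big_split; apply: eq_bigr => j _ /=; rewrite -exprMn /u mulrC divfK.
have y2 : y%:R <= pw n 2 :> R.
 have yM : (y <= M)%N by apply: leq_trans hy1; case: (y) => [|y'] //; rewrite -{1}[y'.+1]expn1 leq_pexp2l.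
 apply: (@le_trans _ _ M%:R); first by rewrite ler_nat.
 apply: le_trans ML _; have f0 : 3 * pw n (1 - ta + kp) <= pw n (1 - ta + 2 * kp) by near: n; apply: near_pw; lra_from k0.
 by apply: le_trans f0 _; apply: ler_pw; lra_from k1, ta0.
have s1 : size (index_enum 'I_m) = m by rewrite -[RHS](card_ord m) cardT /= enumT.
have ye : m%:R * y%:R * ep <= m%:R * pw n 2 * ep by rewrite ler_wpM2r // ler_wpM2l.
have yep : 0 <= y%:R * ep by rewrite mulr_ge0.
have yep2 := ler_wpM2r yep mR1.
have mu1 (l : J) : cab (mon u (fun j => l j) - 1) <= 2 * m%:R * (2 * y%:R * (3 * ep)).
 have := @near1_bigprod R _ (index_enum 'I_m) (fun j => u j ^+ l j) (2 * y%:R * (3 * ep)).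
 rewrite s1; apply.
 - by lra_from yep.
 - move=> j _; have ix : 2 * (l j)%:R * (3 * ep) <= 2 * y%:R * (3 * ep).
   by rewrite ler_wpM2r ?mulr_ge0 // ler_wpM2l // ler_nat -ltnS.
  apply: (le_trans _ ix); apply: near1X; [by rewrite mulr_ge0 | exact: (omP j).2 |].
  by lra_from ix, bnd, ye, e1, yep2, yep.
 by lra_from bnd, ye, e1.
rewrite !zE oE -mulrBr cabM (cab_root1 M0 (mM i')) mul1r.
have -> : mon u (fun j => i j) - mon u (fun j => i' j) = (mon u (fun j => i j) - 1) - (mon u (fun j => i' j) - 1) by ring.
apply: le_trans (cabB _ _) _; have h1 := mu1 i; have h2 := mu1 i'.
have : 0 <= m%:R * y%:R * ep by rewrite -mulrA mulr_ge0.
by lra_from h1, h2, bnd, ye.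
Unshelve. all: by end_near. Qed.

Section Norms.
Variable th : R[i].
Hypotheses (tr : forall p, evz th p = 0 -> p = 0) (halg : forall k, alg_over_th th (xi k)).
Hypothesis (mi : mult_indep xi).
Ltac clr ::= clear -R m xi al vs be ta nu ka th xi0 tr halg mi.

Lemma mon_inj (i i' : 'I_m -> nat) : mon xi i = mon xi i' -> forall k, i k = i' k.
Proof.
move=> h k; have := mi (e := fun k => (i k)%:Z - (i' k)%:Z).
have -> : \prod_(k0 < m) xi k0 ^ ((i k0)%:Z - (i' k0)%:Z) = mon xi i / mon xi i'.
 rewrite /mon -prodf_div; apply: eq_bigr => j _; by rewrite expfzDr // exprnN -exprnP.
rewrite h divff ?mon_neq0 // => /(_ erefl k) /eqP; by rewrite subr_eq0 => /eqP [->].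
Qed.

(** The norm of a difference of two monomials has degree and logarithmic height of order [n^h] and
    is as small as the difference; it is non-zero by multiplicative independence. *)
Lemma near_collision_approximant h w e : 0 <= h -> 0 < e -> h + e < w -> \forall n \near \oo,
 forall (y : nat) (i i' : 'I_m -> nat), y%:R <= pw n h -> (forall k, (i k <= y)%N && (i' k <= y)%N) ->
 (exists k, i k != i' k) -> cab (mon xi i - mon xi i') <= expR (- pw n w) ->
 exists Q, approximant th (h + e) (h + e) (w - h - e) (w - h - e) n Q.
Proof.
move=> h0 e0 hw; have [C [C0 hC]] := norm_bound tr halg.
near=> n => y i i' yh hy [k ik] small.
have pge (a : R) : 0 <= pw n a by exact: pw_ge0.
pose V := (m * y).+1.
have [||N [N0 dN lN vN]] := hC V 2 (fun l => if l == ord0 then 1 else - 1) (fun l => if l == ord0 then i else i') isT.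
- move=> l; apply: (@leq_trans (\sum_(k < m) y)); last by rewrite sum_nat_const card_ord.
 by apply: leq_sum => j _; have /andP[] := hy j; case: ifP.
- rewrite !big_ord_recl big_ord0 /= addr0 mul1r mulN1r subr_eq0; apply: contraNneq ik => /mon_inj ->.
 by rewrite eqxx.
rewrite !big_ord_recl !big_ord0 /= !addr0 mul1r mulN1r normrN normr1 in lN vN.
have V1 : V%:R <= (m%:R + 1) * pw n h.
 by rewrite /V -natr1 natrM; have := ler_wpM2l (ler0n R m) yh; have := pw_ge1 n h0; clr; lra.
have l2 : 0 <= ln (1%:~R + 1%:~R : R) <= 1.
 rewrite (_ : 1%:~R + 1%:~R = 2 :> R) ?ln_ge0 ?ler1n ?ln2_le1 //.
have /andP[l20 l21] := l2.
have lz : ln (cab (mon xi i - mon xi i')) <= - pw n w.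
 have lam0 : 0 < cab (mon xi i - mon xi i').
  by rewrite cab_gt0 subr_eq0; apply: contraNneq ik => /mon_inj ->; rewrite eqxx.
 by rewrite -[leRHS]expRK ler_ln ?posrE ?expR_gt0.
have hV : V%:R + ln (1%:~R + 1%:~R : R) <= (m%:R + 2) * pw n h.
 by have := pw_ge1 n h0; lra_from V1, l21.
have CV := ler_wpM2l (ltW C0) hV; have CV1 := ler_wpM2l (ltW C0) V1.
have f1 : (C * (m%:R + 2)) * pw n h <= pw n (h + e) by near: n; apply: near_pw; lra_from e0.
have f2 : (8 * (C * (m%:R + 2))) * pw n (h + (w - h - e)) <= pw n w by near: n; apply: near_pw; lra_from e0.
have f3 : (8 * (C * (m%:R + 2))) * pw n h <= pw n w by near: n; apply: near_pw; lra_from e0, hw.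
have [|Q [iQ rQ dQ lQ wQ]] := @pick_factor R th N (pw n (w - h - e)) (pw n (w - h - e)) tr N0 (pge _) (pge _) _.
 have h1 : (size N).-1%:R + ln (mz N) <= 2 * (C * (m%:R + 2)) * pw n h.
  have := ltW (mulr_gt0 C0 (pw_gt0 n h)); lra_from dN, lN, CV, CV1.
 have := ler_wpM2r (pge (w - h - e)) h1; rewrite -mulrDl -[leRHS]mulrA -(pwD n h).
 have := pw_gt0 n w; lra_from vN, lz, CV, f2, f3.
exists Q; split=> //.
- apply: le_trans (_ : (size N).-1%:R <= _); first by rewrite ler_nat.
 by have := ltW (mulr_gt0 C0 (pw_gt0 n h)); lra_from dN, CV1, f1.
- by apply: le_trans lQ _; lra_from lN, CV, f1.
Unshelve. all: by end_near. Qed.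

(** The norm of the value of a good factor at a grid point. Exponents up to [n^vs] multiply the
    degree, so [D] gains [vs] and [a] loses it; the bound [1 + al + vs <= be] keeps this from
    affecting [H]. *)
Lemma near_good_approximant e : 0 < ka -> 6 * ka <= e -> 0 < vs -> 0 <= al -> 1 + al + vs <= be ->
 0 <= 1 - al - ta -> vs + 6 * ka < nu - 1 + al -> 6 * ka < nu - be + 2 * al -> \forall n \near \oo,
 forall i : T n, good_factor al be ta nu ka n (zeta i) ->
 exists Q, approximant th (1 - al - ta + vs + e) (be - 2 * al - ta + e) (nu - 1 + al - vs - e) (nu - be + 2 * al - e) n Q.
Proof.
move=> k0 ke vs0 al0 b1 h1 h2 h3; have [C [C0 hC]] := norm_bound tr halg.
near=> n => i [Q [iQ rQ dQ lQ wQ]].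
have pge (a : R) : 0 <= pw n a by exact: pw_ge0.
set d := (size Q).-1 in dQ wQ; have d0 : (0 < d)%N := irrz_deg_gt0 iQ.
have d1 : 1 <= d%:R :> R by rewrite ler1n.
pose V := (d * (m * (lvx vs n).+1))%N.
have hm : m = 0%N \/ (0 < m)%N by case: (m) => [|?]; [left|right].
have sQ : (size Q).-1.+1 = size Q by rewrite prednK // ltnW // irrz_size_gt1.
have lamE : \sum_(l < size Q) (Q`_l)%:~R * mon xi (fun k => (i k * l)%N) = (polyC Q).[zeta i].
 rewrite horner_coef size_polyF; apply: eq_bigr => l _; by rewrite coef_map /= monX.
have V0 : (0 < V.+1)%N by [].
have [||N [N0 dN lN vN]] := hC V.+1 (size Q) (fun l => Q`_l) (fun l k => (i k * l)%N) V0.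
- move=> l; apply: leq_trans (leqnSn _); apply: (@leq_trans (\sum_(k < m) (lvx vs n).+1 * d)).
  by apply: leq_sum => j _; rewrite leq_mul // ?(ltnW (ltn_ord _)) // -ltnS /d sQ.
 by rewrite sum_nat_const card_ord /V [(d * _)%N]mulnC mulnA.
- by rewrite lamE.
rewrite lamE in vN.
have Qs : ln (\sum_(l < size Q) `|Q`_l|%:~R) <= d%:R + ln (mz Q) :> R.
 have -> : \sum_(l < size Q) `|Q`_l|%:~R = n1 (polyC Q).
  by rewrite /n1 size_polyF; apply: eq_bigr => l _; rewrite coef_map /= cab_int.
 have Q0 := irrz_neq0 iQ; have pQ := polyC_neq0 R Q0.
 have n10 : 0 < n1 (polyC Q) by apply: lt_le_trans (mah_le_n1 pQ); apply: mah_gt0.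
 have mq : 0 < mz Q := mah_gt0 pQ.
 apply: (@le_trans _ _ (ln (2 ^+ d * mz Q))).
  have h := n1_le_mah pQ; rewrite size_polyF in h.
  by rewrite ler_ln; [exact: h | rewrite posrE | rewrite posrE mulr_gt0 ?exprn_gt0].
 rewrite (@lnM _ (2 ^+ d)) ?posrE ?exprn_gt0 // lnXn // lerD2r -[ln 2 *+ d]mulr_natl.
 by have := ler_wpM2l (ler0n R d) (@ln2_le1 R); rewrite mulr1.
have lm0 : 0 <= ln (mz Q) by rewrite lnmz_ge0 // irrz_neq0.
have v1 := @pw_ge1 R n vs (ltW vs0).
have NR : (lvx vs n).+1%:R <= 2 * pw n vs.
 by have [hx _] := truncn_pw n vs; rewrite -/(lvx vs n) in hx; rewrite -natr1; lra_from hx, v1.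
pose X := d%:R * pw n vs; have X1 : 1 <= X by rewrite /X -[leLHS]mulr1 ler_pM.
have dX : d%:R <= X by rewrite /X ler_peMr.
have VX : V.+1%:R <= (2 * m%:R + 1) * X.
 rewrite -natr1 /V !natrM; have := ler_wpM2l (mulr_ge0 (ler0n R d) (ler0n R m)) NR.
 by generalize X1; rewrite /X; clr; lra.
have VQ : V.+1%:R + ln (\sum_(l < size Q) `|Q`_l|%:~R) <= (2 * m%:R + 2) * X + ln (mz Q).
 by generalize VX, Qs, dX; clr; lra.
have CVQ := ler_wpM2l (ltW C0) VQ; have CVX := ler_wpM2l (ltW C0) VX.
have m1 := monb_ge1 xi.
have lz : ln (2 * mx1 (zeta i)) <= 3 * monb xi * pw n vs.
 have hh : ln (mx1 (zeta i)) <= monb xi * (lvx vs n).+1%:R.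
  apply: le_trans (_ : ln (1 + cab (zeta i)) <= _); last by apply: ln_cab_mon => j; rewrite -ltnS.
  rewrite ler_ln ?posrE ?mx1_gt0 ?(lt_le_trans ltr01) ?lerDl ?cab_ge0 //.
  by rewrite /mx1 ge_max lerDl lerDr cab_ge0 ler01.
 rewrite ln2mx1E; have l2 := @ln2_le1 R.
 by have := ler_wpM2l (le_trans ler01 m1) NR; have := ler_pM ler01 ler01 m1 v1; generalize hh, l2; clr; lra.
have lzX : d%:R * ln (2 * mx1 (zeta i)) <= 3 * monb xi * X.
 by have := ler_wpM2l (ler0n R d) lz; rewrite /X; clr; lra.
have lv : ln (cab (polyC Q).[zeta i]) = ln (mz Q) + d%:R * ln (2 * mx1 (zeta i)) - wt (zeta i) Q by rewrite /wt -/d; ring.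
pose K := C * (2 * m%:R + 2) + 3 * monb xi + C + 1.
have CX : 0 <= C * X by rewrite mulr_ge0 ?ltW // (lt_le_trans ltr01).
have CL : 0 <= C * ln (mz Q) by rewrite mulr_ge0 // ltW.
have K0 : 0 <= K by have := mulr_ge0 (ltW C0) (ler0n R m); rewrite /K; generalize m1, C0; clr; lra.
have bX : 0 <= monb xi * X by rewrite mulr_ge0 // ?(le_trans ler01 m1) // (le_trans ler01 X1).
have mCX : 0 <= m%:R * (C * X) by rewrite mulr_ge0.
have mCL : 0 <= m%:R * (C * ln (mz Q)) by rewrite mulr_ge0.
have bL : 0 <= monb xi * ln (mz Q) by rewrite mulr_ge0 // (le_trans ler01 m1).
have evN : wt (zeta i) Q - K * (X + ln (mz Q)) <= - ln (cab (evz th N)).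
 by rewrite /K; generalize vN, lv, lzX, CVQ, CX, CL, bX, mCX, mCL, bL, lm0, X1; clr; lra.
have dN' : (size N).-1%:R <= K * X by rewrite /K; generalize dN, CVX, CX, CL, bX, mCX, X1; clr; lra.
have lN' : ln (mz N) <= K * (X + ln (mz Q)) by rewrite /K; generalize lN, CVQ, CX, CL, bX, mCX, mCL, bL, lm0, X1; clr; lra.
set A := pw n (nu - 1 + al - vs - e); set B := pw n (nu - be + 2 * al - e).
have f1 : 16 * K * pw n vs <= pw n (nu - 1 + al - 5 * ka) by near: n; apply: near_pw; generalize k0, h2; clr; lra.
have f2 : 16 * K <= pw n (nu - be + 2 * al - 5 * ka) by near: n; apply: near_pw_ge; generalize k0, h3; clr; lra.
have f3 : 16 * K * pw n (vs + (nu - 1 + al - vs - e)) <= pw n (nu - 1 + al - 5 * ka) by near: n; apply: near_pw; generalize k0, ke; clr; lra.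
have f4 : 16 * K * pw n (vs + (nu - be + 2 * al - e)) <= pw n (nu - 1 + al - 5 * ka) by near: n; apply: near_pw; generalize k0, ke, b1; clr; lra.
have f5 : 16 * K * pw n (nu - be + 2 * al - e) <= pw n (nu - be + 2 * al - 5 * ka) by near: n; apply: near_pw; generalize k0, ke; clr; lra.
rewrite (pwD n vs) -/A in f3; rewrite (pwD n vs) -/B in f4; rewrite -/B in f5.
have A0 : 0 <= A := pge _; have B0 : 0 <= B := pge _.
have g1 := ler_wpM2l (ler0n R d) f1; have g2 := ler_wpM2l lm0 f2; have g3 := ler_wpM2l (ler0n R d) f3.
have g4 := ler_wpM2l (ler0n R d) f4; have g5 := ler_wpM2l lm0 f5.
have [|Q' [iQ' rQ' dQ' lQ' wQ']] := @pick_factor R th N A B tr N0 A0 B0 _.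
 have q1 := ler_wpM2r A0 dN'; have q2 := ler_wpM2r B0 lN'.
 have q3 := mulr_gt0 (lt_le_trans ltr01 d1) (pw_gt0 n (nu - 1 + al - 5 * ka)).
 rewrite /X in q1 q2 evN; have q4 := mulr_ge0 lm0 (pge (nu - be + 2 * al - 5 * ka)).
 by generalize evN, wQ, g1, g2, g3, g4, g5, q1, q2, q3, q4; clr; lra.
have dX2 : X <= pw n (1 - al - ta + vs + 5 * ka).
 rewrite /X (_ : 1 - al - ta + vs + 5 * ka = (1 - al - ta + 5 * ka) + vs); last by ring.
 by rewrite (pwD n _ vs) ler_wpM2r.
exists Q'; split=> //.
- apply: le_trans (_ : (size N).-1%:R <= _); first by rewrite ler_nat.
 apply: le_trans dN' _; have f : K * pw n (1 - al - ta + vs + 5 * ka) <= pw n (1 - al - ta + vs + e) by near: n; apply: near_pw; generalize k0, ke; clr; lra.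
 by apply: le_trans f; rewrite ler_wpM2l.
- apply: le_trans lQ' _; apply: le_trans lN' _.
 have f : (2 * K) * pw n (be - 2 * al - ta + 5 * ka) <= pw n (be - 2 * al - ta + e) by near: n; apply: near_pw; generalize k0, ke; clr; lra.
 apply: le_trans f; rewrite [2 * K]mulrC -mulrA ler_wpM2l //.
 have : pw n (1 - al - ta + vs + 5 * ka) <= pw n (be - 2 * al - ta + 5 * ka) by apply: ler_pw; generalize b1; clr; lra.
 by generalize dX2, lQ; clr; lra.
Unshelve. all: by end_near. Qed.

End Norms.
End Level.

(** * At least two numbers *)

Section Chain.
Variables (R : realType) (m : nat) (xi : 'I_m -> R[i]) (th : R[i]).
Notation T vs n := {ffun 'I_m -> 'I_(lvx vs n).+1}.
Notation zeta i := (mon xi (fun j => nat_of_ord (i j))).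
Notation algebraic z := (algebraicOver (ratr : rat -> R[i]) z).
Hypothesis xi0 : forall j, xi j != 0.
Hypotheses (tr : forall p, evz th p = 0 -> p = 0) (halg : forall k, alg_over_th th (xi k)).
Hypothesis (mi : mult_indep xi).
Hypothesis hAlg : forall x, (#|[set i : {ffun 'I_m -> 'I_x.+1} | `[< algebraic (zeta i) >]]%SET| <= x.+1 ^ m.-1)%N.

Lemma good_exists vs ka n (P : T vs n -> Prop) : 0 < ka -> 1 < pw n ka :> R ->
 #|(~: [set i : T vs n | `[< P i >]])%SET|%:R <= pw n (m%:R * vs - ka) :> R -> exists i, P i.
Proof.
move=> k0 n1 h; apply: contrapT => hn.
have : #|(~: [set i : T vs n | `[< P i >]])%SET| = ((lvx vs n).+1 ^ m)%N.
 rewrite (_ : (~: _)%SET = finset.setT) ?cardsT ?card_ffun ?card_ord //.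
 by apply/finset.setP => i; rewrite !inE; apply/asboolPn => Pi; apply: hn; exists i.
move=> E; rewrite E in h; have [_ hx] := truncn_pw n vs.
have h2 : pw n (m%:R * vs) <= ((lvx vs n).+1 ^ m)%:R.
 by rewrite natrX pwX lerXn2r ?nnegrE ?pw_ge0 // ltW.
have := le_trans h2 h; rewrite -{1}(subrK ka (m%:R * vs)) pwD.
by rewrite -[leRHS]mulr1 ler_pM2l ?pw_gt0 // leNgt n1.
Qed.

Ltac flra := repeat match goal with
 | H : is_true (Order.le _ _) |- _ => revert H
 | H : is_true (Order.lt _ _) |- _ => revert H
 | H : @eq _ _ _ |- _ => revert H
 end; clear -R m xi th xi0 tr halg mi hAlg; lra.

(* State [None]: two nearly equal points of the grid; [Some true]: the xi_j are near torsion points; [Some false]: good factors. *)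
Lemma rank_ge2_absurd s be ta nu : (2 <= m)%N -> 0 < s -> 0 <= ta ->
 5 * (m%:R * s) + s + ta < 1 -> 1 + m%:R * s + 5 * s <= be -> 1 + be - 3 * (m%:R * s) + s - ta < nu ->
 ~ (\forall n \near \oo, exists P, small_at xi ((m%:R + 5) * s) be ta nu n P).
Proof.
move=> m2 s0 ta0 h1 h2 h3 hP.
have m0 : (0 < m)%N by apply: leq_trans m2.
have mR : 2 <= m%:R :> R by rewrite ler_nat.
(* The ratio [(m+1) : 4] of [al] to [vs] makes two lower bounds for [nu] coincide:
   [1 + be + al - m vs - ta] from interpolation, and [1 + be - 3 al + vs - ta] from comparing good
   approximants of consecutive levels. *)
pose w := m%:R * s; pose al := w + s; pose vs := 4 * s.
pose d := Num.min (nu - (1 + be - 3 * w + s - ta)) (Num.min (1 - (5 * w + s + ta)) s).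
have d0 : 0 < d by rewrite /d !lt_min /w; apply/andP; split; [|apply/andP; split=> //]; lra.
have [d1 [d2 d3]] : d <= nu - (1 + be - 3 * w + s - ta) /\ d <= 1 - (5 * w + s + ta) /\ d <= s.
 by rewrite /d !ge_min !lexx !orbT.
pose e := d / 100; pose ka := e / (10 * (m%:R + 1)).
have e0 : 0 < e by rewrite divr_gt0.
have k0 : 0 < ka by rewrite /ka divr_gt0 // mulr_gt0 // ltr_wpDl.
have kE : 10 * (m%:R * ka + ka) = e by rewrite /ka; field; rewrite gt_eqF // ltr_wpDl.
have mk : ka * 2 <= m%:R * ka by rewrite mulrC ler_wpM2r // ltW.
pose kp := (5 * m%:R + 4) * ka.
have kpE : kp = 5 * (m%:R * ka) + 4 * ka by rewrite /kp; ring.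
have dE : d = 100 * e by rewrite /e; field.
have kp0 : 0 < kp by rewrite kpE; lra.
have w2 : 2 * s <= w by rewrite /w ler_wpM2r // ltW.
(* The exponent range of the collision in the torsion state: the [m]-th root of [n^(1-ta)]. *)
pose r := (1 - ta) / m%:R.
have mr : m%:R * r = 1 - ta by rewrite /r mulrC divfK // gt_eqF // (lt_le_trans _ mR).
have r0 : 0 <= r by rewrite /r divr_ge0 // subr_ge0; rewrite /w in w2; lra.
have r5 : 5 * s <= r by rewrite /r ler_pdivlMr ?(lt_le_trans _ mR) //; lra.
have r1 : 2 * r <= 1 - ta by rewrite -mr ler_wpM2r.
have r2 : 2 * r <= 1 - ta - 5 * w + 10 * s.
 have : 0 <= m%:R - 2 :> R by rewrite subr_ge0.
 by move=> q; have := ler_wpM2l q r5; rewrite /w; move: mr; rewrite -/r; lra.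
have omE : m%:R * vs = 4 * w by rewrite /vs /w; ring.
have sgE : (m%:R + 5) * s = al + vs by rewrite /al /vs /w; ring.
rewrite -/w in h1 h2 h3.
(* Given the bound on [nu], and up to slack, the comparison of [H (Some false)] with [a None] is
   exactly the condition [5 * w + s + ta < 1]. *)
pose D (st : option bool) := match st with None => vs + e | Some true => r + 2 * kp + e | Some false => 1 - al - ta + vs + e end.
pose H (st : option bool) := match st with None => vs + e | Some true => r + 2 * kp + e | Some false => be - 2 * al - ta + e end.
pose a (st : option bool) := match st with None => nu - ta - 4 * w - 2 * ka - vs - e | Some true => nu - 1 - 2 * kp - (r + 2 * kp) - e | Some false => nu - 1 + al - vs - e end.
pose b (st : option bool) := match st with None => nu - ta - 4 * w - 2 * ka - vs - e | Some true => nu - 1 - 2 * kp - (r + 2 * kp) - e | Some false => nu - be + 2 * al - e end.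
pose st n := if `[< ~ separated xi vs ta nu ka n >] then None else Some `[< tors_at xi ta nu kp n >].
have key : \forall n \near \oo, (st n = Some false -> ~ tors_at xi ta nu (2 * kp) n) /\
  exists Q, approximant th (D (st n)) (H (st n)) (a (st n)) (b (st n)) n Q.
 have vs0 : 0 < vs by rewrite /vs; flra.
 have C1 : \forall n \near \oo, ~ separated xi vs ta nu ka n -> exists i i' : T vs n, i != i' /\
   cab (zeta i - zeta i') <= expR (- pw n (nu - ta - m%:R * vs - 2 * ka)).
  by apply: near_collision => //; rewrite omE; flra.
 have C2 := @near_collision_approximant R m xi xi0 th tr halg mi vs (nu - ta - 4 * w - 2 * ka) e (ltW vs0) e0 ltac:(rewrite /vs; flra).
 have T1 := @near_tors_collision R m xi ta nu kp m0 kp0 ta0 ltac:(flra) ltac:(flra) ltac:(flra).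
 have T2 := @near_collision_approximant R m xi xi0 th tr halg mi (r + 2 * kp) (nu - 1 - 2 * kp) e ltac:(flra) e0 ltac:(flra).
 have G1 := @near_core R m xi al vs ((m%:R + 5) * s) be ta nu ka xi0 m0 k0.
 have G2 := @near_good_approximant R m xi al vs be ta nu ka th tr halg e k0.
 rewrite omE sgE in G1 G2 C1.
 have {}G1 := G1 ltac:(rewrite -/kp /al; flra) ltac:(rewrite /al; flra) ltac:(rewrite /vs; flra) (lexx _) ta0 ltac:(flra)
  ltac:(rewrite /al; flra) ltac:(rewrite /al; flra) ltac:(rewrite /al /vs; flra) ltac:(rewrite /al; flra) ltac:(rewrite /al; flra) hAlg.
 have {}G2 := G2 ltac:(flra) vs0 ltac:(rewrite /al; flra) ltac:(rewrite /al /vs; flra) ltac:(rewrite /al; flra)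
   ltac:(rewrite /al /vs; flra) ltac:(rewrite /al; flra).
 near=> n; near_have n hP => -[P sP]; rewrite sgE in sP.
 rewrite /st; case: asboolP => [ns|/contrapT sep].
  split=> //; near_have n C1 => /(_ ns) [i [i' [ii' sm]]].
  near_have n C2 => c2; apply: (c2 (lvx vs n) _ _ _ _ _ sm).
  - by have [] := truncn_pw n vs.
  - by move=> k; apply/andP; split; rewrite -ltnS ltn_ord.
  - apply: contrapT => hn; case/eqP: ii'; apply/ffunP => k; apply: val_inj; apply/eqP/negPn/negP => ne.
   by apply: hn; exists k.
 near_have n G1 => /(_ _ sP sep) g1.
 case: asboolP => [tor|ntor].
  split=> //; near_have n T1 => /(_ tor) [y [i [i' [yh hy hk sm]]]].
  by near_have n T2; apply; eassumption.
 case: g1 => // -[nt gd]; split=> //.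
 have p1 : 2 <= pw n (ka / 2) by near: n; apply: near_pw_ge; rewrite divr_gt0.
 rewrite -omE in gd.
 have [i gi] := good_exists (P := fun i => good_factor al be ta nu ka n (zeta i)) (ltac:(by rewrite divr_gt0) : 0 < ka / 2) (lt_le_trans (ltr1n _ 2) p1) gd.
 by near_have n G2; apply; exact: gi.
have tT k : st k = Some true -> tors_at xi ta nu kp k by rewrite /st; case: asboolP => // _ [] /asboolP.
clearbody st.
have TS := @near_tors_succ R m xi ta nu kp kp0 ta0.
have [|Q hQ] := @near_choice {poly int} 0 (fun n Q => approximant th (D (st n)) (H (st n)) (a (st n)) (b (st n)) n Q).
 by apply: filterS key => n [].
apply: (approximant_chain hQ).
 have key0 : \forall n \near \oo, st n = Some false -> ~ tors_at xi ta nu (2 * kp) n by apply: filterS key => n [].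
 have key1 := near_shift key0.
 near=> n => t t' tt.
 near_have n key0 => n1; near_have n key1 => n2; near_have n TS => -[n3 n4].
 (* Only these two transitions would violate the inequalities between states, and the gap in the
    slack rules them out. *)
 have TG : ~ (st n = Some true /\ st n.+1 = Some false) by move=> [/tT /n3 q /n2].
 have GT : ~ (st n = Some false /\ st n.+1 = Some true) by move=> [/n1 q /tT /n4].
 have {}tt : ~ (t = Some true /\ t' = Some false) /\ ~ (t = Some false /\ t' = Some true).
  by case: tt => -[-> ->]; split => // -[? ?]; [apply: GT | apply: TG].
 case: t t' tt => [[]|] [[]|] [q1 q2]; (try by case: q1); (try by case: q2); rewrite /H /D /a /b /al /vs; split; flra.
by case=> [[]|] /=; rewrite /al /vs; flra.
Unshelve. all: by end_near. Qed.

End Chain.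

(** * Roots of approximants near powers of a transcendental number *)

Section NearRoots.
Variable R : realType.
Notation polyC := (map_poly (intr : int -> R[i])).
Notation mz Q := (mah (polyC Q)).
Implicit Types (z r : R[i]) (p W : {poly R[i]}) (Q : {poly int}).

Lemma horner_le_mah z p : p != 0 -> cab p.[z] <= mah p * (2 * mx1 z) ^+ (size p).-1.
Proof.
move=> p0; have p1 : (0 < size p)%N by rewrite size_poly_gt0.
apply: le_trans (n1_horner (n := (size p).-1) z _) _; first by rewrite prednK.
by rewrite exprMn mulrA [mah p * _]mulrC ler_wpM2r ?exprn_ge0 ?(ltW (mx1_gt0 z)) // n1_le_mah.
Qed.

Lemma root_quotient p r : p != 0 -> root p r -> exists W, [/\ p = ('X - r%:P) * W, W != 0, (size W).-1.+1 = (size p).-1 & mah W <= mah p].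
Proof.
move=> p0 /factor_theorem [W pE]; have W0 : W != 0 by apply: contra_neq p0 => W0; rewrite pE W0 mul0r.
have X0 : 'X - r%:P != 0 by rewrite polyXsubC_eq0.
exists W; rewrite mulrC in pE; split=> //.
- by rewrite pE size_mul // size_XsubC /= prednK // size_poly_gt0.
- by rewrite pE mahM // mah_XsubC ler_peMl ?mx1_ge1 // ltW // mah_gt0.
Qed.

Lemma horner_near_root z r p e : p != 0 -> root p r -> cab (z - r) <= e ->
 cab p.[z] <= e * (mah p * (2 * mx1 z) ^+ (size p).-1).
Proof.
move=> p0 /(root_quotient p0) [W [pE W0 sW mW]] hz; rewrite {1}pE hornerM hornerXsubC cabM.
have m2 : 1 <= 2 * mx1 z by have := mx1_ge1 z; lra.
apply: ler_pM; rewrite ?cab_ge0 //; apply: le_trans (horner_le_mah z W0) _.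
apply: ler_pM => //; rewrite ?exprn_ge0 ?(le_trans ler01 m2) ?(ltW (mah_gt0 W0)) //.
by rewrite ler_weXn2l // -sW.
Qed.

(** After division by [X - r] the quotient still has the root [r'] near [z], so both terms of the
    derivative of the product are small. *)
Lemma deriv_near_roots z r r' p e : p != 0 -> root p r -> root p r' -> r != r' ->
 cab (z - r) <= e -> cab (z - r') <= e ->
 cab p^`().[z] <= 2 * e * (mah p * (4 * mx1 z) ^+ (size p).-1).
Proof.
move=> p0 pr pr' rr' h h'; have [W [pE W0 sW mW]] := root_quotient p0 pr.
have Wr' : root W r'.
 move: pr'; rewrite pE rootM root_XsubC => /orP[/eqP E|//]; by case/eqP: rr'.
have m2 : 1 <= 2 * mx1 z by have := mx1_ge1 z; lra.
have m4 : 1 <= 4 * mx1 z by have := mx1_ge1 z; lra.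
have e0 : 0 <= e := le_trans (cab_ge0 _) h.
have mp := mah_gt0 p0; have mW0 := mah_gt0 W0.
rewrite {1}pE derivM derivXsubC mul1r hornerD hornerM hornerXsubC.
have h1 : cab W.[z] <= e * (mah p * (4 * mx1 z) ^+ (size p).-1).
 apply: le_trans (horner_near_root W0 Wr' h') _; rewrite ler_wpM2l //.
 apply: ler_pM => //; rewrite ?exprn_ge0 ?(le_trans ler01 m2) ?(ltW mW0) //.
 apply: (@le_trans _ _ ((4 * mx1 z) ^+ (size W).-1)).
  by rewrite lerXn2r ?nnegrE ?(le_trans ler01 m2) ?(le_trans ler01 m4) // ler_wpM2r ?(ltW (mx1_gt0 z)) // ler_nat.
 by rewrite ler_weXn2l // -sW.
have h2 : cab W^`().[z] <= mah p * (4 * mx1 z) ^+ (size p).-1.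
 have sW1 : (size W <= (size W).-1.+1)%N by apply: leqSpred.
 apply: le_trans (n1_horner (n := (size W).-1) z _) _.
  by apply: leq_trans (leqSpred _); apply: ltnW; apply: lt_size_deriv.
 have d : n1 W^`() <= 2 ^+ (size W).-1 * (2 ^+ (size W).-1 * mah W).
  rewrite -poly.nderivn1; apply: le_trans (n1_nderivn 1 sW1) _; rewrite ler_wpM2l ?exprn_ge0 //; exact: n1_le_mah.
 apply: le_trans (ler_wpM2r _ d) _; first by rewrite exprn_ge0 // ltW // mx1_gt0.
 have -> : 2 ^+ (size W).-1 * (2 ^+ (size W).-1 * mah W) * mx1 z ^+ (size W).-1 = mah W * (4 * mx1 z) ^+ (size W).-1.
  rewrite (_ : 4 * mx1 z = 2 * (2 * mx1 z)); last by ring.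
  by rewrite !exprMn; ring.
 apply: ler_pM => //; rewrite ?exprn_ge0 ?(le_trans ler01 m4) ?(ltW mW0) //.
 by rewrite ler_weXn2l // -sW.
apply: le_trans (cabD _ _) _; rewrite cabM; have := ler_pM (cab_ge0 _) (cab_ge0 _) h h2.
by lra_from h1.
Qed.

Lemma wt_near_root z r Q e : Q != 0 -> ~~ root (polyC Q) z -> root (polyC Q) r -> cab (z - r) <= expR (- e) -> e <= wt z Q.
Proof.
move=> Q0 nr rr h; have pQ := polyC_neq0 R Q0; have := horner_near_root pQ rr h.
rewrite size_polyF {1}cab_horner_wt //.
have m2 : 0 < 2 * mx1 z by rewrite mulr_gt0 // mx1_gt0.
have e1 : mz Q = expR (ln (mz Q)) by rewrite lnK // posrE mah_gt0.
have e2 d : (2 * mx1 z) ^+ d = expR (d%:R * ln (2 * mx1 z)) by rewrite expRM_natl lnK.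
by rewrite e2 [X in _ <= _ * (X * _)]e1 -!expRD ler_expR; lra.
Qed.

Lemma lnmz_deriv Q : (1 < size Q)%N -> Q^`() != 0 /\ ln (mz Q^`()) <= ln (mz Q) + 2 * (size Q).-1%:R.
Proof.
move=> sQ; have Q0 : Q != 0 by rewrite -size_poly_gt0 ltnW.
have Q'0 : Q^`() != 0.
 apply/eqP => /polyP /(_ (size Q).-2); rewrite coef_deriv coef0 => /eqP.
 have -> : (size Q).-2.+1 = (size Q).-1 by case: (size Q) sQ => [|[]].
 by rewrite mulrn_eq0 -lead_coefE lead_coef_eq0 (negPf Q0) orbF; case: (size Q) sQ => [|[]].
split=> //; have pQ := polyC_neq0 R Q0; have pQ' := polyC_neq0 R Q'0.
have h : mz Q^`() <= expR (2 * (size Q).-1%:R) * mz Q.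
 apply: le_trans (mah_le_n1 pQ') _; rewrite -deriv_map -poly.nderivn1.
 have s1 : (size (polyC Q) <= (size Q).-1.+1)%N by rewrite size_polyF leqSpred.
 apply: le_trans (n1_nderivn 1 s1) _.
 have h1 := n1_le_mah pQ; rewrite size_polyF in h1.
 apply: le_trans (ler_wpM2l _ h1) _; first by rewrite exprn_ge0.
 rewrite mulrA ler_wpM2r ?(ltW (mah_gt0 pQ)) // -exprMn (_ : expR (2 * _) = expR 2 ^+ (size Q).-1); last by rewrite -expRM_natl mulrC.
 rewrite lerXn2r ?nnegrE ?expR_ge0 ?mulr_ge0 // (_ : expR 2 = expR 1 * expR 1); last by rewrite -expRD.
 by have e1 := @expR_ge1Dx R 1; apply: ler_pM.
rewrite -[leRHS]expRK ler_ln ?posrE ?expR_gt0 ?mah_gt0 // expRD lnK ?posrE ?mah_gt0 //.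
by rewrite mulrC.
Qed.

Definition transc z := forall Q, Q != 0 -> ~~ root (polyC Q) z.

(* Q and its derivative have no common root, so one of them is not small. *)
Lemma near_deriv_ge D H a b l e : 0 <= l -> 0 <= D -> H < a -> D + l < a -> D < b -> H < e -> D + l < e ->
 \forall n \near \oo, forall z Q, transc z -> ln (mx1 z) <= pw n l -> approximant z D H a b n Q ->
 expR (- ((size Q).-1%:R * pw n e)) <= cab (polyC Q)^`().[z].
Proof.
move=> l0 D0 h1 h2 h3 h4 h5.
(* The derivative has logarithmic Mahler measure at most [ln M(Q) + 2 deg Q], so its exponent is
   taken above both [H] and [D], but still below [a] and [e]. *)
pose H' := Num.max H D + Num.min (Num.min a e - Num.max H D) 1 / 2.
have m1 : Num.max H D < Num.min a e by rewrite gt_max !lt_min; lra.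
have [H1 [H2 [H3 H4]]] : H < H' /\ D < H' /\ H' < a /\ H' < e.
 have : H <= Num.max H D by rewrite le_max lexx.
 have : D <= Num.max H D by rewrite le_max lexx orbT.
 have : Num.min a e <= a by rewrite ge_min lexx.
 have : Num.min a e <= e by rewrite ge_min lexx orbT.
 have : Num.min (Num.min a e - Num.max H D) 1 <= Num.min a e - Num.max H D by rewrite ge_min lexx.
 have : 0 < Num.min (Num.min a e - Num.max H D) 1 by rewrite lt_min ltr01 subr_gt0 m1.
 rewrite /H'; set x := Num.min (_ - _) 1; move: m1; generalize x (Num.min a e) (Num.max H D); clear; move=> *; lra.
pose k := (e - D - l) / 2; have k0 : 0 < k by rewrite /k; lra.
near=> n => z Q tz zl aQ; have [iQ rQ dQ lQ wQ] := aQ.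
have pge (c : R) : 0 <= pw n c by exact: pw_ge0.
have Q0 := irrz_neq0 iQ; have sQ := irrz_size_gt1 iQ.
have [Q'0 lQ'] := lnmz_deriv sQ; have pQ' := polyC_neq0 R Q'0.
have d1 : 1 <= (size Q).-1%:R :> R by rewrite ler1n irrz_deg_gt0.
have d0 : 0 <= (size Q).-1%:R :> R by [].
have dd' : ((size Q^`()).-1 <= (size Q).-1)%N.
 by have := lt_size_deriv Q0; case: (size Q) => [|k'] //=; rewrite ltnS => h; apply: leq_trans h; exact: leq_pred.
have dR : (size Q^`()).-1%:R <= (size Q).-1%:R :> R by rewrite ler_nat.
rewrite deriv_map.
have [c0|cn0] := posnP (size Q^`()).-1.
 have /size_poly1P [c c0' ->] : size Q^`() == 1%N.
  by have := size_poly_gt0 Q^`(); rewrite Q'0; case: (size _) c0 => [|[]].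
 rewrite map_polyC /= hornerC; apply: le_trans (cab_int_ge1 R c0').
 by rewrite -[leRHS]expR0 ler_expR oppr_le0 mulr_ge0.
have lQ2 : ln (mz Q^`()) <= pw n H'.
 have f1 : 2 * pw n H <= pw n H' by near: n; apply: near_pw.
 have f2 : 4 * pw n D <= pw n H' by near: n; apply: near_pw.
 by lra_from lQ', lQ, dQ, f1, f2.
have dQ2 : (size Q^`()).-1%:R <= pw n D by apply: le_trans dQ.
have rz := tz _ Q'0.
have lt : (size Q^`()).-1%:R * ln (mz Q) + (size Q).-1%:R * ln (mz Q^`()) +
  (size Q).-1%:R * (size Q^`()).-1%:R * (4 * ln (mx1 z) + 2 + 4 * ln (2 * ((size Q).-1 + (size Q^`()).-1)%:R)) < wt z Q.
 move: (Q^`()) dQ2 lQ2 => Q1; move: z Q zl aQ {tz iQ rQ dQ lQ wQ Q0 sQ Q'0 lQ' pQ' d1 d0 dd' dR cn0 rz} => z Q zl aQ.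
 by move: z Q Q1 zl aQ; near: n; apply: (@near_resultant_lt R D H a b D H' l).
have nr y : root (polyC Q) y -> ~~ root (polyC Q^`()) y.
 by move=> ry; rewrite -deriv_map; apply: irrz_deriv_root iQ ry.
have := resultant_wt (irrz_deg_gt0 iQ) cn0 rQ rz nr; rewrite ge_min => /orP[|wQ'].
 by move=> /le_lt_trans /(_ lt); rewrite ltxx.
rewrite cab_horner_wt // ler_expR; apply: (@le_trans _ _ (- wt z Q^`())); last first.
 have := ln2mx1_ge0 z; have : 0 <= ln (mz Q^`()) by exact: lnmz_ge0.
 have := mulr_ge0 (ler0n R (size Q^`()).-1) (ln2mx1_ge0 z); clear; lra.
rewrite lerN2; apply: le_trans wQ' _.
have lm0 : 0 <= ln (mz Q) by rewrite lnmz_ge0.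
have lz0 : 0 <= ln (mx1 z) by rewrite ln_ge0 // mx1_ge1.
have hl : ln (2 * ((size Q).-1 + (size Q^`()).-1)%:R) <= pw n k.
 rewrite -[leLHS]mul1r; have : 2 * ((size Q).-1 + (size Q^`()).-1)%:R <= pw n (D + 1).
  have f : 4 * pw n D <= pw n (D + 1) by near: n; apply: near_pw; rewrite ltrDl.
  by apply: le_trans f; rewrite natrD; lra_from dQ, dR.
 by move: (_ * _); near: n; apply: near_ln_pw.
have q1 : pw n l <= pw n (l + k) by apply: ler_pw; rewrite lerDl ltW.
have q2 : pw n k <= pw n (l + k) by apply: ler_pw; rewrite lerDr.
have q3 : 1 <= pw n (l + k) by apply: pw_ge1; rewrite addr_ge0 // ltW.
have f1 : 4 * pw n H' <= pw n e by near: n; apply: near_pw.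
have f2 : 4 * pw n H <= pw n e by near: n; apply: near_pw.
have f3 : 40 * pw n (D + (l + k)) <= pw n e by near: n; apply: near_pw; rewrite /k; lra_from h5.
set X := 4 * ln (mx1 z) + _ + _.
have hX : X <= 10 * pw n (l + k) by rewrite /X; lra_from zl, hl, q1, q2, q3.
have X0 : 0 <= X.
 rewrite /X !addr_ge0 ?mulr_ge0 // ln_ge0 // -natrM ler1n muln_gt0 addn_gt0 irrz_deg_gt0 //.
have g1 : (size Q^`()).-1%:R * ln (mz Q) <= (size Q).-1%:R * (pw n e / 4).
 by apply: ler_pM => //; lra_from lQ, f2.
have g2 : (size Q).-1%:R * ln (mz Q^`()) <= (size Q).-1%:R * (pw n e / 4).
 by rewrite ler_wpM2l //; lra_from lQ2, f1.
have g3 : (size Q).-1%:R * (size Q^`()).-1%:R * X <= (size Q).-1%:R * (pw n e / 4).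
 rewrite -mulrA ler_wpM2l //; apply: (@le_trans _ _ (pw n D * (10 * pw n (l + k)))).
  by apply: ler_pM => //; apply: le_trans dR dQ.
 by rewrite (pwD n D) in f3; lra_from f3.
have := mulr_ge0 d0 (pge e); lra_from g1, g2, g3.
Unshelve. all: by end_near. Qed.


Lemma factor_root (N : {poly int}) r : N != 0 -> root (polyC N) r -> exists Q, [/\ irrz Q, root (polyC Q) r,
 ((size Q).-1 <= (size N).-1)%N & ln (mz Q) <= ln (mz N)].
Proof.
move=> N0; have [c [s [c0 hs NE]]] := irrz_factorization N0.
have nz q : q \in s -> q != 0 by move=> /hs /irrz_neq0.
have lm0 q : q \in s -> 0 <= ln (mz q) by move=> /nz /(lnmz_ge0 R).
rewrite {1}NE map_polyZ /= rootZ ?intr_eq0 // => rr.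
have [q qs rq] : exists2 q, q \in s & root (polyC q) r.
 move: rr; rewrite rmorph_prod /=; clear; elim: s => [|q s IH]; first by rewrite big_nil (negPf (root1 _)).
 rewrite big_cons rootM => /orP[h|/IH [q' q's h]]; [exists q | exists q'] => //; by rewrite inE ?eqxx // q's orbT.
exists q; split=> //; first exact: hs.
- have dN := deg_scaled_prod c0 nz; rewrite -NE in dN.
 by rewrite dN (big_rem q) //= leq_addr.
have lN := lnmz_scaled_prod R c0 nz; rewrite -NE in lN.
apply: le_trans lN; rewrite (big_rem q) //= lerDl big_seq; apply: sumr_ge0 => q' /mem_rem; exact: lm0.
Qed.

(** [near_root] with the lower bound [near_deriv_ge] for the derivative; of the gain in weight at
    least a quarter survives. *)
Lemma near_root_approximant D H a b l : 0 <= l -> 0 <= D -> H < a -> D + l < a -> D < b ->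
 \forall n \near \oo, forall z Q, transc z -> ln (mx1 z) <= pw n l -> approximant z D H a b n Q ->
 exists2 r, root (polyC Q) r & cab (z - r) <= expR (- (((size Q).-1%:R * pw n a + ln (mz Q) * pw n b) / 4)).
Proof.
move=> l0 D0 h1 h2 h3.
pose e := (Num.max H (D + l) + a) / 2.
have [h4 [h5 h6]] : H < e /\ D + l < e /\ e < a.
 have m1 : Num.max H (D + l) < a by rewrite gt_max h1 h2.
 have : H <= Num.max H (D + l) by rewrite le_max lexx.
 have : D + l <= Num.max H (D + l) by rewrite le_max lexx orbT.
 rewrite /e; generalize (Num.max H (D + l)) m1; clear; move=> *; lra.
near=> n => z Q tz zl aQ; have [iQ rQ dQ lQ wQ] := aQ.
have pge (c : R) : 0 <= pw n c by exact: pw_ge0.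
have Q0 := irrz_neq0 iQ; have pQ := polyC_neq0 R Q0.
have d0 : 0 <= (size Q).-1%:R :> R by [].
have lm0 : 0 <= ln (mz Q) by rewrite lnmz_ge0.
have dge : expR (- ((size Q).-1%:R * pw n e)) <= cab (polyC Q)^`().[z].
 by move: z Q tz zl aQ {iQ rQ dQ lQ wQ Q0 pQ d0 lm0}; near: n; apply: (@near_deriv_ge D H a b l e).
have sc : size (croots (polyC Q)) = (size Q).-1 by rewrite size_croots // size_polyF.
have [||r rs hr] := @near_root R (lead_coef (polyC Q)) (croots (polyC Q)) z.
- by rewrite sc irrz_deg_gt0.
- by rewrite lead_coef_eq0.
rewrite -crootsE sc in hr; exists r; first by rewrite -mem_croots.
rewrite cab_horner_wt // in hr.
have d1 : (size Q).-1%:R <= expR (size Q).-1%:R :> R.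
 by apply: le_trans (expR_ge1Dx _); rewrite lerDr.
have {}hr : cab (z - r) * expR (- ((size Q).-1%:R * pw n e)) <= expR ((size Q).-1%:R + (ln (mz Q) + (size Q).-1%:R * ln (2 * mx1 z) - wt z Q)).
 apply: le_trans (ler_wpM2l (cab_ge0 _) dge) _; apply: le_trans hr _.
 by rewrite [leRHS]expRD ler_wpM2r ?expR_ge0.
rewrite -ler_pdivlMr ?expR_gt0 // -expRN -expRD opprK in hr.
apply: le_trans hr _; rewrite ler_expR.
have f1 : 8 * pw n l <= pw n a by near: n; apply: near_pw; lra_from D0, h2.
have f2 : 8 * pw n e <= pw n a by near: n; apply: near_pw.
have f3 : 16 <= pw n a by near: n; apply: near_pw_ge; lra_from D0, h2, l0.
have f4 : 4 <= pw n b by near: n; apply: near_pw_ge; lra_from D0, h3.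
have hl : ln (2 * mx1 z) <= 1 + pw n l by rewrite ln2mx1E lerD ?ln2_le1.
have g1 := ler_wpM2l d0 hl; have g2 := ler_wpM2l d0 f1; have g3 := ler_wpM2l d0 f2; have g4 := ler_wpM2l d0 f3.
have g5 := ler_wpM2l lm0 f4; lra_from g1, g2, g3, g4, g5, wQ, d0, lm0.
Unshelve. all: by end_near. Qed.

Lemma root_lift x r i e : x != 0 -> (0 < i)%N -> cab (x ^+ i - r) <= cab x ^+ i * e -> e <= 1 / 2 ->
 exists2 y, y ^+ i = r & cab (y / x - 1) <= 3 * e.
Proof.
move=> x0 i0 h he; pose t := i.-root r; have tE : t ^+ i = r by rewrite rootCK.
have xi0 : x ^+ i != 0 by rewrite expf_neq0.
have [||w [w1 hw]] := @root_unity_near R (t / x) i e i0.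
- have -> : (t / x) ^+ i - 1 = (r - x ^+ i) / x ^+ i by rewrite expr_div_n tE mulrBl divff.
 by rewrite cabM cabV cab_distC ler_pdivrMr ?cab_gt0 // mulrC cabX.
- exact: he.
have w0 : w != 0 by rewrite -cab_gt0 (cab_root1 i0 w1).
exists (t / w); first by rewrite expr_div_n tE w1 divr1.
by rewrite mulrAC.
Qed.

Lemma transcX x b : (0 < b)%N -> transc x -> transc (x ^+ b).
Proof.
move=> b0 tx Q Q0; have : Q \Po 'X^b != 0 by rewrite comp_poly_eq0 // size_polyXn ltnS.
move=> /tx; apply: contra; by rewrite map_comp_poly map_polyXn /root horner_comp hornerXn.
Qed.

Section Point.
Variable x : R[i].
Hypotheses (x0 : x != 0) (tx : transc x).

Lemma lnmx1X i : ln (mx1 (x ^+ i)) = i%:R * ln (mx1 x).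
Proof. by rewrite mx1X lnXn ?mx1_gt0 // mulr_natl. Qed.

Lemma near_lnmx1X vs l : vs < l -> \forall n \near \oo, forall i : nat, i%:R <= pw n vs -> ln (mx1 (x ^+ i)) <= pw n l.
Proof.
move=> vl; near=> n => i hi; rewrite lnmx1X; have l0 : 0 <= ln (mx1 x) by rewrite ln_ge0 ?mx1_ge1.
apply: le_trans (ler_wpM2r l0 hi) _; rewrite mulrC; near: n; exact: near_pw.
Unshelve. all: by end_near. Qed.

(** An [i]-th root of the root near [x^i] is chosen next to [x] itself, so that the numbers found
    for different [i] become comparable. *)
Lemma near_iroot vs D H a b l : 0 <= vs -> vs < l -> 0 <= D -> H < a -> D + l < a -> D < b ->
 \forall n \near \oo, forall (i : nat) Q, (0 < i)%N -> i%:R <= pw n vs -> approximant (x ^+ i) D H a b n Q ->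
 exists2 y, root (polyC Q) (y ^+ i) &
  cab (y / x - 1) <= expR (- (((size Q).-1%:R * pw n a + ln (mz Q) * pw n b) / 8)).
Proof.
move=> vs0 vl D0 h1 h2 h3; have l0 : 0 <= l by apply: le_trans vs0 (ltW vl).
pose C := ln (1 + (cab x)^-1); have cx : 0 < cab x by rewrite cab_gt0.
have Cx : (cab x)^-1 <= expR C by rewrite /C lnK ?posrE ?addr_gt0 ?invr_gt0 // lerDr.
have C0 : 0 <= C by rewrite /C ln_ge0 // lerDl invr_ge0 ltW.
near=> n => i Q i0 hi aQ; have [iQ rQ dQ lQ wQ] := aQ.
have hl : ln (mx1 (x ^+ i)) <= pw n l by move: i hi {i0 aQ rQ wQ}; near: n; apply: near_lnmx1X.
have [r rr hr] : exists2 r, root (polyC Q) r & cab (x ^+ i - r) <= expR (- (((size Q).-1%:R * pw n a + ln (mz Q) * pw n b) / 4)).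
 have ti := transcX i0 tx; move: (x ^+ i) Q ti hl aQ {iQ rQ dQ lQ wQ}; near: n; exact: near_root_approximant.
set W := (size Q).-1%:R * pw n a + _ in hr *.
have lm0 : 0 <= ln (mz Q) by rewrite lnmz_ge0 // irrz_neq0.
have Wa : pw n a <= W.
 by rewrite /W -[leLHS]addr0 lerD ?mulr_ge0 ?pw_ge0 // ler_peMl ?pw_ge0 // ler1n irrz_deg_gt0.
have f1 : 16 * (C * pw n vs) <= pw n a by rewrite mulrA; near: n; apply: near_pw; lra_from D0, h2, vl.
have f2 : 32 <= pw n a by near: n; apply: near_pw_ge; lra_from D0, h2, vl, vs0.
have Ci := ler_wpM2l C0 hi.
have e3 : 3 * expR (C * i%:R - W / 4) <= expR (- (W / 8)).
 apply: (@le_trans _ _ (expR 2 * expR (C * i%:R - W / 4))).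
  by rewrite ler_wpM2r ?expR_ge0 //; have := @expR_ge1Dx R 2; clear -R x x0 tx; lra.
 by rewrite -expRD ler_expR; lra_from f1, f2, Wa, Ci.
have e1 : expR (- (W / 8)) <= 1.
 by rewrite -[leRHS]expR0 ler_expR; lra_from f2, Wa.
have [||y yE hy] := @root_lift x r i (expR (C * i%:R - W / 4)) x0 i0; last by exists y; [rewrite yE | exact: le_trans e3].
- apply: le_trans hr _; rewrite expRD mulrA ler_peMl ?expR_ge0 //.
 rewrite [C * _]mulrC expRM_natl -exprMn exprn_ege1 //.
 by rewrite mulrC -ler_pdivrMr // div1r.
- lra_from e3, e1.
Unshelve. all: by end_near. Qed.

Lemma cab_powB y b e : e <= 0 -> (0 < b)%N -> cab (y / x - 1) <= expR e -> 2 * b%:R + e <= 0 ->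
 cab (x ^+ b - y ^+ b) <= expR ((ln (1 + cab x) + 2) * b%:R + e).
Proof.
move=> e0 b0 h hb; have b2 : 2 * b%:R <= expR (2 * b%:R) :> R.
 by apply: le_trans (expR_ge1Dx _); rewrite lerDr.
have -> : x ^+ b - y ^+ b = x ^+ b * (1 - (y / x) ^+ b) by rewrite mulrBr mulr1 expr_div_n mulrC divfK ?expf_neq0.
have q : 2 * b%:R * expR e <= expR (2 * b%:R + e) by rewrite expRD ler_wpM2r ?expR_ge0.
rewrite mulrDl -addrA expRD cabM; apply: ler_pM; rewrite ?cab_ge0 //.
 rewrite cabX mulrC expRM_natl lnK ?posrE ?(lt_le_trans ltr01) ?lerDl ?cab_ge0 //.
 by rewrite lerXn2r ?nnegrE ?addr_ge0 ?cab_ge0 // lerDr.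
rewrite cab_distC; apply: (le_trans _ q); apply: near1X => //; first exact: expR_ge0.
by apply: le_trans q _; rewrite -[leRHS]expR0 ler_expR; exact: hb.
Qed.

(** [Q1] is the factor of [Q(X^u)] that vanishes at [y^v]. Its degree grows by at most [u], and it
    is an approximant for [x^v]: this moves information from the exponent [u * v] to [v]. *)
Lemma near_common_factor h D H a b D1 H1 a1 b1 e1 : 0 <= h -> D + h < D1 -> H < H1 -> D < H1 ->
 a1 + h < a -> b1 < b -> b1 < a -> e1 + h < a -> h < a ->
 \forall n \near \oo, forall (u v : nat) y Q, (0 < u)%N -> (0 < v)%N -> u%:R <= pw n h -> v%:R <= pw n h ->
 irrz Q -> (size Q).-1%:R <= pw n D -> ln (mz Q) <= pw n H -> root (polyC Q) (y ^+ (u * v)) ->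
 cab (y / x - 1) <= expR (- (((size Q).-1%:R * pw n a + ln (mz Q) * pw n b) / 8)) ->
 exists Q1, [/\ approximant (x ^+ v) D1 H1 a1 b1 n Q1, root (polyC Q1) (y ^+ v) &
  cab (y / x - 1) <= expR (- ((size Q1).-1%:R * pw n e1))].
Proof.
move=> h0 hD hH hDH ha hb hba he hha.
pose C := ln (1 + cab x) + 2; have C2 : 2 <= C by rewrite /C lerDr ln_ge0 // lerDl cab_ge0.
near=> n => u v y Q u0 v0 hu hv iQ dQ lQ rQ hy.
have pge (c : R) : 0 <= pw n c by exact: pw_ge0.
have Q0 := irrz_neq0 iQ; have pQ := polyC_neq0 R Q0.
set d := (size Q).-1 in dQ hy; have d1 : 1 <= d%:R :> R by rewrite ler1n irrz_deg_gt0.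
have d0 : 0 <= d%:R :> R by [].
have lm0 : 0 <= ln (mz Q) by rewrite lnmz_ge0.
have N0 : Q \Po 'X^u != 0 by rewrite comp_poly_eq0 // size_polyXn ltnS.
have NE : polyC (Q \Po 'X^u) = polyC Q \Po 'X^u by rewrite map_comp_poly map_polyXn.
have [|Q1 [iQ1 rQ1 dQ1 lQ1]] := @factor_root (Q \Po 'X^u) (y ^+ v) N0.
 by rewrite NE /root horner_comp hornerXn -exprM mulnC.
have dQ1R : (size Q1).-1%:R <= pw n h * d%:R.
 apply: le_trans (ler_wpM2r d0 hu); rewrite -natrM ler_nat; apply: leq_trans dQ1 _.
 by rewrite size_comp_poly size_polyXn mulnC.
have lQ1R : ln (mz Q1) <= ln (mz Q) + d%:R.
 apply: le_trans lQ1 _; have pN := polyC_neq0 R N0; have mQ0 := mah_gt0 pQ; have mN0 := mah_gt0 pN.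
 have mN : mz (Q \Po 'X^u) <= 2 ^+ d * mz Q.
  apply: le_trans (mah_le_n1 pN) _; rewrite NE; apply: le_trans (n1_comp_Xn _ _) _.
  by have := n1_le_mah pQ; rewrite size_polyF.
 apply: (@le_trans _ _ (ln (2 ^+ d * mz Q))); first by rewrite ler_ln; [exact: mN | rewrite posrE | rewrite posrE mulr_gt0 ?exprn_gt0].
 rewrite (@lnM _ (2 ^+ d)) ?posrE ?exprn_gt0 // lnXn // addrC lerD2l -[ln 2 *+ d]mulr_natl.
 by have := ler_wpM2l d0 (@ln2_le1 R); rewrite mulr1.
have d10 : 0 <= (size Q1).-1%:R :> R by [].
have lm10 : 0 <= ln (mz Q1) by rewrite lnmz_ge0 // irrz_neq0.
set W := d%:R * pw n a + _ in hy.
have lb : 0 <= ln (mz Q) * pw n b by rewrite mulr_ge0.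
have f1 : 32 * C * pw n h <= pw n a by near: n; apply: near_pw.
have f2 : 64 * pw n (a1 + h) <= pw n a by near: n; apply: near_pw.
have f3 : 64 * pw n b1 <= pw n b by near: n; apply: near_pw.
have f4 : 64 * pw n b1 <= pw n a by near: n; apply: near_pw.
have f5 : 64 * pw n (e1 + h) <= pw n a by near: n; apply: near_pw.
have Wa : pw n a <= W by rewrite /W -[leLHS]addr0 lerD // ler_peMl.
have vC : C * v%:R <= W / 32 by have := ler_wpM2l (le_trans (ler0n R 2) C2) hv; lra_from f1, Wa.
have v2 : 2 * v%:R <= C * v%:R by rewrite ler_wpM2r.
have W0 : 0 <= W by apply: le_trans Wa.
have g2 := ler_wpM2l d0 f2; have g3 := ler_wpM2l lm0 f3; have g4 := ler_wpM2l d0 f4; have g5 := ler_wpM2l d0 f5.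
rewrite (pwD n a1) in g2; rewrite (pwD n e1) in g5.
exists Q1; split=> //.
- split=> //.
 + exact: (transcX v0 tx (irrz_neq0 iQ1)).
 + apply: le_trans dQ1R _; apply: le_trans (ler_wpM2l (pge _) dQ) _; rewrite -pwD.
  by apply: ler_pw; rewrite addrC ltW.
 + apply: le_trans lQ1R _; have f6 : 2 * pw n H <= pw n H1 by near: n; apply: near_pw.
  have f7 : 2 * pw n D <= pw n H1 by near: n; apply: near_pw.
  by lra_from lQ, dQ, f6, f7.
 + have q1 := ler_wpM2r (pge a1) dQ1R; have q2 := ler_wpM2r (pge b1) lQ1R.
  apply: (@le_trans _ _ (W / 16)); first by rewrite /W; generalize q1, q2, g2, g3, g4, lb, (mulr_ge0 d0 (pge a)); clear; lra.
  apply: (@wt_near_root _ (y ^+ v)) => //; [exact: irrz_neq0 | exact: (transcX v0 tx (irrz_neq0 iQ1)) |].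
  apply: le_trans (cab_powB _ v0 hy _) _.
  * by lra_from W0.
  * by lra_from v2, vC, W0.
  * by rewrite ler_expR -/C; lra_from vC, W0.
apply: le_trans hy _; rewrite ler_expR lerN2; have q := ler_wpM2r (pge e1) dQ1R.
by rewrite /W; generalize q, g5, lb, (mulr_ge0 d0 (pge a)); clear; lra.
Unshelve. all: by end_near. Qed.

(** If [y^v] and [y'^v] differ, two roots of [Q] near [x^v] contradict [near_deriv_ge]; if they
    agree, [y / y'] is a [v]-th root of unity too close to 1. *)
Lemma near_root_unique h D H a b l e : 0 <= h -> h < l -> 0 <= D -> H < a -> D + l < a -> D < b -> H < e -> D + l < e ->
 \forall n \near \oo, forall (v : nat) Q y y', (0 < v)%N -> v%:R <= pw n h -> approximant (x ^+ v) D H a b n Q ->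
 root (polyC Q) (y ^+ v) -> root (polyC Q) (y' ^+ v) ->
 cab (y / x - 1) <= expR (- ((size Q).-1%:R * pw n e)) -> cab (y' / x - 1) <= expR (- ((size Q).-1%:R * pw n e)) ->
 y = y'.
Proof.
move=> h0 hl D0 h1 h2 h3 h4 h5; have l0 : 0 <= l by apply: le_trans h0 (ltW hl).
pose e' := (Num.max H (D + l) + e) / 2.
have [h6 [h7 h8]] : H < e' /\ D + l < e' /\ e' < e.
 have m1 : Num.max H (D + l) < e by rewrite gt_max h4 h5.
 have : H <= Num.max H (D + l) by rewrite le_max lexx.
 have : D + l <= Num.max H (D + l) by rewrite le_max lexx orbT.
 rewrite /e'; generalize (Num.max H (D + l)) m1; clear; move=> *; lra.
pose C := ln (1 + cab x) + 2; have C2 : 2 <= C by rewrite /C lerDr ln_ge0 // lerDl cab_ge0.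
near=> n => v Q y y' v0 hv aQ ry ry' hy hy'; have [iQ rQ dQ lQ wQ] := aQ.
have pge (c : R) : 0 <= pw n c by exact: pw_ge0.
have Q0 := irrz_neq0 iQ; have pQ := polyC_neq0 R Q0.
have hlm : ln (mx1 (x ^+ v)) <= pw n l by move: v hv {v0 aQ rQ wQ ry ry'}; near: n; apply: near_lnmx1X.
have dge : expR (- ((size Q).-1%:R * pw n e')) <= cab (polyC Q)^`().[x ^+ v].
 have tv := transcX v0 tx; move: (x ^+ v) Q tv hlm aQ {iQ rQ dQ lQ wQ Q0 pQ ry ry' hy hy'}.
 by near: n; apply: (@near_deriv_ge D H a b l e').
have d1 : 1 <= (size Q).-1%:R :> R by rewrite ler1n irrz_deg_gt0.
set d := (size Q).-1%:R : R in hy hy' dge d1 dQ; have d0 : 0 <= d := le_trans ler01 d1.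
have f1 : 32 * C * pw n h <= pw n e by near: n; apply: near_pw; lra_from hl, D0, h5.
have f2 : 32 * pw n H <= pw n e by near: n; apply: near_pw.
have f3 : 32 * pw n l <= pw n e by near: n; apply: near_pw; lra_from D0, h5.
have f4 : 32 * pw n e' <= pw n e by near: n; apply: near_pw.
have f5 : 1 <= pw n l by apply: pw_ge1.
have dpe : pw n e <= d * pw n e by rewrite ler_peMl.
have vC : C * v%:R <= d * pw n e / 32 by have := ler_wpM2l (le_trans (ler0n R 2) C2) hv; lra_from f1, dpe.
have v2 : 2 * v%:R <= C * v%:R by rewrite ler_wpM2r.
have v1 : 1 <= v%:R :> R by rewrite ler1n.
have yE : y ^+ v = y' ^+ v.
 apply/eqP/negPn/negP => ne.
 have c1 : forall w, cab (w / x - 1) <= expR (- (d * pw n e)) -> cab (x ^+ v - w ^+ v) <= expR (C * v%:R - d * pw n e).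
  move=> w hw; apply: cab_powB => //; first by generalize dpe, (pge e); clear; lra.
  by generalize v2, vC, dpe, (pge e); clear; lra.
 have := deriv_near_roots pQ ry ry' ne (c1 _ hy) (c1 _ hy').
 apply/negP; rewrite -ltNge; apply: lt_le_trans dge.
 rewrite size_polyF -{1}[mz Q]lnK ?posrE ?mah_gt0 //.
 have m4 : 0 < 4 * mx1 (x ^+ v) by rewrite mulr_gt0 ?mx1_gt0.
 rewrite -[4 * _]lnK // -expRM_natl -/d -expRD.
 have e2 : 2 <= expR 1 :> R by have := @expR_ge1Dx R 1; clear -R x x0 tx; lra.
 apply: (@le_lt_trans _ _ (expR 1 * expR (C * v%:R - d * pw n e) * expR (ln (mz Q) + d * ln (4 * mx1 (x ^+ v))))).
  by rewrite ler_wpM2r ?expR_ge0 // ler_wpM2r ?expR_ge0.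
 rewrite -!expRD ltr_expR.
 have l4 : ln (4 * mx1 (x ^+ v)) <= 2 + pw n l.
  rewrite (_ : 4 = 2 * 2 :> R); last by ring.
  rewrite !lnM ?posrE ?mulr_gt0 ?mx1_gt0 //; have := @ln2_le1 R; lra_from hlm.
 have g1 := ler_wpM2l d0 l4; have g3 := ler_wpM2l d0 f3; have g4 := ler_wpM2l d0 f4; have g5 := ler_wpM2l d0 f5.
 by lra_from g1, g3, g4, g5, vC, f2, lQ, dpe, d1, v1, v2.
pose ep := expR (- (d * pw n e)).
have s1 : 8 * v%:R * ep < 1.
 apply: (@le_lt_trans _ _ (expR (8 * v%:R) * ep)).
  by rewrite ler_wpM2r ?expR_ge0 //; apply: le_trans (expR_ge1Dx _); rewrite lerDr.
 rewrite /ep -expRD -[ltRHS]expR0 ltr_expR; lra_from v2, vC, v1.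
have ep0 : 0 <= ep by apply: expR_ge0.
have ep1 : ep <= 1 / 2.
 by have := ler_wpM2r ep0 v1; lra_from s1.
have y'0 : y' != 0.
 apply: contraTneq hy' => ->; rewrite mul0r sub0r cabN cab1 -ltNge -/ep; lra_from ep1.
have /(sep_unity v0) hsep : (y / y') ^+ v = 1 by rewrite expr_div_n yE divff // expf_neq0.
have E : y / x / (y' / x) = y / y' by rewrite invf_div mulrA divfK.
have := near1_div hy hy' ep1; rewrite E -/ep => q.
have /hsep /eqP : v%:R * cab (y / y' - 1) < 1.
 by have := ler_wpM2l (ler0n R v) q; generalize s1, (mulr_ge0 (ler0n R v) ep0); clear; lra.
by rewrite -(inj_eq (mulIf y'0)) divfK // mul1r => /eqP.
Unshelve. all: by end_near. Qed.

End Point.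
End NearRoots.

(** * Products of exponents *)

Section Grid.
Implicit Types (bad : pred nat) (y : nat).

(** Indices are shifted by one, so that both factors run from 1 to [y]. *)
Definition bad_pairs y bad := [set p : 'I_y * 'I_y | bad (p.2.+1 * p.1.+1)%N]%SET.
Definition bad_col y bad b := [set a : 'I_y | bad (a.+1 * b)%N]%SET.

(** Markov's inequality over the columns. *)
Lemma poor_card y bad : (#|[set b : 'I_y | y <= 2 * #|bad_col y bad b.+1|]%SET| * y <= 2 * #|bad_pairs y bad|)%N.
Proof.
have -> : #|bad_pairs y bad| = (\sum_(b < y) #|bad_col y bad b.+1|)%N.
 rewrite -sum1dep_card -(pair_big_dep xpredT (fun b a : 'I_y => bad (a.+1 * b.+1)%N) (fun _ _ => 1%N)) /=.
 by apply: eq_bigr => b _; rewrite sum1dep_card.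
rewrite -sum_nat_const big_distrr /= big_mkcond /=; apply: leq_sum => b _; rewrite inE; by case: ifP.
Qed.

Lemma common_good y bad b b' : (2 * #|bad_col y bad b| < y)%N -> (2 * #|bad_col y bad b'| < y)%N ->
 exists2 a : 'I_y, ~~ bad (a.+1 * b)%N & ~~ bad (a.+1 * b')%N.
Proof.
move=> h h'; apply: contrapT => hn.
have : (#|bad_col y bad b :|: bad_col y bad b'| < y)%N.
 by have := cardsUI (bad_col y bad b) (bad_col y bad b'); lia.
have -> : bad_col y bad b :|: bad_col y bad b' = finset.setT.
 apply/finset.setP => a; rewrite !inE; apply/negPn/negP; rewrite negb_or => /andP[q q'].
 by apply: hn; exists a.
by rewrite cardsT card_ord ltnn.
Qed.

(* Columns with mostly good entries are connected through common good rows. *)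
Lemma grid_const (T : Type) (v0 : T) (y : nat -> nat) (good : nat -> nat -> Prop) (g : nat -> nat -> T)
  (bad := fun n i => `[< ~ good n i >]) :
 (\forall n \near \oo, [/\ (y n <= y n.+1)%N, (16 * #|bad_pairs (y n) (bad n)| < y n * y n)%N
   & (16 * #|bad_pairs (y n.+1) (bad n.+1)| < y n * y n)%N]) ->
 (\forall n \near \oo, forall a a' b, (0 < a <= y n)%N -> (0 < a' <= y n)%N -> (0 < b <= y n)%N ->
   good n (a * b)%N -> good n (a' * b)%N -> g n (a * b)%N = g n (a' * b)%N) ->
 (\forall n \near \oo, forall a a' b, (0 < a <= y n)%N -> (0 < a' <= y n.+1)%N -> (0 < b <= y n)%N ->
   good n (a * b)%N -> good n.+1 (a' * b)%N -> g n (a * b)%N = g n.+1 (a' * b)%N) ->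
 exists v, \forall n \near \oo, exists a b, [/\ (0 < a <= y n)%N, (0 < b <= y n)%N, good n (a * b)%N & g n (a * b)%N = v].
Proof.
move=> h1 h2 h3.
have gd n i : ~~ bad n i -> good n i by move=> /asboolPn /contrapT.
pose rich n (b : nat) := (2 * #|bad_col (y n) (bad n) b| < y n)%N.
have h4 : \forall n \near \oo, exists v, forall a b, (0 < a <= y n)%N -> (0 < b <= y n)%N -> rich n b ->
  good n (a * b)%N -> g n (a * b)%N = v.
 near=> n; near_have n h2 => H2.
 have [[b [hb rb]]|hn] := boolp.EM (exists b, (0 < b <= y n)%N /\ rich n b); last first.
  by exists v0 => a b ha hb rb; case: hn; exists b.
 have [a0 /gd ga0 _] := common_good rb rb.
 exists (g n (a0.+1 * b)%N) => a b' ha hb' rb' gab.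
 have [a1 /gd q1 /gd q2] := common_good rb rb'.
 have o (c : 'I_(y n)) : (0 < c.+1 <= y n)%N by rewrite ltnS leq0n /=.
 rewrite (H2 a a1.+1 b') // -(H2 a1.+1 a0.+1 b) // [in LHS]mulnC [in RHS]mulnC.
 by apply: H2; rewrite // mulnC.
have [u hu] := near_choice v0 h4.
(* Poor columns at levels [n] and [n+1] together do not fill the range, so some column is rich at
   both; through it the values at the two levels are compared. *)
have h5 : \forall n \near \oo, exists b, [/\ (0 < b <= y n)%N, (y n <= y n.+1)%N, rich n b & rich n.+1 b].
 near=> n; near_have n h1 => -[yy c1 c2].
 have p1 := poor_card (y n) (bad n); have p2 := poor_card (y n.+1) (bad n.+1).
 set N1 := [set b : 'I_(y n) | _]%SET in p1; set N2 := [set b : 'I_(y n.+1) | _]%SET in p2.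
 have n1 : (8 * #|N1| < y n)%N by nia.
 have n2 : (8 * #|N2| < y n)%N by nia.
 pose N3 := [set b : 'I_(y n) | widen_ord yy b \in N2]%SET.
 have n3 : (#|N3| <= #|N2|)%N.
  have winj : injective (widen_ord yy) by move=> b b' /(congr1 val) e; apply: val_inj.
 rewrite -(card_imset _ winj); apply: subset_leq_card.
  by apply/fintype.subsetP => b' /imsetP [b]; rewrite inE => hb ->.
 have : ~ (N1 :|: N3 = finset.setT)%SET.
  by move=> E; have := cardsUI N1 N3; rewrite E cardsT card_ord; lia.
 move=> NE; apply: contrapT => hn; apply: NE; apply/finset.setP => b; rewrite !inE; apply/negPn/negP.
 by rewrite negb_or -!ltnNge => /andP[r1 r2]; apply: hn; exists b.+1; split=> //; rewrite ltnS leq0n /=.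
have hu1 := near_shift hu.
have [v hv] : exists v, \forall n \near \oo, u n = v.
 apply: near_const; near=> n.
 near_have n h5 => -[b [hb yy rb rb']]; near_have n h3 => H3.
 have hb' : (0 < b <= y n.+1)%N by case/andP: hb => -> /leq_trans ->.
 have [a /gd ga _] := common_good rb rb; have [a' /gd ga' _] := common_good rb' rb'.
 near_have n hu => H1; have U1 : g n (a.+1 * b)%N = u n.
  by apply: H1 => //; rewrite ltnS leq0n /=.
 near_have n hu1 => H2; have U2 : g n.+1 (a'.+1 * b)%N = u n.+1.
  by apply: H2 => //; rewrite ltnS leq0n /=.
 by rewrite -U1 -U2; symmetry; apply: H3 => //; rewrite ltnS leq0n /=.
exists v; near=> n; near_have n h5 => -[b [hb yy rb _]].
have [a /gd ga _] := common_good rb rb; exists a.+1, b; split=> //; first by rewrite ltnS leq0n /=.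
near_have n hu => H.
rewrite (H a.+1 b) //; last by rewrite ltnS leq0n /=.
by near: n.
Unshelve. all: by end_near. Qed.

(** An exponent [i] is a product of two factors in at most as many ways as it has divisors. *)
Lemma bad_pairs_le y bad N d : (y * y < N)%N -> (forall i, (0 < i < N)%N -> (size (divisors i) <= d)%N) ->
 (#|bad_pairs y bad| <= #|[set i : 'I_N | bad i]%SET| * d)%N.
Proof.
move=> yN hd; set B := [set i : 'I_N | _]%SET.
have lt (p : 'I_y * 'I_y) : (p.2.+1 * p.1.+1 < N)%N.
 by apply: leq_ltn_trans yN; apply: leq_mul; apply: ltn_ord.
pose f (p : 'I_y * 'I_y) : 'I_N := Ordinal (lt p).
rewrite -sum1_card (partition_big f (mem B)) /=; last by move=> p; rewrite !inE.
rewrite -sum_nat_const; apply: leq_sum => i iB; rewrite sum1dep_card.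
have [i0|i0] := posnP i.
 rewrite (_ : [set x | _]%SET = finset.set0) ?cards0 //; apply/finset.setP => p; rewrite !inE; apply/negbTE.
 by rewrite negb_and orbC -val_eqE /= i0 muln_eq0.
apply: leq_trans (hd i _); last by rewrite i0 /=.
rewrite cardE -(size_map (fun p : 'I_y * 'I_y => (p.1 : nat).+1)); apply: uniq_leq_size.
 rewrite map_inj_in_uniq ?enum_uniq // => p q; rewrite !mem_enum !inE => /andP[_ /eqP ep] /andP[_ /eqP eq] [e].
 have : (p.2.+1 * p.1.+1 = q.2.+1 * q.1.+1)%N by move/(congr1 val): (etrans ep (esym eq)).
 rewrite e => /eqP; rewrite eqn_pmul2r // => /eqP [e2].
 by case: p q e e2 {ep eq} => [p1 p2] [q1 q2] /= e e2; congr pair; apply: val_inj.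
move=> k /mapP [p]; rewrite mem_enum inE => /andP[_ /eqP ep] ->.
by rewrite -dvdn_divisors // -ep /= dvdn_mull.
Qed.

End Grid.

(** * One number: grids that are not separated *)

Section Rank1.
Variables (R : realType) (xi : 'I_1 -> R[i]).
Notation polyC := (map_poly (intr : int -> R[i])).
Notation mz Q := (mah (polyC Q)).
Notation T vs n := {ffun 'I_1 -> 'I_(lvx vs n).+1}.
Notation x := (xi ord0).
Notation zeta i := (mon xi (fun j => nat_of_ord (i j))).
Notation algebraic z := (algebraicOver (ratr : rat -> R[i]) z).
Hypotheses (xi0 : forall j, xi j != 0) (tx : transc x).

Lemma mon1 (i : 'I_1 -> nat) : mon xi i = x ^+ i ord0.
Proof. by rewrite /mon big_ord1. Qed.

Lemma cab_mul_ge (u : R[i]) e N : 0 <= e -> cab (u - 1) <= e -> 4 * N%:R * e <= 1 -> 1 / 2 <= cab u ^+ N.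
Proof.
move=> e0 he h; have h1 : cab (u ^+ N - 1) <= 2 * N%:R * e by apply: near1X => //; lra.
by have := cab_ge h1; rewrite cabX; lra.
Qed.

(** For [u] near 1 the difference is a power of [u], times [u - 1], times a geometric sum, and both
    other factors have modulus at least 1/2. *)
Lemma cab_powB_ge (u : R[i]) N k k' : (k <= N)%N -> (k' <= N)%N -> k != k' -> 4 * N%:R * cab (u - 1) <= 1 ->
 cab (u - 1) / 4 <= cab (u ^+ k - u ^+ k').
Proof.
wlog : k k' / (k < k')%N.
 move=> W kN k'N ne h; have [lt|lt|E] := ltngtP k k'; first exact: W.
  by rewrite [leRHS]cab_distC; apply: W => //; rewrite eq_sym.
 by rewrite E eqxx in ne.
move=> kk' kN k'N _ h; set d := cab (u - 1) in h *; have d0 : 0 <= d := cab_ge0 _.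
have le1 (l : nat) : (l <= N)%N -> 4 * l%:R * d <= 1.
 by move=> lN; apply: le_trans h; rewrite ler_wpM2r // ler_wpM2l // ler_nat.
have -> : u ^+ k - u ^+ k' = - (u ^+ k * (u ^+ (k' - k) - 1)).
 by rewrite mulrBr mulr1 -exprD subnKC ?(ltnW kk') // opprB.
rewrite cabN cabM cabX subrX1 cabM -/d.
have h1 := cab_mul_ge d0 (lexx _) (le1 _ kN).
have h2 : 1 / 2 <= cab (\sum_(i < k' - k) u ^+ i).
 have s1 : cab (\sum_(i < k' - k) (1 - u ^+ i)) <= (k' - k)%:R * (1 / 2).
  apply: le_trans (cab_sum _ _ _) _.
  apply: (@le_trans _ _ (\sum_(i < k' - k) (1 / 2))); last by rewrite sumr_const card_ord mulr_natl.
  apply: ler_sum => i _; rewrite cab_distC; have iN : (i <= N)%N by apply: leq_trans (ltnW (ltn_ord i)) _; apply: leq_trans k'N; apply: leq_subr.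
  by apply: le_trans (near1X d0 (lexx _) _) _; have := le1 _ iN; lra.
 rewrite sumrB sumr_const card_ord in s1.
 have := cabD (1 *+ (k' - k) - \sum_(i < k' - k) u ^+ i) (\sum_(i < k' - k) u ^+ i).
 rewrite subrK cab_nat; have : 1 <= (k' - k)%:R :> R by rewrite ler1n subn_gt0.
 by move: s1; set a := cab _; set b := cab _; set c := _%:R; clear; lra.
have q : 1 / 2 * (d * (1 / 2)) <= cab u ^+ k * (d * cab (\sum_(i < k' - k) u ^+ i)).
 by apply: (ler_pM _ _ h1); [rewrite divr_ge0 | rewrite mulr_ge0 ?divr_ge0 | rewrite ler_wpM2l].
by apply: le_trans q; lra.
Qed.

Variables (ta nu ka : R).
Ltac clr := clear -R xi xi0 tx ta nu ka.

(* The small distances between powers of x are those between exponents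
  congruent modulo the order M of a root of unity close to x. *)
Lemma near_not_separated vs kp : 0 < ka -> 0 < vs -> 0 <= ta -> vs + ta + 2 * ka < 1 + kp -> vs < nu - ta - vs - 2 * ka ->
 \forall n \near \oo, ~ separated xi vs ta nu ka n -> tors_at xi ta nu kp n.
Proof.
move=> k0 vs0 ta0 h1 h2.
pose C := ln (1 + (cab x)^-1); have cx : 0 < cab x by rewrite cab_gt0.
have Cx : (cab x)^-1 <= expR C by rewrite /C lnK ?posrE ?addr_gt0 ?invr_gt0 // lerDr.
have C0 : 0 <= C by rewrite /C ln_ge0 // lerDl invr_ge0 ltW.
pose w := nu - ta - vs - 2 * ka.
have NC : \forall n \near \oo, ~ separated xi vs ta nu ka n -> exists i i' : T vs n, i != i' /\
   cab (zeta i - zeta i') <= expR (- pw n (nu - ta - 1%:R * vs - 2 * ka)).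
 by apply: near_collision => //; rewrite mul1r; clear -k0 vs0 h2; lra.
rewrite mul1r -/w in NC h2.
near=> n => ns; set X := lvx vs n; pose L := (lvx vs n)%:R : R.
have pge (a : R) : 0 <= pw n a by exact: pw_ge0.
have [hx _] := truncn_pw n vs; rewrite -/(lvx vs n) in hx.
have [i0 [i0' [ne0 sm]]] : exists i i' : T vs n, i != i' /\ cab (zeta i - zeta i') <= expR (- pw n w) by move: ns; near: n.
have [p [q [pq qX {}sm]]] : exists p q, [/\ (p < q)%N, (q <= X)%N & cab (x ^+ p - x ^+ q) <= expR (- pw n w)].
 rewrite !mon1 in sm; have b (i : T vs n) : (i ord0 <= X)%N by rewrite -ltnS ltn_ord.
 have [lt|lt|E] := ltngtP (i0 ord0) (i0' ord0); first by exists (i0 ord0), (i0' ord0).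
  by exists (i0' ord0), (i0 ord0); rewrite cab_distC.
 by case/eqP: ne0; apply/ffunP => j; rewrite ord1; apply: val_inj.
pose d := (q - p)%N; have d0 : (0 < d)%N by rewrite subn_gt0.
have dX : (d <= X)%N by apply: leq_trans (leq_subr _ _) qX.
have XL : (1 <= X)%N by apply: leq_trans d0 dX.
have L1 : 1 <= L by rewrite /L ler1n.
have f1 : 64 * (C + 4) * pw n vs <= pw n w by near: n; apply: near_pw.
pose ep := expR (C * L - pw n w).
have hd : cab (x ^+ d - 1) <= ep.
 have E : x ^+ d - 1 = (x ^+ q - x ^+ p) / x ^+ p.
  have -> : x ^+ q = x ^+ p * x ^+ d by rewrite -exprD subnKC // ltnW.
  by rewrite mulrBl divff ?expf_neq0 // mulrAC divff ?expf_neq0 // mul1r.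
 rewrite E cabM cab_distC cabV cabX /ep expRD mulrC; apply: ler_pM => //; rewrite ?invr_ge0 ?exprn_ge0 ?cab_ge0 //.
 rewrite -exprVn mulrC expRM_natl; apply: (@le_trans _ _ (expR C ^+ p)).
  by rewrite lerXn2r ?nnegrE ?invr_ge0 ?cab_ge0 ?expR_ge0.
 by rewrite ler_weXn2l ?(ltnW (leq_trans pq qX)) // -[leLHS]expR0 ler_expR.
have CL : C * L <= C * pw n vs by rewrite ler_wpM2l.
have e2 : 64 * (L * L) * ep <= 1.
 apply: (@le_trans _ _ (expR (64 * L) * ep)).
  rewrite ler_wpM2r ?expR_ge0 // (_ : 64 * L = 32 * L + 32 * L); last by ring.
  have q1 : 32 * L <= expR (32 * L) by apply: le_trans (expR_ge1Dx _); rewrite lerDr.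
  have q0 : 0 <= 32 * L by rewrite mulr_ge0.
  rewrite expRD; apply: le_trans (ler_pM q0 q0 q1 q1); have := mulr_ge0 (le_trans ler01 L1) (le_trans ler01 L1); clr; lra.
 rewrite /ep -expRD -[leRHS]expR0 ler_expR; have := mulr_ge0 C0 (pge vs); move: f1 CL L1 (hx : L <= pw n vs); clr; lra.
have LL1 : L <= L * L by rewrite ler_peMl // (le_trans ler01).
have e1 : 64 * L * ep <= 1 by apply: le_trans e2; rewrite ler_wpM2r ?expR_ge0 // ler_wpM2l.
have ep0 : 0 <= ep by exact: expR_ge0.
have ep1 : 64 * ep <= 1 by apply: le_trans e1; rewrite -mulrA ler_wpM2l // ler_peMl.
have [om [omd hom]] : exists om, om ^+ d = 1 /\ cab (x / om - 1) <= 3 * ep.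
 by apply: (root_unity_near d0 hd); lra_from ep1.
have [M pM Md] := prim_order_exists d0 omd; have M0 := prim_order_gt0 pM.
have MX : (M <= X)%N by apply: leq_trans (dvdn_leq d0 Md) dX.
have om0 : om != 0 by rewrite -cab_gt0 (cab_root1 d0 omd).
pose u := x / om; set de := cab (x / om - 1) in hom; have xE : x = om * u by rewrite /u mulrC divfK.
have de0 : 0 < de.
 rewrite /de cab_gt0 subr_eq0; apply/eqP => E.
 have /negP[] := tx (XnB1_neq0 d0); rewrite rmorphB /= map_polyXn rmorph1 /root !hornerE subr_eq0.
 by have := xE; rewrite /u E mulr1 => ->; rewrite omd.
have dL : 4 * L * de <= 1 by have := ler_wpM2l (le_trans ler01 L1) hom; lra_from e1.
have cw k : cab (om ^+ k) = 1 by apply: (@cab_root1 _ _ d) => //; rewrite exprAC omd expr1n.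
(* Distinct powers of [om] differ by at least [1 / d], which dominates the error made in replacing
   [x] by [om]. *)
have far k k' : (k <= X)%N -> (k' <= X)%N -> om ^+ k != om ^+ k' -> (2 * L)^-1 <= cab (x ^+ k - x ^+ k').
 move=> kX k'X ne; have s1 : d%:R^-1 <= cab (om ^+ k - om ^+ k').
  rewrite leNgt; apply/negP => lt; case/eqP: ne; apply/eqP.
  have o0 : om ^+ k' != 0 by rewrite expf_neq0.
  have : om ^+ k / om ^+ k' = 1.
   apply: (@sep_unity _ _ d) => //; first by rewrite expr_div_n ![om ^+ _ ^+ d]exprAC omd !expr1n divr1.
   have -> : om ^+ k / om ^+ k' - 1 = (om ^+ k - om ^+ k') / om ^+ k' by rewrite mulrBl divff.
   by rewrite cabM cabV cw invr1 mulr1 mulrC -ltr_pdivlMr ?ltr0n // div1r.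
  by move=> /(congr1 ( *%R^~ (om ^+ k'))) /=; rewrite divfK // mul1r => ->.
 have s2 : L^-1 <= d%:R^-1 by rewrite lef_pV2 ?posrE ?ltr0n ?(lt_le_trans ltr01) // ler_nat.
 have s3 l : (l <= X)%N -> cab (u ^+ l - 1) <= 2 * L * (3 * ep).
  move=> lX; apply: le_trans (near1X (e := 3 * ep) _ hom _) _; first by rewrite mulr_ge0.
   have : l%:R * ep <= L * ep by rewrite ler_wpM2r // ler_nat.
   by lra_from e1.
  by rewrite ler_wpM2r ?mulr_ge0 // ler_wpM2l // ler_nat.
 have -> : x ^+ k - x ^+ k' = (om ^+ k - om ^+ k') + (om ^+ k * (u ^+ k - 1) - om ^+ k' * (u ^+ k' - 1)).
  by rewrite {1 2}xE !exprMn; ring.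
 set A := om ^+ k - _ in s1 *; set B := _ * _ - _.
 have hB : cab B <= 4 * L * (3 * ep).
  by apply: le_trans (cabB _ _) _; rewrite !cabM !cw !mul1r; have := s3 k kX; have := s3 k' k'X; clear; lra.
 have hA := cabD (A + B) (- B); rewrite addrK cabN in hA.
 have LL : L * L^-1 = 1 by rewrite divff // gt_eqF // (lt_le_trans ltr01).
 have L0 : 0 < L by apply: lt_le_trans L1.
 have Li : 0 < L^-1 by rewrite invr_gt0.
 have eL : 64 * (L * ep) <= L^-1.
  by rewrite -[leRHS]mul1r ler_pdivlMr // -mulrA; move: e2; rewrite [L * ep * L]mulrAC -!mulrA.
 rewrite invfM; lra_from hA, hB, s1, s2, eL, Li.
have near' k k' : (k <= X)%N -> (k' <= X)%N -> k != k' -> om ^+ k = om ^+ k' -> de / 4 <= cab (x ^+ k - x ^+ k').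
 move=> kX k'X ne oE; have -> : x ^+ k - x ^+ k' = om ^+ k * (u ^+ k - u ^+ k').
  by rewrite {1 2}xE !exprMn oE; ring.
 by rewrite cabM cw mul1r; exact: (@cab_powB_ge u X _ _ kX k'X ne dL).
have [s [i [us iS lt]]] : exists s (i : T vs n), [/\ uniq s, i \notin s & \prod_(i' <- s) cab (zeta i - zeta i') < expR (- pw n (nu - ta - ka))].
 apply: contrapT => hn; apply: ns => s i us iS; rewrite leNgt; apply/negP => lt; apply: hn; by exists s, i.
have b (l : T vs n) : (l ord0 <= X)%N by rewrite -ltnS ltn_ord.
have inj (l l' : T vs n) : l ord0 = l' ord0 :> nat -> l = l'.
 by move=> e; apply/ffunP => j; rewrite ord1; apply: val_inj.
pose same (i' : T vs n) := om ^+ i ord0 == om ^+ i' ord0.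
pose l4 := - ln (de / 4); pose l2 := ln (2 * L).
have de4 : 0 < de / 4 by rewrite divr_gt0.
have l40 : 0 <= l4.
 by rewrite /l4 oppr_ge0 ln_le0 // ; move: dL (ler_wpM2r (ltW de0) L1); clr; lra.
have L20 : 0 < 2 * L by rewrite mulr_gt0 // (lt_le_trans ltr01).
have l20 : 0 <= l2 by rewrite /l2 ln_ge0 //; lra_from L1.
have low : expR (- (\sum_(i' <- s) (if same i' then l4 else l2))) <= \prod_(i' <- s) cab (zeta i - zeta i').
 elim: s us iS {lt} => [|i' s IH]; first by rewrite !big_nil oppr0 expR0.
 rewrite !big_cons inE negb_or /= => /andP[_ us] /andP[ne iS]; rewrite opprD expRD; apply: ler_pM; rewrite ?expR_ge0 //; last exact: IH.
 have ne' : i ord0 != i' ord0 :> nat by apply: contra_neq ne => /inj.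
 rewrite !mon1 /same; case: eqP => [e|/eqP e]; first by rewrite /l4 opprK lnK //; apply: near'.
 by rewrite /l2 -lnV // lnK ?posrE ?invr_gt0 //; apply: far.
pose c := count same s.
have sumE : \sum_(i' <- s) (if same i' then l4 else l2) <= c%:R * l4 + (size s)%:R * l2.
 rewrite /c; clear low lt us iS c; elim: s => [|i' s IH]; first by rewrite big_nil !mul0r addr0.
 rewrite big_cons /= natrD -(natr1 (size s)) [_ * l2]mulrDl mul1r [(_ + _) * l4]mulrDl.
 move: IH; set A := \sum_(_ <- _) _; set B := _ * l4; set D := (size s)%:R * l2.
 by case: (same i') => /=; rewrite ?mul1r ?mul0r; lra_from l40, l20.
have sX : (size s <= X)%N.
 have : (size (i :: s) <= #|T vs n|)%N by rewrite -(card_uniqP _) ?max_card //= iS.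
 by rewrite card_ffun !card_ord expn1 /= ltnS.
(* Exponents at which the powers of [om] agree are congruent modulo [M], so their quotients by [M]
   are distinct; the point [i] itself uses one of the available quotients. *)
have cM : (c * M <= X)%N.
 apply: (@leq_trans (X %/ M * M)); last exact: leq_trunc_div.
 rewrite leq_mul2r; apply/orP; right; rewrite -ltnS.
 have -> : c.+1 = size (map (fun l : T vs n => (l ord0 %/ M)%N) (i :: [seq l <- s | same l])) by rewrite size_map /= size_filter.
 rewrite -[(X %/ M).+1](size_iota 0); apply: uniq_leq_size; last first.
  by move=> k /mapP [l _ ->]; rewrite mem_iota /= add0n ltnS leq_div2r.
 rewrite map_inj_in_uniq /=; first by rewrite mem_filter (negPf iS) andbF filter_uniq.
 have sm' l : l \in i :: [seq l <- s | same l] -> i ord0 = l ord0 %[mod M].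
  rewrite inE => /orP[/eqP -> //|]; rewrite mem_filter => /andP[+ _].
  by rewrite /same (eq_prim_root_expr pM) => /eqP.
 by move=> l l' /sm' e /sm' e' ed; apply: inj; rewrite (divn_eq (l ord0) M) ed -e e' -divn_eq.
have f2 : 4 * pw n (vs + vs) <= pw n (nu - ta - ka) by near: n; apply: near_pw; move: h2 k0; rewrite /w; clr; lra.
set A := pw n (nu - ta - ka) in lt.
rewrite -/A in f2.
(* The distances bounded below by [far] cost only [L * l2]. The remaining [c] distances must account
   for the small product, and [c * M <= X] makes [x] extremely close to [om]. *)
have key : A < c%:R * l4 + L * l2.
 have sl : (size s)%:R * l2 <= L * l2 by rewrite ler_wpM2r // ler_nat.
 have := le_lt_trans low lt; rewrite ltr_expR; lra_from sumE, sl.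
have l2L : l2 <= 2 * L.
 rewrite /l2 -[leRHS]expRK ler_ln ?posrE ?expR_gt0 //; apply: le_trans (expR_ge1Dx _); by rewrite lerDr.
have f3 : 32 <= pw n (nu - ta - ka - vs) by near: n; apply: near_pw_ge; move: h2 k0 vs0; rewrite /w; clr; lra.
have f4 : 4 * pw n (nu - 1 - kp) <= pw n (nu - ta - ka - vs) by near: n; apply: near_pw; lra_from h1, k0.
have f5 : 2 * pw n (vs + ta) <= pw n (1 + kp) by near: n; apply: near_pw; lra_from h1, k0.
have M1 : 1 <= M%:R :> R by rewrite ler1n.
have AE : A = pw n vs * pw n (nu - ta - ka - vs) by rewrite -pwD /A; congr (pw n _); ring.
set P := pw n (nu - ta - ka - vs) in f3 f4 AE.
have hl4 : M%:R * P <= 2 * l4.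
 have LL2 : L * l2 <= A / 2.
  have := ler_wpM2l (le_trans ler01 L1) l2L; have : L * L <= pw n (vs + vs) by rewrite pwD; apply: ler_pM; rewrite ?(le_trans ler01).
  by lra_from f2.
 have q1 : A / 2 <= c%:R * l4 by lra_from key, LL2.
 have q2 := ler_wpM2l (ler0n R M) q1.
 have q3 : (c * M)%:R * l4 <= pw n vs * l4 by rewrite ler_wpM2r // (le_trans _ hx) // ler_nat.
 rewrite -(ler_pM2l (pw_gt0 n vs)); rewrite natrM in q3; move: q2 q3; rewrite AE; clr; lra.
exists M; split=> //.
- have /andP[_ t2] := lvt_bounds n ta0; apply: le_trans f5; rewrite pwD mulrCA; apply: ler_pM => //.
 by apply: le_trans hx; rewrite ler_nat.
move=> j; rewrite ord1 xE exprMn (prim_expr_order pM) mul1r.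
have hM : 4 * M%:R * de <= 1 by apply: le_trans dL; rewrite ler_wpM2r ?(ltW de0) // ler_wpM2l // ler_nat.
apply: le_trans (near1X (ltW de0) (lexx _) _) _; first by move: hM; rewrite -/de -mulrA; have := mulr_ge0 (ler0n R M) (ltW de0); clr; lra.
have -> : 2 * M%:R * de = 8 * M%:R * expR (- l4) by rewrite /l4 opprK lnK ?posrE //; field.
apply: (@le_trans _ _ (expR (8 * M%:R) * expR (- l4))).
 by rewrite ler_wpM2r ?expR_ge0 //; apply: le_trans (expR_ge1Dx _); rewrite lerDr.
rewrite -expRD ler_expR; have g3 := ler_wpM2l (ler0n R M) f3; have g4 := ler_wpM2l (ler0n R M) f4.
by lra_from hl4, g3, g4.
Unshelve. all: by end_near. Qed.

End Rank1.

(** * One number: a common root for all exponents and levels *)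

Section Rank1.
Variables (R : realType) (xi : 'I_1 -> R[i]).
Notation polyC := (map_poly (intr : int -> R[i])).
Notation mz Q := (mah (polyC Q)).
Notation T vs n := {ffun 'I_1 -> 'I_(lvx vs n).+1}.
Notation x := (xi ord0).
Notation zeta i := (mon xi (fun j => nat_of_ord (i j))).
Notation algebraic z := (algebraicOver (ratr : rat -> R[i]) z).
Hypotheses (xi0 : forall j, xi j != 0) (tx : transc x).

Lemma transc_evz p : evz x p = 0 -> p = 0.
Proof. by move=> h; apply/eqP/negPn/negP => /tx /negP; apply; apply/eqP. Qed.

(** [X^M - 1] is very small at [x] and has Mahler measure one, so an irreducible factor is an
    approximant with height exponent 0, and a chain with a single state suffices. *)
Lemma torsion_absurd ta nu kp : 0 < kp -> 0 <= ta -> 0 < nu - 1 - 2 * kp -> 1 - ta + 2 * kp < nu - 1 - 2 * kp ->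
 ~ \forall n \near \oo, tors_at xi ta nu kp n.
Proof.
move=> k0 ta0 h0 h1 hT.
have hQ : \forall n \near \oo, exists Q, approximant x (1 - ta + 2 * kp) 0 (nu - 1 - 2 * kp) (nu - 1 - 2 * kp) n Q.
 near=> n; have [M [M0 Mt hM]] : tors_at xi ta nu kp n by near: n.
 pose A := pw n (nu - 1 - 2 * kp); have A0 : 0 < A := pw_gt0 _ _.
 have N0 := XnB1_neq0 M0; have lN : ln (mz ('X^M - 1)) = 0 by rewrite mz_XnB1 // ln1.
 have f1 : 2 * A <= pw n (nu - 1 - kp) by rewrite /A; near: n; apply: near_pw; lra.
 have MR : 1 <= M%:R :> R by rewrite ler1n.
 have vN : M%:R * A < - ln (cab (evz x ('X^M - 1))).
  have nz : evz x ('X^M - 1) != 0 by apply: contraNneq N0 => /transc_evz ->.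
  have E : evz x ('X^M - 1) = x ^+ M - 1 by rewrite /evz /= /horner_eval rmorphB /= map_polyXn rmorph1 !hornerE.
  apply: (@lt_le_trans _ _ (M%:R * pw n (nu - 1 - kp))).
   by rewrite ltr_pM2l ?(lt_le_trans ltr01) //; move: f1 A0; lra.
  rewrite lerNr -[leRHS]expRK ler_ln ?posrE ?expR_gt0 ?cab_gt0 //; rewrite E; exact: hM.
 have [|Q [iQ rQ dQ lQ wQ]] := @pick_factor R x ('X^M - 1) A A transc_evz N0 (ltW A0) (ltW A0) _.
  by rewrite deg_XnB1 // lN mul0r addr0.
 rewrite deg_XnB1 // in dQ; rewrite lN in lQ; exists Q; split=> //; last by rewrite pw0; apply: le_trans lQ _.
 have /andP[t1 _] := lvt_bounds n ta0.
 have f2 : 3 * pw n (1 + kp) <= pw n (1 + 2 * kp) by near: n; apply: near_pw; lra.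
 have f3 : M%:R * pw n ta <= pw n (1 + 2 * kp).
  by have := ler_wpM2l (ler0n R M) t1; move: Mt f2; lra.
 have : (size Q).-1%:R * pw n ta <= pw n (1 + 2 * kp).
  by apply: le_trans f3; rewrite ler_wpM2r ?pw_ge0 // ler_nat.
 rewrite -ler_pdivlMr ?pw_gt0 // -pwN -pwD; congr (_ <= pw n _); ring.
have [Q hQ'] := near_choice 0 hQ.
apply: (@approximant_chain R unit (fun=> 1 - ta + 2 * kp) (fun=> 0) (fun=> nu - 1 - 2 * kp) (fun=> nu - 1 - 2 * kp) x (fun=> tt) Q) => //.
by apply: nearW => n s s' _; split.
Unshelve. all: by end_near. Qed.

(** The number recorded is [y] near [x], not the root [y^i] near [x^i], so that different exponents
    [i] can be compared. *)
Definition close_at (D H a b : R) n i y := exists Q, [/\ irrz Q, (size Q).-1%:R <= pw n D, ln (mz Q) <= pw n H,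
 root (polyC Q) (y ^+ i) & cab (y / x - 1) <= expR (- (((size Q).-1%:R * pw n a + ln (mz Q) * pw n b) / 8))].

Lemma near_same_root h D H a b l e : 0 <= h -> h < l -> 0 <= D -> H < a -> D + l < a -> D < b -> H < e -> D + l < e ->
 \forall n \near \oo, forall (v : nat) Q Q' y y', (0 < v)%N -> v%:R <= pw n h ->
 approximant (x ^+ v) D H a b n Q -> approximant (x ^+ v) D H a b n Q' ->
 root (polyC Q) (y ^+ v) -> root (polyC Q') (y' ^+ v) ->
 cab (y / x - 1) <= expR (- ((size Q).-1%:R * pw n e)) -> cab (y' / x - 1) <= expR (- ((size Q').-1%:R * pw n e)) ->
 y = y'.
Proof.
move=> h0 hl D0 h1 h2 h3 h4 h5; have l0 : 0 <= l by apply: le_trans h0 (ltW hl).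
near=> n => v Q Q' y y' v0 hv aQ aQ' ry ry' hy hy'.
have hlm : ln (mx1 (x ^+ v)) <= pw n l by move: v hv {v0 aQ aQ' ry ry'}; near: n; apply: near_lnmx1X.
have QQ : Q = Q'.
 by move: (x ^+ v) Q Q' hlm aQ aQ' {ry ry' hy hy'}; near: n; apply: (@near_approximant_eq R D H a b D H a b l).
rewrite -QQ in aQ' ry' hy'.
move: v Q y y' v0 hv aQ ry ry' hy hy' {Q' QQ aQ' hlm}; near: n.
exact: (@near_root_unique R x (xi0 ord0) tx h D H a b l e).
Unshelve. all: by end_near. Qed.

(** The trace left at exponent [v] by a number that was found at some multiple of [v]. *)
Definition linked (D H a b e : R) n v y := exists Q, [/\ approximant (x ^+ v) D H a b n Q, root (polyC Q) (y ^+ v) &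
  cab (y / x - 1) <= expR (- ((size Q).-1%:R * pw n e))].

Lemma linked_le D H a b D' H' a' b' e n v y : D <= D' -> H <= H' -> a' <= a -> b' <= b ->
 linked D H a b e n v y -> linked D' H' a' b' e n v y.
Proof. by move=> h1 h2 h3 h4 [Q [aQ rQ hQ]]; exists Q; split=> //; apply: approximant_le aQ. Qed.

Lemma pw_le_succ n a : 0 <= a -> pw n a <= pw n.+1 a :> R.
Proof.
move=> a0; rewrite /pw ler_expR ler_wpM2l //; case: n => [|n]; first by rewrite ln0 // ln_nat_ge0.
by rewrite ler_ln ?posrE ?ltr0n // ler_nat.
Qed.

Lemma near_linked_succ D H a b e k : 0 < k -> 0 <= e -> \forall n \near \oo, forall v y,
 linked D H a b e n.+1 v y -> linked (D + k) (H + k) (a - k) (b - k) e n v y.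
Proof.
move=> k0 e0; near=> n => v y [Q [aQ rQ hQ]]; exists Q; split; [|exact: rQ|].
 by move: (x ^+ v) Q aQ {rQ hQ}; near: n; exact: near_approximant_succ.
by apply: le_trans hQ _; rewrite ler_expR lerN2 ler_wpM2l // pw_le_succ.
Unshelve. all: by end_near. Qed.

Lemma near_bad_pairs vs w k (P : nat -> nat -> Prop) (y : nat -> nat) : 0 < vs -> 0 < k ->
 (forall n, (y n)%:R <= pw n (vs / 2) :> R) ->
 (\forall n \near \oo, #|(~: [set i : T vs n | `[< P n (i ord0) >]])%SET|%:R <= pw n w :> R) ->
 \forall n \near \oo, #|bad_pairs (y n) (fun i => `[< ~ P n i >])|%:R <= pw n (w + k) :> R.
Proof.
move=> vs0 k0 hy hB; have [K [K0 hK]] := @divisors_pw R (k / (2 * vs)) ltac:(rewrite divr_gt0 // mulr_gt0 //).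
near=> n; have hx := truncn_pw n vs; rewrite -/(lvx vs n) in hx; case: hx => hx1 hx2.
have yN : (y n * y n < (lvx vs n).+1)%N.
 rewrite -(ltr_nat R); apply: le_lt_trans hx2; rewrite natrM.
 have -> : vs = vs / 2 + vs / 2 by field.
 by rewrite pwD; apply: ler_pM.
pose d := Num.truncn (K * pw n (k / 2)); have Kp : 0 <= K * pw n (k / 2) by rewrite mulr_ge0 ?pw_ge0.
have hd i : (0 < i < (lvx vs n).+1)%N -> (size (divisors i) <= d)%N.
 move=> /andP[i0 iN]; have := truncn_itv Kp; rewrite -/d => /andP[_ h]; rewrite -ltnS -(ltr_nat R).
 apply: le_lt_trans h; apply: le_trans (hK i i0) _; rewrite ler_wpM2l // /pw ler_expR.
 have li : ln i%:R <= vs * ln n%:R.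
  apply: ln_le_pw; first by rewrite ltr0n.
  by apply: le_trans hx1; rewrite ler_nat -ltnS.
 have k2 : 0 <= k / (2 * vs) by rewrite divr_ge0 ?mulr_ge0 // ltW.
 apply: le_trans (ler_wpM2l k2 li) _; apply: eq_le_ref; field; by rewrite gt_eqF.
have h1 := @bad_pairs_le (y n) (fun i => `[< ~ P n i >]) _ d yN hd.
have h2 : (#|[set i : 'I_(lvx vs n).+1 | `[< ~ P n i >]]%SET| <= #|(~: [set i : T vs n | `[< P n (i ord0) >]])%SET|)%N.
 have inj : injective (fun i : 'I_(lvx vs n).+1 => [ffun=> i] : T vs n).
  by move=> i j /ffunP /(_ ord0); rewrite !ffunE.
 rewrite -(card_imset _ inj); apply: subset_leq_card; apply/fintype.subsetP => l /imsetP [i + ->].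
 by rewrite finset.in_setC !finset.inE ffunE => /asboolP q; apply/asboolPn.
have h3 : #|(~: [set i : T vs n | `[< P n (i ord0) >]])%SET|%:R <= pw n w :> R by near: n.
have h4 : (K + 1) * pw n (w + k / 2) <= pw n (w + k) by near: n; apply: near_pw; lra.
have dK : d%:R <= K * pw n (k / 2) by have := truncn_itv Kp; rewrite -/d => /andP[].
apply: (@le_trans _ _ (pw n w * (K * pw n (k / 2)))).
 apply: (@le_trans _ _ (#|[set i : 'I_(lvx vs n).+1 | `[< ~ P n i >]]%SET| * d)%:R); first by rewrite ler_nat.
 by rewrite natrM; apply: ler_pM => //; apply: le_trans h3; rewrite ler_nat.
by apply: le_trans h4; rewrite pwD; have := mulr_ge0 (pw_ge0 n w) (pw_ge0 n (k / 2)); lra.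
Unshelve. all: by end_near. Qed.

Lemma near_grid vs k (P : nat -> nat -> Prop) (y : nat -> nat) (bad := fun n i => `[< ~ P n i >]) : 0 < vs -> 0 < k ->
 (forall n, y n = Num.truncn (pw n (vs / 2) : R)) ->
 (\forall n \near \oo, #|(~: [set i : T vs n | `[< P n (i ord0) >]])%SET|%:R <= pw n (vs - k) :> R) ->
 \forall n \near \oo, [/\ (y n <= y n.+1)%N, (16 * #|bad_pairs (y n) (bad n)| < y n * y n)%N
   & (16 * #|bad_pairs (y n.+1) (bad n.+1)| < y n * y n)%N].
Proof.
move=> vs0 k0 yE hG; have hy n : (y n)%:R <= pw n (vs / 2) :> R by rewrite yE; have [] := truncn_pw n (vs / 2).
have hy2 n : pw n (vs / 2) < (y n)%:R + 1 by rewrite natr1 yE; have [] := truncn_pw n (vs / 2).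
have hB : \forall n \near \oo, #|bad_pairs (y n) (bad n)|%:R <= pw n (vs - k + k / 2) :> R.
 by apply: (@near_bad_pairs vs (vs - k) (k / 2) P y) => //; rewrite divr_gt0.
have hB1 := near_shift hB.
near=> n; have b1 : #|bad_pairs (y n) (bad n)|%:R <= pw n (vs - k + k / 2) :> R by near: n.
have b2 : #|bad_pairs (y n.+1) (bad n.+1)|%:R <= pw n.+1 (vs - k + k / 2) :> R by near: n.
have [q1 _] : pw n.+1 (vs - k + k / 2) <= pw n (vs - k + k / 2 + k / 4) /\ pw n (vs - k + k / 2) <= pw n.+1 (vs - k + k / 2 + k / 4) :> R.
 by near: n; apply: near_pw_succ; rewrite divr_gt0.
have q2 : 128 * pw n (vs - k + k / 2 + k / 4) <= pw n vs :> R by near: n; apply: near_pw; lra.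
have q3 : 2 <= pw n (vs / 2) :> R by near: n; apply: near_pw_ge; rewrite divr_gt0.
have q4 : pw n (vs - k + k / 2) <= pw n (vs - k + k / 2 + k / 4) :> R by apply: ler_pw; rewrite lerDl divr_ge0 // ltW.
have h := hy2 n; have y1 : pw n (vs / 2) / 2 <= (y n)%:R by lra_from h, q3.
have y2 : pw n vs / 4 <= (y n)%:R * (y n)%:R.
 have : pw n (vs / 2) / 2 * (pw n (vs / 2) / 2) <= (y n)%:R * (y n)%:R by apply: ler_pM; rewrite ?divr_ge0 ?pw_ge0.
 have -> : pw n vs = pw n (vs / 2) * pw n (vs / 2) by rewrite -pwD; congr (pw n _); field.
 by clear -R xi; lra.
have q5 := pw_gt0 n (vs - k + k / 2 + k / 4).
split.
- rewrite -ltnS -(ltr_nat R) -[in ltRHS]natr1; apply: le_lt_trans (hy2 n.+1); apply: le_trans (hy n) _.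
 by apply: pw_le_succ; rewrite divr_ge0 // ltW.
- by rewrite -(ltr_nat R) !natrM; move: b1 q4 q2 y2 q5; clear -R xi; lra.
by rewrite -(ltr_nat R) !natrM; move: b2 q1 q2 y2 q5; clear -R xi; lra.
Unshelve. all: by end_near. Qed.

(** The number attached to [x^(a b)] is linked to the exponent [b] and, by symmetry, to [a]; two
    numbers linked to the same exponent agree. [grid_const] then yields one number for all large
    levels. It must be [x], which would make [x] algebraic. *)
Lemma near_good_absurd s be ta nu ka e : 0 < s -> 0 < ka -> e = 100 * ka -> 100 * e <= s ->
 0 <= ta -> 100 * e <= 1 - 11 * s - ta -> 1 + 11 * s <= be -> 100 * e <= nu - (1 + be - 5 * s - ta) ->
 ~ \forall n \near \oo, #|(~: [set i : T (8 * s) n | `[< good_factor (3 * s) be ta nu ka n (zeta i) >]])%SET|%:R <= pw n (8 * s - ka / 2).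
Proof.
move=> s0 k0 eE e1 ta0 e2 hbe hnu hG.
have e0 : 0 < e by rewrite eE; lra.
pose D0 := 1 - 3 * s - ta + 5 * ka; pose H0 := be - 2 * (3 * s) - ta + 5 * ka.
pose a0 := nu - 1 + 3 * s - 5 * ka; pose b0 := nu - be + 2 * (3 * s) - 5 * ka.
pose good n i := good_factor (3 * s) be ta nu ka n (x ^+ i).
have /boolp.choice [g0 hg0] : forall ni : nat * nat, exists y, (exists y, close_at D0 H0 a0 b0 ni.1 ni.2 y) -> close_at D0 H0 a0 b0 ni.1 ni.2 y.
 by move=> ni; have [[y hy]|hn] := boolp.EM (exists y, close_at D0 H0 a0 b0 ni.1 ni.2 y); [exists y | exists 0].
pose g n i := g0 (n, i); pose y n := Num.truncn (pw n (4 * s) : R).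
have yy n a b : (a <= y n)%N -> (b <= y n)%N -> (a * b)%:R <= pw n (8 * s) :> R.
 have [h _] := truncn_pw n (4 * s); rewrite -/(y n) in h => ha hb.
 rewrite natrM (_ : 8 * s = 4 * s + 4 * s); last by ring.
 by rewrite pwD; apply: ler_pM => //; apply: le_trans h; rewrite ler_nat.
have hc : \forall n \near \oo, forall i, (0 < i)%N -> i%:R <= pw n (8 * s) -> good n i -> close_at D0 H0 a0 b0 n i (g n i).
 have I := @near_iroot R x (xi0 ord0) tx (8 * s) D0 H0 a0 b0 (8 * s + e) ltac:(lra) ltac:(lra) ltac:(rewrite /D0; lra)
  ltac:(rewrite /H0 /a0; lra) ltac:(rewrite /D0 /a0; lra) ltac:(rewrite /D0 /b0; lra).
 near=> n => i i0 hi [Q aQ]; apply: (hg0 (n, i)); rewrite /=; have [iQ _ dQ lQ _] := aQ.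
 near_have n I => /(_ i Q i0 hi aQ) [z rz hz].
 by exists z, Q; split.
(* Passing from [x^(a b)] to [x^b] multiplies the degree by at most [n^(4s)]: [D] increases and [a]
   decreases by [4 * s], while [H] and [b] change only by slack. *)
pose D1 := 1 + s - ta + e; pose H1 := be - 6 * s - ta + e; pose a1 := nu - 1 - s - e; pose b1 := nu - be + 6 * s - e.
have hl : \forall n \near \oo, forall a b, (0 < a)%N -> (0 < b)%N -> a%:R <= pw n (4 * s) -> b%:R <= pw n (4 * s) ->
  good n (a * b)%N -> linked D1 H1 a1 b1 a1 n b (g n (a * b)%N).
 have I := @near_common_factor R x (xi0 ord0) tx (4 * s) D0 H0 a0 b0 D1 H1 a1 b1 a1 ltac:(lra) ltac:(rewrite /D0 /D1; lra)
  ltac:(rewrite /H0 /H1; lra) ltac:(rewrite /D0 /H1; lra) ltac:(rewrite /a0 /a1; lra) ltac:(rewrite /b0 /b1; lra)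
  ltac:(rewrite /a0 /b1; lra) ltac:(rewrite /a0 /a1; lra) ltac:(rewrite /a0; lra).
 near=> n => a b ap bp ha hb gab.
 have hab : (a * b)%:R <= pw n (8 * s).
  rewrite natrM (_ : 8 * s = 4 * s + 4 * s); last by ring.
  by rewrite pwD; apply: ler_pM.
 have abp : (0 < a * b)%N by rewrite muln_gt0 ap.
 near_have n hc => /(_ _ abp hab gab) [Q [iQ dQ lQ rQ hQ]].
 by near_have n I => /(_ a b _ Q); apply.
have hS := @near_same_root (4 * s) (D1 + e) (H1 + e) (a1 - e) (b1 - e) (4 * s + e) a1 ltac:(lra) ltac:(lra) ltac:(rewrite /D1; lra)
 ltac:(rewrite /H1 /a1; lra) ltac:(rewrite /D1 /a1; lra) ltac:(rewrite /D1 /b1; lra) ltac:(rewrite /H1 /a1; lra) ltac:(rewrite /D1 /a1; lra).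
have hl2 := near_shift hl.
have hsucc := @near_linked_succ D1 H1 a1 b1 a1 e e0 ltac:(rewrite /a1; lra).
have a00 : 0 < a0 by rewrite /a0; lra.
have yle n k : (k <= y n)%N -> k%:R <= pw n (4 * s) :> R.
 by move=> ky; have [h _] := truncn_pw n (4 * s); apply: le_trans h; rewrite ler_nat.
have same n : (forall (v : nat) Q Q' z z', (0 < v)%N -> v%:R <= pw n (4 * s) ->
 approximant (x ^+ v) (D1 + e) (H1 + e) (a1 - e) (b1 - e) n Q -> approximant (x ^+ v) (D1 + e) (H1 + e) (a1 - e) (b1 - e) n Q' ->
 root (polyC Q) (z ^+ v) -> root (polyC Q') (z' ^+ v) ->
 cab (z / x - 1) <= expR (- ((size Q).-1%:R * pw n a1)) -> cab (z' / x - 1) <= expR (- ((size Q').-1%:R * pw n a1)) ->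
 z = z') -> forall v z z', (0 < v <= y n)%N -> linked D1 H1 a1 b1 a1 n v z -> linked (D1 + e) (H1 + e) (a1 - e) (b1 - e) a1 n v z' -> z = z'.
 move=> hs v z z' /andP[v0 vy] [Q [aQ rQ hQ]] [Q' [aQ' rQ' hQ']].
 apply: (hs v Q Q') => //; [exact: yle | by apply: approximant_le aQ; rewrite ?lerDl ?gerBl ltW].
have [v hv] : exists v, \forall n \near \oo, exists a b, [/\ (0 < a <= y n)%N, (0 < b <= y n)%N, good n (a * b)%N & g n (a * b)%N = v].
 apply: (grid_const (0 : R[i])).
 - apply: (@near_grid (8 * s) (ka / 2) good y); [lra | lra | | ].
   by move=> n; rewrite /y; congr (Num.truncn (pw n _)); field.
  by apply: filterS hG => n; apply: le_trans; rewrite ler_nat; apply: subset_leq_card; apply/fintype.subsetP => i; rewrite !finset.in_setC !finset.inE mon1.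
 - near=> n => a a' b /andP[ap ha] /andP[ap' ha'] hb gab gab'; have /andP[bp hbb] := hb.
  near_have n hl => L.
  apply: (same n _ b) => //; [by near_have n hS | by apply: L => //; apply: yle |].
  by apply: (@linked_le D1 H1 a1 b1); [lra|lra|lra|lra|]; apply: L => //; apply: yle.
 - near=> n => a a' b /andP[ap ha] /andP[ap' ha'] hb gab gab'; have /andP[bp hbb] := hb.
  near_have n hl => L.
  near_have n hl2 => L2; near_have n hsucc => S.
  apply: (same n _ b) => //; [by near_have n hS | by apply: L => //; apply: yle |].
  by apply/S/L2 => //; [apply: yle | apply: le_trans (yle _ _ hbb) _; apply: pw_le_succ; lra].
have hv2 : \forall n \near \oo, exists2 i, (0 < i)%N & close_at D0 H0 a0 b0 n i v.
 near=> n; near_have n hv => -[a [b [/andP[ap ha] /andP[bp hb] gab gv]]].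
 near_have n hc => C.
 exists (a * b)%N; first by rewrite muln_gt0 ap.
 by rewrite -gv; apply: C => //; [rewrite muln_gt0 ap | apply: yy].
(* [v] does not depend on the level, whereas its distance to [x] is bounded by a quantity tending to
   0. *)
have vx : v = x.
 apply/eqP/negPn/negP => ne; have c0 : 0 < cab (v / x - 1).
  by rewrite cab_gt0 subr_eq0; apply: contra_neq ne => /(congr1 ( *%R^~ x)) /=; rewrite divfK // mul1r.
 have [n [h1 [i i0 [Q [iQ dQ lQ rQ hQ]]]]] := filter_ex (filterI (@near_pw_ge R (8 * (1 - ln (cab (v / x - 1)))) a0 a00) hv2).
 have := hQ; rewrite -[leLHS]lnK ?posrE // ler_expR.
 have : pw n a0 <= (size Q).-1%:R * pw n a0 + ln (mz Q) * pw n b0.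
  rewrite -[leLHS]addr0 lerD ?mulr_ge0 ?pw_ge0 ?lnmz_ge0 ?(irrz_neq0 iQ) // ler_peMl ?pw_ge0 // ler1n; exact: irrz_deg_gt0.
 by lra_from h1.
have [n [i i0 [Q [iQ _ _ rQ _]]]] := filter_ex hv2.
by have /negP[] := transcX i0 tx (irrz_neq0 iQ); rewrite -vx.
Unshelve. all: by end_near. Qed.

End Rank1.

(** * One number: conclusion *)

Section Rank1.
Variables (R : realType) (xi : 'I_1 -> R[i]).
Notation x := (xi ord0).
Notation zeta i := (mon xi (fun j => nat_of_ord (i j))).
Notation algebraic z := (algebraicOver (ratr : rat -> R[i]) z).
Hypotheses (xi0 : forall j, xi j != 0) (tx : transc x).
Hypothesis hAlg : forall N, (#|[set i : {ffun 'I_1 -> 'I_N.+1} | `[< algebraic (zeta i) >]]%SET| <= N.+1 ^ 1.-1)%N.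

Lemma rank1_absurd s be ta nu : 0 < s -> 0 <= ta -> 11 * s + ta < 1 -> 1 + 11 * s <= be -> 1 + be - 5 * s - ta < nu ->
 ~ (\forall n \near \oo, exists P, small_at xi (11 * s) be ta nu n P).
Proof.
move=> s0 ta0 h1 h2 h3 hP.
pose d := Num.min (nu - (1 + be - 5 * s - ta)) (Num.min (1 - 11 * s - ta) s).
have d0 : 0 < d by rewrite /d !lt_min; apply/andP; split; [|apply/andP; split=> //]; lra.
have [d1 [d2 d3]] : d <= nu - (1 + be - 5 * s - ta) /\ d <= 1 - 11 * s - ta /\ d <= s.
 by rewrite /d !ge_min !lexx !orbT.
pose e := d / 100; pose ka := e / 100.
have e0 : 0 < e by rewrite divr_gt0.
have dE : d = 100 * e by rewrite /e; field.
have k0 : 0 < ka by rewrite divr_gt0.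
have kE : e = 100 * ka by rewrite /ka; field.
clearbody d e ka.
pose kp := (5 * 1%:R + 4) * ka : R; have kpE : kp = 9 * ka by rewrite /kp; ring.
have omE : 1%:R * (8 * s) = 8 * s by rewrite mul1r.
(* Here [al : vs = 3 : 8]. This equates the bound [1 + be + al - vs - ta] for [nu] from
   interpolation with [1 + be - 3 al + vs / 2 - ta], needed for approximants at exponents up to
   [n^(vs/2)]. *)
have G1 := @near_core R 1 xi (3 * s) (8 * s) (11 * s) be ta nu ka xi0 isT k0.
rewrite omE -/kp in G1.
have {}G1 := G1 ltac:(lra) ltac:(lra) ltac:(lra) ltac:(lra) ta0 ltac:(lra) ltac:(lra) ltac:(lra) ltac:(lra) ltac:(lra) ltac:(lra) hAlg.
have kp0 : 0 < kp by rewrite kpE; lra.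
have C1 := @near_not_separated R xi xi0 tx ta nu ka (8 * s) kp k0 ltac:(lra) ta0 ltac:(lra) ltac:(lra).
have TS := @near_tors_succ R 1 xi ta nu kp kp0 ta0.
pose good n := #|(~: [set i : {ffun 'I_1 -> 'I_(lvx (8 * s) n).+1} | `[< good_factor (3 * s) be ta nu ka n (zeta i) >]])%SET|%:R <= pw n (8 * s - ka / 2).
have key : \forall n \near \oo, tors_at xi ta nu kp n \/ (~ tors_at xi ta nu (2 * kp) n /\ good n).
 near=> n; have [sep|ns] := boolp.EM (separated xi (8 * s) ta nu ka n); last by left; near_have n C1; apply.
 by near_have n hP => -[P sP]; near_have n G1; apply; [exact: sP | exact: sep].
have key1 := near_shift key.
(* By the gap the alternative cannot change between consecutive levels, so one side of it holds for
   all large [n]. *)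
have [v hv] : exists v, \forall n \near \oo, `[< tors_at xi ta nu kp n >] = v.
 apply: near_const; near=> n.
 near_have n key => q1; near_have n key1 => q2; near_have n TS => -[q3 q4].
 apply/asbool_equiv_eq; split=> h.
  case: q1 => [t|[nt _]]; [exact: t | exact: False_ind _ (nt (q4 h))].
 case: q2 => [t|[nt _]]; [exact: t | exact: False_ind _ (nt (q3 h))].
case: v hv => hv.
 by apply: (@torsion_absurd R xi tx ta nu kp) => //; [lra | lra | apply: filterS hv => n /asboolP].
apply: (@near_good_absurd R xi xi0 tx s be ta nu ka e) => //; try lra.
near=> n; near_have n key => q1.
have /asboolP q2 : `[< tors_at xi ta nu kp n >] = false by near: n.
by case: q1 => // -[].
Unshelve. all: by end_near. Qed.

End Rank1.

(** * From the hypotheses on fields to polynomial statements *)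

Section Transcendence.
Variable R : realType.
Notation polyC := (map_poly (intr : int -> R[i])).
Notation algebraic z := (algebraicOver (ratr : rat -> R[i]) z).

Lemma int_poly_vanish (p : {poly int}) : (forall a : rat, (map_poly intr p).[a] = 0) -> p = 0.
Proof.
move=> h; apply/eqP; rewrite -(polyF_eq0 rat); apply/negPn/negP => p0.
have := max_poly_roots (rs := [seq i%:R : rat | i <- iota 0 (size (map_poly intr p : {poly rat}))]) p0.
rewrite size_map size_iota ltnn => H; suff : false by []; apply: H.
 by apply/allP => a _; rewrite /root h.
by rewrite map_inj_uniq ?iota_uniq // => i j /eqP; rewrite eqr_nat => /eqP.
Qed.

(** An integer polynomial in one variable is turned into a multivariate one; that the latter
    vanishes is brought back by evaluating at all rational numbers. *)
Lemma alg_indep_evz (t : 'I_1 -> R[i]) : alg_indepQ t -> forall p, evz (t ord0) p = 0 -> p = 0.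
Proof.
move=> ht p hp.
pose X : mpoly 1 rat := mpolyX rat (mnm1 ord0).
pose q : mpoly 1 rat := (map_poly intr p).[X].
have mq (F : numFieldType) (u : 'I_1 -> F) : mmap (ratr : rat -> F) u q = (map_poly intr p).[u ord0].
 rewrite /q -horner_map /= mmapX mmap1U -map_poly_comp /=; congr (_.[_]).
 by apply: eq_map_poly => z /=; rewrite rmorph_int.
have q0 : q = 0 by apply: ht; rewrite mq.
apply: int_poly_vanish => a; by rewrite -(mq rat (fun=> a)) q0 rmorph0.
Qed.

(** The fractions of values of integer polynomials at [th] form a subfield containing [S]; their
    denominators are non-zero by transcendence. *)
Lemma adjoinQ_frac (th : R[i]) (S : set R[i]) z : (forall p, evz th p = 0 -> p = 0) -> S `<=` [set th] -> adjoinQ S z ->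
 exists a b, b != 0 /\ z = evz th a / evz th b.
Proof.
move=> tr St; pose K := [set z | exists a b, b != 0 /\ z = evz th a / evz th b].
have ne b : b != 0 -> evz th b != 0 by apply: contra_neq => /tr.
have eM p q : evz th (p * q) = evz th p * evz th q by exact: rmorphM.
have eB p q : evz th (p - q) = evz th p - evz th q by exact: rmorphB.
apply: (@smallest_sub _ _ _ K); last first.
 move=> _ /St ->; exists 'X, 1; split; first exact: oner_neq0.
 by rewrite rmorph1 divr1 /evz /= map_polyX /horner_eval hornerX.
split; first by rewrite inE /=; exists 1, 1; rewrite oner_neq0 rmorph1 divr1.
- move=> u v; rewrite !inE /= => -[a [b [b0 ->]]] [c [d [d0 ->]]].
 exists (a * d - c * b), (b * d); split; first by rewrite mulf_neq0.
 rewrite eB !eM; have := ne _ b0; have := ne _ d0; move: (evz th b) (evz th d) => B D D0 B0.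
 by field; rewrite B0 D0.
move=> u v; rewrite !inE /= => -[a [b [b0 ->]]] [c [d [d0 ->]]].
have [->|c0] := eqVneq c 0.
 by exists 0, 1; split; [exact: oner_neq0 | rewrite !rmorph0 !mul0r invr0 mulr0].
exists (a * d), (b * c); split; first by rewrite mulf_neq0.
rewrite !eM; have := ne _ b0; have := ne _ d0; have := ne _ c0; move: (evz th b) (evz th d) (evz th c) => B D C C0 D0 B0.
by field; rewrite B0 D0 C0.
Qed.

(** Multiplying by the product of all denominators turns the coefficients into values of integer
    polynomials at [th]. *)
Lemma algebraic_over_alg (th z : R[i]) (S : set R[i]) : (forall p, evz th p = 0 -> p = 0) -> S `<=` [set th] ->
 algebraic_over (adjoinQ S) z -> alg_over_th th z.
Proof.
move=> tr St [p [p0 pK pz]].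
have /boolp.choice [ab hab] : forall i, exists ab : {poly int} * {poly int}, ab.2 != 0 /\ p`_i = evz th ab.1 / evz th ab.2.
 by move=> i; have [a [b h]] := adjoinQ_frac tr St (pK i); exists (a, b).
have ne b : b != 0 -> evz th b != 0 by apply: contra_neq => /tr.
have eM f g : evz th (f * g) = evz th f * evz th g by exact: rmorphM.
pose n := (size p).-1; pose D := \prod_(j < n.+1) (ab j).2.
have D0 : D != 0 by apply/prodf_neq0 => j _; case: (hab j).
have sp : size p = n.+1 by rewrite /n prednK // size_poly_gt0.
pose c (i : nat) := if insub i : option 'I_n.+1 is Some i' then (ab i').1 * \prod_(j < n.+1 | j != i') (ab j).2 else 0.
have cE (i : 'I_n.+1) : evz th (c i) = p`_i * evz th D.
 have DE : D = (ab i).2 * \prod_(j < n.+1 | j != i) (ab j).2 by rewrite /D (bigD1 i).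
 rewrite DE /c valK !eM; have [b0 ->] := hab i.
 by rewrite mulrA divfK // ne.
have pn : p`_n != 0 by rewrite -lead_coefE lead_coef_eq0.
exists c, n; split.
- rewrite lt0n; apply/negP => /eqP n0; move: pz; rewrite /root horner_coef sp n0 big_ord1 expr0 mulr1 => /eqP e.
 by move: pn; rewrite n0 e eqxx.
- apply: contra_neq pn => cn; have := cE ord_max; rewrite /= cn rmorph0 => /esym/eqP.
 by rewrite mulf_eq0 (negPf (ne _ D0)) orbF => /eqP.
rewrite (eq_bigr (fun i : 'I_n.+1 => evz th D * (p`_i * z ^+ i))) => [|i _]; last by rewrite cE mulrAC mulrC.
by rewrite -mulr_sumr -sp -horner_coef (eqP pz) mulr0.
Qed.

Lemma exists_transc m (xi : 'I_m -> R[i]) th : (forall p, evz th p = 0 -> p = 0) -> adjoinQ (range xi) th ->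
 exists k, ~ algebraic (xi k).
Proof.
move=> tr ht; apply: contrapT => hn.
have hA k : algebraic (xi k) by apply: contrapT => hk; apply: hn; exists k.
have : algebraic th.
 apply: (@smallest_sub _ _ _ [set z | algebraic z] _ _ _ ht); last by move=> _ [k _ <-]; exact: hA.
 split; first by rewrite inE /=; exact: algebraic1.
  by move=> u v; rewrite !inE /=; exact: algebraic_sub.
 by move=> u v; rewrite !inE /=; exact: algebraic_div.
by move=> /algebraic_minpoly [Q [/irrz_neq0 /eqP Q0 /eqP rQ]]; apply/Q0/tr.
Qed.

(** On a line in direction [k0] two algebraic monomials would have an algebraic quotient, a positive
    power of [xi k0]; so each line carries at most one. *)
Lemma algebraic_count m (xi : 'I_m -> R[i]) k0 : (forall k, xi k != 0) -> ~ algebraic (xi k0) ->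
 forall x, (#|[set i : {ffun 'I_m -> 'I_x.+1} | `[< algebraic (mon xi (fun j => nat_of_ord (i j))) >]]%SET| <= x.+1 ^ m.-1)%N.
Proof.
move=> xi0 na x; set B := finset _.
pose f (i : {ffun 'I_m -> 'I_x.+1}) : {ffun 'I_m.-1 -> 'I_x.+1} := [ffun j => i (lift k0 j)].
have inj : {in B &, injective f}.
 move=> i i'; rewrite !finset.inE => /asboolP ai /asboolP ai' fE.
 have off k : k != k0 -> i k = i' k.
  move=> kk; have [j ->|e] := unliftP k0 k; last by rewrite e eqxx in kk.
  by move/ffunP/(_ j): fE; rewrite !ffunE.
 have W (u v : {ffun 'I_m -> 'I_x.+1}) : (forall k, k != k0 -> u k = v k) -> algebraic (mon xi (fun j => nat_of_ord (u j))) ->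
   algebraic (mon xi (fun j => nat_of_ord (v j))) -> ~ (u k0 < v k0)%N.
  move=> uv au av lt; apply: na.
  have E := @mon_axis R m xi (fun j => nat_of_ord (u j)) (fun j => nat_of_ord (v j)) k0 (ltnW lt) (fun k kk => congr1 val (uv k kk)).
  have : algebraic (xi k0 ^+ (v k0 - u k0)).
   have -> : xi k0 ^+ (v k0 - u k0) = mon xi (fun j => nat_of_ord (v j)) / mon xi (fun j => nat_of_ord (u j)).
    by rewrite E mulrC mulKf // mon_neq0.
   exact: algebraic_div.
  move=> /algebraic_minpoly [Q [iQ rQ]]; apply: (@minpoly_algebraic R[i] (Q \Po 'X^(v k0 - u k0))).
   by rewrite comp_poly_eq0 ?irrz_neq0 // size_polyXn ltnS subn_gt0.
  by rewrite map_comp_poly map_polyXn /root horner_comp hornerXn.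
 apply/ffunP => k; have [->|/off //] := eqVneq k k0.
 have offV k' : k' != k0 -> i' k' = i k' by move=> kk; rewrite off.
 have q1 := W i' i offV ai' ai.
 have q2 := W i i' off ai ai'.
 apply: val_inj => /=; by case: (ltngtP (i k0) (i' k0)) q1 q2.
rewrite -(card_in_imset inj); apply: leq_trans (max_card _) _; by rewrite card_ffun !card_ord.
Qed.

Lemma finite_nat_near (P : nat -> Prop) : ~ infinite_set [set n | (0 < n)%N /\ ~ P n] -> \forall n \near \oo, P n.
Proof.
move=> /contrapT /finite_seqP [s sE]; near=> n; apply: contrapT => nP.
have : [set n | (0 < n)%N /\ ~ P n] n by split=> //; near: n; exact: near_ge1.
rewrite sE /= => ns; have : (n <= \max_(i <- s) i)%N by apply: leq_bigmax_seq.
by rewrite leqNgt => /negP; apply; near: n; exact: near_ge.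
Unshelve. all: by end_near. Qed.

(** [height] is the largest coefficient of the primitive part, and division by the content can only
    decrease the values. *)
Lemma small_at_primitive m (xi : 'I_m -> R[i]) (sg be ta nu : R) n (P : {poly int}) : (0 < n)%N -> P != 0 -> ((size P).-1 <= n)%N ->
 height R P <= expR (n%:R `^ be) ->
 (forall (i : 'I_m -> nat) (j : nat), (forall k, (i k)%:R <= n%:R `^ sg) -> j%:R < n%:R `^ ta ->
   `|dderiv_at P j (\prod_(k < m) xi k ^+ i k)| < (expR (- (n%:R `^ nu)))%:C%C) ->
 small_at xi sg be ta nu n (zprimitive P).
Proof.
move=> n0 P0 dP hP sm; set c := zcontents P.
have c0 : c != 0 by rewrite zcontents_eq0.
have cR : 0 < `|c|%N%:R :> R by rewrite ltr0n absz_gt0.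
have PE : P = c *: zprimitive P by apply: zpolyEprim.
have cE (k : nat) : (`|((zprimitive P)`_k)%R| * `|zcontents P|)%N = `|(P`_k)%R|%N.
 by rewrite mulnC -abszM -coefZ -PE.
rewrite !powR_pw // in hP sm *; split.
- by rewrite zprimitive_eq0.
- by rewrite size_zprimitive.
- rewrite /n1 size_polyF size_zprimitive.
 apply: (@le_trans _ _ (\sum_(i < size P) height R P)).
  apply: ler_sum => i _; rewrite coef_map /= cab_int /height ler_pdivlMr //.
  rewrite -natr_absz -natrM ler_nat.
  rewrite cE.
  exact: (leq_bigmax (F := fun i : 'I_(size P) => `|(P`_i)%R|%N)).
 rewrite sumr_const card_ord -[_ *+ size P]mulr_natl; apply: ler_pM => //.
  by rewrite /height divr_ge0.
 by rewrite ler_nat; move: dP; case: (size P).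
move=> i j hi hj; have /ltW := sm i j hi hj.
rewrite cabE lecR; apply: le_trans.
rewrite /dderiv_at {2}PE linearZ /= map_polyZ /= hornerZ cabM ler_peMl ?cab_ge0 //.
exact: cab_int_ge1.
Qed.

End Transcendence.

Theorem theorem1p1 (R : realType) (m : nat) (xi : 'I_m -> R[i])
  (beta sigma tau nu : R)
  (m_gt0 : (0 < m)%N)
  (xi_neq0 : forall k, xi k != 0)
  (xi_indep : mult_indep xi)
  (xi_trdeg : has_trdegQ (adjoinQ (range xi)) 1)
  (sigma_ge0 : 0 <= sigma)
  (tau_ge0 : 0 <= tau)
  (sigma_tau : (5 * m%:R + 1) / (m%:R + 5) * sigma + tau < 1)
  (beta_ge : 1 + sigma <= beta)
  (nu_gt : (2 <= m)%N ->
   1 + beta - (3 * m%:R - 1) / (m%:R + 5) * sigma - tau < nu)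
  (nu_gt1 : m = 1%N -> 1 + beta - 5 / 11 * sigma - tau < nu) :
 infinite_set [set n : nat | (0 < n)%N /\
  ~ exists P : {poly int},
   [/\ P != 0,
     ((size P).-1 <= n)%N,
     height R P <= expR (n%:R `^ beta)
    & forall (i : 'I_m -> nat) (j : nat),
      (forall k, (i k)%:R <= n%:R `^ sigma) ->
      j%:R < n%:R `^ tau ->
      `|dderiv_at P j (\prod_(k < m) xi k ^+ i k)|
       < (expR (- (n%:R `^ nu)))%:C%C]].
Proof.
apply: contrapT => /finite_nat_near hP.
have {}hP : \forall n \near \oo, exists P, small_at xi sigma beta tau nu n P.
 near=> n; have n0 : (0 < n)%N by near: n; exact: near_ge1.
 near_have n hP => -[P [P0 dP hH sm]].
 by exists (zprimitive P); apply: small_at_primitive.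
have [t [tK tI tA]] := xi_trdeg; pose th := t ord0.
have tr := alg_indep_evz tI.
have rt : range t `<=` [set th] by move=> _ [k _ <-]; rewrite ord1.
have halg k : alg_over_th th (xi k).
 by apply: (algebraic_over_alg tr rt); apply: tA; apply: sub_gen_smallest; exists k.
have [k0 na] := exists_transc tr (tK ord0).
have hAlg := algebraic_count xi_neq0 na.
have m5 : 0 < m%:R + 5 :> R by rewrite ltr_wpDl.
(* For [sigma = 0] the two bounds on [nu] coincide and the grid does not grow, so this case rests on
   derivatives alone. *)
have [s0|sn0] := eqVneq sigma 0.
 rewrite s0 !mulr0 ?subr0 ?add0r ?addr0 in sigma_tau beta_ge nu_gt nu_gt1 hP.
 apply: (sigma0_absurd na tau_ge0 sigma_tau beta_ge _ hP).
 by have [/nu_gt|] := leqP 2 m; [lra | case: (m) m_gt0 nu_gt1 => [|[]] // _ /(_ erefl); lra].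
have sp : 0 < sigma by rewrite lt_neqAle eq_sym sn0.
have [m2|] := leqP 2 m.
 (* With this unit all exponents of the main case are integral combinations of [s] and [m * s]. *)
 pose s := sigma / (m%:R + 5); have sE : (m%:R + 5) * s = sigma by rewrite /s mulrC divfK // gt_eqF.
 have sE1 : (5 * m%:R + 1) / (m%:R + 5) * sigma = 5 * (m%:R * s) + s by rewrite /s; field; rewrite gt_eqF.
 have sE2 : (3 * m%:R - 1) / (m%:R + 5) * sigma = 3 * (m%:R * s) - s by rewrite /s; field; rewrite gt_eqF.
 have := nu_gt m2; rewrite sE2 => nu'; rewrite sE1 in sigma_tau; rewrite -sE in beta_ge hP.
 apply: (@rank_ge2_absurd R m xi th xi_neq0 tr halg xi_indep hAlg s beta tau nu) hP => //.
 - by rewrite /s divr_gt0.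
 - by move: beta_ge; lra.
 - by move: nu'; lra.
move=> m1; have m1E : m = 1%N by case: (m) m_gt0 m1 => [|[]].
subst m; have nu' := nu_gt1 erefl.
have tx : transc (xi ord0).
 move=> Q Q0; apply/negP => rQ; apply: na; rewrite ord1; exact: minpoly_algebraic rQ.
pose s := sigma / 11; have sE : 11 * s = sigma by rewrite /s; field.
rewrite -sE in hP; apply: (rank1_absurd xi_neq0 tx hAlg _ tau_ge0 _ _ _ hP).
- by rewrite divr_gt0.
- by rewrite sE; move: sigma_tau; rewrite mulr1 (_ : (5 + 1) / (1 + 5) = 1 :> R) ?mul1r //; field.
- by rewrite sE.
by rewrite (_ : 5 * s = 5 / 11 * sigma) // /s; field.
Unshelve. all: by end_near. Qed.
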